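(* (1) Let $\psi\in\mathcal N_{\underline\Theta}$. Then for any $a>d_\phi$ (or $a\ge0$ if $\phi(0)>0$ and $d_\phi=0$), any $\epsilon>0$ and $n$ large, uniformly in $x>0$, $$x^a|w_n(x)|=O\big(n^{\frac12-a}e^{(T_{\underline\Theta}+\epsilon)n}\big),\qquad T_{\underline\Theta}=-\ln\sin\underline\Theta_\phi.$$ Therefore, for $\alpha\in(0,1)$ and $\mathbf p_\alpha(x)=x^{-\alpha}$, for large $n$, $$\|w_n\|=O\big(n^{\frac12-a}e^{(T_{\underline\Theta}+\epsilon)n}\big)\ \text{ for any }d_\phi<a<\tfrac12,\qquad\Big\|\frac{w_n}{\mathbf p_\alpha}\Big\|_{\mathbf p_\alpha}=O\big(n^{\frac12-a}e^{(T_{\underline\Theta}+\epsilon)n}\big)\ \text{ for any }d_\phi<a<\tfrac{\alpha+1}2.$$ (2) Let $\psi\in\mathcal N_\alpha$ for some $\alpha\in(0,1)$. (a) For any $a>d_\phi$ and $\epsilon>0$, $$\Big\|\frac{w_n}{\overline\nu_\gamma}\Big\|_{\overline\nu_\gamma}=O\big(n^{\frac12-a}e^{(T_{\pi_\alpha}+\epsilon)n}\big),$$ where $T_{\pi_\alpha}=-\ln\sin(\frac\pi2\alpha)$ and $\overline\nu_\gamma(x)=e^{-x^{1/\gamma}}$, $x>0$, $\gamma>1+\alpha$. (b) With $T_{\pi_\alpha,\rho_\alpha}=\max\big(T_{\pi_\alpha},1+\frac1{\rho_\alpha}\big)$, where $\rho_\alpha$ is the largest solution of $(1-\rho)^{\frac1\alpha}\cos\big(\frac{\arcsin(\rho)}\alpha\big)=\frac12$,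 for large $n$ and any $\epsilon>0$, $$\|\mathcal V_n\|_\nu=O\big(e^{(T_{\pi_\alpha,\rho_\alpha}+\epsilon)n}\big).$$
   Context: $\mathcal N$ is the set of functions $\psi(z)=\sigma^2z^2+mz+\int_0^\infty(e^{-zy}-1+zy)\Pi(dy)$ (for $z\in i\mathbb R$, extended to $\Re z\ge0$), with $\sigma\ge0$, $m\ge0$ and $\Pi$ a $\sigma$-finite positive measure on $(0,\infty)$ with $\int_0^\infty(y^2\wedge y)\Pi(dy)<\infty$, $(\sigma,\Pi)\ne(0,0)$. $\overline\Pi(y)=\int_y^\infty\Pi(dr)$, $\phi(z)=\psi(z)/z=m+\sigma^2z+\int_0^\infty(1-e^{-zy})\overline\Pi(y)dy$, $d_\phi=\sup\{u\le0:\phi(u)=-\infty\text{ or }\phi(u)=0\}\in[-\infty,0]$. $\nu$ is the density of the unique invariant probability measure of the generalized Laguerre semigroup associated with $\psi$, i.e. the Feller semigroup on $C_0([0,\infty))$ with generator $\mathbf Gf(x)=\sigma^2xf''(x)+(m+\sigma^2-x)f'(x)+\int_0^\infty(f(e^{-y}x)-f(x)+yxf'(x))\frac{\Pi(dy)}x$; equivalently $\nu$ is the density of the probability law determined by its moments $\int x^n\nu(x)dx=\prod_{k=1}^n\phi(k)$, $n\ge0$. For the classes below, $\nu$ is $C^\infty$ and positive on $(0,\infty)$. $w_n(x)=\frac{(x^n\nu(x))^{(n)}}{n!}$, $\mathcal V_n(x)=w_n(x)/\nu(x)$. $\|\cdot\|$ is the norm of $L^2((0,\infty),dx)$, and $\|\cdot\|_g$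 the norm of $L^2((0,\infty),g(x)dx)$ for a weight $g$. $\mathcal N_{\underline\Theta}=\{\psi\in\mathcal N:\underline\Theta_\phi>0\}$ with $\underline\Theta_\phi=\liminf_{b\to\infty}\int_0^\infty\ln\frac{|\phi(by+ib)|}{\phi(by)}dy$; for $\alpha\in(0,1)$, $\mathcal N_\alpha$ is the set of $\psi\in\mathcal N$ with $\psi(u)\sim C_\alpha u^{\alpha+1}$ as $u\to\infty$ for some $C_\alpha>0$. *)

(* Defs.v *)
From HB Require Import structures.
From mathcomp Require Import all_boot all_order all_algebra.
From mathcomp Require Import all_classical all_reals all_analysis.
From mathcomp Require Import complex.

Set Implicit Arguments.
Unset Strict Implicit.
Unset Printing Implicit Defensive.

Import Order.TTheory GRing.Theory Num.Theory.
Import numFieldNormedType.Exports.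

Local Open Scope classical_set_scope.
Local Open Scope ring_scope.

Section ComplexAnalysis.
Variable R : realType.

Definition cexp (z : R[i]) : R[i] :=
  (expR (complex.Re z) * cos (complex.Im z)
   +i* (expR (complex.Re z) * sin (complex.Im z)))%C.

Definition cintegral (mu : {measure set (measurableTypeR R) -> \bar R})
    (D : set (measurableTypeR R)) (f : R -> R[i]) : R[i] :=
  ((\int[mu]_(y in D) complex.Re (f y))%R
   +i* (\int[mu]_(y in D) complex.Im (f y))%R)%C.

End ComplexAnalysis.

(** An element of the class N, given by its characteristic triplet, which the
    function psi determines uniquely.  The measure on (0,oo) is encoded as a
    Borel measure on the line that does not charge ]-oo, 0]. *)
Record classN (R : realType) := ClassN {
  sigma : R ;
  drift : R ;
  Pi : {sigma_finite_measure set (measurableTypeR R) -> \bar R} ;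
  sigma_ge0 : 0 <= sigma ;
  drift_ge0 : 0 <= drift ;
  Pi_supp : Pi [set` `]-oo, 0%R]] = 0%E ;
  Pi_int : (\int[Pi]_(y in `]0%R, +oo[) (Num.min (y ^+ 2) y)%:E < +oo)%E ;
  nondegenerate : sigma <> 0 \/ (0 < Pi [set` `]0%R, +oo[])%E
}.

Section Exponents.
Variables (R : realType) (p : classN R).

Definition psi (z : R[i]) : R[i] :=
  (sigma p ^+ 2)%:C%C * z ^+ 2 + (drift p)%:C%C * z
  + cintegral (Pi p) `]0, +oo[
      (fun y => cexp (- (z * y%:C%C)) - 1 + z * y%:C%C).

Definition Pi_tail (y : R) : \bar R := Pi p [set` `]y, +oo[].

(** For Re z >= 0; there the tail is integrated against a function dominated
    by a multiple of min(y,1), so that the integral converges. *)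
Definition phi (z : R[i]) : R[i] :=
  (drift p)%:C%C + (sigma p ^+ 2)%:C%C * z
  + cintegral lebesgue_measure `]0, +oo[
      (fun y => (1 - cexp (- (z * y%:C%C))) * (fine (Pi_tail y))%:C%C).

(** The same function on the whole real line; it may be -oo at u < 0. *)
Definition phie (u : R) : \bar R :=
  ((drift p + sigma p ^+ 2 * u)%:E
   + \int[lebesgue_measure]_(y in `]0%R, +oo[)
       ((1 - expR (- (u * y)))%:E * Pi_tail y))%E.

Definition d_phi : \bar R :=
  ereal_sup [set u%:E | u in
    [set u : R | u <= 0 /\ (phie u = -oo%E \/ phie u = 0%E)]].

(** phi is positive on (0,oo), so phi(by) is its own real part. *)
Definition Theta_low : \bar R :=
  limf_einf (fun b : R =>
    (\int[lebesgue_measure]_(y in `]0%R, +oo[)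
       (ln (ComplexField.Normc.normc (phi ((b * y) +i* b)%C)
            / complex.Re (phi (b * y)%:C%C)))%:E)%E)
    (+oo : set_system R).

Definition in_N_Theta : Prop := (0 < Theta_low)%E.

Definition in_N_alpha (alpha : R) : Prop :=
  exists2 C : R, 0 < C &
    complex.Re (psi u%:C%C) / (C * u `^ (alpha + 1)) @[u --> +oo] --> (1 : R).

(** The smooth positive version of the density of the law on (0,oo) whose n-th
    moment is phi(1)...phi(n).  As phi(k) = O(k), these moments are at most
    C^n n!, so they determine the law. *)
Definition is_nu (nu : R -> R) : Prop :=
  [/\ forall x : R, 0 < x -> 0 < nu x,
      forall (n : nat) (x : R), 0 < x -> derivable (derive1n n nu) x 1
    & forall n : nat,
        (\int[lebesgue_measure]_(x in `]0%R, +oo[) (x ^+ n * nu x)%:E)%E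
        = (\prod_(1 <= k < n.+1) complex.Re (phi k%:R%:C%C))%:E].

(** Theta_low always lies in [0, pi/2], hence the projection [fine]. *)
Definition T_Theta : R := - ln (sin (fine Theta_low)).

End Exponents.

Section CoEigenfunctions.
Variable R : realType.

Definition w (nu : R -> R) (n : nat) (x : R) : R :=
  derive1n n (fun y : R => y ^+ n * nu y) x / n`!%:R.

Definition V (nu : R -> R) (n : nat) (x : R) : R := w nu n x / nu x.

Definition wnorm (g f : R -> R) : \bar R :=
  ((\int[lebesgue_measure]_(x in `]0%R, +oo[) (`|f x| ^+ 2 * g x)%:E)
   `^ 2^-1)%E.

(** u n = O(v n) as n -> oo, for u with values in [0,oo]; in particular u n is
    eventually finite. *)
Definition bigO_seq (u : nat -> \bar R) (v : nat -> R) : Prop :=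
  exists C : R, \forall n \near \oo, (u n <= (C * v n)%:E)%E.

Definition rate (a T : R) (n : nat) : R :=
  n%:R `^ (2^-1 - a) * expR (T * n%:R).

Definition p_weight (alpha x : R) : R := x `^ (- alpha).

Definition nubar (gamma x : R) : R := expR (- (x `^ gamma^-1)).

Definition T_pi (alpha : R) : R := - ln (sin (pi / 2 * alpha)).

(** Solutions are sought on [-1,1], the domain of arcsin. *)
Definition rho_solution (alpha rho : R) : Prop :=
  -1 <= rho <= 1 /\
  (1 - rho) `^ alpha^-1 * cos (asin rho / alpha) = 2^-1.

Definition is_rho (alpha rho : R) : Prop :=
  rho_solution alpha rho /\
  forall r : R, rho_solution alpha r -> r <= rho.

Definition T_pi_rho (alpha rho : R) : R :=
  Num.max (T_pi alpha) (1 + rho^-1).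

End CoEigenfunctions.

(* Main.v *)
(** The Mellin transform [M z = E (X ^ (z - 1))] of the invariant law satisfies
    [M (z + 1) = phi z * M z], first for integers and then on vertical lines with
    integral abscissa, because the invariance identity extends from polynomials
    to bounded continuous test functions by Bernstein approximation.  Since
    [|phi (u + i b)| / phi u >= 1] is nonincreasing in [u], iterating this
    equation gives [|M (n + i b)| <= M n exp (- b Tail)], where [Tail] is an
    integral of [ln (|phi (b y + i b)| / phi (b y))] in [y].  Mellin inversion
    then bounds [x ^ n |w_j x|] for integral [n].

    To reach the exponents close to [d_phi], the differences
    [w_j - w_(j-1)] are mapped to [x w_j] by a nonlocal operator that multiplies
    [x ^ - u] by [phi u]; a maximum principle, applied where [phi u > 0],
    gives the bound of part (1).

    When [psi] is regularly varying, [phi (b (y + i)) / (C b ^ alpha)] converges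
    to [(y + i) ^ alpha], so the limit of the integrals is [pi alpha / 2].
    Optimizing the integer [n] in terms of [x] gives an exponential decay of
    [w_j] at infinity, hence part (2a).  For (2b), the equation with [j = 0] also
    yields lower bounds on [nu]: a minimum principle near the origin, and at
    infinity a Harnack inequality combined with Chebyshev's inequality for the
    laws with density proportional to [x ^ n nu]. *)
Require Import Defs.
From HB Require Import structures.
From mathcomp Require Import all_boot all_order all_algebra.
From mathcomp Require Import all_classical all_reals all_analysis.
From mathcomp Require Import complex.
From mathcomp Require Import measurable_realfun.
From mathcomp Require Import ring lra.

Set Implicit Arguments.
Unset Strict Implicit.
Unset Printing Implicit Defensive.

Import Order.TTheory GRing.Theory Num.Theory.
Import numFieldNormedType.Exports.

Local Open Scope classical_set_scope.
Local Open Scope ring_scope.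

(** * Integration on the line *)

(** The rates come from one concave function, [Glog], the primitive of ln |1 + i / y|. The j-th
    derivative multiplies the Mellin transform by j factors, so that |w_j| is governed by the
    integral of prod_(k <= j) |1 + i b / k| against exp (- th b). Comparing the product with an
    integral, and [Glog] with its tangent at tan t, bounds the product by exp (t b) / (sin t) ^ j,
    which is integrable against exp (- th b) when t < th. Letting t tend to th gives - ln (sin th).
    All powers of n are absorbed in epsilon, so no sharp prefactor is sought.

    The obstacle is the origin: inversion starts on the line of abscissa 1 and bounds only x w_j, x
    ^ 2 w_j, and so on. The nonlocal operator at x sees only the points x exp v with v >= 0, so a
    maximum can be sought on [t, oo), with bounds that do not depend on t and no prior control near
    0.

    In part (2b), rho enters only through 0 < rho <= 1 - 2 ^ (- alpha). The angle pi / 3 and the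
    number 2 ^ (alpha / 2) are convenient choices for which the rate 1 + 1 / rho leaves enough
    room. *)

Lemma measurable_funV (R : realType) : measurable_fun setT (@GRing.inv R).
Proof.
(* [powR] with exponent -1 inverts only nonnegative reals, hence the square. *)
have -> : @GRing.inv R = (fun x => x * (x ^+ 2) `^ (- 1)).
  apply/funext => x; have [->|x0] := eqVneq x 0; first by rewrite mul0r invr0.
  rewrite powR_inv1; last exact: sqr_ge0.
  by rewrite expr2 invfM mulrA divff// mul1r.
apply: measurable_funM => //.
apply: (measurableT_comp (f := fun x => x `^ (- 1))); first exact: measurable_powR.
exact: exprn_measurable.
Qed.

Section MeasurableComp.
Context {d : measure_display} {T : measurableType d} {R : realType}.
Variables (f : T -> R) (mf : measurable_fun setT f).

Lemma measurable_fun_opp : measurable_fun setT (fun x => - f x).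
Proof. exact: measurable_funN. Qed.

Lemma measurable_fun_comp (h : R -> R) : measurable_fun setT h ->
  measurable_fun setT (fun x => h (f x)).
Proof. by move=> mh; exact: (measurableT_comp mh mf). Qed.

Lemma measurable_fun_inv : measurable_fun setT (fun x => (f x)^-1).
Proof. exact: (measurable_fun_comp (@measurable_funV R)). Qed.

Lemma measurable_fun_abs : measurable_fun setT (fun x => `|f x|).
Proof. exact: (measurable_fun_comp (@normr_measurable R setT)). Qed.

Lemma measurable_fun_expR : measurable_fun setT (fun x => expR (f x)).
Proof. exact: (measurable_fun_comp (@measurable_expR R)). Qed.

Lemma measurable_fun_ln : measurable_fun setT (fun x => ln (f x)).
Proof. exact: (measurable_fun_comp (@measurable_ln R)). Qed.

Lemma measurable_fun_cos : measurable_fun setT (fun x => cos (f x)).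
Proof.
exact: (measurable_fun_comp (continuous_measurable_fun (@continuous_cos R))).
Qed.

Lemma measurable_fun_sin : measurable_fun setT (fun x => sin (f x)).
Proof.
exact: (measurable_fun_comp (continuous_measurable_fun (@continuous_sin R))).
Qed.

Lemma measurable_fun_powR (a : R) : measurable_fun setT (fun x => f x `^ a).
Proof. exact: (measurable_fun_comp (@measurable_powR R a)). Qed.

Lemma measurable_fun_sqrt : measurable_fun setT (fun x => Num.sqrt (f x)).
Proof.
exact: (measurable_fun_comp (continuous_measurable_fun (@sqrt_continuous R))).
Qed.

End MeasurableComp.

Ltac meas :=
  repeat first [ assumption | exact: measurable_cst | exact: measurable_id
  | exact: measurable_fst | exact: measurable_snd
  | apply: measurable_fun_opp | apply: measurable_funB
  | apply: measurable_funD | apply: measurable_funX | apply: measurable_funM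
  | apply: measurable_fun_inv | apply: measurable_fun_abs
  | apply: measurable_fun_expR | apply: measurable_fun_ln
  | apply: measurable_fun_cos | apply: measurable_fun_sin
  | apply: measurable_fun_powR | apply: measurable_fun_sqrt
  | apply: measurable_maxr | apply: measurable_minr
  | match goal with H : measurable_fun _ ?h |- measurable_fun _ (fun x => ?h _) =>
      apply: (measurable_fun_comp _ H) end ].

Section RealIntegral.
Variable R : realType.
Implicit Types f g : R -> R.

Local Notation mu := (@lebesgue_measure R).

(** Lebesgue integrals are taken over the whole line; a half-line is expressed by an integrand that
    vanishes elsewhere. *)
Definition itg f := mu.-integrable setT (EFin \o f).
Definition I f : R := (\int[mu]_x f x)%R.

Lemma itg_meas f : itg f -> measurable_fun setT f.
Proof. by move=> /integrableP[/measurable_EFinP]. Qed.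

Lemma itg_dom g f : measurable_fun setT f -> itg g ->
  (forall x, `|f x| <= g x) -> itg f.
Proof.
move=> mf ig fg; apply: le_integrable ig => //.
  exact/measurable_EFinP.
move=> x _ /=; rewrite lee_fin (le_trans (fg x))// ler_norm //.
Qed.

Lemma itgD f g : itg f -> itg g -> itg (fun x => f x + g x).
Proof. by move=> iF ig; have := integrableD measurableT iF ig. Qed.

Lemma itgB f g : itg f -> itg g -> itg (fun x => f x - g x).
Proof. by move=> iF ig; have := integrableB measurableT iF ig. Qed.

Lemma itgZ f (k : R) : itg f -> itg (fun x => k * f x).
Proof. by move=> iF; have := integrableZl measurableT k iF. Qed.

Lemma itg_norm f : itg f -> itg (fun x => `|f x|).
Proof. by move=> iF; have := integrable_norm iF. Qed.

Lemma itg0 : itg (fun=> 0).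
Proof. exact: integrable0. Qed.

Lemma itg_eq f g : f =1 g -> itg f -> itg g.
Proof. by move=> /funext ->. Qed.

Lemma itg_sum n (F : nat -> R -> R) : (forall k, (k < n)%N -> itg (F k)) ->
  itg (fun x => \sum_(k < n) F k x).
Proof.
elim: n => [|n IH] iF.
  by apply: itg_eq itg0 => x; rewrite big_ord0.
apply: (@itg_eq (fun x => \sum_(k < n) F k x + F n x)).
  by move=> x; rewrite big_ord_recr.
by apply: itgD; [apply: IH => k kn; apply: iF; rewrite ltnW|exact: iF].
Qed.

Lemma I_eq f g : f =1 g -> I f = I g.
Proof. by move=> /funext ->. Qed.

Lemma I_D f g : itg f -> itg g -> I (fun x => f x + g x) = I f + I g.
Proof. by move=> iF ig; rewrite /I RintegralD. Qed.

Lemma I_B f g : itg f -> itg g -> I (fun x => f x - g x) = I f - I g.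
Proof. by move=> iF ig; rewrite /I RintegralB. Qed.

Lemma I_Z f (k : R) : itg f -> I (fun x => k * f x) = k * I f.
Proof. by move=> iF; rewrite /I RintegralZl. Qed.

Lemma I0 : I (fun=> 0) = 0.
Proof. by rewrite /I Rintegral_cst// mul0r. Qed.

Lemma I_sum n (F : nat -> R -> R) : (forall k, (k < n)%N -> itg (F k)) ->
  I (fun x => \sum_(k < n) F k x) = \sum_(k < n) I (F k).
Proof.
elim: n => [|n IH] iF.
  by rewrite big_ord0 -[RHS]I0; apply: I_eq => x; rewrite big_ord0.
rewrite big_ord_recr/= -IH; last by move=> k kn; apply: iF; rewrite ltnW.
rewrite -I_D; last exact: iF.
  by apply: I_eq => x; rewrite big_ord_recr.
by apply: itg_sum => k kn; apply: iF; rewrite ltnW.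
Qed.

Lemma I_le f g : itg f -> itg g -> (forall x, f x <= g x) -> I f <= I g.
Proof. by move=> iF ig fg; apply: le_Rintegral. Qed.

Lemma I_ge0 f : (forall x, 0 <= f x) -> 0 <= I f.
Proof. by move=> f0; apply: Rintegral_ge0. Qed.

Lemma I_norm f : itg f -> `|I f| <= I (fun x => `|f x|).
Proof. by move=> iF; apply: le_normr_Rintegral. Qed.

Lemma I_norm_le f g : measurable_fun setT f -> itg g ->
  (forall x, `|f x| <= g x) -> `|I f| <= I g.
Proof.
move=> mf ig fg; have iF := itg_dom mf ig fg.
by rewrite (le_trans (I_norm iF))// I_le//; exact: itg_norm.
Qed.

Lemma I_dct (fs : nat -> R -> R) f g : (forall n, measurable_fun setT (fs n)) ->
  (forall x, fs n x @[n --> \oo] --> f x) -> itg g ->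
  (forall n x, `|fs n x| <= g x) ->
  itg f /\ I (fs n) @[n --> \oo] --> I f.
Proof.
move=> mfs fsf ig fsg.
have mf : measurable_fun setT f.
  by apply: (measurable_fun_cvg (h := fs)) => // x _.
have mfE n : measurable_fun setT (EFin \o fs n) by exact/measurable_EFinP.
have mE : measurable_fun setT (EFin \o f) by exact/measurable_EFinP.
have [|||||i _ c] := @dominated_convergence _ _ _ mu setT measurableT
  (fun n => EFin \o fs n) (EFin \o f) (EFin \o g).
- exact: mfE.
- exact: mE.
- by apply: aeW => x _; apply: cvg_EFin; [exact: nearW|exact: fsf].
- exact: ig.
- by apply: aeW => x n _ /=; rewrite lee_fin.
split=> //; rewrite /I.
apply: fine_cvg; rewrite fineK//.
exact: integrable_fin_num.
Qed.

Lemma I_fubini (F : R * R -> R) (a b : R -> R) : measurable_fun setT F ->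
  itg a -> itg b -> (forall x y, `|F (x, y)| <= a x * b y) ->
  I (fun x => I (fun y => F (x, y))) = I (fun y => I (fun x => F (x, y))).
Proof.
move=> mF ia ib Fab.
have mE : measurable_fun setT (EFin \o F) by exact/measurable_EFinP.
have iF : ((mu \x mu)%E).-integrable setT (EFin \o F).
  apply: (proj2 (@integrable12ltyP _ _ _ _ _ mu mu _ mE)).
  apply: (@le_lt_trans _ _ (\int[mu]_x (`|a x| * I (fun y => `|b y|))%:E)%E).
    apply: ge0_le_integral => //.
    - by move=> x _; apply: integral_ge0.
    - apply: (measurable_fun_fubini_tonelli_F (m2 := mu) (fun z : R * R => `|(EFin \o F) z|%E)).
        exact: measurableT_comp.
      by move=> z.
    - apply/measurable_EFinP; apply: measurable_funM => //.
      by apply: measurableT_comp => //; exact: itg_meas.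
    - move=> x _.
      have -> : (`|a x| * I (fun y => `|b y|))%:E =
          (\int[mu]_y (`|a x| * `|b y|)%:E)%E.
        rewrite -(@I_Z (fun y => `|b y|)); last exact: itg_norm.
        rewrite /I /Rintegral fineK//; apply: integrable_fin_num => //.
        by apply: (@itgZ (fun y => `|b y|)); exact: itg_norm.
      apply: ge0_le_integral => //.
      + by apply/measurable_EFinP/measurableT_comp => //; apply: measurableT_comp.
      + by apply/measurable_EFinP/measurable_funM => //;
          apply: measurableT_comp => //; exact: itg_meas.
      + by move=> y _ /=; rewrite lee_fin -normrM (le_trans (Fab _ _))// ler_norm.
  have : itg (fun x => `|a x| * I (fun y => `|b y|)).
    apply: (@itg_eq (fun x => I (fun y => `|b y|) * `|a x|)).
      by move=> x; rewrite mulrC.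
    by apply: itgZ; exact: itg_norm.
  move=> /integrableP[_]; apply: le_lt_trans; rewrite le_eqVlt; apply/orP; left.
  apply/eqP/eq_integral => x _ /=.
  have h : 0 <= `|a x| * I (fun y => `|b y|).
    by apply: mulr_ge0 => //; exact: I_ge0.
  by rewrite (ger0_norm h).
have := Fubini iF; rewrite /I /Rintegral => FF.
have E1 x : (\int[mu]_y (F (x, y))%:E)%E = (fine (\int[mu]_y (F (x, y))%:E)%E)%:E.
  rewrite fineK//; apply: integrable_fin_num => //.
  apply: (@itg_dom (fun y => a x * b y)).
  - exact: measurable_fun_pair2.
  - exact: itgZ.
  - by move=> y; exact: Fab.
have E2 y : (\int[mu]_x (F (x, y))%:E)%E = (fine (\int[mu]_x (F (x, y))%:E)%E)%:E.
  rewrite fineK//; apply: integrable_fin_num => //.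
  apply: (@itg_dom (fun x => b y * a x)).
  - exact: measurable_fun_pair1.
  - exact: itgZ.
  - by move=> x; rewrite mulrC; exact: Fab.
congr fine.
transitivity (\int[mu]_x (\int[mu]_y (F (x, y))%:E))%E.
  by apply: eq_integral => x _; rewrite -E1.
by apply: (etrans FF); apply: eq_integral => y _; exact: E2.
Qed.

(** Joint integrability is not assumed: Tonelli gives the measurability for the positive and
    negative parts of [F] separately. *)
Lemma I_fubini_meas (F : R * R -> R) : measurable_fun setT F ->
  (forall x, itg (fun y => F (x, y))) -> measurable_fun setT (fun x => I (fun y => F (x, y))).
Proof.
move=> mF iF.
have mE : measurable_fun setT (EFin \o F) by exact/measurable_EFinP.
have -> : (fun x => I (fun y => F (x, y))) =
  (fun x => I (fun y => Num.max (F (x, y)) 0) - I (fun y => Num.max (- F (x, y)) 0)).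
  apply/funext => x; rewrite -I_B; last first.
  - apply: (itg_dom (g := fun y => `|F (x, y)|)); last 2 first.
    + exact: itg_norm.
    + by move=> y; rewrite /Num.max; case: ifPn; rewrite ?normr0// normrN.
    + apply: measurable_maxr => //; apply: measurableT_comp => //.
      exact: itg_meas (iF x).
  - apply: (itg_dom (g := fun y => `|F (x, y)|)); last 2 first.
    + exact: itg_norm.
    + by move=> y; rewrite /Num.max; case: ifPn; rewrite ?normr0.
    + by apply: measurable_maxr => //; exact: itg_meas (iF x).
  apply: I_eq => y; rewrite /Num.max; do 2 case: ltrP => ?; lra.
apply: measurable_funB.
- apply: (measurableT_comp (f := fine)) => //.
  apply: (measurable_fun_fubini_tonelli_F (m2 := mu) (fun z : R * R => (Num.max (F z) 0)%:E)).
    by apply/measurable_EFinP/measurable_maxr.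
  by move=> z; rewrite lee_fin le_max lexx orbT.
- apply: (measurableT_comp (f := fine)) => //.
  apply: (measurable_fun_fubini_tonelli_F (m2 := mu) (fun z : R * R => (Num.max (- F z) 0)%:E)).
    by apply/measurable_EFinP/measurable_maxr => //; apply: measurableT_comp.
  by move=> z; rewrite lee_fin le_max lexx orbT.
Qed.

Lemma IE f : I f = (\int[mu]_x f x)%R.
Proof. by []. Qed.

Lemma itgE f : itg f = mu.-integrable setT (EFin \o f).
Proof. by []. Qed.

Lemma itg_indic_itv (a b : R) : itg (\1_`[a, b] : R -> R).
Proof. exact: integrable_indic_itv. Qed.

Lemma I_indic_itv (a b : R) : a <= b -> I (\1_`[a, b] : R -> R) = b - a.
Proof.
rewrite le_eqVlt => /predU1P[->|ab]; rewrite /I /Rintegral integral_indic// setIT.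
  have := lebesgue_measure_itv `[b, b].
  by rewrite /= lte_fin ltxx => ->; rewrite subrr.
by have := lebesgue_measure_itv `[a, b]; rewrite /= lte_fin ab => ->; rewrite -EFinB.
Qed.

End RealIntegral.

#[global] Opaque I itg.

(** * Real calculus *)

Section DeriveCalculus.
Variable R : realType.
Implicit Types (f g : R -> R) (x : R).

(* [is_derive] is a class; this copy of it is not, so that [apply:] leaves its
   premises open instead of searching instances for them. *)
Definition hasd f x (df : R) : Prop := is_derive x 1 f df.

Lemma hasd_eq f x df df' : hasd f x df -> df = df' -> hasd f x df'.
Proof. by move=> h <-. Qed.

Lemma der_cst (c x : R) : hasd (fun=> c) x 0.
Proof. exact: is_derive_cst. Qed.

Lemma der_id x : hasd (fun y : R => y) x 1.
Proof. exact: is_derive_id. Qed.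

Lemma der_add f g x df dg : hasd f x df -> hasd g x dg ->
  hasd (fun y => f y + g y) x (df + dg).
Proof. by move=> hf hg; exact: is_deriveD. Qed.

Lemma der_sub f g x df dg : hasd f x df -> hasd g x dg ->
  hasd (fun y => f y - g y) x (df - dg).
Proof. by move=> hf hg; exact: is_deriveB. Qed.

Lemma der_opp f x df : hasd f x df ->
  hasd (fun y => - f y) x (- df).
Proof. by move=> hf; exact: is_deriveN. Qed.

Lemma der_mul f g x df dg : hasd f x df -> hasd g x dg ->
  hasd (fun y => f y * g y) x (f x * dg + g x * df).
Proof. by move=> hf hg; exact: is_deriveM. Qed.

Lemma der_comp f g x df dg : hasd f (g x) df -> hasd g x dg ->
  hasd (fun y => f (g y)) x (df * dg).
Proof. by move=> hf hg; have := is_derive1_comp hf hg; rewrite /comp mulrC. Qed.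

Lemma der_expR f x df : hasd f x df ->
  hasd (fun y => expR (f y)) x (expR (f x) * df).
Proof. by move=> hf; apply: (der_comp _ hf); exact: is_derive_expR. Qed.

Lemma der_cos f x df : hasd f x df ->
  hasd (fun y => cos (f y)) x (- sin (f x) * df).
Proof. by move=> hf; apply: (der_comp _ hf); exact: is_derive_cos. Qed.

Lemma der_sin f x df : hasd f x df ->
  hasd (fun y => sin (f y)) x (cos (f x) * df).
Proof. by move=> hf; apply: (der_comp _ hf); exact: is_derive_sin. Qed.

Lemma der_atan f x df : hasd f x df ->
  hasd (fun y => atan (f y)) x ((1 + f x ^+ 2)^-1 * df).
Proof. by move=> hf; apply: (der_comp _ hf); exact: is_derive1_atan. Qed.

Lemma der_ln f x df : 0 < f x -> hasd f x df ->
  hasd (fun y => ln (f y)) x ((f x)^-1 * df).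
Proof. by move=> f0 hf; apply: der_comp => //; exact: is_derive1_ln. Qed.

Lemma der_powR f x df (a : R) : 0 < f x -> hasd f x df ->
  hasd (fun y => f y `^ a) x (a * f x `^ (a - 1) * df).
Proof.
by move=> f0 hf; apply: (der_comp (f := fun z => z `^ a)) => //; exact: is_derive1_powR.
Qed.

Lemma der_exp f x df n : hasd f x df ->
  hasd (fun y => f y ^+ n) x (n%:R * f x ^+ n.-1 * df).
Proof.
move=> hf; have h : is_derive x 1 (f ^+ n) ((n%:R * f x ^+ n.-1) *: df) by exact: is_deriveX.
have -> : (fun y => f y ^+ n) = f ^+ n; last exact: h.
by apply/funext => y; rewrite fctE.
Qed.

Lemma der_inv f x df : f x != 0 -> hasd f x df ->
  hasd (fun y => (f y)^-1) x (- (f x ^- 2) * df).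
Proof.
move=> f0 hf; apply: DeriveDef.
  by apply: derivableV => //; case: hf.
by case: hf => hd <-; rewrite deriveV.
Qed.

Lemma der_continuous f x df : hasd f x df -> {for x, continuous f}.
Proof. by move=> [hd _]; apply: differentiable_continuous; exact/derivable1_diffP. Qed.

Lemma der_cont f x : (exists df, hasd f x df) -> {for x, continuous f}.
Proof. by move=> [df]; exact: der_continuous. Qed.

Lemma der_incr f df (a b : R) : a <= b ->
  (forall x, a <= x <= b -> hasd f x (df x)) ->
  (forall x, a < x < b -> 0 <= df x) -> f a <= f b.
Proof.
rewrite le_eqVlt => /predU1P[->//|ab] hf hdf.
have [||c cab e] := @MVT _ f df _ _ ab.
- by move=> x; rewrite in_itv/= => /andP[? ?]; apply: hf; rewrite !ltW.
- apply: continuous_in_subspaceT => x /set_mem/=; rewrite in_itv/= => /hf.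
  exact: der_continuous.
- rewrite -subr_ge0 e mulr_ge0 ?subr_ge0 ?(ltW ab)//.
  by apply: hdf; move: cab; rewrite in_itv.
Qed.

Lemma der_decr f df (a b : R) : a <= b ->
  (forall x, a <= x <= b -> hasd f x (df x)) ->
  (forall x, a < x < b -> df x <= 0) -> f b <= f a.
Proof.
move=> ab hf hdf; rewrite -lerN2.
apply: (@der_incr (fun x => - f x) (fun x => - df x)) => //.
  by move=> x xab; apply: der_opp; exact: hf.
by move=> x xab; rewrite oppr_ge0; exact: hdf.
Qed.

End DeriveCalculus.

Ltac der :=
  repeat first [ exact: der_cst | exact: der_id
  | apply: der_sub | apply: der_add | apply: der_opp
  | apply: der_exp | apply: der_mul | apply: der_inv | apply: der_expR
  | apply: der_cos | apply: der_sin | apply: der_atan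
  | apply: der_ln | apply: der_powR ].

(** * Exponential and trigonometric inequalities, and the model function [Glog] *)

Section Elementary.
Variable R : realType.
Implicit Types x y b c t : R.

(** This is x / 2 <= sinh (x / 2) multiplied by 2 exp (- x / 2). *)
Lemma sinh_ge x : 0 <= x -> x * expR (- x / 2) <= 1 - expR (- x).
Proof.
move=> x0; rewrite -subr_ge0.
pose F y : R := 1 - expR (- y) - y * expR (- y / 2).
pose dF y : R := expR (- y / 2) * (expR (- y / 2) - (1 + - y / 2)).
have -> : 1 - expR (- x) - x * expR (- x / 2) = F x by [].
have F0 : F 0 = 0 by rewrite /F oppr0 expR0 mul0r; lra.
rewrite -F0; apply: (@der_incr R F dF 0 x x0) => y _.
  apply: hasd_eq; first by rewrite /F; der.
  rewrite /dF mulrBr -expRD (_ : - y / 2 + - y / 2 = - y); last by field.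
  by ring.
by rewrite /dF mulr_ge0 ?expR_ge0// subr_ge0 expR_ge1Dx.
Qed.

Lemma sin_le x : 0 <= x -> sin x <= x.
Proof.
move=> x0; rewrite -subr_ge0.
have -> : x - sin x = (fun y => y - sin y) x by [].
have <- : (fun y => y - sin y) 0 = 0 :> R by rewrite /= sin0 subrr.
apply: (@der_incr R (fun y => y - sin y) (fun y => 1 - cos y) 0 x x0) => y _.
  by apply: hasd_eq; [der|rewrite mulr1].
by rewrite subr_ge0 cos_le1.
Qed.

Lemma abs_sin_le x : `|sin x| <= `|x|.
Proof.
wlog x0 : x / 0 <= x => [h|].
  have [/h//|/ltW x0] := leP 0 x.
  by rewrite -normrN -sinN -(normrN x); apply: h; rewrite oppr_ge0.
rewrite (ger0_norm x0); rewrite ler_norml sin_le// andbT.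
have -> : - x <= sin x = (0 <= (fun y => sin y + y) x) by rewrite /=; apply/idP/idP; lra.
have <- : (fun y => sin y + y) 0 = 0 :> R by rewrite /= sin0 addr0.
apply: (@der_incr R (fun y => sin y + y) (fun y => cos y + 1) 0 x x0) => y _.
  by apply: hasd_eq; [der|rewrite mulr1].
by have := cos_geN1 y; lra.
Qed.

Lemma cos_ge x : 1 - x ^+ 2 / 2 <= cos x.
Proof.
have -> : cos x = cos ((x / 2) *+ 2) by congr cos; field.
rewrite cos_mulr2n cos2sin2.
have : sin (x / 2) ^+ 2 <= (x / 2) ^+ 2.
  by rewrite -(real_normK (num_real (sin _))) -[leRHS]real_normK ?num_real// lerXn2r ?nnegrE// abs_sin_le.
have -> : (x / 2) ^+ 2 = x ^+ 2 / 4 by field.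
lra.
Qed.

Lemma one_sub_cexp_sqr x b :
  (1 - expR (- x) * cos b) ^+ 2 + (expR (- x) * sin b) ^+ 2
  = (1 - expR (- x)) ^+ 2 + 2 * expR (- x) * (1 - cos b).
Proof.
have := sin2cos2 b => s2; rewrite [(_ * sin b) ^+ 2]exprMn s2; ring.
Qed.

(** In complex terms, |1 - exp (- z)| / |z| <= (1 - exp (- x)) / x for z = x + i b. Since 2 (1 - cos
    b) <= b ^ 2, it reduces to x ^ 2 exp (- x) <= (1 - exp (- x)) ^ 2, which is [sinh_ge]. *)
Lemma one_sub_cexp_le x b : 0 < x ->
  (1 - expR (- x) * cos b) ^+ 2 + (expR (- x) * sin b) ^+ 2
  <= (1 + b ^+ 2 / x ^+ 2) * (1 - expR (- x)) ^+ 2.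
Proof.
move=> x0; rewrite one_sub_cexp_sqr [leRHS]mulrDl mul1r lerD2l.
have h1 : 2 * expR (- x) * (1 - cos b) <= expR (- x) * b ^+ 2.
  have := cos_ge b; have := expR_ge0 (- x); nra.
apply: (le_trans h1).
have := sinh_ge (ltW x0) => h2.
have h3 : (x * expR (- x / 2)) ^+ 2 <= (1 - expR (- x)) ^+ 2.
  rewrite lerXn2r ?nnegrE//; first by rewrite mulr_ge0 ?expR_ge0// ltW.
  by rewrite subr_ge0 expR_le1 oppr_le0 ltW.
have e : expR (- x) = (x * expR (- x / 2)) ^+ 2 / x ^+ 2.
  rewrite exprMn expr2 (expr2 (expR _)) -expRD (_ : - x / 2 + - x / 2 = - x); last by field.
  by field; rewrite gt_eqF.
rewrite {1}e (_ : _ * b ^+ 2 = b ^+ 2 / x ^+ 2 * (x * expR (- x / 2)) ^+ 2).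
  by rewrite ler_wpM2l// divr_ge0 ?sqr_ge0.
by field; rewrite gt_eqF.
Qed.

(* [logr y] is the logarithm of the modulus of [1 + i / y], [Glog] its primitive. *)
Definition logr y : R := ln (1 + y ^- 2) / 2.

Definition Glog c : R := c * logr c + atan c.

Lemma logr_arg_gt0 y : 0 < 1 + y ^- 2 :> R.
Proof. by rewrite ltr_pwDl// invr_ge0 sqr_ge0. Qed.

Lemma logr_ge0 y : 0 <= logr y.
Proof. by rewrite divr_ge0// ln_ge0// lerDl invr_ge0 sqr_ge0. Qed.

Lemma logr_decr x y : 0 < x -> x <= y -> logr y <= logr x.
Proof.
move=> x0 xy; rewrite ler_pM2r ?invr_gt0// ler_ln ?posrE ?logr_arg_gt0//.
rewrite lerD2l lef_pV2 ?posrE ?exprn_gt0//; last exact: lt_le_trans xy.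
by rewrite lerXn2r ?nnegrE// ?(ltW x0)// (le_trans (ltW x0)).
Qed.

Lemma hasd_Glog c : 0 < c -> hasd Glog c (logr c).
Proof.
move=> c0; apply: hasd_eq.
  rewrite /Glog /logr; der; first exact: logr_arg_gt0.
  by rewrite expf_eq0/= gt_eqF.
rewrite /logr /=; field; rewrite ?gt_eqF//= ?andbT.
by have := sqr_ge0 c; lra.
Qed.

(** [Glog] is concave because its derivative [logr] is nonincreasing. The right-hand side is its
    tangent at tan t, whose slope [logr (tan t)] equals - ln (sin t). *)
Lemma Glog_le t c : 0 < t < pi / 2 -> 0 < c -> Glog c <= t - c * ln (sin t).
Proof.
move=> /andP[t0 tp] c0.
have st0 : 0 < sin t by apply: sin_gt0_pihalf; rewrite t0.
have ct0 : 0 < cos t by apply: cos_gt0_pihalf; rewrite tp andbT; have := pi_gt0 R; lra.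
pose s0 := tan t.
have s00 : 0 < s0 by rewrite divr_gt0.
have e0 : 1 + s0 ^- 2 = (sin t) ^- 2.
  rewrite /s0 /tan expr_div_n invfM invrK -[1](divff (expf_neq0 2 (lt0r_neq0 st0))).
  by rewrite [X in _ + X]mulrC -mulrDl addrC cos2Dsin2 mul1r.
have lr0 : logr s0 = - ln (sin t).
  by rewrite /logr e0 lnV ?posrE ?exprn_gt0// lnXn//; field.
have D0 : t - s0 * ln (sin t) - Glog s0 = 0.
  rewrite /Glog lr0 mulrN tanK; last first.
    by rewrite in_itv/= tp andbT; have := pi_gt0 R; lra.
  by ring.
rewrite -subr_ge0 -D0.
pose D c := t - c * ln (sin t) - Glog c.
pose dD c := logr s0 - logr c.
have dDE x : 0 < x -> hasd D x (dD x).
  move=> x0; apply: hasd_eq.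
    rewrite /D; apply: der_sub; last exact: hasd_Glog.
    by der.
  by rewrite /dD lr0; ring.
have [cs|/ltW sc] := leP c s0.
- apply: (@der_decr R D dD c s0 cs) => x /andP[h1 h2].
    by apply: dDE; exact: lt_le_trans h1.
  by rewrite subr_le0 logr_decr//; [exact: lt_trans h1|exact: ltW].
- apply: (@der_incr R D dD s0 c sc) => x /andP[h1 h2].
    by apply: dDE; exact: lt_le_trans h1.
  by rewrite subr_ge0 logr_decr// ltW.
Qed.

Lemma Glog_ge0 c : 0 <= c -> 0 <= Glog c.
Proof.
move=> c0; apply: addr_ge0; first by rewrite mulr_ge0 ?logr_ge0.
by have := @le_atan R 0 c c0; rewrite atan0.
Qed.

Lemma Glog_small (e : R) : 0 < e -> exists2 d : R, 0 < d & forall c, 0 < c -> c <= d -> Glog c <= e.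
Proof.
move=> e0; pose t := Num.min (e / 2) 1.
have t0 : 0 < t by rewrite lt_min ltr01 andbT divr_gt0.
have tp : t < pi / 2 .
  have h : (1 : R) < pi / 2 by have := @pihalf_ge1 R; rewrite le_eqVlt => /predU1P[h|//];
    have := cos1_gt0 R; rewrite h cos_pihalf ltxx.
  by rewrite /t gt_min h orbT.
have st0 : 0 < sin t by apply: sin_gt0_pihalf; rewrite t0.
have L0 : 0 <= - ln (sin t) by rewrite oppr_ge0 ln_le0// sin_le1.
exists (e / 2 / (1 - ln (sin t))); first by rewrite !divr_gt0//; lra.
move=> c c0; rewrite ler_pdivlMr; last by lra.
move=> cd; have := @Glog_le t c _ c0; rewrite t0 tp => /(_ isT) h.
have te : t <= e / 2 by rewrite ge_min lexx.
have : c * (1 - ln (sin t)) = c - c * ln (sin t) by ring.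
lra.
Qed.

(** The k-th term is [logr (k / b)] and [logr] is nonincreasing, so the sum is a lower Riemann sum,
    at most b [Glog (n / b)]; then apply the tangent bound. This is where the rate - ln (sin t) per
    derivative arises. *)
Lemma sum_logr_le n b t : 0 <= b -> 0 < t < pi / 2 ->
  \sum_(k < n) ln (1 + b ^+ 2 / k.+1%:R ^+ 2) / 2 <= t * b - n%:R * ln (sin t).
Proof.
move=> b0 ht; have t0 : 0 < t by case/andP: ht.
have [->|bn0] := eqVneq b 0.
  rewrite big1; last by move=> k _; rewrite expr0n/= mul0r addr0 ln1 mul0r.
  rewrite mulr0 sub0r oppr_ge0 mulr_ge0_le0// ln_le0//; exact: sin_le1.
have {bn0}b0 : 0 < b by rewrite lt_neqAle eq_sym bn0.
have lE (k : nat) : ln (1 + b ^+ 2 / k.+1%:R ^+ 2) / 2 = logr (k.+1%:R / b).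
  by rewrite /logr expr_div_n invf_div.
case: n => [|n].
  by rewrite big_ord0 mul0r subr0 mulr_ge0 ?ltW.
apply: (@le_trans _ _ (b * Glog (n.+1%:R / b))).
  elim: n => [|n IH].
    rewrite big_ord1 (lE 0) /Glog (_ : b * _ = logr (1 / b) + b * atan (1 / b)) ?lerDl; last first.
      by field; rewrite gt_eqF.
    rewrite mulr_ge0 ?(ltW b0)//.
    have h : 0 <= 1 / b by rewrite divr_ge0// ltW.
    by have := @le_atan R 0 _ h; rewrite atan0.
  rewrite big_ord_recr/= lE; apply: (le_trans (lerD IH (lexx _))).
  rewrite -lerBrDl -mulrBr.
  have pos (m : nat) : 0 < m.+1%:R / b by rewrite divr_gt0.
  have [|||c] := @MVT _ Glog logr (n.+1%:R / b) (n.+2%:R / b).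
  - by rewrite ltr_pM2r ?invr_gt0// ltr_nat.
  - move=> x; rewrite in_itv/= => /andP[h _]; apply: hasd_Glog.
    exact: lt_trans h.
  - apply: continuous_in_subspaceT => x /set_mem/=; rewrite in_itv/= => /andP[h _].
    by apply: (der_continuous (df := logr x)); apply: hasd_Glog; exact: lt_le_trans h.
  - rewrite in_itv/= => /andP[c1 c2] ->.
    rewrite (_ : n.+2%:R / b - n.+1%:R / b = b^-1); last first.
      by rewrite -mulrBl -natrB// subSnn mul1r.
    rewrite mulrCA divff ?gt_eqF// mulr1 logr_decr ?(ltW c2)//.
    exact: lt_trans c1.
rewrite mulrC; apply: (le_trans (ler_wpM2r (ltW b0) (Glog_le ht _))).
  by rewrite divr_gt0.
by rewrite mulrBl mulrAC divfK ?gt_eqF.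
Qed.

(** Since c [logr c] <= 1 / (2 c), only the arctangent survives. So [logr] has total integral pi /
    2, the value that bounds [Theta_low]. *)
Lemma Glog_cvg_pihalf : Glog c @[c --> +oo] --> (pi / 2 : R).
Proof.
rewrite -[X in _ --> X]add0r; apply: cvgD; last exact: cvgy_atan.
apply: (@squeeze_cvgr _ _ _ _ (fun=> 0) (fun c => c^-1 / 2)).
- near=> c.
  have c0 : 0 < c by near: c; exact: nbhs_pinfty_gt.
  rewrite mulr_ge0 ?logr_ge0 ?(ltW c0)//=.
  rewrite /logr mulrA ler_pM2r ?invr_gt0//.
  have : ln (1 + c ^- 2) <= c ^- 2 by apply: le_ln1Dx; rewrite (@lt_trans _ _ 0)// invr_gt0 exprn_gt0.
  move=> /(ler_wpM2l (ltW c0)) /le_trans; apply.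
  by rewrite expr2 invfM mulrA divff ?mul1r// gt_eqF.
- exact: cvg_cst.
- rewrite -(mul0r (2^-1)); apply: cvgMl.
  by apply/gtr0_cvgV0; [near=> c; near: c; exact: nbhs_pinfty_gt|exact: cvg_id].
Unshelve. all: by end_near.
Qed.

End Elementary.

(** * Exponents *)

Section Norm2.
Variable R : realType.
Implicit Types a b c d x y : R.

Definition norm2 a b : R := Num.sqrt (a ^+ 2 + b ^+ 2).

Lemma norm2E a b : norm2 a b = Num.sqrt (a ^+ 2 + b ^+ 2).
Proof. by []. Qed.

Lemma norm2_ge0 a b : 0 <= norm2 a b.
Proof. exact: sqrtr_ge0. Qed.

Lemma norm2_sqr a b : norm2 a b ^+ 2 = a ^+ 2 + b ^+ 2.
Proof. by rewrite sqr_sqrtr// addr_ge0 ?sqr_ge0. Qed.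

Lemma norm2_le a b c : 0 <= c -> a ^+ 2 + b ^+ 2 <= c ^+ 2 -> norm2 a b <= c.
Proof. by move=> c0 h; rewrite -[leRHS](ger0_norm c0) -sqrtr_sqr ler_wsqrtr. Qed.

Lemma norm2_ge_l a b : `|a| <= norm2 a b.
Proof. by rewrite -sqrtr_sqr ler_wsqrtr// lerDl sqr_ge0. Qed.

Lemma norm2N a b : norm2 a (- b) = norm2 a b.
Proof. by rewrite /norm2 sqrrN. Qed.

Lemma norm2M a b c d : norm2 (a * c - b * d) (a * d + b * c) = norm2 a b * norm2 c d.
Proof.
rewrite /norm2 -sqrtrM ?addr_ge0 ?sqr_ge0//; congr Num.sqrt; ring.
Qed.

Lemma norm2Z c a b : norm2 (c * a) (c * b) = `|c| * norm2 a b.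
Proof. by rewrite -sqrtr_sqr /norm2 -sqrtrM ?sqr_ge0//; congr Num.sqrt; ring. Qed.

Lemma norm2_l0 a : norm2 a 0 = `|a|.
Proof. by rewrite /norm2 expr0n/= addr0 sqrtr_sqr. Qed.

Lemma cauchy_schwarz2 a b c d : a * c + b * d <= norm2 a b * norm2 c d.
Proof.
rewrite (le_trans (ler_norm _))// -sqrtr_sqr /norm2 -sqrtrM ?addr_ge0 ?sqr_ge0//.
by rewrite ler_wsqrtr//; have := sqr_ge0 (a * d - b * c); nra.
Qed.

Lemma norm2D a b c d : norm2 (a + c) (b + d) <= norm2 a b + norm2 c d.
Proof.
apply: norm2_le; first by rewrite addr_ge0 ?norm2_ge0.
have := cauchy_schwarz2 a b c d.
have -> : (norm2 a b + norm2 c d) ^+ 2 =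
    norm2 a b ^+ 2 + 2 * (norm2 a b * norm2 c d) + norm2 c d ^+ 2 by ring.
by rewrite !norm2_sqr; nra.
Qed.

Lemma sqr_le_weight a b c d : a ^+ 2 + b ^+ 2 <= c ^+ 2 ->
  (a * d) ^+ 2 + (b * d) ^+ 2 <= (c * d) ^+ 2.
Proof. by move=> h; rewrite !exprMn -mulrDl ler_wpM2r// sqr_ge0. Qed.

(** Minkowski's inequality for a complex integrand: pair the integrand with its own integral, apply
    Cauchy-Schwarz pointwise, and divide by the norm [S]. *)
Lemma I_norm2 (A B H : R -> R) : itg A -> itg B -> itg H ->
  (forall x, 0 <= H x) -> (forall x, A x ^+ 2 + B x ^+ 2 <= H x ^+ 2) ->
  norm2 (I A) (I B) <= I H.
Proof.
move=> iA iB iH H0 AB; have IH0 : 0 <= I H by exact: I_ge0.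
set S := norm2 _ _.
have S0 : 0 <= S by exact: norm2_ge0.
have : S ^+ 2 <= S * I H.
  rewrite norm2_sqr !expr2 -(I_Z _ iA) -(I_Z _ iB) -(I_Z _ iH) -I_D; try exact: itgZ.
  apply: I_le => [||x]; [by apply: itgD; exact: itgZ|exact: itgZ|].
  rewrite (le_trans (cauchy_schwarz2 _ _ _ _))// ler_wpM2l//.
  by apply: norm2_le.
rewrite expr2; move: S0; rewrite le_eqVlt => /predU1P[<- //|S0].
by rewrite ler_pM2l.
Qed.

End Norm2.

(* Drift, Gaussian coefficient [sigma ^+ 2] and tail [y |-> Pi (y, oo)] of an
   exponent: [phi] only sees the measure through its tail. *)
Record levy (R : realType) := Levy {
  lm : R ; ls : R ; lq : R -> R ;
  lm_ge0 : 0 <= lm ; ls_ge0 : 0 <= ls ;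
  lq_ge0 : forall y, 0 <= lq y ;
  lq_meas : measurable_fun setT lq ;
  lq_eq0 : forall y, y <= 0 -> lq y = 0 ;
  lq_decr : forall x y, 0 < x -> x <= y -> lq y <= lq x ;
  lq_int : itg (fun y => Num.min y 1 * lq y) ;
  l_nondeg : 0 < ls \/ exists2 y, 0 < y & 0 < lq y }.

Section Bernstein.
Variables (R : realType) (p : levy R).
Local Notation m := (lm p).
Local Notation s := (ls p).
Local Notation q := (lq p).
Implicit Types u v b y : R.

(* Real and imaginary parts of [phi] at [u + i b]. *)
Definition phiR u b := m + s * u + I (fun y => (1 - expR (- (u * y)) * cos (b * y)) * q y).
Definition phiI u b := s * b + I (fun y => expR (- (u * y)) * sin (b * y) * q y).
Definition ph u := m + s * u + I (fun y => (1 - expR (- (u * y))) * q y).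
Definition phN u b := norm2 (phiR u b) (phiI u b).
Definition ratio u b := phN u b / ph u.

Lemma itg_minq k : itg (fun y => k * (Num.min y 1 * q y)).
Proof. by apply: itgZ; exact: lq_int. Qed.

Lemma itg_dom_minq (h : R -> R) k : measurable_fun setT h ->
  (forall y, 0 < y -> `|h y| <= k * Num.min y 1) -> itg (fun y => h y * q y).
Proof.
move=> mh hk; apply: (itg_dom _ (itg_minq k)).
  by have := lq_meas p => mq; meas.
move=> y; rewrite normrM (ger0_norm (lq_ge0 p y)) mulrA.
have [y0|y0] := leP y 0; first by rewrite lq_eq0// !mulr0.
by rewrite ler_wpM2r ?lq_ge0// hk.
Qed.

Lemma one_subE_le u y : 0 <= u -> 0 < y -> 0 <= 1 - expR (- (u * y)) <= (1 + u) * Num.min y 1.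
Proof.
move=> u0 y0; have uy : 0 <= u * y by rewrite mulr_ge0// ltW.
rewrite subr_ge0 expR_le1 oppr_le0 uy/=.
rewrite /Num.min; case: ifPn => h.
  have := expR_ge1Dx (- (u * y)); have : 0 <= y by exact: ltW.
  nra.
by have := expR_ge0 (- (u * y)); lra.
Qed.

Lemma expR_sin_le u b y : 0 <= u -> 0 < y ->
  `|expR (- (u * y)) * sin (b * y)| <= (1 + `|b|) * Num.min y 1.
Proof.
move=> u0 y0; rewrite normrM (ger0_norm (expR_ge0 _)).
have e1 : expR (- (u * y)) <= 1 by rewrite expR_le1 oppr_le0 mulr_ge0// ltW.
have h1 : expR (- (u * y)) * `|sin (b * y)| <= `|sin (b * y)|.
  by rewrite ler_piMl.
apply: (le_trans h1); rewrite /Num.min; case: ifPn => h.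
  apply: (le_trans (abs_sin_le _)); rewrite normrM (gtr0_norm y0).
  by have := normr_ge0 b; nra.
by apply: (le_trans (sin_max _)); rewrite mulr1 lerDl.
Qed.

Lemma one_sub_cos_le1 b y : 0 < y -> 1 - cos (b * y) <= 2 * (1 + `|b|) * Num.min y 1.
Proof.
move=> y0; have b0 := normr_ge0 b.
have -> : cos (b * y) = cos (`|b| * y) by rewrite -(cos_norm (b * y)) normrM (gtr0_norm y0).
have h2 := cos_ge (`|b| * y); have h3 := cos_geN1 (`|b| * y).
have by0 : 0 <= `|b| * y by rewrite mulr_ge0// ltW.
rewrite /Num.min; case: ifPn => h; last by nra.
have [hb|hb] := leP (`|b| * y) 2; first by nra.
by nra.
Qed.

Lemma one_sub_cexp_bound u b y : 0 <= u -> 0 < y ->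
  `|1 - expR (- (u * y)) * cos (b * y)| <= (3 + u + 2 * `|b|) * Num.min y 1.
Proof.
move=> u0 y0.
have /andP[e0 e1] := one_subE_le u0 y0.
have uy : expR (- (u * y)) <= 1 by lra.
have g0 := expR_ge0 (- (u * y)).
have c1 := cos_le1 (b * y).
have -> : 1 - expR (- (u * y)) * cos (b * y) = (1 - expR (- (u * y))) + expR (- (u * y)) * (1 - cos (b * y)) by ring.
rewrite ger0_norm; last by rewrite addr_ge0// mulr_ge0// subr_ge0.
have : expR (- (u * y)) * (1 - cos (b * y)) <= 1 - cos (b * y).
  by rewrite ler_piMl// subr_ge0.
by have := one_sub_cos_le1 b y0; nra.
Qed.

Lemma itg_re u b : 0 <= u -> itg (fun y => (1 - expR (- (u * y)) * cos (b * y)) * q y).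
Proof.
move=> u0; apply: (itg_dom_minq (k := 3 + u + 2 * `|b|)); first by meas.
by move=> y y0; exact: one_sub_cexp_bound.
Qed.

Lemma itg_im u b : 0 <= u -> itg (fun y => expR (- (u * y)) * sin (b * y) * q y).
Proof.
move=> u0; apply: (itg_dom_minq (k := 1 + `|b|)); first by meas.
by move=> y y0; exact: expR_sin_le.
Qed.

Lemma itg_ph u : 0 <= u -> itg (fun y => (1 - expR (- (u * y))) * q y).
Proof.
move=> u0; apply: (itg_dom_minq (k := 1 + u)); first by meas.
by move=> y y0; have /andP[h1 h2] := one_subE_le u0 y0; rewrite ger0_norm.
Qed.

Lemma phR0 u : phiR u 0 = ph u.
Proof. by rewrite /phiR/ph; congr (_ + I _); apply/funext => y; rewrite mul0r cos0 mulr1. Qed.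

Lemma phI0 u : phiI u 0 = 0.
Proof.
rewrite /phiI mulr0 add0r -[RHS](I0 R); apply: I_eq => y.
by rewrite mul0r sin0 mulr0 mul0r.
Qed.

Lemma ph_mono v u : 0 <= v -> v <= u -> ph v <= ph u.
Proof.
move=> v0 vu; have u0 := le_trans v0 vu.
rewrite lerD ?lerD2l ?ler_wpM2r ?ls_ge0//; first by rewrite ler_wpM2l// ls_ge0.
apply: I_le => [||y]; [exact: itg_ph|exact: itg_ph|].
have [y0|y0] := leP y 0; first by rewrite lq_eq0// !mulr0.
by rewrite ler_wpM2r ?lq_ge0// lerD2l lerN2 ler_expR lerN2 ler_wpM2r// ltW.
Qed.

Lemma ph_ge0 u : 0 <= u -> 0 <= ph u.
Proof.
move=> u0; rewrite !addr_ge0 ?lm_ge0// ?mulr_ge0 ?ls_ge0//.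
apply: I_ge0 => y; have [y0|y0] := leP y 0; first by rewrite lq_eq0// !mulr0.
by rewrite mulr_ge0 ?lq_ge0//; have /andP[] := one_subE_le u0 y0.
Qed.

(* The integrand is at least a positive constant on an interval. *)
Lemma ph_gt0 u : 0 < u -> 0 < ph u.
Proof.
move=> u0; have u0' := ltW u0; have [s0|[y0 y0_gt0 qy0]] := l_nondeg p.
  apply: (@lt_le_trans _ _ (s * u)); first by rewrite mulr_gt0.
  rewrite /ph -addrA addrCA lerDl addr_ge0 ?lm_ge0//.
  apply: I_ge0 => y; have [y0|y0] := leP y 0; first by rewrite lq_eq0// !mulr0.
  by rewrite mulr_ge0 ?lq_ge0//; have /andP[] := one_subE_le u0' y0.
pose c := (1 - expR (- (u * (y0 / 2)))) * q y0.
have c0 : 0 < c.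
  by rewrite mulr_gt0// subr_gt0 expR_lt1 oppr_lt0 mulr_gt0// divr_gt0.
pose f y := c * \1_(`[y0 / 2, y0]) y.
have iF : itg f.
  apply: itgZ; apply: itg_indic_itv.
have If : I f = c * (y0 / 2).
  rewrite /f I_Z; last exact: itg_indic_itv.
  congr (_ * _); rewrite I_indic_itv; first by field.
  by have := ltW y0_gt0; lra.
apply: (@lt_le_trans _ _ (I f)).
  by rewrite If mulr_gt0// divr_gt0.
apply: (@le_trans _ _ (I (fun y => (1 - expR (- (u * y))) * q y))); last first.
  by rewrite lerDr addr_ge0 ?lm_ge0// mulr_ge0 ?ls_ge0.
apply: I_le => // [|y]; first exact: itg_ph.
rewrite /f indicE; case: (boolP (y \in _)) => /=.
  rewrite inE/= in_itv/= => /andP[h1 h2]; rewrite mulr1; apply: ler_pM; rewrite ?lq_ge0//.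
  - by rewrite subr_ge0 expR_le1 oppr_le0 mulr_ge0// divr_ge0// ltW.
  - by rewrite lerD2l lerN2 ler_expR lerN2 ler_wpM2l.
  - by apply: lq_decr => //; apply: lt_le_trans h1; rewrite divr_gt0.
move=> _; rewrite mulr0; have [y1|y1] := leP y 0; first by rewrite lq_eq0// !mulr0.
by rewrite mulr_ge0 ?lq_ge0//; have /andP[] := one_subE_le u0' y1.
Qed.

Lemma ph_le_phiR u b : 0 <= u -> ph u <= phiR u b.
Proof.
move=> u0; rewrite lerD2l; apply: I_le => [||y]; [exact: itg_ph|exact: itg_re|].
rewrite ler_wpM2r ?lq_ge0// lerD2l lerN2 ler_piMr ?expR_ge0//; exact: cos_le1.
Qed.

Lemma phN_ge u b : 0 <= u -> ph u <= phN u b.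
Proof.
move=> u0; rewrite (le_trans (ph_le_phiR b u0))//.
by rewrite (le_trans (ler_norm _))// norm2_ge_l.
Qed.

(** That is, |phi z| / |z| <= phi u / u for z = u + i b. It holds for the drift, the Gaussian term
    and, by [one_sub_cexp_le], for each point of the integral. *)
Lemma phN_le u b : 0 < u -> phN u b <= Num.sqrt (1 + b ^+ 2 / u ^+ 2) * ph u.
Proof.
move=> u0; set c := Num.sqrt _; have u0' := ltW u0.
have c1 : 1 <= c.
  by rewrite -(sqrtr1 R) ler_wsqrtr// lerDl divr_ge0// sqr_ge0.
have c0 : 0 <= c by rewrite (le_trans _ c1).
have csq : c ^+ 2 = 1 + b ^+ 2 / u ^+ 2.
  by rewrite sqr_sqrtr// addr_ge0// divr_ge0// sqr_ge0.
rewrite /phN /phiR /phiI -[s * b]add0r.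
apply: (le_trans (norm2D _ _ _ _)); rewrite /ph mulrDr; apply: lerD.
  apply: (le_trans (norm2D _ _ _ _)); rewrite mulrDr; apply: lerD.
    by rewrite norm2_l0 ger0_norm ?lm_ge0// ler_peMl// lm_ge0.
  rewrite norm2Z (ger0_norm (ls_ge0 p)) mulrCA ler_wpM2l ?ls_ge0//.
  apply: norm2_le; first by rewrite mulr_ge0.
  by rewrite exprMn csq mulrDl mul1r divfK// expf_neq0// gt_eqF.
rewrite -I_Z; last exact: itg_ph.
apply: I_norm2 => [||||y].
- exact: itg_re.
- exact: itg_im.
- by apply: itgZ; exact: itg_ph.
- move=> y; have [y0|y0] := leP y 0; first by rewrite lq_eq0// !mulr0.
  by rewrite mulr_ge0// mulr_ge0 ?lq_ge0//; have /andP[] := one_subE_le u0' y0.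
rewrite mulrA; have [y0|y0] := leP y 0.
  by rewrite lq_eq0// !mulr0 expr0n/= addr0.
apply: sqr_le_weight; rewrite [leRHS]exprMn csq.
apply: (le_trans (one_sub_cexp_le _ (mulr_gt0 u0 y0))).
by rewrite !exprMn -mulf_div divff ?mulr1// expf_neq0// gt_eqF.
Qed.

(** The increment of phi from v + i b to u + i b has modulus at most its value at b = 0, because the
    oscillating factor of the integrand is the same at both points. *)
Lemma phN_sub v u b : 0 <= v -> v <= u -> phN u b <= phN v b + (ph u - ph v).
Proof.
move=> v0 vu; have u0 := le_trans v0 vu.
have iR := itgB (itg_re b u0) (itg_re b v0).
have iI := itgB (itg_im b u0) (itg_im b v0).
have iH := itgB (itg_ph u0) (itg_ph v0).
have -> : ph u - ph v = s * (u - v) +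
    I (fun y => (1 - expR (- (u * y))) * q y - (1 - expR (- (v * y))) * q y).
  by rewrite I_B; [rewrite /ph; move: (I _) (I _) => ? ?; ring|exact: itg_ph|exact: itg_ph].
rewrite /phN.
have -> : phiR u b = phiR v b + (s * (u - v) +
   I (fun y => (1 - expR (- (u * y)) * cos (b * y)) * q y - (1 - expR (- (v * y)) * cos (b * y)) * q y)).
  by rewrite I_B; [rewrite /phiR; move: (I _) (I _) => ? ?; ring|exact: itg_re|exact: itg_re].
have -> : phiI u b = phiI v b + (0 +
   I (fun y => expR (- (u * y)) * sin (b * y) * q y - expR (- (v * y)) * sin (b * y) * q y)).
  by rewrite I_B; [rewrite /phiI; move: (I _) (I _) => ? ?; ring|exact: itg_im|exact: itg_im].
apply: (le_trans (norm2D _ _ _ _)); rewrite lerD2l.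
apply: (le_trans (norm2D _ _ _ _)); apply: lerD.
  by rewrite norm2_l0 ger0_norm// mulr_ge0 ?ls_ge0// subr_ge0.
have mono y : 0 < y -> expR (- (u * y)) <= expR (- (v * y)).
  by move=> y0; rewrite ler_expR lerN2 ler_wpM2r// ltW.
apply: I_norm2 => // y.
  rewrite -mulrBl; have [y0|y0] := leP y 0; first by rewrite lq_eq0// !mulr0.
  by rewrite mulr_ge0 ?lq_ge0//; have := mono _ y0; lra.
rewrite -!mulrBl; apply: sqr_le_weight.
rewrite -[X in X ^+ 2](_ : - ((expR (- (u * y)) - expR (- (v * y))) * cos (b * y)) = _); last by ring.
rewrite sqrrN !exprMn -mulrDr cos2Dsin2 mulr1.
by rewrite le_eqVlt; apply/orP; left; apply/eqP; ring.
Qed.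

Lemma ratio_ge1 u b : 0 < u -> 1 <= ratio u b.
Proof. by move=> u0; rewrite ler_pdivlMr ?ph_gt0// mul1r phN_ge// ltW. Qed.

Lemma ratio_le u b : 0 < u -> ratio u b <= Num.sqrt (1 + b ^+ 2 / u ^+ 2).
Proof. by move=> u0; rewrite ler_pdivrMr ?ph_gt0// phN_le. Qed.

(* [ratio u b] is at most a convex combination of [ratio v b] and [1]. *)
Lemma ratio_decr v u b : 0 < v -> v <= u -> ratio u b <= ratio v b.
Proof.
move=> v0 vu; have u0 := lt_le_trans v0 vu.
have pu := ph_gt0 u0; have pv := ph_gt0 v0.
have r1 := ratio_ge1 b v0.
have hN : phN v b = ratio v b * ph v by rewrite divfK// gt_eqF.
rewrite [leLHS]/ratio ler_pdivrMr//; apply: (le_trans (phN_sub b (ltW v0) vu)).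
rewrite hN; have := ph_mono (ltW v0) vu.
by move: (ratio v b) (ph v) (ph u) r1 => r x y; nra.
Qed.

Lemma one_subE_scale c x : 1 <= c -> 0 <= x ->
  1 - expR (- (c * x)) <= c * (1 - expR (- x)) :> R.
Proof.
move=> c1 x0; rewrite -subr_ge0.
pose D x : R := c * (1 - expR (- x)) - (1 - expR (- (c * x))).
pose dD x : R := c * (expR (- x) - expR (- (c * x))).
have -> : c * (1 - expR (- x)) - (1 - expR (- (c * x))) = D x by [].
have <- : D 0 = 0 by rewrite /D mulr0 oppr0 expR0; ring.
apply: (@der_incr R D dD 0 x x0) => y.
  by move=> _; apply: hasd_eq; [rewrite /D; der|rewrite /dD; ring].
move=> /andP[y0 _]; rewrite mulr_ge0 ?(le_trans _ c1)// subr_ge0 ler_expR lerN2.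
by rewrite ler_peMl// ltW.
Qed.

(** By concavity of 1 - exp (- u y) in u; the drift does not depend on u, and u / v >= 1. *)
Lemma ph_scale v u : 0 < v -> v <= u -> ph u <= u / v * ph v.
Proof.
move=> v0 vu; have u0 := lt_le_trans v0 vu.
have c1 : 1 <= u / v by rewrite ler_pdivlMr// mul1r.
rewrite /ph !mulrDr; apply: lerD; first apply: lerD.
- by rewrite ler_peMl// lm_ge0.
- by rewrite mulrCA divfK// gt_eqF.
rewrite -I_Z; last exact: itg_ph (ltW v0).
apply: I_le => [||y]; [exact: itg_ph (ltW u0)|by apply: itgZ; exact: itg_ph (ltW v0)|].
have [y0|y0] := leP y 0; first by rewrite lq_eq0// !mulr0.
rewrite mulrA ler_wpM2r ?lq_ge0//.
have := one_subE_scale c1 (ltW (mulr_gt0 v0 y0)).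
by rewrite mulrA divfK// gt_eqF.
Qed.

Lemma phiR_meas b (f : R -> R) : measurable_fun setT f -> (forall x, 0 <= f x) ->
  measurable_fun setT (fun x => phiR (f x) b).
Proof.
move=> mf f0; have mq := lq_meas p; rewrite /phiR; apply: measurable_funD; first by meas.
apply: (@I_fubini_meas R (fun z => (1 - expR (- (f z.1 * z.2)) * cos (b * z.2)) * q z.2)).
  meas.
by move=> x /=; exact: itg_re.
Qed.

Lemma phiI_meas b (f : R -> R) : measurable_fun setT f -> (forall x, 0 <= f x) ->
  measurable_fun setT (fun x => phiI (f x) b).
Proof.
move=> mf f0; have mq := lq_meas p; rewrite /phiI; apply: measurable_funD; first by meas.
apply: (@I_fubini_meas R (fun z => expR (- (f z.1 * z.2)) * sin (b * z.2) * q z.2)).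
  meas.
by move=> x /=; exact: itg_im.
Qed.

Lemma phE u : ph u = m + s * u + I (fun y => (1 - expR (- (u * y))) * q y).
Proof. by []. Qed.

Lemma phiRE u b : phiR u b = m + s * u + I (fun y => (1 - expR (- (u * y)) * cos (b * y)) * q y).
Proof. by []. Qed.

Lemma phiIE u b : phiI u b = s * b + I (fun y => expR (- (u * y)) * sin (b * y) * q y).
Proof. by []. Qed.

Lemma ratioE u b : ratio u b = phN u b / ph u.
Proof. by []. Qed.

Lemma phNE u b : phN u b = norm2 (phiR u b) (phiI u b).
Proof. by []. Qed.

End Bernstein.

#[global] Opaque phiR phiI ph phN ratio norm2.

Section MoreIntegral.
Variable R : realType.

(** Yields integrability of the limit together with the bound, in situations where no dominating
    function is known beforehand. *)
Lemma I_fatou (fs : nat -> R -> R) (f : R -> R) (C : R) :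
  (forall n, itg (fs n)) -> (forall n x, 0 <= fs n x) ->
  (forall x, fs n x @[n --> \oo] --> f x) -> (forall n, I (fs n) <= C) ->
  itg f /\ I f <= C.
Proof.
move=> ifs fs0 fsf IC.
have f0 x : 0 <= f x.
  rewrite -(cvg_lim _ (fsf x))//; apply: limr_ge; first by apply/cvg_ex; exists (f x).
  by apply: nearW => n; exact: fs0.
have mf : measurable_fun setT f.
  apply: (measurable_fun_cvg (h := fs)) => [n|x _]; last exact: fsf.
  exact: itg_meas.
have mE : measurable_fun setT (EFin \o f) by exact/measurable_EFinP.
have key : (\int[@lebesgue_measure R]_x (f x)%:E <= C%:E)%E.
  have mfE n : measurable_fun setT (EFin \o fs n).
    by apply/measurable_EFinP; exact: itg_meas.
  have := @fatou _ _ R (@lebesgue_measure R) setT measurableT (fun n => EFin \o fs n) mfE.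
  move=> /(_ (fun n x _ => _)) h.
  have {h} := h (fun n x => fs0 n x).
  rewrite (_ : (fun x => limn_einf (fun n => (EFin \o fs n) x)) = (fun x => (f x)%:E)); last first.
    apply/funext => x.
    have cx : (EFin \o fs n) x @[n --> \oo] --> (f x)%:E.
      by apply: cvg_EFin; [exact: nearW|exact: fsf].
    by rewrite is_cvg_limn_einfE; [exact/cvg_lim|apply/cvg_ex; eexists; exact: cx].
  move=> /le_trans; apply.
  rewrite (_ : (fun n => \int[@lebesgue_measure R]_x (EFin \o fs n) x)%E = (fun n => (I (fs n))%:E)); last first.
    apply/funext => n; rewrite IE /Rintegral fineK//.
    by apply: integrable_fin_num => //; rewrite -itgE.
  rewrite limn_einf_lim; apply: lime_le; first exact: is_cvg_einfs.
  apply: nearW => n; apply: (@le_trans _ _ (I (fs n))%:E); last by rewrite lee_fin.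
  by apply: ereal_inf_lbound; exists n => //=.
have iF : itg f.
  rewrite itgE; apply/integrableP; split => //.
  apply: le_lt_trans (ltry C); apply: le_trans key.
  by rewrite le_eqVlt; apply/orP; left; apply/eqP/eq_integral => x _ /=; rewrite ger0_norm.
split=> //; rewrite -lee_fin IE /Rintegral fineK//.
by apply: integrable_fin_num => //; rewrite -itgE.
Qed.

(** The Heaviside factor, which cuts an integral to a half-line without changing its domain. *)
Definition stp (u : R) : R := (0 < u)%R%:R.

Lemma stp_meas : measurable_fun setT stp.
Proof.
have -> : stp = \1_(`]0, +oo[ : set R).
  apply/funext => u; rewrite /stp indicE; congr (nat_of_bool _)%:R.
  by apply/idP/idP; rewrite inE/= in_itv/= andbT.
exact: measurable_indic.
Qed.

Lemma stp1 u : 0 < u -> stp u = 1.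
Proof. by rewrite /stp => ->. Qed.

Lemma stp0 u : u <= 0 -> stp u = 0.
Proof. by rewrite /stp ltNge => ->. Qed.

(* The integral of [g] over (0, x), equal to 0 when [x <= 0]. *)
Definition prim (g : R -> R) (x : R) : R := I (fun t => g t * (stp t * stp (x - t))).

Lemma stp_mul_itv a x t : 0 <= a -> a <= x ->
  `|stp t * (stp (x - t) - stp (a - t))| <= \1_`[a, x] t.
Proof.
move=> a0 ax; rewrite indicE.
have [t0|t0] := leP t 0; first by rewrite (stp0 t0) mul0r normr0.
rewrite stp1// mul1r; have [ta|ta] := ltP t a.
  by rewrite !stp1 ?subr_gt0// ?subrr ?normr0// (lt_le_trans ta).
rewrite (@stp0 (a - t)) ?subr_le0// subr0.
have [tx|tx] := ltP t x.
  rewrite stp1 ?subr_gt0// normr1 mem_set//=; rewrite in_itv/= ta; exact: ltW.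
by rewrite stp0 ?subr_le0// normr0.
Qed.

End MoreIntegral.

Section Prim.
Variables (R : realType) (h : R).
Hypothesis h0 : 0 <= h.
Implicit Types (g : R -> R) (K : R).

(** Growth class of the test functions: their primitives are integrable against the law as soon as
    the law has an exponential moment of order larger than h. *)
Definition expbd g K := forall t, 0 < t -> `|g t| <= K * expR (h * t).

Lemma expbd_ge0 g K : expbd g K -> 0 <= K.
Proof.
move=> /(_ 1 ltr01) gK; have := le_trans (normr_ge0 _) gK.
by rewrite pmulr_lge0// expR_gt0.
Qed.

Lemma prim_itg g K x : measurable_fun setT g -> expbd g K ->
  itg (fun t => g t * (stp t * stp (x - t))).
Proof.
move=> mg gK; have mst := @stp_meas R; have K0 := expbd_ge0 gK.
have [x0|x0] := leP x 0.
  apply: itg_eq (itg0 R) => t; have [t0|t0] := leP t 0.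
    by rewrite (stp0 t0) mul0r mulr0.
  by rewrite (@stp0 _ (x - t)) ?mulr0// subr_le0 (le_trans x0)// ltW.
apply: (itg_dom _ (itgZ (K * expR (h * x)) (itg_indic_itv 0 x))).
  by meas.
move=> t; rewrite indicE; have [t0|t0] := leP t 0.
  by rewrite (stp0 t0) mul0r mulr0 normr0 !mulr_ge0 ?expR_ge0.
have [xt|xt] := leP x t.
  by rewrite (@stp0 _ (x - t)) ?subr_le0// !mulr0 normr0 !mulr_ge0 ?expR_ge0.
rewrite !stp1 ?subr_gt0// !mulr1 mem_set/= ?mulr1; last by rewrite in_itv/= !ltW.
apply: (le_trans (gK _ t0)); rewrite ler_wpM2l// ler_expR ler_wpM2l//; exact: ltW.
Qed.

Lemma prim_sub g K a x : measurable_fun setT g -> expbd g K -> 0 <= a -> a <= x ->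
  `|prim g x - prim g a| <= K * expR (h * x) * (x - a).
Proof.
move=> mg gK a0 ax; have mst := @stp_meas R; have K0 := expbd_ge0 gK.
rewrite /prim -I_B; [|exact: prim_itg gK|exact: prim_itg gK].
rewrite -(I_indic_itv ax) -I_Z; last exact: itg_indic_itv.
apply: I_norm_le => [||t]; [by meas|by apply: itgZ; exact: itg_indic_itv|].
rewrite -mulrBr -mulrBr normrM.
have [t0|t0] := leP t 0; first by rewrite (stp0 t0) mul0r normr0 mulr0 mulr_ge0// mulr_ge0 ?expR_ge0.
have [tx|tx] := leP t x.
  apply: ler_pM => //; last exact: stp_mul_itv.
  by apply: (le_trans (gK _ t0)); rewrite ler_wpM2l// ler_expR ler_wpM2l.
rewrite (@stp0 _ (x - t)) ?subr_le0 ?(ltW tx)// (@stp0 _ (a - t)) ?subr_le0; last first.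
  by rewrite (le_trans ax)// ltW.
by rewrite subrr mulr0 normr0 mulr0 mulr_ge0// mulr_ge0 ?expR_ge0.
Qed.

Lemma prim_le0 g x : x <= 0 -> prim g x = 0.
Proof.
move=> x0; rewrite -[RHS](I0 R); apply: I_eq => t; have [t0|t0] := leP t 0.
  by rewrite (stp0 t0) mul0r mulr0.
by rewrite (@stp0 _ (x - t)) ?mulr0// subr_le0 (le_trans x0)// ltW.
Qed.

Lemma prim_bound g K x : measurable_fun setT g -> expbd g K -> 0 <= x ->
  `|prim g x| <= K * expR (h * x) * x.
Proof.
move=> mg gK x0; have := prim_sub mg gK (lexx 0) x0.
by rewrite (prim_le0 g (lexx 0)) !subr0.
Qed.

Lemma prim_meas g K : measurable_fun setT g -> expbd g K ->
  measurable_fun setT (prim g).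
Proof.
move=> mg gK; have mst := @stp_meas R.
apply: (@I_fubini_meas R (fun z => g z.2 * (stp z.2 * stp (z.1 - z.2)))).
  by meas.
by move=> x /=; exact: prim_itg gK.
Qed.

Lemma prim_cvg (gs : nat -> R -> R) g K x : (forall n, measurable_fun setT (gs n)) ->
  (forall n, expbd (gs n) K) -> (forall t, 0 < t -> gs n t @[n --> \oo] --> g t) ->
  prim (gs n) x @[n --> \oo] --> prim g x.
Proof.
move=> mgs gsK gsg; have mst := @stp_meas R; have K0 := expbd_ge0 (gsK 0).
have ie : itg (fun t => K * expR (h * t) * (stp t * stp (x - t))).
  apply: (@prim_itg _ K); first by meas.
  by move=> t t0; rewrite ger0_norm// mulr_ge0 ?expR_ge0.
apply: (proj2 (I_dct _ _ ie _)).
- by move=> n; have := mgs n => ?; meas.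
- move=> t; have [t0|t0] := leP t 0.
    rewrite (stp0 t0) mul0r mulr0; under eq_fun do rewrite mulr0; exact: cvg_cst.
  by apply: cvgMl; exact: gsg.
- move=> n t; rewrite normrM; have [t0|t0] := leP t 0.
    by rewrite (stp0 t0) mul0r normr0 !mulr0.
  rewrite (@ger0_norm _ (stp t * _)) ?mulr_ge0//; first by rewrite ler_wpM2r ?mulr_ge0// gsK.
  all: by rewrite /stp ler0n.
Qed.

Lemma prim_lin g1 g2 K1 K2 (a b : R) x : measurable_fun setT g1 -> measurable_fun setT g2 ->
  expbd g1 K1 -> expbd g2 K2 ->
  prim (fun t => a * g1 t + b * g2 t) x = a * prim g1 x + b * prim g2 x.
Proof.
move=> m1 m2 b1 b2; rewrite /prim -!I_Z; try by apply: prim_itg; eassumption.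
rewrite -I_D; try by apply: itgZ; apply: prim_itg; eassumption.
by apply: I_eq => t; ring.
Qed.

(* [F] may fail to be differentiable at 0. *)
Lemma prim_FTC g F K x : measurable_fun setT g -> expbd g K -> 0 < x ->
  (forall t, 0 < t -> hasd F t (g t)) -> (forall t, 0 < t -> {for t, continuous g}) ->
  F t @[t --> 0^'+] --> 0 -> prim g x = F x.
Proof.
move=> mg gK x0 dF cg F0.
have step a : 0 < a -> a < x -> prim g x - prim g a = F x - F a.
  move=> a0 ax; have mst := @stp_meas R.
  rewrite /prim -I_B; [|exact: prim_itg gK|exact: prim_itg gK].
  have := @continuous_FTC2 R g F a x ax.
  have cgi : {within `[a, x], continuous g}.
    apply: continuous_in_subspaceT => t /set_mem/=; rewrite in_itv/= => /andP[ta _].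
    by apply: cg; exact: lt_le_trans ta.
  have dFi : derivable_oo_LRcontinuous F a x.
    split.
    - move=> t; rewrite in_itv/= => /andP[ta _].
      by case: (dF t (lt_trans a0 ta)).
    - by apply: cvg_at_right_filter; exact: der_continuous (dF a a0).
    - by apply: cvg_at_left_filter; exact: der_continuous (dF x x0).
  have dE : {in `]a, x[, F^`()%classic =1 g}.
    move=> t; rewrite in_itv/= => /andP[ta _].
    by rewrite derive1E; case: (dF t (lt_trans a0 ta)).
  move=> /(_ cgi dFi dE) FTC.
  have -> : F x - F a = fine (\int[@lebesgue_measure R]_(t in `[a, x]) (g t)%:E)%E.
    by rewrite FTC.
  rewrite IE; transitivity (Rintegral (@lebesgue_measure R) `[a, x[ g); last first.
    have ic : (@lebesgue_measure R).-integrable [set` `[a, x]] (EFin \o g).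
      by apply: continuous_compact_integrable => //; exact: segment_compact.
    apply: Rintegral_itv_bndo_bndc; apply: integrableS ic => //.
    by apply: subset_itvl; rewrite bnd_simp.
  rewrite [RHS]Rintegral_mkcond; apply: eq_Rintegral => t _; rewrite patchE.
  case: ifPn; rewrite ?inE/= ?in_itv/=.
    move=> /andP[at_ tx]; have t0 : 0 < t by exact: lt_le_trans at_.
    by rewrite (stp1 t0) (@stp1 _ (x - t)) ?subr_gt0// (@stp0 _ (a - t)) ?subr_le0//; ring.
  have -> : (point : R) = 0 by [].
  move=> /negP; rewrite inE/= in_itv/= => /negP; rewrite negb_and -ltNge -leNgt => /orP[ta|xt].
    by rewrite (@stp1 _ (x - t)) ?subr_gt0 ?(lt_trans ta)// (@stp1 _ (a - t)) ?subr_gt0//; ring.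
  rewrite (@stp0 _ (x - t)) ?subr_le0// (@stp0 _ (a - t)) ?subr_le0; first by ring.
  by rewrite (le_trans _ xt)// ltW.
have e : prim g x - F x = 0.
  apply/eqP; rewrite -normr_le0; apply/ler_addgt0Pr => e e0; rewrite add0r.
  have K0 := expbd_ge0 gK.
  pose C := K * expR (h * x) + 1.
  have C0 : 0 < C by rewrite ltr_wpDl// mulr_ge0 ?expR_ge0.
  have e2 : 0 < e / 2 by rewrite divr_gt0.
  near (0 : R)^'+ => a.
  have a0 : 0 < a by near: a; exact: nbhs_right_gt.
  have ax : a < x by near: a; exact: nbhs_right_lt.
  have ->: prim g x - F x = prim g a - F a by have := step _ a0 ax; lra.
  rewrite (le_trans (ler_normB _ _))// [leRHS](splitr e) lerD//.
    rewrite (le_trans (prim_bound mg gK (ltW a0)))//.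
    apply: (@le_trans _ _ (C * a)).
      rewrite ler_wpM2r ?(ltW a0)// /C -[leLHS]addr0 lerD// ler_wpM2l// ler_expR ler_wpM2l//; exact: ltW.
    rewrite mulrC -ler_pdivlMr//; apply: ltW; near: a; apply: nbhs_right_lt.
    by rewrite divr_gt0.
  near: a; move/cvgr0Pnorm_le : F0; exact.
by apply/eqP; rewrite -subr_eq0 e.
Unshelve. all: by end_near.
Qed.

End Prim.

(** * The functional equation of the Mellin transform *)

Record law (R : realType) (p : levy R) := Law {
  dens : R -> R ;
  dens_gt0 : forall x, 0 < x -> 0 < dens x ;
  dens_eq0 : forall x, x <= 0 -> dens x = 0 ;
  dens_meas : measurable_fun setT dens ;
  dens_cont : forall x, 0 < x -> {for x, continuous dens} ;
  dens_itg : forall n, itg (fun x => x ^+ n * dens x) ;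
  dens_mom : forall n, I (fun x => x ^+ n * dens x) = \prod_(k < n) ph p k.+1%:R }.

Section Bern.
Variable R : realType.

(* Expectation of [f] under the binomial law (n, u), by conditioning on the
   first trial. *)
Fixpoint bern (n : nat) (f : nat -> R) (u : R) : R :=
  if n is k.+1 then u * bern k (fun j => f j.+1) u + (1 - u) * bern k f u else f 0%N.

Lemma bern_dist n f g (c u : R) : 0 <= u <= 1 -> (forall j, (j <= n)%N -> `|f j - c| <= g j) ->
  `|bern n f u - c| <= bern n g u.
Proof.
move=> /andP[u0 u1]; elim: n f g => [|n IH] f g fg /=; first exact: fg.
have h1 := IH (fun j => f j.+1) (fun j => g j.+1) (fun j jn => fg j.+1 jn).
have h2 := IH f g (fun j jn => fg j (leqW jn)).
have -> : u * bern n (fun j => f j.+1) u + (1 - u) * bern n f u - c =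
  u * (bern n (fun j => f j.+1) u - c) + (1 - u) * (bern n f u - c) by ring.
have u1' : 0 <= 1 - u by rewrite subr_ge0.
rewrite (le_trans (ler_normD _ _))// !normrM (ger0_norm u0) (ger0_norm u1').
by rewrite lerD// ler_wpM2l.
Qed.

(** Squared bias plus variance of the binomial law. The form a + k (j - x) ^ 2 is that of the
    majorants used in Chebyshev's argument. *)
Lemma bern_var n (a k x u : R) :
  bern n (fun j => a + k * (j%:R - x) ^+ 2) u = a + k * ((n%:R * u - x) ^+ 2 + n%:R * u * (1 - u)).
Proof.
elim: n x => [|n IH] x /=; first by rewrite !mul0r addr0.
have -> : (fun j : nat => a + k * (j.+1%:R - x) ^+ 2) = (fun j : nat => a + k * (j%:R - (x - 1)) ^+ 2).
  by apply/funext => j; rewrite -natr1; congr (_ + _ * _ ^+ 2); ring.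
by rewrite !IH -natr1; ring.
Qed.

(** Bernstein's theorem at one point: continuity bounds |F - F u| by e / 2 near u, and a multiple of
    the squared distance bounds it elsewhere; the binomial variance makes the second contribution of
    order 1 / n. *)
Lemma bern_cvg (F : R -> R) (K u : R) : 0 <= u <= 1 -> (forall x, `|F x| <= K) ->
  {for u, continuous F} -> bern n.+1 (fun j => F (j%:R / n.+1%:R)) u @[n --> \oo] --> F u.
Proof.
move=> u01 FK cF; apply/cvgrPdist_le => e e0.
have K0 : 0 <= K := le_trans (normr_ge0 _) (FK 0).
have e2 : 0 < e / 2 by rewrite divr_gt0.
have [d /= d0 dF] : exists2 d : R, 0 < d & forall x, `|u - x| < d -> `|F u - F x| <= e / 2.
  move: cF => /cvgrPdist_le /(_ _ e2) /nbhs_ballP[d /= d0 dF].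
  by exists d => // x ux; apply: dF.
pose C := 2 * K / d ^+ 2.
have C0 : 0 <= C by apply: divr_ge0; [apply: mulr_ge0|exact: sqr_ge0].
near=> n.
pose N : R := n.+1%:R.
have N0 : 0 < N by rewrite ltr0n.
rewrite distrC.
have bd j : `|F (j%:R / n.+1%:R) - F u| <= e / 2 + C / N ^+ 2 * (j%:R - N * u) ^+ 2.
  have e1 : C / N ^+ 2 * (j%:R - N * u) ^+ 2 = C * (j%:R / N - u) ^+ 2.
    by field; rewrite gt_eqF.
  rewrite e1 -/N; set x := j%:R / N.
  have [ux|ux] := ltP `|u - x| d.
    by rewrite distrC (le_trans (dF _ ux))// lerDl mulr_ge0// sqr_ge0.
  have h : 2 * K <= C * (x - u) ^+ 2.
    rewrite /C mulrAC ler_pdivlMr ?exprn_gt0// ler_wpM2l ?mulr_ge0//.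
    rewrite -[leRHS]real_normK ?num_real// distrC lerXn2r ?nnegrE// ltW//.
  rewrite (le_trans (ler_normB _ _))//; have := FK x; have := FK u; lra.
apply: (le_trans (bern_dist u01 (fun j (_ : (j <= n.+1)%N) => bd j))).
rewrite bern_var -/N subrr expr0n/= add0r.
have e1 : C / N ^+ 2 * (N * u * (1 - u)) = C * (u * (1 - u)) / N.
  by field; rewrite gt_eqF.
rewrite e1 [leRHS](splitr e) lerD2l.
have : C * (u * (1 - u)) <= C by case/andP: u01 => u0 u1; nra.
move=> h; rewrite ler_pdivrMr// (le_trans h)// mulrC -ler_pdivrMr//.
rewrite /N; near: n; exists (Num.bound (C / (e / 2))) => // n /= hn.
have := archi_boundP (divr_ge0 C0 (ltW e2)) => /ltW/le_trans; apply.
by rewrite ler_nat (leq_trans hn).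
Unshelve. all: by end_near.
Qed.

End Bern.

Section ExpSeries.
Variable R : realType.
Implicit Types x t c : R.

Lemma exp_partial_cvg x : \sum_(j < n) x ^+ j / j`!%:R @[n --> \oo] --> expR x.
Proof.
have := @is_cvg_series_exp_coeff R x => /cvg_ex[l hl].
have el : expR x = l by apply/cvg_lim.
rewrite el (_ : (fun n => _) = series (exp_coeff x))//.
by apply/funext => n; rewrite /series/= big_mkord.
Qed.

Lemma exp_partial_le n x : 0 <= x -> \sum_(j < n) x ^+ j / j`!%:R <= expR x.
Proof.
move=> x0; rewrite -(cvg_lim _ (@exp_partial_cvg x))//.
apply: (@nondecreasing_cvgn_le _ (fun n => \sum_(j < n) x ^+ j / j`!%:R)).
  apply/nondecreasing_seqP => k; rewrite big_ord_recr/= lerDl.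
  by rewrite divr_ge0 ?exprn_ge0.
by apply/cvg_ex; exists (expR x); exact: exp_partial_cvg.
Qed.

Lemma exp_partial_abs_le n x : `|\sum_(j < n) x ^+ j / j`!%:R| <= expR `|x|.
Proof.
rewrite (le_trans _ (@exp_partial_le n _ (normr_ge0 x)))//.
rewrite (le_trans (ler_norm_sum _ _ _))//; apply: ler_sum => j _.
by rewrite normrM normrX (ger0_norm (_ : 0 <= j`!%:R^-1))// invr_ge0.
Qed.

Lemma pow_le_exp k x : 0 <= x -> x ^+ k / k`!%:R <= expR x.
Proof.
move=> x0; apply: le_trans (exp_partial_le k.+1 x0).
rewrite big_ord_recr/= lerDr sumr_ge0// => j _.
by rewrite divr_ge0 ?exprn_ge0.
Qed.

Lemma pow_le_expM k c t : 0 < c -> 0 <= t -> t ^+ k <= k`!%:R / c ^+ k * expR (c * t).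
Proof.
move=> c0 t0; have := @pow_le_exp k (c * t) (mulr_ge0 (ltW c0) t0).
rewrite exprMn ler_pdivrMr ?ltr0n ?fact_gt0// => h.
rewrite mulrAC ler_pdivlMr ?exprn_gt0// mulrC [leRHS]mulrC; exact: h.
Qed.

End ExpSeries.

Section FunctionalEquation.
Variables (R : realType) (p : levy R) (L : law p).
Local Notation m := (lm p).
Local Notation s := (ls p).
Local Notation q := (lq p).
Local Notation nu := (dens L).
Implicit Types (g : R -> R) (K x t b : R).

(** The n-th moment is at most (phi 1) ^ n n!, so exponential moments exist below the order 1 / phi
    1. The order 2 [he] is half of that, which gives a geometric series of ratio 1 / 2, and test
    functions may grow like exp ([he] x), half of the order again. *)
Definition he : R := (4 * ph p 1)^-1.

Lemma he_gt0 : 0 < he.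
Proof. by rewrite invr_gt0 mulr_gt0// ph_gt0. Qed.

Lemma dens_ge0 x : 0 <= nu x.
Proof. by have [/dens_eq0->|/dens_gt0/ltW] := leP x 0. Qed.

Lemma mom_le n : I (fun x => x ^+ n * nu x) <= ph p 1 ^+ n * n`!%:R.
Proof.
rewrite dens_mom; elim: n => [|n IH]; first by rewrite big_ord0 expr0 fact0 mul1r.
rewrite big_ord_recr/= factS natrM exprSr.
have -> : ph p 1 ^+ n * ph p 1 * (n.+1%:R * n`!%:R) = (ph p 1 ^+ n * n`!%:R) * (n.+1%:R * ph p 1) by ring.
apply: ler_pM => //; try exact: ph_ge0.
  by apply: prodr_ge0 => k _; exact: ph_ge0.
have := @ph_scale R p 1 n.+1%:R ltr01; rewrite divr1; apply.
by rewrite ler1n.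
Qed.

Lemma exp_dens_itg : itg (fun x => expR (2 * he * x) * nu x).
Proof.
have p1 : 0 < ph p 1 by exact: ph_gt0.
pose c : R := 2 * he.
have c0 : 0 < c by rewrite mulr_gt0// he_gt0.
pose fs n x := \sum_(k < n) (c ^+ k / k`!%:R * (x ^+ k * nu x)).
have fsE n x : fs n x = (\sum_(k < n) (c * x) ^+ k / k`!%:R) * nu x.
  by rewrite mulr_suml; apply: eq_bigr => k _; rewrite [(c * x) ^+ k]exprMn mulrA; congr (_ * _); exact: mulrAC.
have [] // := @I_fatou R fs (fun x => expR (2 * he * x) * nu x) 2.
- move=> n; apply: (@itg_sum R n (fun k x => c ^+ k / k`!%:R * (x ^+ k * nu x))) => k _.
  by apply: itgZ; exact: dens_itg.
- move=> n x; have [x0|x0] := leP x 0; first by rewrite fsE dens_eq0// mulr0.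
  apply: sumr_ge0 => k _; rewrite !mulr_ge0 ?dens_ge0 ?exprn_ge0 ?(ltW c0) ?(ltW x0)//.
- move=> x; under eq_fun do rewrite fsE; apply: cvgMl; exact: exp_partial_cvg.
- move=> n; rewrite (@I_sum R n (fun k x => c ^+ k / k`!%:R * (x ^+ k * nu x))); last by move=> k _; apply: itgZ; exact: dens_itg.
  apply: (@le_trans _ _ (\sum_(k < n) (2^-1) ^+ k)); last first.
    have h : (1 - 2^-1) * (\sum_(k < n) (2^-1) ^+ k) = 1 - 2^-1 ^+ n :> R.
      by rewrite -opprB mulNr -subrX1 opprB.
    have : 0 <= 2^-1 ^+ n :> R by rewrite exprn_ge0.
    lra.
  apply: ler_sum => k _; rewrite I_Z; last exact: dens_itg.
  apply: (le_trans (ler_wpM2l _ (mom_le k))).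
    by rewrite divr_ge0// exprn_ge0// ltW.
  have -> : c ^+ k / k`!%:R * (ph p 1 ^+ k * k`!%:R) = (c * ph p 1) ^+ k.
    by rewrite [(c * _) ^+ k]exprMn; field; rewrite pnatr_eq0 -lt0n fact_gt0.
  rewrite (_ : c * ph p 1 = 2^-1)//.
  by rewrite /c /he; field; rewrite gt_eqF.
Qed.

Local Notation mE := (fun x => expR (2 * he * x) * nu x).
Local Notation bd := (expbd he).

(** If x f' = [prim g], the generator of the semigroup is G f = [opA g] - [prim g]: the terms in f''
    and f' combine into the derivative of x f', and one integration by parts in the jump size
    replaces the measure by its tail. *)
Definition inner g x := I (fun y => (prim g x - prim g (x * expR (- y))) * q y).
Definition opA g x := m * (prim g x / x) + s * g x + inner g x / x.
(* Invariance of the law, tested on the primitive of [g]. *)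
Definition inZ g := [/\ measurable_fun setT g, exists K, bd g K &
  I (fun x => prim g x * nu x) = I (fun x => opA g x * nu x)].

Lemma x_expR_le x : 0 <= x -> expR (he * x) * x <= he^-1 * expR (2 * he * x).
Proof.
move=> x0; have h0 := he_gt0.
rewrite (_ : 2 * he * x = he * x + he * x); last by ring.
rewrite expRD mulrCA ler_wpM2l ?expR_ge0//.
rewrite mulrC ler_pdivlMr// mulrC; have := expR_ge1Dx (he * x); lra.
Qed.

Lemma expR_he_le x : 0 <= x -> expR (he * x) <= expR (2 * he * x).
Proof. by move=> x0; rewrite ler_expR; have := mulr_ge0 (ltW he_gt0) x0; lra. Qed.

Definition Qm := I (fun y => Num.min y 1 * q y).

Lemma inner_bd g K x y : measurable_fun setT g -> bd g K ->
  `|(prim g x - prim g (x * expR (- y))) * q y| <=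
    (K * expR (he * x) * Num.max x 0) * (Num.min y 1 * q y).
Proof.
move=> mg gK; have K0 := expbd_ge0 gK; have h0 := ltW he_gt0.
have [y0|y0] := leP y 0; first by rewrite lq_eq0// !mulr0 normr0.
have [x0|x0] := leP x 0.
  rewrite (prim_le0 _ x0) prim_le0; last by rewrite pmulr_lle0// expR_gt0.
  by rewrite subrr mul0r normr0 mulr0 mul0r.
have ey : expR (- y) <= 1 by rewrite expR_le1 oppr_le0 ltW.
have e0 := expR_ge0 (- y).
rewrite normrM (ger0_norm (lq_ge0 p y)) mulrA ler_wpM2r ?lq_ge0//.
apply: (le_trans (prim_sub h0 mg gK _ _)).
- by rewrite mulr_ge0// ltW.
- by rewrite ler_piMr// ltW.
- rewrite -!mulrA ler_wpM2l// ler_wpM2l ?expR_ge0//.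
  rewrite -[X in X - _]mulr1 -mulrBr ler_wpM2l ?(ltW x0)//.
  rewrite /Num.min; case: ifPn => h; last by lra.
  by have := expR_ge1Dx (- y); lra.
Qed.

Lemma inner_itg g K x : measurable_fun setT g -> bd g K ->
  itg (fun y => (prim g x - prim g (x * expR (- y))) * q y).
Proof.
move=> mg gK; have mq := lq_meas p; have h0 := ltW he_gt0.
have mp := prim_meas h0 mg gK.
apply: (itg_dom _ (itg_minq p (K * expR (he * x) * Num.max x 0))); first by meas.
by move=> y; exact: inner_bd.
Qed.

Lemma inner_le g K x : measurable_fun setT g -> bd g K ->
  `|inner g x| <= K * expR (he * x) * Num.max x 0 * Qm.
Proof.
move=> mg gK; have iq := inner_itg x mg gK.
rewrite /Qm -I_Z; last exact: lq_int.
apply: I_norm_le; [exact: itg_meas iq|exact: itg_minq|].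
by move=> y; exact: inner_bd.
Qed.

Lemma inner_meas g K : measurable_fun setT g -> bd g K -> measurable_fun setT (inner g).
Proof.
move=> mg gK; have mq := lq_meas p; have h0 := ltW he_gt0.
have mp := prim_meas h0 mg gK.
apply: (@I_fubini_meas R (fun z => (prim g z.1 - prim g (z.1 * expR (- z.2))) * q z.2)).
  by meas.
by move=> x /=; exact: inner_itg gK.
Qed.

Lemma opA_le g K x : measurable_fun setT g -> bd g K ->
  `|opA g x * nu x| <= K * (m + s + Qm) * mE x.
Proof.
move=> mg gK; have K0 := expbd_ge0 gK; have h0 := ltW he_gt0.
have m0 := lm_ge0 p; have s0 := ls_ge0 p.
have Q0 : 0 <= Qm.
  apply: I_ge0 => y; have [y0|y0] := leP y 0; first by rewrite lq_eq0// mulr0.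
  by rewrite mulr_ge0 ?lq_ge0// le_min ler01 ltW.
have [x0|x0] := leP x 0; first by rewrite dens_eq0// !mulr0 normr0.
rewrite normrM (ger0_norm (dens_ge0 x)) [leRHS]mulrA ler_wpM2r ?dens_ge0//.
have x0' := ltW x0; have E0 := expR_ge0 (he * x).
apply: (@le_trans _ _ (K * (m + s + Qm) * expR (he * x))); last first.
  by rewrite ler_wpM2l ?expR_he_le// mulr_ge0// !addr_ge0.
rewrite /opA (le_trans (ler_normD _ _))// (_ : K * (m + s + Qm) * expR (he * x) =
  (m * (K * expR (he * x)) + s * (K * expR (he * x))) + K * expR (he * x) * Qm); last by ring.
rewrite lerD//.
  rewrite (le_trans (ler_normD _ _))// lerD//.
    rewrite normrM (ger0_norm m0) ler_wpM2l// normrM normfV (gtr0_norm x0) ler_pdivrMr//.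
    exact: prim_bound.
  by rewrite normrM (ger0_norm s0) ler_wpM2l// gK.
rewrite normrM normfV (gtr0_norm x0) ler_pdivrMr//.
have := inner_le x mg gK; rewrite (max_l x0').
by rewrite -!mulrA (mulrC x Qm).
Qed.

Lemma prim_dens_le g K x : measurable_fun setT g -> bd g K ->
  `|prim g x * nu x| <= K / he * mE x.
Proof.
move=> mg gK; have K0 := expbd_ge0 gK; have h0 := ltW he_gt0.
have [x0|x0] := leP x 0; first by rewrite dens_eq0// !mulr0 normr0.
rewrite normrM (ger0_norm (dens_ge0 x)) [leRHS]mulrA ler_wpM2r ?dens_ge0//.
apply: (le_trans (prim_bound h0 mg gK (ltW x0))).
by rewrite -mulrA -[leRHS]mulrA ler_wpM2l// x_expR_le// ltW.
Qed.

Lemma opA_meas g K : measurable_fun setT g -> bd g K -> measurable_fun setT (opA g).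
Proof.
move=> mg gK; have mp := prim_meas (ltW he_gt0) mg gK; have mi := inner_meas mg gK.
by rewrite /opA; meas.
Qed.

Lemma opA_itg g K : measurable_fun setT g -> bd g K -> itg (fun x => opA g x * nu x).
Proof.
move=> mg gK; have mA := opA_meas mg gK; have mn := dens_meas L.
apply: (itg_dom _ (itgZ (K * (m + s + Qm)) exp_dens_itg)); first by meas.
by move=> x; exact: opA_le.
Qed.

Lemma prim_dens_itg g K : measurable_fun setT g -> bd g K -> itg (fun x => prim g x * nu x).
Proof.
move=> mg gK; have mA := prim_meas (ltW he_gt0) mg gK; have mn := dens_meas L.
apply: (itg_dom _ (itgZ (K / he) exp_dens_itg)); first by meas.
by move=> x; exact: prim_dens_le.
Qed.

(** A common exponential bound dominates all the integrals at once, so invariance passes to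
    pointwise limits. *)
Lemma inZ_lim (gs : nat -> R -> R) g K : (forall n, inZ (gs n)) -> (forall n, bd (gs n) K) ->
  measurable_fun setT g -> (forall t, 0 < t -> gs n t @[n --> \oo] --> g t) -> inZ g.
Proof.
move=> Zg bK mg gsg; have h0 := ltW he_gt0.
have mgs n : measurable_fun setT (gs n) by case: (Zg n).
have gK : bd g K.
  move=> t t0; have c : `|gs n t| @[n --> \oo] --> `|g t| by apply: cvg_norm; exact: gsg.
  rewrite -(cvg_lim _ c)//; apply: limr_le; first by apply/cvg_ex; exists `|g t|.
  by apply: nearW => n; exact: bK.
have pc x : prim (gs n) x @[n --> \oo] --> prim g x by apply: prim_cvg bK gsg.
have mn := dens_meas L.
split=> //; first by exists K.
have [_ c1] : itg (fun x => prim g x * nu x) /\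
    I (fun x => prim (gs n) x * nu x) @[n --> \oo] --> I (fun x => prim g x * nu x).
  apply: (I_dct (g := fun x => K / he * mE x)).
  - by move=> n; have := prim_meas h0 (mgs n) (bK n) => ?; meas.
  - by move=> x; apply: cvgMl; exact: pc.
  - by apply: itgZ; exact: exp_dens_itg.
  - by move=> n x; exact: prim_dens_le.
have ic x : inner (gs n) x @[n --> \oo] --> inner g x.
  apply: (proj2 (I_dct (g := fun y => (K * expR (he * x) * Num.max x 0) * (Num.min y 1 * q y)) _ _ _ _)).
  - by move=> n; exact: itg_meas (inner_itg x (mgs n) (bK n)).
  - by move=> y; apply: cvgMl; apply: cvgB; exact: pc.
  - exact: itg_minq.
  - by move=> n y; exact: inner_bd.
have [_ c2] : itg (fun x => opA g x * nu x) /\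
    I (fun x => opA (gs n) x * nu x) @[n --> \oo] --> I (fun x => opA g x * nu x).
  apply: (I_dct (g := fun x => K * (m + s + Qm) * mE x)).
  - by move=> n; have := opA_meas (mgs n) (bK n) => ?; meas.
  - move=> x; have [x0|x0] := leP x 0.
      by under eq_fun do rewrite dens_eq0// mulr0; rewrite dens_eq0// mulr0; exact: cvg_cst.
    apply: cvgMl; apply: cvgD; last by apply: cvgMl; exact: ic.
    apply: cvgD; first by apply: cvgMr; apply: cvgMl; exact: pc.
    by apply: cvgMr; exact: gsg.
  - by apply: itgZ; exact: exp_dens_itg.
  - by move=> n x; exact: opA_le.
have e : (fun n => I (fun x => prim (gs n) x * nu x)) = (fun n => I (fun x => opA (gs n) x * nu x)).
  by apply/funext => n; case: (Zg n).
by rewrite e in c1; rewrite -(cvg_lim _ c1)// -(cvg_lim _ c2).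
Qed.

Lemma inZ_lin g1 g2 (a b : R) : inZ g1 -> inZ g2 -> inZ (fun t => a * g1 t + b * g2 t).
Proof.
move=> [m1 [K1 b1] e1] [m2 [K2 b2] e2]; have h0 := ltW he_gt0.
split; first by meas.
  exists (`|a| * K1 + `|b| * K2) => t t0; rewrite (le_trans (ler_normD _ _))//.
  by rewrite !normrM mulrDl -!mulrA lerD// ler_wpM2l// ?b1 ?b2.
have pl x := prim_lin h0 a b x m1 m2 b1 b2.
have il x : inner (fun t => a * g1 t + b * g2 t) x = a * inner g1 x + b * inner g2 x.
  rewrite /inner -!I_Z; [|exact: inner_itg b2|exact: inner_itg b1].
  rewrite -I_D; [|by apply: itgZ; exact: inner_itg b1|by apply: itgZ; exact: inner_itg b2].
  by apply: I_eq => y; rewrite !pl; ring.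
transitivity (a * I (fun x => prim g1 x * nu x) + b * I (fun x => prim g2 x * nu x)).
  rewrite -!I_Z; [|exact: prim_dens_itg b2|exact: prim_dens_itg b1].
  rewrite -I_D; [|by apply: itgZ; exact: prim_dens_itg b1|by apply: itgZ; exact: prim_dens_itg b2].
  by apply: I_eq => x; rewrite pl; ring.
rewrite e1 e2 -!I_Z; [|exact: opA_itg b2|exact: opA_itg b1].
rewrite -I_D; [|by apply: itgZ; exact: opA_itg b1|by apply: itgZ; exact: opA_itg b2].
by apply: I_eq => x; rewrite /opA pl il; ring.
Qed.

Lemma inZ_eq g1 g2 : g1 =1 g2 -> inZ g1 -> inZ g2.
Proof. by move=> /funext ->. Qed.


Lemma inZ_sum n (gs : nat -> R -> R) (a : nat -> R) : (forall k, inZ (gs k)) ->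
  inZ (fun t => \sum_(k < n) a k * gs k t).
Proof.
move=> Zg; elim: n => [|n IH].
  apply: (@inZ_eq (fun t => 0 * gs 0%N t + 0 * gs 0%N t)); last exact: (@inZ_lin _ _ 0 0 (Zg 0%N) (Zg 0%N)).
  by move=> t; rewrite big_ord0 !mul0r addr0.
apply: (@inZ_eq (fun t => 1 * (\sum_(k < n) a k * gs k t) + a n * gs n t)).
  by move=> t; rewrite big_ord_recr/= mul1r.
exact: (@inZ_lin (fun t => \sum_(k < n) a k * gs k t) (gs n) 1 (a n) IH (Zg n)).
Qed.

Lemma exprn_bd k : bd (fun t => t ^+ k) (k`!%:R / he ^+ k).
Proof.
by move=> t t0; rewrite ger0_norm ?exprn_ge0 ?(ltW t0)// pow_le_expM ?he_gt0// ltW.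
Qed.

Lemma cvg0_expr k : (fun t : R => t ^+ k.+1) t @[t --> 0^'+] --> (0 : R).
Proof.
apply: cvg_at_right_filter; have := @exprn_continuous R k.+1 0.
by rewrite /continuous_at expr0n.
Qed.

Lemma prim_expr k x : 0 < x -> prim (fun t => t ^+ k) x = x ^+ k.+1 / k.+1%:R.
Proof.
move=> x0; apply: (@prim_FTC R he (ltW he_gt0) (fun t => t ^+ k) (fun t => t ^+ k.+1 / k.+1%:R) _ x _ (exprn_bd k)) => //.
- by move=> t t0; apply: hasd_eq; [der|rewrite /= mulr0 add0r mulr1 mulrA mulVf ?pnatr_eq0// mul1r].
- by move=> t _; exact: exprn_continuous.
- by rewrite -[X in _ --> X](mul0r (k.+1%:R^-1)); apply: cvgMl; exact: cvg0_expr.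
Qed.

(** On a monomial, invariance is the recursion of the moments, M_(k+1) = phi (k + 1) M_k, because
    the operator maps x ^ (k + 1) to phi (k + 1) x ^ k. *)
Lemma inZ_expr k : inZ (fun t => t ^+ k).
Proof.
have mt : measurable_fun setT (fun t : R => t ^+ k) by meas.
split=> //; first by eexists; exact: exprn_bd.
transitivity (k.+1%:R^-1 * I (fun x => x ^+ k.+1 * nu x)).
  rewrite -I_Z; last exact: dens_itg.
  apply: I_eq => x; have [x0|x0] := leP x 0; first by rewrite dens_eq0// !mulr0.
  by rewrite prim_expr//; ring.
transitivity (k.+1%:R^-1 * (ph p k.+1%:R * I (fun x => x ^+ k * nu x))).
  by rewrite !dens_mom big_ord_recr/= (mulrC (ph p _)).
rewrite -I_Z; last exact: dens_itg.
rewrite -I_Z; last by apply: itgZ; exact: dens_itg.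
apply: I_eq => x; have [x0|x0] := leP x 0; first by rewrite dens_eq0// !mulr0.
rewrite !mulrA; congr (_ * _); rewrite /opA prim_expr//.
have -> : inner (fun t => t ^+ k) x = x ^+ k.+1 / k.+1%:R * I (fun y => (1 - expR (- (k.+1%:R * y))) * q y).
  rewrite -I_Z; last exact: itg_ph.
  apply: I_eq => y; rewrite !prim_expr ?mulr_gt0 ?expR_gt0//.
  by rewrite exprMn -expRM_natl mulrN; ring.
rewrite phE; move: (I _) => J; rewrite exprS.
by field; rewrite gt_eqF//= pnatr_eq0.
Qed.

(** Half of [he]: one factor exp ([hs] t) dominates t ^ k, another one the partial sums of exp (-
    [hs] t). *)
Definition hs : R := he / 2.

Lemma hs_gt0 : 0 < hs.
Proof. by rewrite divr_gt0// he_gt0. Qed.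

(** The factors exp (- [hs] t) are introduced one at a time. Expanding exp (- i [hs] t) at once
    would give partial sums as large as exp (i [hs] t), outside the growth class for large i; after
    each step the limit is small again. *)
Lemma inZ_exp i k : inZ (fun t => t ^+ k * expR (- (i%:R * hs * t))).
Proof.
have h0 := hs_gt0; elim: i k => [|i IH] k.
  by apply: inZ_eq (inZ_expr k) => t; rewrite !mul0r oppr0 expR0 mulr1.
apply: (@inZ_lim (fun n t => \sum_(j < n) ((- hs) ^+ j / j`!%:R) * (t ^+ (k + j) * expR (- (i%:R * hs * t)))) _
  (k`!%:R / hs ^+ k)).
- move=> n; exact: (@inZ_sum n (fun j t => t ^+ (k + j) * expR (- (i%:R * hs * t))) (fun j => (- hs) ^+ j / j`!%:R) (fun j => IH (k + j)%N)).
- move=> n t t0; rewrite (_ : \sum_(j < n) _ =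
    t ^+ k * expR (- (i%:R * hs * t)) * \sum_(j < n) (- hs * t) ^+ j / j`!%:R); last first.
    rewrite mulr_sumr; apply: eq_bigr => j _.
    by rewrite [(- hs * t) ^+ j]exprMn exprD; ring.
  rewrite !normrM (ger0_norm (expR_ge0 _)) (ger0_norm (exprn_ge0 _ (ltW t0))).
  apply: (@le_trans _ _ (k`!%:R / hs ^+ k * expR (hs * t) * 1 * expR (hs * t))).
    apply: ler_pM => //; first by rewrite mulr_ge0 ?expR_ge0 ?exprn_ge0// ltW.
      apply: ler_pM; rewrite ?expR_ge0 ?exprn_ge0 ?(ltW t0)//.
        by rewrite pow_le_expM// ltW.
      rewrite expR_le1 oppr_le0; apply: mulr_ge0; last exact: ltW.
      by apply: mulr_ge0; [rewrite ler0n|exact: ltW].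
    apply: (le_trans (exp_partial_abs_le _ _)).
    by rewrite normrM normrN (gtr0_norm h0) (gtr0_norm t0).
  rewrite mulr1 -mulrA -expRD (_ : hs * t + hs * t = he * t)//.
  by rewrite /hs; field.
- by meas.
- move=> t t0; have -> : expR (- (i.+1%:R * hs * t)) = expR (- (i%:R * hs * t)) * expR (- hs * t).
    by rewrite -expRD -natr1; congr expR; ring.
  rewrite mulrA.
  rewrite (_ : (fun n => _) = (fun n => t ^+ k * expR (- (i%:R * hs * t)) * \sum_(j < n) (- hs * t) ^+ j / j`!%:R)).
    by apply: cvgMr; exact: exp_partial_cvg.
  apply/funext => n; rewrite mulr_sumr; apply: eq_bigr => j _.
  by rewrite [(- hs * t) ^+ j]exprMn exprD; ring.
Qed.

Lemma inZ_bern n f i k : inZ (fun t => t ^+ k * expR (- (i%:R * hs * t)) * bern n f (expR (- (hs * t)))).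
Proof.
elim: n f i => [|n IH] f i /=.
  apply: (@inZ_eq (fun t => f 0%N * (t ^+ k * expR (- (i%:R * hs * t))) + 0 * (t ^+ k * expR (- (i%:R * hs * t))))).
    by move=> t; ring.
  by apply: inZ_lin; exact: inZ_exp.
have e t : expR (- (i.+1%:R * hs * t)) = expR (- (i%:R * hs * t)) * expR (- (hs * t)).
  by rewrite -expRD -natr1; congr expR; ring.
apply: (@inZ_eq (fun t => 1 * (1 * (t ^+ k * expR (- (i.+1%:R * hs * t)) * bern n (fun j => f j.+1) (expR (- (hs * t))))
  + 1 * (t ^+ k * expR (- (i%:R * hs * t)) * bern n f (expR (- (hs * t)))))
  + (- 1) * (t ^+ k * expR (- (i.+1%:R * hs * t)) * bern n f (expR (- (hs * t)))))).
  by move=> t; rewrite e; ring.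
by apply: inZ_lin; [apply: inZ_lin|]; exact: IH.
Qed.

Lemma bern_abs_le n f (K u : R) : 0 <= u <= 1 -> (forall j, `|f j| <= K) -> `|bern n f u| <= K.
Proof.
move=> u01 fK.
have h j : `|f j - 0| <= K + 0 * (j%:R - 0) ^+ 2 by rewrite subr0 mul0r addr0.
by have := bern_dist u01 (fun j (_ : (j <= n)%N) => h j); rewrite bern_var mul0r addr0 subr0.
Qed.

(** In the variable u = exp (- [hs] t) in (0, 1), Bernstein polynomials of [B] are combinations of
    the exponentials of [inZ_exp], and they keep the bound [K]. *)
Lemma inZ_cont (B : R -> R) (K : R) k : measurable_fun setT B -> (forall t, `|B t| <= K) ->
  (forall t, 0 < t -> {for t, continuous B}) -> inZ (fun t => t ^+ k * B t).
Proof.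
move=> mB BK cB; have h0 := hs_gt0.
have K0 : 0 <= K := le_trans (normr_ge0 _) (BK 0).
pose F u := B (- ln u / hs).
pose gs n t := t ^+ k * expR (- (0%:R * hs * t)) * bern n.+1 (fun j => F (j%:R / n.+1%:R)) (expR (- (hs * t))).
have u01 t : 0 < t -> 0 <= expR (- (hs * t)) <= 1.
  by move=> t0; rewrite expR_ge0 expR_le1 oppr_le0 mulr_ge0// ltW.
apply: (@inZ_lim gs _ (k`!%:R / he ^+ k * K)).
- by move=> n; exact: inZ_bern.
- move=> n t t0; rewrite !normrM mul0r mul0r oppr0 expR0 normr1 mulr1.
  rewrite [leRHS]mulrAC; apply: ler_pM => //; first exact: exprn_bd.
  by apply: bern_abs_le => [|j]; [exact: u01|exact: BK].
- by meas.
- move=> t t0; rewrite /gs !mul0r oppr0 expR0.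
  under eq_fun do rewrite mulr1.
  apply: cvgMr; have -> : B t = F (expR (- (hs * t))).
    by rewrite /F expRK opprK mulrAC divff ?mul1r// gt_eqF.
  apply: (bern_cvg (K := K)); [exact: u01|by move=> x; exact: BK|].
  have c1 : {for expR (- (hs * t)), continuous (fun u => - ln u / hs)}.
    apply: cvgMl; apply: cvgN; apply: continuous_ln; exact: expR_gt0.
  apply: (continuous_comp c1); rewrite expRK opprK (_ : _ / hs = t); first exact: cB.
  by rewrite mulrAC divff ?mul1r// gt_eqF.
Qed.

(* [Mc n b + i Ms n b] is the Mellin transform of [nu] at [n + 1 + i b]; working
   with integral real parts only avoids moments of negative order. *)
Definition Mc n b := I (fun x => x ^+ n * cos (b * ln x) * nu x).
Definition Ms n b := I (fun x => x ^+ n * sin (b * ln x) * nu x).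

Lemma Mc_itg n b : itg (fun x => x ^+ n * cos (b * ln x) * nu x).
Proof.
have mn := dens_meas L; apply: (itg_dom _ (dens_itg L n)); first by meas.
move=> x; have [x0|x0] := leP x 0; first by rewrite dens_eq0// !mulr0 normr0.
rewrite mulrAC normrM ger0_norm; last by rewrite mulr_ge0 ?dens_ge0 ?exprn_ge0// ltW.
by rewrite ler_piMr ?cos_max// mulr_ge0 ?dens_ge0 ?exprn_ge0// ltW.
Qed.

Lemma Ms_itg n b : itg (fun x => x ^+ n * sin (b * ln x) * nu x).
Proof.
have mn := dens_meas L; apply: (itg_dom _ (dens_itg L n)); first by meas.
move=> x; have [x0|x0] := leP x 0; first by rewrite dens_eq0// !mulr0 normr0.
rewrite mulrAC normrM ger0_norm; last by rewrite mulr_ge0 ?dens_ge0 ?exprn_ge0// ltW.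
by rewrite ler_piMr ?sin_max// mulr_ge0 ?dens_ge0 ?exprn_ge0// ltW.
Qed.

Lemma cos_ln_cont b t : 0 < t -> {for t, continuous (fun t => cos (b * ln t))}.
Proof.
move=> t0; apply: (@der_continuous R _ t (- sin (b * ln t) * (b * (t^-1 * 1) + ln t * 0))).
by der.
Qed.

Lemma sin_ln_cont b t : 0 < t -> {for t, continuous (fun t => sin (b * ln t))}.
Proof.
move=> t0; apply: (@der_continuous R _ t (cos (b * ln t) * (b * (t^-1 * 1) + ln t * 0))).
by der.
Qed.

(* The derivative of [t ^+ n.+1 * (u cos (b ln t) + v sin (b ln t))]. *)
Let osc n b (u v : R) t := t ^+ n * ((n.+1%:R * u + b * v) * cos (b * ln t) + (n.+1%:R * v - b * u) * sin (b * ln t)).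

Lemma inZ_osc n b u v : inZ (osc n b u v).
Proof.
apply: (@inZ_cont (fun t => (n.+1%:R * u + b * v) * cos (b * ln t) + (n.+1%:R * v - b * u) * sin (b * ln t))
  (`|n.+1%:R * u + b * v| + `|n.+1%:R * v - b * u|)).
- by meas.
- move=> t; rewrite (le_trans (ler_normD _ _))// !normrM lerD// ler_piMr// ?cos_max ?sin_max//.
- move=> t t0; apply: cvgD; apply: cvgMr; [exact: cos_ln_cont|exact: sin_ln_cont].
Qed.

Lemma prim_osc n b u v x : 0 < x ->
  prim (osc n b u v) x = x ^+ n.+1 * (u * cos (b * ln x) + v * sin (b * ln x)).
Proof.
move=> x0; have [mo [K bK] _] := inZ_osc n b u v.
apply: (@prim_FTC R he (ltW he_gt0) _ (fun x => x ^+ n.+1 * (u * cos (b * ln x) + v * sin (b * ln x))) K) => //.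
- move=> t t0; apply: hasd_eq; first by der.
  by rewrite /osc /= exprS; field; rewrite gt_eqF.
- move=> t t0; apply: cvgM; first exact: exprn_continuous.
  by apply: cvgD; apply: cvgMr; [exact: cos_ln_cont|exact: sin_ln_cont].
- apply/cvgr0Pnorm_le => e e0.
  pose C := `|u| + `|v| + 1.
  have C0 : 0 < C by rewrite ltr_wpDl// addr_ge0.
  near=> t; have t0 : 0 < t by near: t; exact: nbhs_right_gt.
  rewrite normrM (ger0_norm (exprn_ge0 _ (ltW t0))).
  apply: (@le_trans _ _ (t ^+ n.+1 * C)).
    rewrite ler_wpM2l ?exprn_ge0 ?(ltW t0)// (le_trans (ler_normD _ _))// !normrM.
    have h1 : `|u| * `|cos (b * ln t)| <= `|u| by rewrite ler_piMr// cos_max.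
    have h2 : `|v| * `|sin (b * ln t)| <= `|v| by rewrite ler_piMr// sin_max.
    by rewrite /C; lra.
  rewrite -ler_pdivlMr// -[leLHS]ger0_norm ?exprn_ge0 ?(ltW t0)//.
  near: t; have /cvgr0Pnorm_le := cvg0_expr n; apply; exact: divr_gt0.
Unshelve. all: by end_near.
Qed.

(** The operator maps x ^ z to phi z x ^ (z - 1). With z = n + 1 + i b, invariance is M (z + 1) =
    phi z M z, paired here with the vector (u, v); the two unit vectors give the real and imaginary
    parts. *)
Lemma osc_eq n b u v : u * Mc n.+1 b + v * Ms n.+1 b =
  phiR p n.+1%:R b * (u * Mc n b + v * Ms n b) + phiI p n.+1%:R b * (v * Mc n b - u * Ms n b).
Proof.
have [mo [K bK] e] := inZ_osc n b u v.
transitivity (I (fun x => prim (osc n b u v) x * nu x)).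
  rewrite -!I_Z; [|exact: Ms_itg|exact: Mc_itg].
  rewrite -I_D; [|by apply: itgZ; exact: Mc_itg|by apply: itgZ; exact: Ms_itg].
  apply: I_eq => x; have [x0|x0] := leP x 0; first by rewrite dens_eq0// !mulr0 addr0.
  by rewrite prim_osc//; ring.
rewrite e.
set A := phiR p _ _; set B := phiI p _ _.
transitivity (I (fun x => (A * u + B * v) * (x ^+ n * cos (b * ln x) * nu x) +
    (A * v - B * u) * (x ^+ n * sin (b * ln x) * nu x))); last first.
  rewrite I_D; [|by apply: itgZ; exact: Mc_itg|by apply: itgZ; exact: Ms_itg].
  rewrite !I_Z; [|exact: Ms_itg|exact: Mc_itg].
  by rewrite /Mc /Ms; move: (I _) (I _) => ? ?; ring.
apply: I_eq => x; have [x0|x0] := leP x 0; first by rewrite dens_eq0// !mulr0 addr0.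
rewrite /opA prim_osc//.
pose JR := I (fun y => (1 - expR (- (n.+1%:R * y)) * cos (b * y)) * q y).
pose JI := I (fun y => expR (- (n.+1%:R * y)) * sin (b * y) * q y).
have -> : inner (osc n b u v) x = x ^+ n.+1 * ((u * cos (b * ln x) + v * sin (b * ln x)) * JR +
    (v * cos (b * ln x) - u * sin (b * ln x)) * JI).
  rewrite -!I_Z; [|exact: itg_im|exact: itg_re].
  rewrite -I_D; [|by apply: itgZ; exact: itg_re|by apply: itgZ; exact: itg_im].
  rewrite -I_Z; last by apply: itgD; apply: itgZ; [exact: itg_re|exact: itg_im].
  apply: I_eq => y; rewrite !prim_osc ?mulr_gt0 ?expR_gt0//.
  have -> : b * ln (x * expR (- y)) = b * ln x - b * y.
    by rewrite lnM ?posrE ?expR_gt0// expRK; ring.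
  by rewrite cosB sinB exprMn -expRM_natl mulrN; ring.
have -> : A = m + s * n.+1%:R + JR by rewrite /A phiRE.
have -> : B = s * b + JI by rewrite /B phiIE.
by rewrite /osc exprS; field; rewrite gt_eqF.
Qed.

Lemma Mc_rec n b : Mc n.+1 b = phiR p n.+1%:R b * Mc n b - phiI p n.+1%:R b * Ms n b.
Proof. by have := osc_eq n b 1 0; rewrite !mul1r !mul0r !addr0 sub0r mulrN. Qed.

Lemma Ms_rec n b : Ms n.+1 b = phiR p n.+1%:R b * Ms n b + phiI p n.+1%:R b * Mc n b.
Proof. by have := osc_eq n b 0 1; rewrite !mul1r !mul0r !add0r subr0. Qed.

Lemma McE n b : Mc n b = I (fun x => x ^+ n * cos (b * ln x) * nu x).
Proof. by []. Qed.

Lemma MsE n b : Ms n b = I (fun x => x ^+ n * sin (b * ln x) * nu x).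
Proof. by []. Qed.

End FunctionalEquation.

#[global] Opaque Mc Ms.

(** * Decay of the Mellin transform *)

Section LogrIntegral.
Variable R : realType.
Local Notation st := (@stp R).

Lemma logr_meas : measurable_fun setT (@logr R).
Proof. by rewrite /logr; meas. Qed.

Lemma logr_tail (c : R) : 0 < c ->
  itg (fun y => st (y - c) * logr y) /\ I (fun y => st (y - c) * logr y) = pi / 2 - Glog c.
Proof.
move=> c0; have ml := logr_meas; have ms := @stp_meas R.
have cl y : c <= y -> {for y, continuous (@logr R)}.
  move=> cy; have y0 := lt_le_trans c0 cy.
  apply: (@der_continuous R _ y (ln (1 + y ^- 2) * 0 + 2^-1 * ((1 + y ^- 2)^-1 * (0 + - (y ^+ 2) ^- 2 * (2%:R * y ^+ 1 * 1))))).
  rewrite /logr; der; first exact: logr_arg_gt0.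
  by rewrite expf_eq0/= gt_eqF.
have FTC : (\int[@lebesgue_measure R]_(x in `[c, +oo[) (logr x)%:E = (pi / 2)%:E - (Glog c)%:E)%E.
  apply: ge0_continuous_FTC2y.
  - by move=> x _; exact: logr_ge0.
  - apply/continuous_within_itvcyP; split.
      by move=> x xc; apply: cl; move: xc; rewrite in_itv/= andbT => /ltW.
    by apply: cvg_at_right_filter; exact: cl.
  - exact: Glog_cvg_pihalf.
  - by move=> x cx; case: (hasd_Glog (lt_trans c0 cx)).
  - by apply: cvg_at_right_filter; exact: der_continuous (hasd_Glog c0).
  - move=> x; rewrite in_itv/= andbT => cx.
    by rewrite derive1E; case: (hasd_Glog (lt_trans c0 cx)).
have mE : measurable_fun setT (EFin \o (@logr R)) by exact/measurable_EFinP.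
have e : (\int[@lebesgue_measure R]_x (st (x - c) * logr x)%:E = (pi / 2)%:E - (Glog c)%:E)%E.
  rewrite -FTC -integral_itv_obnd_cbnd; last exact: measurable_funTS.
  rewrite [RHS]integral_mkcond; apply: eq_integral => x _; rewrite patchE.
  case: ifPn; rewrite ?inE/= ?in_itv/= ?andbT.
    by move=> cx; rewrite stp1 ?subr_gt0// mul1r.
  move=> /negP; rewrite inE/= in_itv/= andbT => /negP; rewrite -leNgt => xc.
  by rewrite stp0 ?subr_le0// mul0r.
split; last by rewrite IE /Rintegral e.
rewrite itgE; apply/integrableP; split.
  by apply/measurable_EFinP; meas.
rewrite (_ : (\int[_]_x _ = (pi / 2)%:E - (Glog c)%:E)%E) ?ltry// -e.
by apply: eq_integral => x _ /=; rewrite ger0_norm// mulr_ge0 ?logr_ge0// /stp ler0n.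
Qed.

Lemma stp_ge0 u : 0 <= st u.
Proof. by rewrite /stp ler0n. Qed.

Lemma stp_le1 u : st u <= 1.
Proof. by rewrite /stp; case: (0 < u). Qed.

Lemma logr_total : itg (fun y => st y * logr y) /\ I (fun y => st y * logr y) <= pi / 2.
Proof.
apply: (@I_fatou R (fun n y => st (y - n.+1%:R^-1) * logr y)).
- by move=> n; have [] := @logr_tail n.+1%:R^-1; rewrite ?invr_gt0.
- by move=> n x; rewrite mulr_ge0 ?logr_ge0 ?stp_ge0.
- move=> x; apply: cvgMl; have [x0|x0] := leP x 0.
    rewrite (stp0 x0) (_ : (fun n => _) = fun=> 0); first exact: cvg_cst.
    by apply/funext => n; rewrite stp0// subr_le0 (le_trans x0)// invr_ge0.
  rewrite (stp1 x0); apply: cvg_near_cst.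
  exists (Num.bound x^-1) => // n /= hn; rewrite stp1// subr_gt0.
  rewrite invf_plt ?posrE//.
  have := archi_boundP (_ : 0 <= x^-1) => /(_ _)/lt_le_trans; apply.
    by rewrite invr_ge0 ltW.
  by rewrite ler_nat (leq_trans hn).
- move=> n; have [_ ->] := @logr_tail n.+1%:R^-1 ltac:(by rewrite invr_gt0).
  by rewrite gerBl Glog_ge0// invr_ge0.
Qed.

End LogrIntegral.

(** * The modulus of the Mellin transform, by iteration of the functional equation *)

Section MellinBound.
Variables (R : realType) (p : levy R) (L : law p).
Local Notation nu := (dens L).
Local Notation st := (@stp R).
Implicit Types (b c y : R).

Definition Mo n := I (fun x => x ^+ n * nu x).
Definition MN n b := norm2 (Mc L n b) (Ms L n b).

Lemma Mo_gt0 n : 0 < Mo n.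
Proof. by rewrite /Mo dens_mom; apply: prodr_gt0 => k _; exact: ph_gt0. Qed.

Lemma Mo_rec n : Mo n.+1 = ph p n.+1%:R * Mo n.
Proof. by rewrite /Mo !dens_mom big_ord_recr/= mulrC. Qed.

Lemma MN_rec n b : MN n.+1 b = phN p n.+1%:R b * MN n b.
Proof.
by rewrite /MN Mc_rec Ms_rec phNE -norm2M; congr norm2; ring.
Qed.

Lemma MN_ge0 n b : 0 <= MN n b.
Proof. exact: norm2_ge0. Qed.

Lemma MN_le_Mo n b : MN n b <= Mo n.
Proof.
rewrite /MN McE MsE; apply: I_norm2 => [||||x].
- exact: Mc_itg.
- exact: Ms_itg.
- exact: dens_itg.
- move=> x; have [x0|x0] := leP x 0; first by rewrite dens_eq0// mulr0.
  by rewrite mulr_ge0 ?dens_ge0// exprn_ge0// ltW.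
- apply: sqr_le_weight; rewrite !exprMn -mulrDr cos2Dsin2 mulr1.
  by [].
Qed.

Lemma MN_add n J b : MN (n + J) b / Mo (n + J) =
  MN n b / Mo n * \prod_(k < J) ratio p (n + k).+1%:R b.
Proof.
elim: J => [|J IH]; first by rewrite addn0 big_ord0 mulr1.
rewrite addnS MN_rec Mo_rec big_ord_recr/= mulrA -IH ratioE.
have := Mo_gt0 (n + J) => h; have := @ph_gt0 R p (n + J).+1%:R ltac:(by rewrite ltr0n) => h'.
by field; rewrite !gt_eqF.
Qed.

(** The integrand that defines [Theta_low], in the scale u = b y on which it is dominated by [logr]
    uniformly in b. *)
Definition lnr b y := st y * ln (ratio p (b * y) b).

Lemma lnr_meas b : 0 <= b -> measurable_fun setT (lnr b).
Proof.
move=> b0; have ms := @stp_meas R.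
have e : lnr b = (fun y => st y * ln (phN p (b * Num.max y 0) b / phiR p (b * Num.max y 0) 0)).
  apply/funext => y; rewrite /lnr ratioE phR0; have [y0|y0] := leP y 0.
    have -> : st y = 0 by exact: stp0.
    by transitivity (0 : R); [exact: mul0r|symmetry; exact: mul0r].
  by [].
have mm : measurable_fun setT (fun y : R => b * Num.max y 0) by meas.
have pp x : 0 <= b * Num.max x 0 by rewrite mulr_ge0// le_max lexx orbT.
have m1 := phiR_meas p b mm pp; have m2 := phiI_meas p b mm pp; have m3 := phiR_meas p 0 mm pp.
by rewrite e; under eq_fun do rewrite phNE norm2E; meas.
Qed.

Lemma lnr_ge0 b y : 0 < b -> 0 <= lnr b y.
Proof.
move=> b0; have [y0|y0] := leP y 0; first by rewrite /lnr stp0// mul0r.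
by rewrite mulr_ge0 ?stp_ge0// ln_ge0// ratio_ge1// mulr_gt0.
Qed.

Lemma lnr_le b y : 0 < b -> lnr b y <= st y * logr y.
Proof.
move=> b0; have [y0|y0] := leP y 0; first by rewrite /lnr stp0// !mul0r.
rewrite ler_wpM2l ?stp_ge0//.
have by0 : 0 < b * y by rewrite mulr_gt0.
have r0 : 0 < ratio p (b * y) b by apply: lt_le_trans (ratio_ge1 _ _ by0).
have h := ratio_le p b by0.
have e : 1 + b ^+ 2 / (b * y) ^+ 2 = 1 + y ^- 2.
  by rewrite exprMn invfM mulrA divff ?mul1r// expf_neq0// gt_eqF.
rewrite e in h; have a0 := logr_arg_gt0 y.
rewrite /logr ler_pdivlMr// mulr_natr -lnXn// ler_ln ?posrE ?exprn_gt0//.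
by rewrite -[leRHS]sqr_sqrtr ?(ltW a0)// lerXn2r ?nnegrE ?sqrtr_ge0// ltW.
Qed.

Lemma lnr_itg b : 0 < b -> itg (lnr b).
Proof.
move=> b0; apply: (itg_dom (lnr_meas (ltW b0)) (proj1 (@logr_total R))) => y.
by rewrite ger0_norm ?lnr_ge0// lnr_le.
Qed.

Definition Tail b c := I (fun y => st (y - c) * lnr b y).

Lemma Tail_itg b c : 0 < b -> itg (fun y => st (y - c) * lnr b y).
Proof.
move=> b0; have ms := @stp_meas R; have ml := lnr_meas (ltW b0).
apply: (itg_dom _ (lnr_itg b0)); first by meas.
move=> y; have l0 := lnr_ge0 y b0; rewrite ger0_norm; first by rewrite ler_piMl// stp_le1.
by rewrite mulr_ge0// stp_ge0.
Qed.

(** One cell of a Riemann sum: [ratio] is nonincreasing in its first argument, so its value at the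
    left end n + 1 bounds it on the whole cell. *)
Lemma Tail_step b n : 0 < b ->
  b * (Tail b (n.+1%:R / b) - Tail b (n.+2%:R / b)) <= ln (ratio p n.+1%:R b).
Proof.
move=> b0; have ms := @stp_meas R; have ml := lnr_meas (ltW b0).
have c0 : 0 < n.+1%:R / b by rewrite divr_gt0.
have cc : n.+1%:R / b <= n.+2%:R / b by rewrite ler_pM2r ?invr_gt0// ler_nat.
have r0 : 0 <= ln (ratio p n.+1%:R b) by rewrite ln_ge0// ratio_ge1.
rewrite /Tail -I_B; try exact: Tail_itg.
apply: (@le_trans _ _ (b * I (fun y => ln (ratio p n.+1%:R b) * \1_`[n.+1%:R / b, n.+2%:R / b] y))).
  rewrite ler_pM2l//; apply: I_le => [||y].
  - by apply: itgB; exact: Tail_itg.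
  - by apply: itgZ; exact: itg_indic_itv.
  rewrite -mulrBl indicE; have [yc|yc] := leP y (n.+1%:R / b).
    rewrite (@stp0 _ (y - _)) ?subr_le0// (@stp0 _ (y - _)) ?subr_le0 ?(le_trans yc)//.
    by rewrite subrr mul0r mulr_ge0.
  have [yc2|yc2] := leP y (n.+2%:R / b).
    rewrite (@stp1 _ (y - _)) ?subr_gt0// (@stp0 _ (y - n.+2%:R / b)) ?subr_le0//.
    rewrite subr0 mul1r mem_set/= ?in_itv/= ?(ltW yc)// mulr1.
    have y0 := lt_trans c0 yc; rewrite /lnr stp1// mul1r.
    have by0 : n.+1%:R <= b * y by rewrite mulrC -ler_pdivrMr// ltW.
    have n0 : 0 < n.+1%:R :> R by rewrite ltr0n.
    rewrite ler_ln ?posrE; first exact: ratio_decr.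
    - by apply: lt_le_trans (ratio_ge1 _ _ _) => //; exact: lt_le_trans by0.
    - by apply: lt_le_trans (ratio_ge1 _ _ _).
  by rewrite !stp1 ?subr_gt0// ?subrr ?mul0r ?mulr_ge0// (lt_trans yc).
rewrite I_Z; last exact: itg_indic_itv.
rewrite I_indic_itv// -mulrBl -natrB// subSnn mul1r mulrCA divff ?mulr1// gt_eqF//.
Qed.

Lemma Tail_le b c : 0 < b -> 0 < c -> Tail b c <= pi / 2 - Glog c.
Proof.
move=> b0 c0; have [i e] := logr_tail c0; rewrite -e.
apply: I_le => // [|y]; first exact: Tail_itg.
rewrite ler_wpM2l ?stp_ge0//; have [y0|y0] := leP y 0.
  by rewrite /lnr stp0// mul0r logr_ge0.
by apply: (le_trans (lnr_le _ b0)); rewrite stp1// mul1r.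
Qed.

(** Iterate the functional equation J times upwards and use only [MN] <= [Mo] at n + J. The cells
    add up to a difference of tails, and the farther tail vanishes as J grows because [logr] is
    integrable at infinity. *)
Lemma MN_le_Tail n b : 0 < b -> MN n b <= Mo n * expR (- (b * Tail b (n.+1%:R / b))).
Proof.
move=> b0; have o0 := Mo_gt0 n.
have key J : MN n b / Mo n <= expR (- (b * Tail b (n.+1%:R / b))) * expR (b * Tail b ((n + J).+1%:R / b)).
  have h : MN (n + J) b / Mo (n + J) <= 1 by rewrite ler_pdivrMr ?Mo_gt0// mul1r MN_le_Mo.
  rewrite MN_add in h.
  have e : expR (b * (Tail b (n.+1%:R / b) - Tail b ((n + J).+1%:R / b))) <= \prod_(k < J) ratio p (n + k).+1%:R b.
    elim: J {h} => [|J IH]; first by rewrite big_ord0 addn0 subrr mulr0 expR0.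
    rewrite big_ord_recr/= (_ : b * _ = b * (Tail b (n.+1%:R / b) - Tail b ((n + J).+1%:R / b)) +
      b * (Tail b ((n + J).+1%:R / b) - Tail b ((n + J).+2%:R / b))); last by rewrite addnS; ring.
    rewrite expRD; apply: ler_pM; rewrite ?expR_ge0//.
    have r0 : 0 < ratio p (n + J).+1%:R b by apply: lt_le_trans (ratio_ge1 _ _ _).
    by rewrite -[leRHS]lnK ?posrE// ler_expR Tail_step.
  rewrite -expRD (_ : _ + _ = - (b * (Tail b (n.+1%:R / b) - Tail b ((n + J).+1%:R / b)))); last by ring.
  rewrite expRN -[leRHS]mul1r ler_pdivlMr ?expR_gt0//; apply: le_trans h.
  by rewrite ler_wpM2l// divr_ge0 ?MN_ge0// ltW.
rewrite -ler_pdivrMl// mulrC.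
set T := Tail b _ in key *.
have cJ : (n + J).+1%:R / b @[J --> \oo] --> +oo.
  apply/cvgryPge => A; exists (Num.bound (`|A| * b)) => // J /= hJ.
  rewrite ler_pdivlMr//; apply: (@le_trans _ _ (`|A| * b)).
    by rewrite ler_wpM2r ?ler_norm// ltW.
  have := archi_boundP (mulr_ge0 (normr_ge0 A) (ltW b0)) => /ltW/le_trans; apply.
  by rewrite ler_nat (leq_trans hJ)// (leq_trans (leq_addl n J)).
have cG := (cvg_pinftyP _ _).1 (@Glog_cvg_pihalf R) _ cJ.
have cv : expR (- (b * T)) * expR (b * (pi / 2 - Glog ((n + J).+1%:R / b))) @[J --> \oo] -->
    expR (- (b * T)) * expR (b * (pi / 2 - pi / 2)).
  apply: cvgMr; apply: continuous_cvg; first exact: continuous_expR.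
  by apply: cvgMr; apply: cvgB; [exact: cvg_cst|exact: cG].
rewrite (_ : expR (- (b * T)) = expR (- (b * T)) * expR (b * (pi / 2 - pi / 2))); last first.
  by rewrite subrr mulr0 expR0 mulr1.
rewrite -(cvg_lim _ cv)//; apply: limr_ge; first by apply/cvg_ex; eexists; exact: cv.
apply: nearW => J; apply: (le_trans (key J)).
by rewrite ler_wpM2l ?expR_ge0// ler_expR ler_wpM2l ?(ltW b0)// Tail_le// divr_gt0.
Qed.

Lemma Tail_ge_total b c : 0 < b -> 0 < c -> I (lnr b) - Glog c <= Tail b c.
Proof.
move=> b0 c0; have [i1 e1] := logr_tail c0; have [i2 e2] := @logr_total R.
have iT := Tail_itg c b0; have il := lnr_itg b0.
suff : I (lnr b) - Tail b c <= I (fun y => st y * logr y) - I (fun y => st (y - c) * logr y).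
  by rewrite e1; lra.
rewrite /Tail -!I_B//; apply: I_le => [||y]; [exact: itgB|exact: itgB|].
have [y0|y0] := leP y 0.
  rewrite (stp0 y0) (@stp0 _ (y - c)) ?subr_le0 ?(le_trans y0 (ltW c0))//.
  by rewrite /lnr (stp0 y0) !mul0r.
have := lnr_le y b0; rewrite (stp1 y0) mul1r => h.
have [yc|yc] := leP y c; first by rewrite (@stp0 _ (y - c)) ?subr_le0// !mul0r !subr0.
by rewrite stp1 ?subr_gt0// !mul1r !subrr.
Qed.

Lemma lnr_total_le b : 0 < b -> I (lnr b) <= pi / 2.
Proof.
move=> b0; have [i2 e2] := @logr_total R; apply: le_trans e2.
by apply: I_le => // [|y]; [exact: lnr_itg|exact: lnr_le].
Qed.

(** Starting at c = (n + 1) / b instead of 0 loses at most [Glog c], which is below e once b is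
    large; smaller b are absorbed in the constant. *)
Lemma MN_decay n (th : R) : 0 < th ->
  (\forall b \near +oo, th < I (lnr b)) ->
  forall e : R, 0 < e -> exists2 A : R, 0 < A & forall b, 0 < b -> MN n b <= A * expR (- ((th - e) * b)).
Proof.
move=> th0 [b0 [_ hb0]] e e0; have o0 := Mo_gt0 n.
have [d d0 Gd] := @Glog_small R e e0.
pose B := Num.max (Num.max b0 1) (n.+1%:R / d).
have B0 : 0 < B by rewrite !lt_max ltr01 orbT.
exists (Mo n * expR (th * B)); first by rewrite mulr_gt0 ?expR_gt0.
move=> b bb0; have [bB|bB] := leP b B.
  apply: (le_trans (MN_le_Mo n b)); rewrite -mulrA -expRD ler_peMr ?(ltW o0)//.
  rewrite -expR0 ler_expR.
  have : th * b <= th * B by rewrite ler_pM2l.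
  have : 0 <= e * b by rewrite mulr_ge0 ?ltW.
  lra.
have [bb1 bb2] : b0 < b /\ n.+1%:R / d < b.
  by move: bB; rewrite !gt_max => /andP[/andP[-> _] ->].
apply: (le_trans (MN_le_Tail n bb0)); rewrite -mulrA ler_pM2l//.
rewrite -expRD ler_expR.
have c0 : 0 < n.+1%:R / b by rewrite divr_gt0.
have cd : n.+1%:R / b <= d by rewrite ler_pdivrMr// mulrC -ler_pdivrMr// ltW.
have h1 := Tail_ge_total bb0 c0; have h2 := Gd _ c0 cd; have h3 := hb0 _ bb1.
have : b * (th - e) <= b * Tail b (n.+1%:R / b) by rewrite ler_pM2l//; lra.
have : 0 <= th * B by rewrite mulr_ge0 ?ltW.
lra.
Qed.

Lemma MoE n : Mo n = I (fun x => x ^+ n * nu x).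
Proof. by []. Qed.

Lemma lnrE b y : lnr b y = st y * ln (ratio p (b * y) b).
Proof. by []. Qed.

Lemma TailE b c : Tail b c = I (fun y => st (y - c) * lnr b y).
Proof. by []. Qed.

End MellinBound.

#[global] Opaque MN Mo lnr Tail.

(** * Mellin inversion *)

Section DifferentiateIntegral.
Variable R : realType.

Lemma hasd_I_loc (f df : R -> R -> R) (H : R -> R) (a c l : R) : a < l < c ->
  (forall x, a < x < c -> itg (f x)) -> (forall x y, a < x < c -> hasd (f^~ y) x (df x y)) ->
  itg H -> (forall x y, a < x < c -> `|df x y| <= H y) ->
  hasd (fun x => I (f x)) l (I (df l)).
Proof.
move=> lac iF hd iH dH.
have Il : [set` `]a, c[] l by rewrite /= in_itv.
have H0 y : 0 <= H y by exact: le_trans (normr_ge0 _) (dH l y lac).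
have inI x : [set` `]a, c[] x -> a < x < c by rewrite /= in_itv.
have df1 (x y : R) : [set` `]a, c[] x -> setT y -> derivable (f^~ y) x 1 by move=> /inI h _; case: (hd x y h).
have dE (x y : R) : [set` `]a, c[] x -> partial1of2 f x y = df x y.
  by move=> /inI h; rewrite /partial1of2 derive1E; case: (hd x y h).
have intf x : [set` `]a, c[] x -> (@lebesgue_measure R).-integrable setT (EFin \o f x).
  by move=> /inI h; rewrite -itgE; exact: iF.
have intH : (@lebesgue_measure R).-integrable setT (EFin \o H) by rewrite -itgE.
have Hub x y : [set` `]a, c[] x -> setT y -> `|partial1of2 f x y| <= H y.
  by move=> h _; rewrite dE//; exact: dH (inI _ h).
have d1 := @derivable_under_integral R _ _ (@lebesgue_measure R) f setT measurableT l a c Il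
  intf df1 H H0 intH Hub.
have d2 := @differentiation_under_integral R _ _ (@lebesgue_measure R) f setT measurableT l a c Il
  intf df1 H H0 intH Hub.
have e : (fun x => I (f x)) = (fun x => \int[@lebesgue_measure R]_(y in setT) f x y)%R.
  by apply/funext => x; rewrite IE.
rewrite /hasd e; apply: DeriveDef; first exact: d1.
rewrite -derive1E d2 IE; apply: eq_Rintegral => y _; exact: dE.
Qed.

Lemma hasd_I (f df : R -> R -> R) (H : R -> R) (l : R) :
  (forall x, itg (f x)) -> (forall x y, hasd (f^~ y) x (df x y)) ->
  itg H -> (forall x y, `|df x y| <= H y) ->
  hasd (fun x => I (f x)) l (I (df l)).
Proof.
move=> iF hd iH dH; apply: (@hasd_I_loc f df H (l - 1) (l + 1) l) => //.
by apply/andP; split; lra.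
Qed.

Lemma indic_itvE (a c x : R) : \1_`[a, c] x = (a <= x <= c)%R%:R :> R.
Proof. by rewrite indicE; congr (nat_of_bool _)%:R; apply/idP/idP; rewrite inE/= in_itv. Qed.

Lemma I_FTC_itv (F g : R -> R) (a c : R) : a < c ->
  (forall x, a <= x <= c -> hasd F x (g x)) ->
  (forall x, a <= x <= c -> {for x, continuous g}) ->
  itg (fun x => \1_`[a, c] x * g x) /\ I (fun x => \1_`[a, c] x * g x) = F c - F a.
Proof.
move=> ac dF cg.
have cgi : {within `[a, c], continuous g}.
  by apply: continuous_in_subspaceT => t /set_mem/=; rewrite in_itv/= => /cg.
have dFi : derivable_oo_LRcontinuous F a c.
  split.
  - by move=> t; rewrite in_itv/= => /andP[h1 h2]; case: (dF t _) => //; rewrite !ltW.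
  - by apply: cvg_at_right_filter; apply: der_continuous (dF a _); rewrite lexx ltW.
  - by apply: cvg_at_left_filter; apply: der_continuous (dF c _); rewrite lexx ltW.
have dE : {in `]a, c[, F^`()%classic =1 g}.
  move=> t; rewrite in_itv/= => /andP[h1 h2].
  by rewrite derive1E; case: (dF t _) => //; rewrite !ltW.
have FTC := @continuous_FTC2 R g F a c ac cgi dFi dE.
have ic : (@lebesgue_measure R).-integrable [set` `[a, c]] (EFin \o g).
  by apply: continuous_compact_integrable => //; exact: segment_compact.
have e : (fun x => \1_`[a, c] x * g x) = g \_ [set` `[a, c]].
  apply/funext => x; rewrite indicE patchE; case: (x \in _); first by rewrite mul1r.
  by rewrite mul0r.
split; last by rewrite IE e -Rintegral_mkcond /Rintegral FTC.
by rewrite e itgE -restrict_EFin; apply/integrable_restrict => //=; rewrite setTI.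
Qed.

End DifferentiateIntegral.

Section HalfLine.
Variable R : realType.
Local Notation st := (@stp R).
Implicit Types (c e v b : R).

Lemma half_exp c : 0 < c -> itg (fun b => st b * expR (- (c * b))) /\
  I (fun b => st b * expR (- (c * b))) <= c^-1.
Proof.
move=> c0; have ms := @stp_meas R; have cn := lt0r_neq0 c0.
have mg : measurable_fun setT (fun b : R => expR (- (c * b))) by meas.
have gK : expbd 0 (fun b : R => expR (- (c * b))) 1.
  move=> t t0; rewrite mul0r expR0 mulr1 ger0_norm ?expR_ge0// expR_le1 oppr_le0.
  by rewrite mulr_ge0 ?ltW.
have pr x : 0 < x -> prim (fun b => expR (- (c * b))) x = c^-1 * (1 - expR (- (c * x))).
  move=> x0; apply: (@prim_FTC R 0 (lexx 0) _ (fun x => c^-1 * (1 - expR (- (c * x)))) 1 x mg gK x0).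
  - move=> t _; apply: hasd_eq; first by der.
    by rewrite /=; field.
  - by move=> t _; apply: (@der_continuous R _ t (expR (- (c * t)) * - (c * 1 + t * 0))); der.
  - apply: cvg_at_right_filter.
    rewrite -[X in _ --> X](_ : c^-1 * (1 - expR (- (c * 0))) = 0); last by rewrite mulr0 oppr0 expR0 subrr mulr0.
    by apply: (@der_continuous R (fun x => c^-1 * (1 - expR (- (c * x)))) 0
       (c^-1 * (0 - expR (- (c * 0)) * - (c * 1 + 0 * 0)) + (1 - expR (- (c * 0))) * 0)); der.
apply: (@I_fatou R (fun n b => expR (- (c * b)) * (st b * st (n.+1%:R - b)))).
- by move=> n; exact: (prim_itg (lexx 0) n.+1%:R mg gK).
- by move=> n b; rewrite !mulr_ge0 ?expR_ge0 ?stp_ge0.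
- move=> b; rewrite (_ : st b * _ = expR (- (c * b)) * (st b * 1)); last by ring.
  apply: cvgMr; apply: cvgMr.
  apply: cvg_near_cst; exists (Num.bound `|b|) => // n /= hn.
  rewrite stp1// subr_gt0 (le_lt_trans (ler_norm b))//.
  have := archi_boundP (normr_ge0 b) => /lt_le_trans; apply.
  by rewrite ler_nat (leq_trans hn).
- move=> n; have := pr n.+1%:R (ltr0Sn _ _); rewrite /prim => ->.
  apply: ler_piMr; first by rewrite invr_ge0 ltW.
  by have := expR_ge0 (- (c * n.+1%:R)); lra.
Qed.

(** The Laplace transform of the cosine. With v = ln x - l it is the Poisson kernel, an approximate
    identity in ln x as e tends to 0. *)
Lemma half_kernel e v : 0 < e ->
  I (fun b => st b * expR (- (e * b)) * cos (b * v)) = e / (e ^+ 2 + v ^+ 2).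
Proof.
move=> e0; have ms := @stp_meas R.
have D0 : 0 < e ^+ 2 + v ^+ 2 by rewrite ltr_pwDl ?exprn_gt0// sqr_ge0.
have Dn := lt0r_neq0 D0.
pose g b := expR (- (e * b)) * cos (b * v).
have mg : measurable_fun setT g by rewrite /g; meas.
have gK : expbd 0 g 1.
  move=> t t0; rewrite mul0r expR0 mulr1 normrM (ger0_norm (expR_ge0 _)).
  rewrite mulr_ile1 ?expR_ge0 ?cos_max// expR_le1 oppr_le0.
  by rewrite mulr_ge0 ?ltW.
pose F b := expR (- (e * b)) * (v * sin (b * v) - e * cos (b * v)) / (e ^+ 2 + v ^+ 2) + e / (e ^+ 2 + v ^+ 2).
have dF t : hasd F t (g t).
  by apply: hasd_eq; [rewrite /F; der|rewrite /g /=; field].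
have F0 : F 0 = 0 by rewrite /F mulr0 oppr0 expR0 mul0r sin0 cos0; field.
have pr x : 0 < x -> prim g x = F x.
  move=> x0; apply: (@prim_FTC R 0 (lexx 0) _ F 1 x mg gK x0).
  - by move=> t _; exact: dF.
  - move=> t _; apply: (@der_continuous R _ t (expR (- (e * t)) * (- sin (t * v) * (t * 0 + v * 1)) + cos (t * v) * (expR (- (e * t)) * - (e * 1 + t * 0)))).
    by rewrite /g; der.
  - by rewrite -[X in _ --> X]F0; apply: cvg_at_right_filter; exact: der_continuous (dF 0).
have [ie _] := half_exp e0.
have [_ c1] : itg (fun b => st b * expR (- (e * b)) * cos (b * v)) /\
   I (fun b => g b * (st b * st (n.+1%:R - b))) @[n --> \oo] --> I (fun b => st b * expR (- (e * b)) * cos (b * v)).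
  apply: (I_dct _ _ ie).
  - by move=> n; meas.
  - move=> b; rewrite (_ : st b * _ * _ = g b * (st b * 1)); last by rewrite /g; ring.
    apply: cvgMr; apply: cvgMr.
    apply: cvg_near_cst; exists (Num.bound `|b|) => // n /= hn.
    rewrite stp1// subr_gt0 (le_lt_trans (ler_norm b))//.
    have := archi_boundP (normr_ge0 b) => /lt_le_trans; apply.
    by rewrite ler_nat (leq_trans hn).
  - move=> n b; rewrite /g !normrM (ger0_norm (expR_ge0 _)) !(ger0_norm (stp_ge0 _)).
    rewrite mulrC -mulrA ler_wpM2l ?stp_ge0// mulrCA ler_piMr ?expR_ge0//.
    by rewrite mulr_ile1 ?stp_ge0 ?stp_le1 ?cos_max.
rewrite -(cvg_lim _ c1)//; apply/cvg_lim => //.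
rewrite (_ : (fun n => _) = (fun n => F n.+1%:R)); last first.
  by apply/funext => n; rewrite -pr.
rewrite -[X in _ --> X]add0r; apply: cvgD; last exact: cvg_cst.
apply/cvgr0Pnorm_le => d d0.
pose C := (`|v| + e) / (e ^+ 2 + v ^+ 2).
have C0 : 0 < C by rewrite divr_gt0// ltr_wpDl.
near=> n.
apply: (@le_trans _ _ (expR (- (e * n.+1%:R)) * C)).
  rewrite !normrM (ger0_norm (expR_ge0 _)) normfV (gtr0_norm D0) /C mulrA ler_pM2r ?invr_gt0//.
  rewrite ler_wpM2l ?expR_ge0// (le_trans (ler_normB _ _))// !normrM (gtr0_norm e0) lerD//.
    by rewrite ler_piMr// sin_max.
  by rewrite ler_piMr ?cos_max// ltW.
have en : 0 < e * n.+1%:R by rewrite mulr_gt0.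
rewrite expRN mulrC ler_pdivrMr ?expR_gt0// -ler_pdivrMl//.
apply: (@le_trans _ _ (e * n.+1%:R)); last by have := expR_ge1Dx (e * n.+1%:R); lra.
rewrite -ler_pdivrMl//; near: n.
have q0 : 0 <= e^-1 * (d^-1 * C).
  apply: mulr_ge0; first by rewrite invr_ge0 ltW.
  by apply: mulr_ge0; [rewrite invr_ge0 ltW|exact: ltW].
exists (Num.bound (e^-1 * (d^-1 * C))) => // n /= hn.
have := archi_boundP q0 => /ltW/le_trans; apply.
by rewrite ler_nat (leq_trans hn).
Unshelve. all: by end_near.
Qed.

End HalfLine.

Section Inversion.
Variables (R : realType) (p : levy R) (L : law p).
Local Notation nu := (dens L).
Local Notation st := (@stp R).
Implicit Types (b x l : R).

Lemma dens_mul_cont n x : 0 < x -> {for x, continuous (fun x => x ^+ n * nu x)}.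
Proof. by move=> x0; apply: cvgM; [exact: exprn_continuous|exact: dens_cont]. Qed.

Lemma poisson_window (e d l : R) : 0 < e -> 0 < d ->
  itg (fun x => \1_`[expR (l - d), expR (l + d)] x * (x^-1 * (e / (e ^+ 2 + (ln x - l) ^+ 2)))) /\
  I (fun x => \1_`[expR (l - d), expR (l + d)] x * (x^-1 * (e / (e ^+ 2 + (ln x - l) ^+ 2)))) = 2 * atan (d / e).
Proof.
move=> e0 d0; have en := lt0r_neq0 e0.
have ac : expR (l - d) < expR (l + d) by rewrite ltr_expR; lra.
pose F x := atan ((ln x - l) / e).
have pos x : expR (l - d) <= x <= expR (l + d) -> 0 < x.
  by move=> /andP[h _]; apply: lt_le_trans h; exact: expR_gt0.
have D0 x : 0 < e ^+ 2 + (ln x - l) ^+ 2 by rewrite ltr_pwDl ?exprn_gt0// sqr_ge0.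
have dF x : expR (l - d) <= x <= expR (l + d) -> hasd F x (x^-1 * (e / (e ^+ 2 + (ln x - l) ^+ 2))).
  move=> hx; have x0 := pos _ hx; have xn := lt0r_neq0 x0; have Dn := lt0r_neq0 (D0 x).
  apply: hasd_eq; first by rewrite /F; der.
  by rewrite /=; field; rewrite ?xn ?en ?Dn.
have cF x : expR (l - d) <= x <= expR (l + d) -> {for x, continuous (fun x => x^-1 * (e / (e ^+ 2 + (ln x - l) ^+ 2)))}.
  move=> hx; have x0 := pos _ hx; have xn := lt0r_neq0 x0; have Dn := lt0r_neq0 (D0 x).
  by apply: der_cont; eexists; der.
have [i ->] := I_FTC_itv ac dF cF.
split=> //; rewrite /F !expRK.
have -> : (l + d - l) / e = d / e by congr (_ / _); ring.
have -> : (l - d - l) / e = - (d / e) by rewrite -mulNr; congr (_ / _); ring.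
by rewrite atanN; ring.
Qed.

Lemma Mc_meas n : measurable_fun setT (Mc L n).
Proof.
have -> : Mc L n = (fun b => I (fun x => x ^+ n * cos (b * ln x) * nu x)) by apply/funext => b; exact: McE.
have mn := dens_meas L.
apply: (@I_fubini_meas R (fun z => z.2 ^+ n * cos (z.1 * ln z.2) * nu z.2)); first by meas.
by move=> x /=; exact: Mc_itg.
Qed.

Lemma Ms_meas n : measurable_fun setT (Ms L n).
Proof.
have -> : Ms L n = (fun b => I (fun x => x ^+ n * sin (b * ln x) * nu x)) by apply/funext => b; exact: MsE.
have mn := dens_meas L.
apply: (@I_fubini_meas R (fun z => z.2 ^+ n * sin (z.1 * ln z.2) * nu z.2)); first by meas.
by move=> x /=; exact: Ms_itg.
Qed.

Lemma rot_le (A B t : R) : `|A * cos t + B * sin t| <= norm2 A B.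
Proof.
have h : norm2 (cos t) (sin t) = 1 by rewrite norm2E cos2Dsin2 sqrtr1.
rewrite ler_norml; apply/andP; split.
  have := cauchy_schwarz2 (- A) (- B) (cos t) (sin t).
  by rewrite h mulr1 norm2N -(norm2N (- A)) -(norm2N A) norm2E norm2E !sqrrN; lra.
by have := cauchy_schwarz2 A B (cos t) (sin t); rewrite h mulr1.
Qed.

(** The damping exp (- e b) makes the double integral absolutely convergent, which the undamped
    inversion integral is not. *)
Lemma poisson_fubini n (e l : R) : 0 < e ->
  I (fun b => st b * expR (- (e * b)) * (Mc L n b * cos (b * l) + Ms L n b * sin (b * l))) =
  I (fun x => x ^+ n * nu x * (e / (e ^+ 2 + (ln x - l) ^+ 2))).
Proof.
move=> e0; have mn := dens_meas L; have ms := @stp_meas R.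
pose F (z : R * R) := st z.1 * expR (- (e * z.1)) * (z.2 ^+ n * nu z.2 * cos (z.1 * (ln z.2 - l))).
have mF : measurable_fun setT F by rewrite /F; meas.
have := I_fubini mF (proj1 (half_exp e0)) (dens_itg L n).
have hF x y : `|F (x, y)| <= st x * expR (- (e * x)) * (y ^+ n * nu y).
  rewrite /F /= normrM ger0_norm; last by rewrite mulr_ge0 ?stp_ge0 ?expR_ge0.
  rewrite ler_wpM2l ?mulr_ge0 ?stp_ge0 ?expR_ge0//.
  have h : 0 <= y ^+ n * nu y.
    have [y0|y0] := leP y 0; first by rewrite dens_eq0// mulr0.
    by rewrite mulr_ge0 ?dens_ge0// exprn_ge0// ltW.
  by rewrite normrM ger0_norm// ler_piMr// cos_max.
move=> /(_ hF) E; transitivity (I (fun x => I (fun y => F (x, y)))).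
  apply: I_eq => b; rewrite McE MsE.
  rewrite [X in _ * X](_ : _ = I (fun y => cos (b * l) * (y ^+ n * cos (b * ln y) * nu y) +
     sin (b * l) * (y ^+ n * sin (b * ln y) * nu y))); last first.
    rewrite I_D; [|by apply: itgZ; exact: Mc_itg|by apply: itgZ; exact: Ms_itg].
    by rewrite !I_Z; [ring|exact: Ms_itg|exact: Mc_itg].
  rewrite -I_Z; last by apply: itgD; apply: itgZ; [exact: Mc_itg|exact: Ms_itg].
  by apply: I_eq => y; rewrite /F /= mulrBr cosB; ring.
rewrite E; apply: I_eq => x; rewrite /F /=.
rewrite -(half_kernel _ e0) -I_Z; last first.
  apply: (itg_dom _ (proj1 (half_exp e0))); first by meas.
  move=> b; have w0 : 0 <= st b * expR (- (e * b)) by apply: mulr_ge0; [exact: stp_ge0|exact: expR_ge0].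
  rewrite normrM (ger0_norm w0); apply: ler_piMr => //; exact: cos_max.
by apply: I_eq => b; ring.
Qed.

Lemma poisson_limit n x0 : 0 < x0 ->
  I (fun x => x ^+ n * nu x * (k.+1%:R^-1 / (k.+1%:R^-1 ^+ 2 + (ln x - ln x0) ^+ 2))) @[k --> \oo]
  --> pi * (x0 ^+ n.+1 * nu x0).
Proof.
move=> x00; set l := ln x0; pose h x := x ^+ n.+1 * nu x.
have mn := dens_meas L.
rewrite -/(h x0); have h0 : 0 <= h x0 by rewrite mulr_ge0 ?dens_ge0 ?exprn_ge0// ltW.
pose FF (k : nat) := I (fun x => x ^+ n * nu x * (k.+1%:R^-1 / (k.+1%:R^-1 ^+ 2 + (ln x - l) ^+ 2))).
apply/cvgrPdist_le; change (forall e : R, 0 < e -> \forall k \near \oo, `|pi * h x0 - FF k| <= e) => e e0.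
rewrite {}/FF; pose eta : R := e / (3 * pi).
have pi0 := @pi_gt0 R.
have eta0 : 0 < eta by rewrite divr_gt0// mulr_gt0.
have [d d0 hd] : exists2 d : R, 0 < d & forall x, expR (l - d) <= x <= expR (l + d) -> `|h x - h x0| <= eta.
  have cc : {for l, continuous (fun y => h (expR y))}.
    apply: continuous_comp; first exact: continuous_expR.
    by rewrite lnK ?posrE//; exact: dens_mul_cont.
  move: cc => /cvgrPdist_le /(_ _ eta0) /nbhs_ballP[r /= r0 hr].
  exists (r / 2); first by rewrite divr_gt0.
  move=> x /andP[x1 x2]; have xp : 0 < x by apply: lt_le_trans x1; exact: expR_gt0.
  have := hr (ln x); rewrite lnK ?posrE// lnK ?posrE// distrC; apply.
  rewrite /ball /= distrC ltr_norml.
  have y1 : l - r / 2 <= ln x by rewrite -[leLHS]expRK ler_ln ?posrE ?expR_gt0.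
  have y2 : ln x <= l + r / 2 by rewrite -[leRHS]expRK ler_ln ?posrE ?expR_gt0.
  by apply/andP; split; lra.
pose A k := 2 * atan (d / k.+1%:R^-1) : R.
have cA : A k @[k --> \oo] --> pi.
  rewrite (_ : (pi : R) = 2 * (pi / 2)); last by field.
  apply: cvgMr; apply: (cvg_pinftyP _ _).1; first exact: cvgy_atan.
  apply/cvgryPge => B; exists (Num.bound (`|B| / d)) => // k /= hk.
  rewrite invrK mulrC -ler_pdivrMr//.
  apply: (@le_trans _ _ (`|B| / d)); first by rewrite ler_pM2r ?invr_gt0// ler_norm.
  have := archi_boundP (divr_ge0 (normr_ge0 B) (ltW d0)) => /ltW/le_trans; apply.
  by rewrite ler_nat (leq_trans hk).
have Ale k : 0 <= A k <= pi.
  have a0 : 0 <= d / k.+1%:R^-1 by rewrite divr_ge0 ?invr_ge0// ltW.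
  have := @le_atan R 0 _ a0; rewrite atan0 /A => h1; have := @atan_ltpi2 R (d / k.+1%:R^-1) => h2.
  by apply/andP; split; lra.
pose Mon := I (fun x => x ^+ n * nu x).
have Mon0 : 0 <= Mon.
  apply: I_ge0 => x; have [y0|y0] := leP x 0; first by rewrite dens_eq0// mulr0.
  by rewrite mulr_ge0 ?dens_ge0// exprn_ge0// ltW.
(* Compare with h x0 times the mass [A k] of the window |ln x - l| <= d. Inside the window h varies
   by at most eta; outside, the kernel is at most 1 / ((k + 1) d ^ 2) and the moment bounds the
   rest. *)
have bound k : `|I (fun x => x ^+ n * nu x * (k.+1%:R^-1 / (k.+1%:R^-1 ^+ 2 + (ln x - l) ^+ 2))) - h x0 * A k|
   <= k.+1%:R^-1 * (Mon / d ^+ 2) + eta * A k.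
  set ek : R := k.+1%:R^-1; have ek0 : 0 < ek by rewrite invr_gt0.
  have D0 x : 0 < ek ^+ 2 + (ln x - l) ^+ 2 by rewrite ltr_pwDl ?exprn_gt0// sqr_ge0.
  have [iw ew] := @poisson_window ek d l ek0 d0.
  pose K x := ek / (ek ^+ 2 + (ln x - l) ^+ 2).
  have K0 x : 0 <= K x by rewrite divr_ge0 ?ltW.
  have mK : measurable_fun setT K by rewrite /K; meas.
  have KB x : K x <= ek^-1.
    have e1 : ek^-1 * ek ^+ 2 = ek by field; rewrite lt0r_neq0.
    rewrite /K ler_pdivrMr// mulrDr e1.
    by rewrite lerDl mulr_ge0 ?sqr_ge0// invr_ge0 ltW.
  have nn x : 0 <= x ^+ n * nu x.
    have [y0|y0] := leP x 0; first by rewrite dens_eq0// mulr0.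
    by rewrite mulr_ge0 ?dens_ge0// exprn_ge0// ltW.
  have i1 : itg (fun x => x ^+ n * nu x * K x).
    apply: (itg_dom _ (itgZ ek^-1 (dens_itg L n))); first by meas.
    move=> x; rewrite ger0_norm; last exact: mulr_ge0.
    by rewrite [leRHS]mulrC; apply: ler_wpM2l; [exact: nn|exact: KB].
  rewrite /A -/ek -ew -I_Z// -I_B//; last exact: itgZ.
  have e1 : ek * (Mon / d ^+ 2) = (ek / d ^+ 2) * Mon by move: Mon {Mon0} => u; ring.
  rewrite -I_Z// e1.
  rewrite /Mon -I_Z; last exact: dens_itg.
  rewrite -I_D; [|by apply: itgZ; exact: dens_itg|exact: itgZ].
  apply: I_norm_le.
  - by apply: measurable_funB; [exact: itg_meas i1|exact: itg_meas (itgZ _ iw)].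
  - by apply: itgD; apply: itgZ => //; exact: dens_itg.
  move=> x; rewrite -/(K x) indic_itvE; have ed0 : 0 <= ek / d ^+ 2 by rewrite divr_ge0 ?sqr_ge0// ltW.
  case: (boolP (expR (l - d) <= x <= expR (l + d))) => hx.
    have xp : 0 < x by case/andP: hx => x1 _; apply: lt_le_trans x1; exact: expR_gt0.
    rewrite !mul1r (_ : x ^+ n * nu x * K x - h x0 * (x^-1 * K x) = x^-1 * K x * (h x - h x0)); last first.
      have -> : h x = x * (x ^+ n * nu x) by rewrite /h exprS mulrA.
      by move: (x ^+ n * nu x) (K x) (h x0) => u v w; field; rewrite lt0r_neq0.
    have xk : 0 <= x^-1 * K x by rewrite mulr_ge0// invr_ge0 ltW.
    rewrite normrM (ger0_norm xk).
    have hx' := hd x hx; move: (`|_ - _|) hx' => v hv.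
    apply: (@le_trans _ _ (x^-1 * K x * eta)); first exact: ler_wpM2l.
    rewrite [leLHS]mulrC lerDr; apply: mulr_ge0 => //; exact: nn.
  rewrite !mul0r !mulr0 subr0 addr0 ger0_norm; last by apply: mulr_ge0; [exact: nn|exact: K0].
  have [y0|y0] := leP x 0; first by rewrite dens_eq0// !(mulr0, mul0r).
  rewrite mulrC ler_wpM2r// /K ler_wpM2l ?(ltW ek0)// lef_pV2 ?posrE ?exprn_gt0//.
  suff : d ^+ 2 <= (ln x - l) ^+ 2 by have := sqr_ge0 ek; lra.
  rewrite -[leRHS]real_normK ?num_real// lerXn2r ?nnegrE ?(ltW d0)//.
  move: hx => /negP; apply: contra_notT; rewrite -ltNge ltr_norml => /andP[y1 y2].
  have -> : x = expR (ln x) by rewrite lnK ?posrE.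
  by rewrite !ler_expR; apply/andP; split; lra.
have cEn : \forall k \near \oo, k.+1%:R^-1 * (Mon / d ^+ 2) <= e / 3.
  have q0 : 0 <= Mon / d ^+ 2 by rewrite divr_ge0 ?sqr_ge0.
  have e30 : 0 < e / 3 by rewrite divr_gt0.
  move: q0; move: (Mon / d ^+ 2) => q q0.
  exists (Num.bound (q / (e / 3))) => // k /= hk.
  rewrite ler_pdivrMl// -ler_pdivrMr//.
  have := archi_boundP (divr_ge0 q0 (ltW e30)) => /ltW/le_trans; apply.
  by rewrite ler_nat (leq_trans hk).
near=> k.
set J := I _.
have := bound k; rewrite -/J => hb.
have cA2 : (h x0 + 1) * `|pi - A k| <= e / 3.
  rewrite -ler_pdivlMl ?ltr_wpDl//; near: k; move/cvgrPdist_le : cA; apply.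
  by rewrite mulr_gt0 ?invr_gt0 ?divr_gt0 ?ltr_wpDl.
have cE : k.+1%:R^-1 * (Mon / d ^+ 2) <= e / 3 by near: k; exact: cEn.
have eA : eta * A k <= e / 3.
  have /andP[_ h2] := Ale k; apply: (@le_trans _ _ (eta * pi)); first by rewrite ler_pM2l.
  by rewrite /eta invfM mulrA -mulrA mulVf ?mulr1// lt0r_neq0.
have -> : pi * h x0 - J = (h x0 * A k - J) + h x0 * (pi - A k) by ring.
rewrite (le_trans (ler_normD _ _))// distrC normrM (ger0_norm h0).
have : h x0 * `|pi - A k| <= (h x0 + 1) * `|pi - A k| by rewrite ler_wpM2r// lerDl.
move=> h3; apply: (le_trans (lerD (le_trans hb (lerD cE eA)) (le_trans h3 cA2))).
by rewrite le_eqVlt; apply/orP; left; apply/eqP; field.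
Unshelve. all: by end_near.
Qed.

(** Integrability of the modulus allows the damping to be removed by dominated convergence. *)
Lemma mellin_inversion n x0 : 0 < x0 -> itg (fun b => st b * MN L n b) ->
  I (fun b => st b * (Mc L n b * cos (b * ln x0) + Ms L n b * sin (b * ln x0))) =
  pi * (x0 ^+ n.+1 * nu x0).
Proof.
move=> x00 iM; have ms := @stp_meas R; have m1 := Mc_meas n; have m2 := Ms_meas n.
set g := fun b => Mc L n b * cos (b * ln x0) + Ms L n b * sin (b * ln x0).
have mg : measurable_fun setT g by rewrite /g; meas.
have gM b : `|g b| <= MN L n b by exact: rot_le.
have [_ c1] : itg (fun b => st b * g b) /\
  I (fun b => st b * expR (- (k.+1%:R^-1 * b)) * g b) @[k --> \oo] --> I (fun b => st b * g b).
  apply: (I_dct _ _ iM).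
  - by move=> k; meas.
  - move=> b; rewrite (_ : st b * g b = st b * 1 * g b); last by rewrite mulr1.
    apply: cvgMl; apply: cvgMr.
    have c0 : - (k.+1%:R^-1 * b) @[k --> \oo] --> (0 : R).
      rewrite -[X in _ --> X]oppr0; apply: cvgN; rewrite -[X in _ --> X](mul0r b).
      by apply: cvgMl; exact: cvg_harmonic.
    have cE : expR (- (k.+1%:R^-1 * b)) @[k --> \oo] --> expR (0 : R).
      by apply: continuous_cvg; [exact: continuous_expR|exact: c0].
    by rewrite expR0 in cE.
  - move=> k b; rewrite normrM (ger0_norm (_ : 0 <= st b * _)) ?mulr_ge0 ?stp_ge0 ?expR_ge0//.
    have [b0|b0] := leP b 0; first by rewrite (stp0 b0) !mul0r.
    rewrite (stp1 b0) !mul1r (le_trans _ (gM b))// ler_piMl// expR_le1 oppr_le0.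
    by rewrite mulr_ge0 ?invr_ge0// ltW.
rewrite -(cvg_lim _ c1)//; apply/cvg_lim => //.
rewrite (_ : (fun k => _) = (fun k : nat => I (fun x => x ^+ n * nu x * (k.+1%:R^-1 / (k.+1%:R^-1 ^+ 2 + (ln x - ln x0) ^+ 2))))); last first.
  by apply/funext => k; apply: poisson_fubini; rewrite invr_gt0.
exact: poisson_limit.
Qed.

End Inversion.

(** * Bounds at integral exponents *)

Section Binomial.
Variable R : realType.

(** With X = 1 + d and Y = 1 + 1 / d one has X + Y = X Y, so X ^ j Y ^ N obeys Pascal's rule. *)
Lemma bin_le (d : R) j N : 0 < d -> ('C(j + N, j))%:R <= (1 + d) ^+ j * (1 + d^-1) ^+ N.
Proof.
move=> d0; have dn := lt0r_neq0 d0; have di : 0 < d^-1 by rewrite invr_gt0.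
have X1 : 1 <= 1 + d by rewrite lerDl ltW.
have Y1 : 1 <= 1 + d^-1 by rewrite lerDl ltW.
elim: j N => [|j IHj] N; first by rewrite bin0 expr0 mul1r exprn_ege1.
elim: N => [|N IHN]; first by rewrite addn0 binn expr0 mulr1 exprn_ege1.
rewrite addnS binS natrD.
have h1 : ('C(j.+1 + N, j.+1))%:R <= (1 + d) ^+ j.+1 * (1 + d^-1) ^+ N by exact: IHN.
have h2 : ('C(j.+1 + N, j))%:R <= (1 + d) ^+ j * (1 + d^-1) ^+ N.+1.
  by rewrite addSnnS; exact: IHj.
apply: (le_trans (lerD h1 h2)); rewrite !exprS.
move: ((1 + d) ^+ j) ((1 + d^-1) ^+ N) => X Y.
by rewrite le_eqVlt; apply/orP; left; apply/eqP; field.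
Qed.

Lemma norm2_shift_le (i N b : R) : 0 < i -> 0 <= N ->
  norm2 (i - N) b <= (i + N) * Num.sqrt (1 + b ^+ 2 / i ^+ 2).
Proof.
move=> i0 N0; have s0 : 0 <= 1 + b ^+ 2 / i ^+ 2 by rewrite addr_ge0// divr_ge0// sqr_ge0.
apply: norm2_le; first by rewrite mulr_ge0 ?sqrtr_ge0// addr_ge0// ltW.
rewrite exprMn sqr_sqrtr// mulrDr mulr1; apply: lerD.
  have h : 0 <= i * N by apply: mulr_ge0 => //; exact: ltW.
  nra.
rewrite mulrA ler_pdivlMr ?exprn_gt0// mulrC ler_wpM2r ?sqr_ge0//.
by rewrite lerXn2r ?nnegrE ?lerDl ?addr_ge0 ?(ltW i0).
Qed.

End Binomial.

(** * Inversion formula for the functions w and bounds at integral exponents *)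

Section CoEigen.
Variables (R : realType) (p : levy R) (L : law p).
Local Notation nu := (dens L).
Local Notation st := (@stp R).
Implicit Types (b x y l : R).
Variables (n : nat) (A th : R).
Hypotheses (A0 : 0 < A) (th0 : 0 < th).
Hypothesis decay : forall b, 0 < b -> MN L n b <= A * expR (- (th * b)).

(** Inversion on the line of abscissa n + 1 writes y ^ j nu as a superposition of the powers y ^ (j
    - n - 1 - i b); after d derivatives, [kap j d] is the real part of the exponent. *)
Definition kap j d : R := j%:R - d%:R - n.+1%:R.

(* Real and imaginary part of the product of the factors [kap - i b] with the
   Mellin transform at [n + 1 + i b]. *)
Fixpoint AB j d b : R * R :=
  if d is k.+1 then
    (kap j k * (AB j k b).1 + b * (AB j k b).2, kap j k * (AB j k b).2 - b * (AB j k b).1)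
  else (Mc L n b, Ms L n b).

Definition ABn j d b := norm2 (AB j d b).1 (AB j d b).2.

Lemma ABn_S j d b : ABn j d.+1 b = norm2 (kap j d) b * ABn j d b.
Proof.
rewrite /ABn /= -(norm2N (kap j d) b) -norm2M; congr norm2; ring.
Qed.

Lemma ABn0 j b : ABn j 0 b = MN L n b.
Proof. by []. Qed.

Lemma AB_meas j d : measurable_fun setT (fun b => (AB j d b).1) /\
  measurable_fun setT (fun b => (AB j d b).2).
Proof.
elim: d => [|d [h1 h2]] /=; first by split; [exact: Mc_meas|exact: Ms_meas].
by split; meas.
Qed.

Lemma ABn_meas j d : measurable_fun setT (ABn j d).
Proof.
have [h1 h2] := AB_meas j d; rewrite /ABn.
by under eq_fun do rewrite norm2E; meas.
Qed.

Lemma ABn_pow j d b : (d <= j)%N -> 0 < b ->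
  ABn j d b <= ((j + n.+1)%:R + b) ^+ d * (A * expR (- (th * b))).
Proof.
move=> + b0; elim: d => [_|d IH dj]; first by rewrite expr0 mul1r ABn0 decay.
rewrite ABn_S exprS -mulrA; apply: ler_pM; rewrite ?norm2_ge0// ?IH// 1?ltnW//.
apply: (le_trans (y := `|kap j d| + b)).
  rewrite -[kap j d]addr0 -[X in norm2 _ X]add0r (le_trans (norm2D _ _ _ _))//.
  by rewrite norm2_l0 addr0 lerD2l norm2E expr0n/= add0r sqrtr_sqr gtr0_norm.
rewrite lerD2r /kap -natrB 1?ltnW// natrD (le_trans (ler_normB _ _))//.
by rewrite !ger0_norm// lerD2r ler_nat leq_subr.
Qed.

Lemma ABn_dom k j d : (d <= j)%N -> exists K, forall b, 0 < b ->
  (1 + b) ^+ k * ABn j d b <= K * expR (- (th / 2 * b)).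
Proof.
move=> dj; pose c : R := (j + n.+1)%:R + 1; have t2 : 0 < th / 2 by rewrite divr_gt0.
exists ((k + d)`!%:R / (th / 2) ^+ (k + d) * expR (th / 2 * c) * A) => b b0.
have c0 : 0 <= c by rewrite addr_ge0.
have cb : 0 <= c + b := addr_ge0 c0 (ltW b0).
have b1 : 0 <= 1 + b := addr_ge0 ler01 (ltW b0).
have h1 : (1 + b) ^+ k * ABn j d b <= (c + b) ^+ (k + d) * (A * expR (- (th * b))).
  rewrite exprD -mulrA; apply: ler_pM; rewrite ?norm2_ge0 ?exprn_ge0//.
    by rewrite lerXn2r ?nnegrE// lerD2r /c lerDr.
  apply: (le_trans (ABn_pow dj b0)); rewrite ler_wpM2r ?mulr_ge0 ?expR_ge0 ?(ltW A0)//.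
  by rewrite lerXn2r ?nnegrE// ?addr_ge0 ?(ltW b0)// lerD2r /c lerDl.
apply: (le_trans h1).
have h2 := pow_le_expM (k + d) t2 cb.
apply: (le_trans (ler_wpM2r _ h2)); first by rewrite mulr_ge0 ?expR_ge0// ltW.
rewrite le_eqVlt; apply/orP; left; apply/eqP.
have -> : expR (th / 2 * (c + b)) = expR (th / 2 * c) * expR (th / 2 * b) by rewrite -expRD; congr expR; ring.
have -> : expR (- (th / 2 * b)) = expR (th / 2 * b) * expR (- (th * b)) by rewrite -expRD; congr expR; field.
move: (expR _) (expR _) (expR _) (_ / _ ^+ (k + d)) => x1 x2 x3 x4; ring.
Qed.

Lemma ABn_itgX k j d : (d <= j)%N -> itg (fun b => st b * ((1 + b) ^+ k * ABn j d b)).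
Proof.
move=> dj; have [K hK] := ABn_dom k dj; have ms := @stp_meas R; have mA := ABn_meas j d.
have [i _] := half_exp (divr_gt0 th0 (ltr0Sn R 1)).
apply: (itg_dom _ (itgZ K i)); first by meas.
move=> b; have [b0|b0] := leP b 0; first by rewrite (stp0 b0) !mul0r normr0 mulr0.
have b1 : 0 <= (1 + b) ^+ k by rewrite exprn_ge0// addr_ge0// ltW.
by rewrite (stp1 b0) !mul1r ger0_norm ?hK//; apply: mulr_ge0 => //; exact: norm2_ge0.
Qed.

Lemma ABn_itg j d : (d <= j)%N -> itg (fun b => st b * ((1 + b) * ABn j d b)).
Proof. exact: (@ABn_itgX 1). Qed.

Definition GG j d l := I (fun b => st b * ((AB j d b).1 * cos (b * l) + (AB j d b).2 * sin (b * l))).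

Lemma GG_itg j d l : (d <= j)%N ->
  itg (fun b => st b * ((AB j d b).1 * cos (b * l) + (AB j d b).2 * sin (b * l))).
Proof.
move=> dj; have [h1 h2] := AB_meas j d; have ms := @stp_meas R.
apply: (itg_dom _ (ABn_itg dj)); first by meas.
move=> b; have [b0|b0] := leP b 0; first by rewrite (stp0 b0) !mul0r normr0.
rewrite (stp1 b0) !mul1r (le_trans (rot_le _ _ _))// ler_peMl ?norm2_ge0// lerDl ltW//.
Qed.

Lemma GG_dom_itg j d l : (d <= j)%N ->
  itg (fun b => st b * (b * (AB j d b).2 * cos (b * l) + - (b * (AB j d b).1) * sin (b * l))).
Proof.
move=> dj; have [h1 h2] := AB_meas j d; have ms := @stp_meas R.
apply: (itg_dom _ (ABn_itg dj)); first by meas.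
move=> b; have [b0|b0] := leP b 0; first by rewrite (stp0 b0) !mul0r normr0.
rewrite (stp1 b0) !mul1r (le_trans (rot_le _ _ _))//.
rewrite norm2N norm2Z (gtr0_norm b0) /ABn !norm2E addrC.
by rewrite ler_wpM2r ?sqrtr_ge0// lerDr.
Qed.

Lemma hasd_GG j d l : (d <= j)%N -> hasd (GG j d) l
  (I (fun b => st b * (b * (AB j d b).2 * cos (b * l) + - (b * (AB j d b).1) * sin (b * l)))).
Proof.
move=> dj.
apply: (@hasd_I R (fun l b => st b * ((AB j d b).1 * cos (b * l) + (AB j d b).2 * sin (b * l)))
  (fun l b => st b * (b * (AB j d b).2 * cos (b * l) + - (b * (AB j d b).1) * sin (b * l)))
  (fun b => st b * ((1 + b) * ABn j d b))).
- by move=> x; exact: GG_itg.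
- by move=> x b; apply: hasd_eq; [der|rewrite /=; ring].
- exact: ABn_itg.
- move=> x b; have [b0|b0] := leP b 0; first by rewrite (stp0 b0) !mul0r normr0.
  rewrite (stp1 b0) !mul1r (le_trans (rot_le _ _ _))//.
  rewrite norm2N norm2Z (gtr0_norm b0) /ABn !norm2E addrC.
  by rewrite ler_wpM2r ?sqrtr_ge0// lerDr.
Qed.

Lemma GG_S j d l : (d <= j)%N -> GG j d.+1 l = kap j d * GG j d l +
  I (fun b => st b * (b * (AB j d b).2 * cos (b * l) + - (b * (AB j d b).1) * sin (b * l))).
Proof.
move=> dj; rewrite /GG -I_Z; last exact: GG_itg.
rewrite -I_D; [|by apply: itgZ; exact: GG_itg|exact: GG_dom_itg].
by apply: I_eq => b /=; ring.
Qed.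

Definition Wd j d y := y ^+ (j - d) / y ^+ n.+1 * GG j d (ln y).

Lemma hasd_Wd j d y : (d < j)%N -> 0 < y -> hasd (Wd j d) y (Wd j d.+1 y).
Proof.
move=> dj y0; have yn := lt0r_neq0 y0; have h := hasd_GG (ln y) (ltnW dj).
apply: hasd_eq.
  rewrite /Wd; apply: der_mul; last first.
    by apply: (der_comp h); exact: is_derive1_ln.
  by der; rewrite expf_neq0.
rewrite /Wd (GG_S _ (ltnW dj)).
set G := GG j d _; set G' := I _.
have -> : (j - d)%N = (j - d.+1).+1 by rewrite -subSn.
have kE : kap j d = (j - d.+1).+1%:R - n.+1%:R.
  by rewrite /kap -natrB ?(ltnW dj)//; congr (_%:R - _); rewrite -subSn.
rewrite kE /= !exprS; field; rewrite ?yn ?expf_neq0//.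
Qed.

Lemma derive1n_pow_dens (f : R -> R) j d y : (forall x, 0 < x -> f x = nu x) ->
  (d <= j)%N -> 0 < y -> derive1n d (fun x => x ^+ j * f x) y = pi^-1 * Wd j d y.
Proof.
move=> fnu; have pn : (pi : R) != 0 by rewrite gt_eqF// pi_gt0.
elim: d y => [|d IH] y dj y0.
  rewrite derive1n0 fnu// /Wd subn0 /GG mellin_inversion//; last first.
    have ms := @stp_meas R; have := ABn_itg (leq0n j) => iA.
    apply: (itg_dom _ iA); first by apply: measurable_funM => //; have := ABn_meas j 0.
    move=> b; have [b0|b0] := leP b 0; first by rewrite (stp0 b0) !mul0r normr0.
    by rewrite (stp1 b0) !mul1r ger0_norm ?norm2_ge0// ler_peMl ?norm2_ge0// lerDl ltW.
  have yn : y ^+ n.+1 != 0 by rewrite expf_neq0// lt0r_neq0.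
  by move: yn pn; move: (y ^+ n.+1) (pi : R) => u v u0 v0; field; rewrite u0 v0.
rewrite derive1nS derive1E.
have h : is_derive y 1 (fun x => pi^-1 * Wd j d x) (pi^-1 * Wd j d.+1 y).
  have h1 := hasd_Wd dj y0.
  by apply: (@hasd_eq R _ y (pi^-1 * Wd j d.+1 y + Wd j d y * 0)); [der|ring].
have h2 : is_derive y 1 (derive1n d (fun x => x ^+ j * f x)) (pi^-1 * Wd j d.+1 y).
  apply: (near_eq_is_derive _ h); near=> z; rewrite IH ?(ltnW dj)//.
  by near: z; exact: lt_nbhsr.
by case: h2.
Unshelve. all: by end_near.
Qed.

Lemma ABn_prod j d b : ABn j d b = \prod_(k < d) norm2 (kap j k) b * MN L n b.
Proof.
elim: d => [|d IH]; first by rewrite big_ord0 mul1r.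
by rewrite ABn_S IH big_ord_recr/= mulrA [X in X * _]mulrC.
Qed.

(** With i = j - k, each factor satisfies |i - (n + 1) - i b| <= (i + n + 1) |1 + i b / i|, where i
    also denotes the imaginary unit in front of b. The first parts multiply to binomial (j + n + 1,
    j) j!, the second ones are controlled by [sum_logr_le] after reversing the order of the
    indices. *)
Lemma ABn_le j b t : 0 < b -> 0 < t < pi / 2 ->
  ABn j j b <= ('C(j + n.+1, j) * j`!)%:R * (sin t ^+ j)^-1 * (A * expR (- ((th - t) * b))).
Proof.
move=> b0 ht; have st0 : 0 < sin t by apply: sin_gt0_pihalf.
have i0 (k : 'I_j) : 0 < (j - k)%:R :> R by rewrite ltr0n subn_gt0.
rewrite ABn_prod.
have h1 : \prod_(k < j) norm2 (kap j k) b <=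
    \prod_(k < j) ((j + n.+1 - k)%:R * Num.sqrt (1 + b ^+ 2 / (j - k)%:R ^+ 2)).
  apply: ler_prod => k _; rewrite norm2_ge0/= /kap -natrB 1?ltnW//.
  have := @norm2_shift_le R (j - k)%:R n.+1%:R b (i0 k) (ler0n _ _).
  by rewrite -natrD addnC addnBA 1?ltnW// [(n.+1 + j)%N]addnC.
have h2 : \prod_(k < j) Num.sqrt (1 + b ^+ 2 / (j - k)%:R ^+ 2) <= expR (t * b) * (sin t ^+ j)^-1.
  have e (i : R) : 0 < i -> Num.sqrt (1 + b ^+ 2 / i ^+ 2) = expR (ln (1 + b ^+ 2 / i ^+ 2) / 2).
    move=> ip; have s0 : 0 < 1 + b ^+ 2 / i ^+ 2 by rewrite ltr_pwDl// divr_ge0// sqr_ge0.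
    rewrite -[X in Num.sqrt X](lnK (_ : _ \is Num.pos)) ?posrE//.
    rewrite -[X in Num.sqrt (expR X)](_ : ln (1 + b ^+ 2 / i ^+ 2) / 2 + ln (1 + b ^+ 2 / i ^+ 2) / 2 = _); last by field.
    by rewrite expRD -expr2 sqrtr_sqr ger0_norm ?expR_ge0.
  rewrite (eq_bigr (fun k : 'I_j => expR (ln (1 + b ^+ 2 / (j - k)%:R ^+ 2) / 2))); last by move=> k _; exact: e.
  rewrite -expR_sum (reindex_inj rev_ord_inj)/=.
  rewrite (eq_bigr (fun k : 'I_j => ln (1 + b ^+ 2 / k.+1%:R ^+ 2) / 2)); last first.
    by move=> k _; rewrite subKn.
  have := sum_logr_le j (ltW b0) ht; rewrite -ler_expR => /le_trans; apply.
  by rewrite expRB expRM_natl lnK ?posrE.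
have h3 : \prod_(k < j) (j + n.+1 - k)%:R = ('C(j + n.+1, j) * j`!)%:R :> R.
  by rewrite bin_ffact ffact_prod natr_prod.
rewrite big_split/= h3 in h1.
apply: (@le_trans _ _ (('C(j + n.+1, j) * j`!)%:R * (expR (t * b) * (sin t ^+ j)^-1) * (A * expR (- (th * b))))).
  apply: ler_pM => //; last exact: decay.
  - by apply: prodr_ge0 => k _; exact: norm2_ge0.
  - exact: MN_ge0.
  - by apply: (le_trans h1); rewrite ler_wpM2l.
rewrite le_eqVlt; apply/orP; left; apply/eqP.
have -> : expR (- ((th - t) * b)) = expR (t * b) * expR (- (th * b)) by rewrite -expRD; congr expR; ring.
move: (expR _) (expR _) (_%:R) (_^-1) => x1 x2 x3 x4; ring.
Qed.

(** Integration in b leaves 1 / (th - t), the factorial cancels the one in [w], and the binomial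
    coefficient costs (1 + d) ^ j, with d as small as desired. *)
Lemma w_bound (f : R -> R) (t d : R) : (forall x, 0 < x -> f x = nu x) ->
  0 < t < pi / 2 -> t < th -> 0 < d ->
  forall j y, 0 < y -> y ^+ n.+1 * `|w f j y| <=
    A / (pi * (th - t)) * ((1 + d) ^+ j * (1 + d^-1) ^+ n.+1) * (sin t ^+ j)^-1.
Proof.
move=> fnu ht tth d0 j y y0; have ms := @stp_meas R.
have st0 : 0 < sin t by apply: sin_gt0_pihalf.
have tt0 : 0 < th - t by rewrite subr_gt0.
have pi0 := @pi_gt0 R; have y1 : 0 < y ^+ n.+1 by rewrite exprn_gt0.
have jf : 0 < j`!%:R :> R by rewrite ltr0n fact_gt0.
rewrite /w (derive1n_pow_dens fnu (leqnn j) y0) /Wd subnn expr0.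
rewrite !normrM !normfV normr1 (gtr0_norm pi0) (gtr0_norm jf) (gtr0_norm y1).
rewrite (_ : y ^+ n.+1 * _ = pi^-1 * `|GG j j (ln y)| / j`!%:R); last first.
  move: (lt0r_neq0 pi0) (lt0r_neq0 y1) (lt0r_neq0 jf).
  move: (`|GG _ _ _|) (y ^+ n.+1) (pi : R) (j`!%:R) => g a1 a2 a3 e1 e2 e3.
  by field; rewrite e1 e2 e3.
have [iE IE1] := half_exp tt0.
have hG : `|GG j j (ln y)| <= ('C(j + n.+1, j) * j`!)%:R * (sin t ^+ j)^-1 * A * (th - t)^-1.
  apply: (@le_trans _ _ (I (fun b => (('C(j + n.+1, j) * j`!)%:R * (sin t ^+ j)^-1 * A) * (st b * expR (- ((th - t) * b)))))).
    rewrite /GG; apply: I_norm_le.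
    - exact: itg_meas (GG_itg _ (leqnn j)).
    - exact: itgZ.
    - move=> b; have [b0|b0] := leP b 0; first by rewrite (stp0 b0) !mul0r normr0 mulr0.
      rewrite (stp1 b0) !mul1r (le_trans (rot_le _ _ _))//.
      by rewrite -mulrA; exact: ABn_le.
  rewrite I_Z// ler_wpM2l// !mulr_ge0// ?invr_ge0 ?exprn_ge0 ?(ltW A0) ?(ltW st0)//.
apply: (@le_trans _ _ (pi^-1 * (('C(j + n.+1, j) * j`!)%:R * (sin t ^+ j)^-1 * A * (th - t)^-1) / j`!%:R)).
  by rewrite ler_pM2r ?invr_gt0// ler_pM2l ?invr_gt0.
rewrite natrM (_ : pi^-1 * _ / _ = A / (pi * (th - t)) * ('C(j + n.+1, j))%:R * (sin t ^+ j)^-1); last first.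
  have s1 : 0 < sin t ^+ j by rewrite exprn_gt0.
  move: (lt0r_neq0 pi0) (lt0r_neq0 tt0) (lt0r_neq0 jf) (lt0r_neq0 s1).
  move: (th - t) ('C(_, _)%:R) (pi : R) (j`!%:R) (sin t ^+ j) => g a1 a2 a3 a4 e1 e2 e3 e4.
  by field; rewrite e1 e2 e3 e4.
rewrite ler_wpM2r ?invr_ge0 ?exprn_ge0 ?(ltW st0)// ler_wpM2l ?bin_le//.
by rewrite divr_ge0 ?mulr_ge0 ?ltW.
Qed.

End CoEigen.

(** * The nonlocal equation and its maximum principle *)

Lemma norm2_meas (R : realType) (f g : R -> R) : measurable_fun setT f -> measurable_fun setT g ->
  measurable_fun setT (fun x => norm2 (f x) (g x)).
Proof. by move=> mf mg; under eq_fun do rewrite norm2E; meas. Qed.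

Section Transform.
Variables (R : realType) (p : levy R).
Local Notation st := (@stp R).
Local Notation q := (lq p).
Variables Z1 Z2 : R -> R.
Hypotheses (mZ1 : measurable_fun setT Z1) (mZ2 : measurable_fun setT Z2).
Hypothesis iZ : itg (fun b => st b * ((1 + b) * norm2 (Z1 b) (Z2 b))).

Definition trans l := I (fun b => st b * (Z1 b * cos (b * l) + Z2 b * sin (b * l))).
Definition dtrans l := I (fun b => st b * (b * Z2 b * cos (b * l) + - (b * Z1 b) * sin (b * l))).

Lemma trans_itg l : itg (fun b => st b * (Z1 b * cos (b * l) + Z2 b * sin (b * l))).
Proof.
have ms := @stp_meas R; apply: (itg_dom _ iZ); first by meas.
move=> b; have [b0|b0] := leP b 0; first by rewrite (stp0 b0) !mul0r normr0.
rewrite (stp1 b0) !mul1r (le_trans (rot_le _ _ _))// ler_peMl ?norm2_ge0// lerDl ltW//.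
Qed.

Lemma dtrans_dom l b :
  `|st b * (b * Z2 b * cos (b * l) + - (b * Z1 b) * sin (b * l))| <=
  st b * ((1 + b) * norm2 (Z1 b) (Z2 b)).
Proof.
have [b0|b0] := leP b 0; first by rewrite (stp0 b0) !mul0r normr0.
rewrite (stp1 b0) !mul1r (le_trans (rot_le _ _ _))//.
rewrite norm2N norm2Z (gtr0_norm b0) !norm2E addrC.
by rewrite ler_wpM2r ?sqrtr_ge0// lerDr.
Qed.

Lemma dtrans_itg l : itg (fun b => st b * (b * Z2 b * cos (b * l) + - (b * Z1 b) * sin (b * l))).
Proof.
by have ms := @stp_meas R; apply: (itg_dom _ iZ); [meas|exact: dtrans_dom].
Qed.

Lemma hasd_trans l : hasd trans l (dtrans l).
Proof.
apply: (@hasd_I R (fun l b => st b * (Z1 b * cos (b * l) + Z2 b * sin (b * l)))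
  (fun l b => st b * (b * Z2 b * cos (b * l) + - (b * Z1 b) * sin (b * l)))
  (fun b => st b * ((1 + b) * norm2 (Z1 b) (Z2 b)))).
- exact: trans_itg.
- by move=> x b; apply: hasd_eq; [der|rewrite /=; ring].
- exact: iZ.
- exact: dtrans_dom.
Qed.

(** The integrand in (b, v) of the transform after its argument is multiplied by the jump part of
    phi (1 + i b), before integrating in either variable. *)
Definition levyF l (z : R * R) :=
  st z.1 * ((Z1 z.1 * cos (z.1 * l) + Z2 z.1 * sin (z.1 * l)) * ((1 - expR (- (1 * z.2)) * cos (z.1 * z.2)) * q z.2)
    + (Z1 z.1 * sin (z.1 * l) - Z2 z.1 * cos (z.1 * l)) * (expR (- (1 * z.2)) * sin (z.1 * z.2) * q z.2)).

Lemma levyF_meas l : measurable_fun setT (levyF l).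
Proof. by have ms := @stp_meas R; have mq := lq_meas p; rewrite /levyF; meas. Qed.

Lemma levyF_dom l b v : `|levyF l (b, v)| <=
  st b * ((1 + b) * norm2 (Z1 b) (Z2 b)) * (6 * (Num.min v 1 * q v)).
Proof.
rewrite /levyF /=; have [b0|b0] := leP b 0; first by rewrite (stp0 b0) !mul0r normr0.
rewrite (stp1 b0) !mul1r; have [v0|v0] := leP v 0.
  by rewrite (lq_eq0 p v0) !(mulr0, addr0) normr0.
have q0 := lq_ge0 p v.
have h1 := one_sub_cexp_bound b (@ler01 R) v0; have h2 := expR_sin_le b (@ler01 R) v0.
move: h1 h2; rewrite (gtr0_norm b0) mul1r; move: (1 - _) (_ * sin (b * v)) => C S h1 h2.
have r1 := rot_le (Z1 b) (Z2 b) (b * l).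
have r2 := rot_le (- Z2 b) (Z1 b) (b * l).
rewrite (_ : norm2 (- Z2 b) (Z1 b) = norm2 (Z1 b) (Z2 b)) in r2; last by rewrite !norm2E sqrrN addrC.
set N := norm2 _ _ in r1 r2 *; set mi := Num.min v 1 in h1 h2 *.
have mi0 : 0 <= mi by rewrite le_min ler01 ltW.
have N0 : 0 <= N by exact: norm2_ge0.
rewrite (_ : _ + _ = ((Z1 b * cos (b * l) + Z2 b * sin (b * l)) * C +
    (- Z2 b * cos (b * l) + Z1 b * sin (b * l)) * S) * q v); last by ring.
rewrite normrM (ger0_norm q0) (_ : (1 + b) * N * (6 * (mi * q v)) = (1 + b) * N * 6 * mi * q v); last by ring.
apply: ler_wpM2r => //; apply: (le_trans (ler_normD _ _)); rewrite !normrM.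
have k1 : `|Z1 b * cos (b * l) + Z2 b * sin (b * l)| * `|C| <= N * ((3 + 1 + 2 * b) * mi) by apply: ler_pM.
have k2 : `|- Z2 b * cos (b * l) + Z1 b * sin (b * l)| * `|S| <= N * ((1 + b) * mi) by apply: ler_pM.
apply: (le_trans (lerD k1 k2)).
have : 0 <= N * mi by exact: mulr_ge0.
have : 0 <= N * mi * b by apply: mulr_ge0; [exact: mulr_ge0|exact: ltW].
by nra.
Qed.

Lemma levyF_inner l b : 0 < b -> itg (fun v => levyF l (b, v)) /\
  st b * ((phiR p 1 b * Z1 b - phiI p 1 b * Z2 b) * cos (b * l)
   + (phiR p 1 b * Z2 b + phiI p 1 b * Z1 b) * sin (b * l)) =
  lm p * (st b * (Z1 b * cos (b * l) + Z2 b * sin (b * l)))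
  + ls p * (st b * (Z1 b * cos (b * l) + Z2 b * sin (b * l))
            - st b * (b * Z2 b * cos (b * l) + - (b * Z1 b) * sin (b * l)))
  + I (fun v => levyF l (b, v)).
Proof.
move=> b0; rewrite /levyF /= (stp1 b0).
have i1 := itg_re p b (@ler01 R); have i2 := itg_im p b (@ler01 R).
split.
  by apply: itgZ; apply: itgD; apply: itgZ.
rewrite phiRE phiIE I_Z; last by apply: itgD; apply: itgZ.
rewrite I_D; [|exact: itgZ|exact: itgZ]; rewrite I_Z// I_Z//.
move: (I _) (I _) => u v; ring.
Qed.

Lemma trans_levy l :
  itg (fun v => (trans l - expR (- v) * trans (l + v)) * q v) /\
  I (fun b => st b * ((phiR p 1 b * Z1 b - phiI p 1 b * Z2 b) * cos (b * l)
   + (phiR p 1 b * Z2 b + phiI p 1 b * Z1 b) * sin (b * l))) =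
  lm p * trans l + ls p * (trans l - dtrans l)
  + I (fun v => (trans l - expR (- v) * trans (l + v)) * q v).
Proof.
have mF := levyF_meas l.
have ia := itg_minq p 6.
have iv v : itg (fun b => levyF l (b, v)).
  apply: (itg_dom _ (itgZ (6 * (Num.min v 1 * q v)) iZ)).
    by have ms := @stp_meas R; rewrite /levyF/=; meas.
  by move=> b; apply: (le_trans (levyF_dom l b v)); rewrite mulrC.
have ib b : itg (fun v => levyF l (b, v)).
  have [b0|b0] := leP b 0; last exact: (levyF_inner l b0).1.
  by apply: itg_eq (itg0 R) => v; rewrite /levyF /= (stp0 b0) mul0r.
have Fv v : I (fun b => levyF l (b, v)) = (trans l - expR (- v) * trans (l + v)) * q v.
  rewrite /trans [RHS]mulrC -[X in _ * (_ - X)]I_Z; last exact: trans_itg.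
  rewrite -I_B; [|exact: trans_itg|by apply: itgZ; exact: trans_itg].
  rewrite -I_Z; last by apply: itgB; [exact: trans_itg|apply: itgZ; exact: trans_itg].
  by apply: I_eq => b; rewrite /levyF /= (mulrDr b l v) cosD sinD mul1r; ring.
have mF' : measurable_fun setT (fun z : R * R => levyF l (z.2, z.1)).
  by apply: (measurableT_comp mF); exact: (measurable_fun_pair measurable_snd measurable_fst).
have iI : itg (fun v => (trans l - expR (- v) * trans (l + v)) * q v).
  apply: (@itg_eq _ (fun v => I (fun b => levyF l (b, v)))); first exact: Fv.
  apply: (itg_dom _ (itgZ (I (fun b => st b * ((1 + b) * norm2 (Z1 b) (Z2 b)))) ia)).
    exact: (@I_fubini_meas R (fun z => levyF l (z.2, z.1))).
  move=> v; rewrite mulrC -I_Z//; apply: I_norm_le; [exact: itg_meas (iv v)|exact: itgZ|].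
  by move=> b; rewrite [leRHS]mulrC; exact: levyF_dom.
split => //.
have iF : itg (fun b => I (fun v => levyF l (b, v))).
  apply: (itg_dom _ (itgZ (I (fun v => 6 * (Num.min v 1 * q v))) iZ)).
    exact: (@I_fubini_meas R (levyF l)).
  move=> b; rewrite mulrC -I_Z//; apply: I_norm_le; [exact: itg_meas (ib b)|exact: itgZ|].
  by move=> v; exact: levyF_dom.
rewrite -(I_eq Fv) -(I_fubini mF iZ ia (levyF_dom l)) /trans /dtrans.
have it := trans_itg l; have idt := dtrans_itg l.
rewrite -I_B// -I_Z//; rewrite -[X in _ + X + _]I_Z; last exact: itgB.
rewrite -I_D; [|exact: itgZ|by apply: itgZ; exact: itgB].
rewrite -I_D//; last by apply: itgD; apply: itgZ => //; exact: itgB.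
apply: I_eq => b; have [b0|b0] := leP b 0; last exact: (levyF_inner l b0).2.
rewrite (I_eq (g := fun=> 0)); last by move=> v; rewrite /levyF /= (stp0 b0) mul0r.
by rewrite I0 (stp0 b0) !(mul0r, mulr0, subr0, addr0).
Qed.

(** The factor 1 / y absorbs exp (- v), so that translations of ln y become plain differences H y -
    H (y exp v). *)
Lemma scaled_trans_levy c : exists D' : R -> R,
  let H y := c * (y^-1 * trans (ln y)) in
  forall y, 0 < y -> [/\ hasd H y (D' y),
    itg (fun v => (H y - H (y * expR v)) * q v) &
    c * (y^-1 * I (fun b => st b * ((phiR p 1 b * Z1 b - phiI p 1 b * Z2 b) * cos (b * ln y)
      + (phiR p 1 b * Z2 b + phiI p 1 b * Z1 b) * sin (b * ln y)))) =
    lm p * H y - ls p * (y * D' y) + I (fun v => (H y - H (y * expR v)) * q v)].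
Proof.
exists (fun y => c * (y^-1 * (y^-1 * dtrans (ln y)) - y^-1 * (y^-1 * trans (ln y)))) => H y y0.
have yn := lt0r_neq0 y0.
have [i1 e1] := trans_levy (ln y).
have Hv v : (H y - H (y * expR v)) * q v =
   c * y^-1 * ((trans (ln y) - expR (- v) * trans (ln y + v)) * q v).
  rewrite /H lnM ?posrE ?expR_gt0// expRK expRN; have en : expR v != 0 by rewrite lt0r_neq0 ?expR_gt0.
  rewrite invfM; ring.
split.
- have h1 : hasd (fun y => y^-1) y (- y ^- 2 * 1) by apply: der_inv yn _; exact: der_id.
  have h2 := der_comp (hasd_trans (ln y)) (is_derive1_ln y0).
  apply: (hasd_eq (der_mul (der_cst c y) (der_mul h1 h2))) => /=.
  by move: (trans _) (dtrans _) => u v; field.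
- by apply: itg_eq (itgZ (c * y^-1) i1) => v; rewrite Hv.
- have fld (u v w : R) : c * (y^-1 * (lm p * v + ls p * (v - w) + u)) = lm p * (c * (y^-1 * v))
      - ls p * (y * (c * (y^-1 * (y^-1 * w) - y^-1 * (y^-1 * v)))) + c * y^-1 * u by field.
  by rewrite (I_eq Hv) I_Z// e1; exact: fld.
Qed.

End Transform.

Section CoEigenEquation.
Variables (R : realType) (p : levy R) (L : law p).
Local Notation nu := (dens L).
Local Notation st := (@stp R).
Local Notation q := (lq p).
Implicit Types (b y : R).

(** [kap] depends only on j - d - n, so both products share all their factors but the first one, j -
    i b. *)
Lemma AB_shift0 j d b : AB L 0 j.+1 d.+1 b =
  (j%:R * (AB L 0 j d b).1 + b * (AB L 0 j d b).2, j%:R * (AB L 0 j d b).2 - b * (AB L 0 j d b).1).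
Proof.
have k0 i d' : kap R 0 i.+1 d'.+1 = kap R 0 i d' by rewrite /kap -!natr1; ring.
elim: d => [|d IH] /=.
  by rewrite (_ : kap R 0 j.+1 0 = j%:R)// /kap -!natr1; ring.
by rewrite k0 [X in (X, _)](_ : _ = kap R 0 j d * (AB L 0 j.+1 d.+1 b).1 + b * (AB L 0 j.+1 d.+1 b).2)//
  [X in (_, X)](_ : _ = kap R 0 j d * (AB L 0 j.+1 d.+1 b).2 - b * (AB L 0 j.+1 d.+1 b).1)// IH /=;
  congr (_, _); ring.
Qed.

(** Raising n and j together leaves [kap] unchanged; what differs is the Mellin transform at
    abscissa 2 instead of 1, that is a factor phi (1 + i b). *)
Lemma AB_shift1 j d b : AB L 1 j.+1 d b =
  (phiR p 1 b * (AB L 0 j d b).1 - phiI p 1 b * (AB L 0 j d b).2,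
   phiR p 1 b * (AB L 0 j d b).2 + phiI p 1 b * (AB L 0 j d b).1).
Proof.
have k0 d' : kap R 1 j.+1 d' = kap R 0 j d' by rewrite /kap -!natr1; ring.
elim: d => [|d IH] /=; first by rewrite Mc_rec Ms_rec.
by rewrite IH k0 /=; congr (_, _); ring.
Qed.

(* The equation satisfied by [wdiff] reads [x w_j = A (w_j - w_(j-1))] with [A] nonlocal:
   it is obtained by Mellin inversion from the recursion for [Mc] and [Ms]. *)
Definition wdiff (f : R -> R) j y := w f j y - (if j is i.+1 then w f i y else 0).

Lemma hasd_near (f g : R -> R) y d : (forall x, 0 < x -> f x = g x) -> 0 < y ->
  hasd g y d -> hasd f y d.
Proof.
move=> fg y0 h; apply: (near_eq_is_derive _ h); near=> z; rewrite fg//.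
by near: z; exact: lt_nbhsr.
Unshelve. all: by end_near.
Qed.

Variables (A0 th0 A1 th1 : R).
Hypotheses (A00 : 0 < A0) (th00 : 0 < th0) (A10 : 0 < A1) (th10 : 0 < th1).
Hypothesis decay0 : forall b, 0 < b -> MN L 0 b <= A0 * expR (- (th0 * b)).
Hypothesis decay1 : forall b, 0 < b -> MN L 1 b <= A1 * expR (- (th1 * b)).
Variable f : R -> R.
Hypothesis fnu : forall x, 0 < x -> f x = nu x.

Lemma w_trans0 j y : 0 < y -> w f j y = (j`!%:R * pi)^-1 * (y^-1 * GG L 0 j j (ln y)).
Proof.
move=> y0; rewrite /w (derive1n_pow_dens A00 th00 decay0 fnu (leqnn j) y0) /Wd subnn expr0 expr1.
rewrite invfM; move: (GG _ _ _ _ _) (pi^-1) (_%:R^-1) (y^-1) => a b c d; ring.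
Qed.

Lemma w_trans1 j y : 0 < y -> y * w f j y = (j`!%:R * pi)^-1 * (y^-1 * GG L 1 j j (ln y)).
Proof.
move=> y0; rewrite /w (derive1n_pow_dens A10 th10 decay1 fnu (leqnn j) y0) /Wd subnn expr0.
rewrite exprS expr1 !invfM; have e : y * y^-1 = 1 by rewrite mulfV// lt0r_neq0.
move: (GG _ _ _ _ _) (pi^-1) (_%:R^-1) (y^-1) e => a b c d e.
transitivity ((y * d) * (b * (d * a) * c)); first by ring.
by rewrite e; ring.
Qed.

Lemma coeigen_equation j : exists D' : R -> R, forall y, 0 < y ->
  [/\ hasd (wdiff f j) y (D' y),
      itg (fun v => (wdiff f j y - wdiff f j (y * expR v)) * q v) &
      y * w f j y = lm p * wdiff f j y - ls p * (y * D' y)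
        + I (fun v => (wdiff f j y - wdiff f j (y * expR v)) * q v)].
Proof.
(* On the Mellin side w_(i+1) has the factor (i - i b) / (i + 1)! relative to [AB L 0 i i] by
   [AB_shift0], and w_i has (i + 1) / (i + 1)!. Their difference has the factor - 1 - i b, which is
   also the last factor of x w_(i+1) on the line of abscissa 2. *)
pose Z b : R * R := if j is i.+1 then (- (AB L 0 i i b).1 + b * (AB L 0 i i b).2,
  - (AB L 0 i i b).2 - b * (AB L 0 i i b).1) else AB L 0 0 0 b.
pose c : R := (j`!%:R * pi)^-1.
have mZ : measurable_fun setT (fun b => (Z b).1) /\ measurable_fun setT (fun b => (Z b).2).
  rewrite /Z; case: (j) => [|i]; first exact: AB_meas.
  by have [h1 h2] := AB_meas L 0 i i; split => /=; meas.
have iZ : itg (fun b => st b * ((1 + b) * norm2 (Z b).1 (Z b).2)).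
  have [mZ1 mZ2] := mZ; have ms := @stp_meas R.
  have mN := norm2_meas mZ1 mZ2.
  have mS : measurable_fun setT (fun b => st b * ((1 + b) * norm2 (Z b).1 (Z b).2)).
    by apply: measurable_funM => //; apply: measurable_funM => //; meas.
  rewrite /Z in mS *; case: (j) mS => [|i] mS; first exact: (ABn_itg A00 th00 decay0 (leqnn 0)).
  apply: (itg_dom mS (ABn_itgX A00 th00 decay0 2 (leqnn i))).
  move=> b; have [b0|b0] := leP b 0; first by rewrite (stp0 b0) !mul0r normr0.
  have b1 : 0 <= 1 + b := addr_ge0 ler01 (ltW b0).
  rewrite (stp1 b0) !mul1r ger0_norm; last by apply: mulr_ge0 => //; exact: norm2_ge0.
  rewrite expr2 -mulrA; apply: ler_wpM2l => //=.
  have -> : norm2 (- (AB L 0 i i b).1 + b * (AB L 0 i i b).2) (- (AB L 0 i i b).2 - b * (AB L 0 i i b).1)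
     = norm2 (-1) (- b) * norm2 (AB L 0 i i b).1 (AB L 0 i i b).2.
    by rewrite -norm2M; congr norm2; ring.
  apply: ler_wpM2r; first exact: norm2_ge0.
  rewrite norm2N -[X in norm2 X](addr0 (-1)) -[X in norm2 _ X](add0r b).
  apply: (le_trans (norm2D _ _ _ _)); rewrite norm2_l0 normrN1 lerD2l.
  by rewrite norm2E expr0n /= add0r sqrtr_sqr gtr0_norm.
have [mZ1 mZ2] := mZ.
have [D' hD] := scaled_trans_levy p mZ1 mZ2 iZ c.
have wH y : 0 < y -> wdiff f j y = c * (y^-1 * trans (fun b => (Z b).1) (fun b => (Z b).2) (ln y)).
  move=> y0; rewrite /wdiff w_trans0// -/c.
  rewrite /trans /Z /c; case: (j) => [|i]; first by rewrite subr0.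
  rewrite w_trans0// factS natrM.
  have -> : I (fun b => st b * ((- (AB L 0 i i b).1 + b * (AB L 0 i i b).2) * cos (b * ln y)
      + (- (AB L 0 i i b).2 - b * (AB L 0 i i b).1) * sin (b * ln y))) =
     GG L 0 i.+1 i.+1 (ln y) - i.+1%:R * GG L 0 i i (ln y).
    rewrite /GG -I_Z; last exact: (GG_itg A00 th00 decay0).
    rewrite -I_B; [|exact: (GG_itg A00 th00 decay0)|by apply: itgZ; exact: (GG_itg A00 th00 decay0)].
    by apply: I_eq => b; rewrite AB_shift0 /= -natr1; ring.
  move: (GG _ _ _ _ _) (GG _ _ _ _ _) => a1 a2; rewrite !invfM.
  have e : (i.+1%:R : R) != 0 by [].
  move: (i.+1%:R : R) e (pi^-1 : R) (i`!%:R^-1 : R) (y^-1 : R) => b2 e b3 b4 b5.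
  by field.
exists D' => y y0; have [h1 h2 h3] := hD y y0.
have eqI v : (wdiff f j y - wdiff f j (y * expR v)) * q v =
  (c * (y^-1 * trans (fun b => (Z b).1) (fun b => (Z b).2) (ln y)) -
   c * ((y * expR v)^-1 * trans (fun b => (Z b).1) (fun b => (Z b).2) (ln (y * expR v)))) * q v.
  by rewrite !wH// mulr_gt0// expR_gt0.
split.
- exact: hasd_near wH y0 h1.
- by apply: itg_eq h2 => v; rewrite eqI.
- rewrite (I_eq eqI) wH// -h3 w_trans1// -/c /GG; congr (c * (y^-1 * _)).
  apply: I_eq => b; rewrite /Z; case: (j) => [|i] /=.
    by rewrite Mc_rec Ms_rec.
  rewrite !AB_shift1 /= (_ : kap R 1 i.+1 i = -1); last by rewrite /kap -!natr1; ring.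
  by ring.
Qed.

End CoEigenEquation.

Section MaxPrinciple.
Variable R : realType.

Lemma powR_antitone (c x y : R) : 0 < x -> x <= y -> c <= 0 -> y `^ c <= x `^ c.
Proof.
move=> x0 xy c0; have y0 : 0 < y by exact: lt_le_trans xy.
rewrite -[c]opprK (powRN y) (powRN x) lef_pV2 ?posrE ?powR_gt0//.
by apply: ge0_ler_powR; rewrite ?nnegrE ?oppr_ge0// ltW.
Qed.

(** Either t is a maximum point, or some value exceeds g t and the decay at infinity confines the
    search to a compact interval. *)
Lemma attain_max (g : R -> R) (t B : R) : 0 < t -> (forall x, 0 < x -> {for x, continuous g}) ->
  (forall x, 0 < x -> 0 <= g x) -> (forall y, 1 <= y -> g y <= B / y) ->
  exists2 z, t <= z & forall y, t <= y -> g y <= g z.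
Proof.
move=> t0 gc g0 gB.
case: (pselect (forall y, t <= y -> g y <= g t)) => [h|/existsNP[y1 /not_implyP[ty1 /negP]]].
  by exists t.
rewrite -ltNge => gy1.
have gp : 0 < g y1 by apply: le_lt_trans gy1; exact: g0.
pose X := Num.max y1 (Num.max 1 (B / g y1)).
have Xy : y1 <= X by rewrite le_max lexx.
have X1 : 1 <= X by rewrite !le_max lexx orbT.
have XB : B / g y1 <= X by rewrite !le_max lexx !orbT.
have tX : t <= X by exact: le_trans Xy.
have X0 : 0 < X by exact: lt_le_trans X1.
have [|z /[!in_itv]/= /andP[tz zX] hz] := EVT_max (f := g) tX.
  apply: continuous_in_subspaceT => x /set_mem/=; rewrite in_itv/= => /andP[tx _].
  by apply: gc; exact: lt_le_trans tx.
have hy1 : g y1 <= g z by apply: hz; rewrite in_itv/= ty1.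
exists z => // y ty; have [yX|yX] := leP y X; first by apply: hz; rewrite in_itv/= ty.
apply: le_trans hy1; have y0 : 0 < y by exact: lt_trans yX.
apply: (le_trans (gB _ (le_trans X1 (ltW yX)))).
by rewrite ler_pdivrMr// mulrC -ler_pdivrMr// (le_trans XB)// ltW.
Qed.

Lemma der_right_max_le0 (h : R -> R) z d : hasd h z d -> (forall y, z <= y -> h y <= h z) -> d <= 0.
Proof.
move=> [hd <-] hm.
have c : (fun e : R => e^-1 *: (h (e *: 1 + z) - h z)) @ 0^'+ --> 'D_1 h z.
  exact: (cvg_dnbhs_at_right hd).
have -> : 'D_1 h z = lim ((fun e : R => e^-1 *: (h (e *: 1 + z) - h z)) @ 0^'+) by apply/esym/cvg_lim.
apply: limr_le; first by apply/cvg_ex; exists ('D_1 h z).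
near=> e; have e0 : 0 < e by near: e; exact: nbhs_right_gt.
rewrite /GRing.scale/= mulr1 pmulr_rle0 ?invr_gt0// subr_le0; apply: hm.
by rewrite lerDr ltW.
Unshelve. all: by end_near.
Qed.

Variable p : levy R.
Local Notation q := (lq p).

(* At a maximum of [y `^ u * D y] the jumps of [D] are at most those of
   [y `^ - u], on which the operator acts as [ph p u]. *)
Lemma max_point (D dD W : R -> R) u z : 0 < z -> hasd D z (dD z) ->
  itg (fun v => (D z - D (z * expR v)) * q v) ->
  z * W z = lm p * D z - ls p * (z * dD z) + I (fun v => (D z - D (z * expR v)) * q v) ->
  itg (fun y => (1 - expR (- (u * y))) * q y) ->
  (forall y, z <= y -> y `^ u * D y <= z `^ u * D z) ->
  ph p u * D z <= z * W z.
Proof.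
move=> z0 hD iD -> iu hm.
have zu : 0 < z `^ u by rewrite powR_gt0.
have hE v : 0 < v -> D (z * expR v) <= D z * expR (- (u * v)).
  move=> v0; have e1 : 1 <= expR v by rewrite -[X in X <= _]expR0 ler_expR ltW.
  have := hm (z * expR v); rewrite ler_peMr// => [/(_ isT)|]; last exact: ltW.
  rewrite powRM ?expR_ge0 ?(ltW z0)// -mulrA ler_pM2l// -expRM mulrC (mulrC v).
  by rewrite expRN ler_pdivlMr ?expR_gt0.
have hd : z * dD z <= - (u * D z).
  have h1 := der_mul (der_powR u z0 (der_id z)) hD.
  have := der_right_max_le0 h1 hm; rewrite powRB; last by rewrite (gt_eqF z0) implybT.
  rewrite powRr1; last exact: ltW.
  have -> : z `^ u * dD z + D z * (u * (z `^ u / z) * 1) = z `^ u / z * (z * dD z + u * D z).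
    by field; rewrite lt0r_neq0.
  by rewrite pmulr_rle0 ?divr_gt0//; lra.
rewrite phE mulrDl mulrDl; apply: lerD.
  rewrite lerD2l -mulrA -mulrN; apply: ler_wpM2l; first exact: ls_ge0.
  by rewrite lerNr.
rewrite mulrC -I_Z//; apply: I_le => //; first exact: itgZ.
move=> v; rewrite mulrA; have [v0|v0] := leP v 0; first by rewrite (lq_eq0 p v0) !mulr0.
by apply: ler_wpM2r; [exact: lq_ge0|have := hE v v0; lra].
Qed.

(** All jumps go to the right, so a maximum over [t, oo) suffices, for any t > 0 and whatever
    happens near the origin. [max_point] is applied to D or to - D according to the sign at the
    maximum. *)
Lemma max_principle (D dD W : R -> R) (u t B : R) : 0 < t ->
  (forall y, 0 < y -> [/\ hasd D y (dD y),
      itg (fun v => (D y - D (y * expR v)) * q v) &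
      y * W y = lm p * D y - ls p * (y * dD y) + I (fun v => (D y - D (y * expR v)) * q v)]) ->
  itg (fun y => (1 - expR (- (u * y))) * q y) ->
  (forall y, 1 <= y -> y `^ u * `|D y| <= B / y) ->
  exists z, [/\ t <= z, (forall y, t <= y -> y `^ u * `|D y| <= z `^ u * `|D z|) &
    ph p u * `|D z| <= z * `|W z| ].
Proof.
move=> t0 hD iu hB.
have [||z tz hz] := @attain_max (fun y => y `^ u * `|D y|) t B t0 _ _ hB.
- move=> x x0; have [h1 _ _] := hD x x0.
  have c1 : {for x, continuous (fun y => y `^ u)} by apply: der_cont; eexists; exact: der_powR u x0 (der_id x).
  have c2 : {for x, continuous (fun y => `|D y|)}.
    by apply: continuous_comp; [exact: der_continuous h1|exact: norm_continuous].
  exact: cvgM c1 c2.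
- by move=> x x0; rewrite mulr_ge0 ?powR_ge0.
have z0 := lt_le_trans t0 tz; have [h1 h2 h3] := hD z z0.
exists z; split => //.
have [Dz|Dz] := leP 0 (D z).
  rewrite ger0_norm//; have h : ph p u * D z <= z * W z.
    apply: max_point z0 h1 h2 h3 iu _ => y zy.
    rewrite -[X in _ <= _ * X]ger0_norm//; apply: le_trans (hz _ (le_trans tz zy)).
    by rewrite ler_wpM2l ?powR_ge0// ler_norm.
  by apply: (le_trans h); rewrite ler_pM2l// ler_norm.
rewrite ltr0_norm//; have h : ph p u * (- D z) <= z * (- W z).
  have e v : ((- D z) - (- D (z * expR v))) * q v = - 1 * ((D z - D (z * expR v)) * q v) by ring.
  apply: (@max_point (fun y => - D y) (fun y => - dD y) (fun y => - W y)) => //.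
  - exact: der_opp.
  - by apply: itg_eq (itgZ (-1) h2) => v; rewrite e.
  - by rewrite (I_eq e) I_Z// mulrN h3; move: (I _) => ?; ring.
  move=> y zy; rewrite -(ltr0_norm Dz); apply: le_trans (hz _ (le_trans tz zy)).
  by rewrite ler_wpM2l ?powR_ge0// -normrN ler_norm.
by apply: (le_trans h); rewrite ler_pM2l// -normrN ler_norm.
Qed.

End MaxPrinciple.

(** (1 + d) / sin t is the growth per step in [w_bound]. By continuity of the sine some t < th is
    still admissible for T, and d is adjusted to reach equality. *)
Lemma choose_rate (R : realType) (th T : R) : 0 < th -> th <= pi / 2 -> - ln (sin th) < T ->
  exists t d, [/\ 0 < t < th, 0 < d & (1 + d) / sin t = expR T].
Proof.
move=> th0 thpi hT.
have sth : 0 < sin th.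
  apply: sin_gt0_pi; rewrite th0/=.
  by apply: le_lt_trans thpi _; rewrite ltr_pdivrMr// ltr_pMr ?pi_gt0// ltr1n.
have eT : expR (- T) < sin th by rewrite -ltr_ln ?posrE ?expR_gt0// expRK ltrNl.
have [t /andP[t0 tth] st] : exists2 t, 0 < t < th & expR (- T) < sin t.
  have c := @continuous_sin R th; have s0 : 0 < sin th - expR (- T) by rewrite subr_gt0.
  move: c => /cvgrPdist_lt /(_ _ s0) /nbhs_ballP[r /= r0 hr].
  pose t := th - Num.min (r / 2) (th / 2).
  have m0 : 0 < Num.min (r / 2) (th / 2) by rewrite lt_min !divr_gt0.
  have m1 : Num.min (r / 2) (th / 2) <= r / 2 by rewrite ge_min lexx.
  have m2 : Num.min (r / 2) (th / 2) <= th / 2 by rewrite ge_min lexx orbT.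
  exists t; first by rewrite /t; apply/andP; split; lra.
  have : `|sin th - sin t| < sin th - expR (- T).
    by apply: hr; rewrite /ball/= /t opprB addrC subrK gtr0_norm//; lra.
  by move=> /ltr_normlW; lra.
have st0 : 0 < sin t by apply: lt_trans st; exact: expR_gt0.
exists t, (expR T * sin t - 1); split; first by rewrite t0.
- by rewrite subr_gt0 mulrC -ltr_pdivrMr ?expR_gt0// div1r -expRN.
- by rewrite addrC subrK mulfK// gt_eqF.
Qed.

(** * Pointwise bounds at every exponent where [ph] is positive *)

Section PointwiseBound.
Variables (R : realType) (p : levy R) (L : law p) (f : R -> R).
Local Notation nu := (dens L).
Local Notation q := (lq p).
Hypothesis fnu : forall x, 0 < x -> f x = nu x.
Variable th : R.
Hypothesis th0 : 0 < th.
Hypothesis decay : forall n t, 0 < t -> t < th ->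
  exists2 A, 0 < A & forall b, 0 < b -> MN L n b <= A * expR (- (t * b)).

Lemma coeigen_equation_decay j : exists D' : R -> R, forall y, 0 < y ->
  [/\ hasd (wdiff f j) y (D' y),
      itg (fun v => (wdiff f j y - wdiff f j (y * expR v)) * q v) &
      y * w f j y = lm p * wdiff f j y - ls p * (y * D' y)
        + I (fun v => (wdiff f j y - wdiff f j (y * expR v)) * q v)].
Proof.
have t2 : 0 < th / 2 by rewrite divr_gt0.
have t3 : th / 2 < th by lra.
have [A0 A00 h0] := decay 0 t2 t3; have [A1 A10 h1] := decay 1 t2 t3.
exact: (coeigen_equation A00 t2 A10 t2 h0 h1 fnu).
Qed.

Lemma w_cont j x : 0 < x -> {for x, continuous (w f j)}.
Proof.
move=> x0; elim: j => [|j IH].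
  have [D' hD] := coeigen_equation_decay 0; have [h _ _] := hD x x0.
  have e : w f 0 = wdiff f 0 by apply/funext => y; rewrite /wdiff subr0.
  by rewrite e; exact: der_continuous h.
have [D' hD] := coeigen_equation_decay j.+1; have [h _ _] := hD x x0.
have e : w f j.+1 = (fun y => wdiff f j.+1 y + w f j y) by apply/funext => y; rewrite /wdiff subrK.
by rewrite e; apply: cvgD; [exact: der_continuous h|exact: IH].
Qed.

Variable T : R.
Hypothesis thpi : th <= pi / 2.
Hypothesis hT : - ln (sin th) < T.

Lemma w_bound_int N : exists2 C, 0 < C &
  forall j y, 0 < y -> y ^+ N.+1 * `|w f j y| <= C * expR (T * j%:R).
Proof.
have [t [d [/andP[t0 tth] d0 rd]]] := choose_rate th0 thpi hT.
have ht : 0 < t < pi / 2 by rewrite t0/=; exact: lt_le_trans tth thpi.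
have st0 : 0 < sin t := sin_gt0_pihalf ht.
pose t' : R := (t + th) / 2.
have t't : t < t' by rewrite /t'; lra.
have [A A0 hA] : exists2 A, 0 < A & forall b, 0 < b -> MN L N b <= A * expR (- (t' * b)).
  by apply: decay; rewrite /t'; lra.
have wb := w_bound A0 (lt_trans t0 t't) hA fnu ht t't d0.
exists (A / (pi * (t' - t)) * (1 + d^-1) ^+ N.+1).
  by rewrite mulr_gt0 ?divr_gt0 ?mulr_gt0 ?exprn_gt0 ?subr_gt0 ?pi_gt0// addr_gt0// invr_gt0.
move=> j y y0; apply: (le_trans (wb j y y0)).
rewrite [T * _]mulrC expRM_natl -rd expr_div_n le_eqVlt; apply/orP; left; apply/eqP.
move: (A / _) (_ ^+ N.+1) ((1 + d) ^+ j) ((sin t ^+ j)^-1) => a1 a2 a3 a4; ring.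
Qed.

(** Induction on j. The maximum of x ^ u |w_j| over [t, oo) is at most the bound for w_(j-1) plus
    the maximum for [wdiff]; at a maximum point x of the latter, the equation bounds it by x / phi u
    times the former, a contraction when x is small. For x away from 0 integral exponents are
    enough. *)
Theorem coeigen_bound (u : R) : itg (fun y => (1 - expR (- (u * y))) * q y) -> 0 < ph p u ->
  exists2 K, 0 < K & forall j y, 0 < y -> y `^ u * `|w f j y| <= K * expR (T * j%:R).
Proof.
move=> iu phu.
have T0 : 0 < T.
  have : ln (sin th) <= 0 by apply: ln_le0; exact: sin_le1.
  by move: hT; lra.
pose r : R := expR T; have r1 : 1 < r by rewrite /r expR_gt1.
have r0 : 0 < r by exact: lt_trans r1.
(* The induction hypothesis carries the factor 1 / r = 1 - 2 [kp], which leaves [kp] for the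
   contraction and [kp] for the bounds away from 0. *)
pose kp : R := (1 - r^-1) / 2.
have ri : r^-1 < 1 by rewrite invf_lt1.
have kp0 : 0 < kp by rewrite /kp divr_gt0 ?subr_gt0.
have rE j : expR (T * j%:R) = r ^+ j by rewrite mulrC expRM_natl.
(* For x <= [de] one has x / phi u <= [kp]. *)
pose de : R := Num.min 1 (kp * ph p u).
have de0 : 0 < de by rewrite lt_min ltr01 mulr_gt0.
have de1 : de <= 1 by rewrite ge_min lexx.
have de2 : de <= kp * ph p u by rewrite ge_min lexx orbT.
have [N uN] : exists N, u + 1 <= N.+1%:R.
  exists (Num.bound u).+1; have : u <= (Num.bound u)%:R.
    have [u0|u0] := leP 0 u; first by have := archi_boundP u0 => /ltW.
    by rewrite (le_trans (ltW u0)).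
  by rewrite -!natr1; lra.
have [C C0 hC] := w_bound_int N.
have big j y : 1 <= y -> y `^ u * `|w f j y| <= C * r ^+ j / y.
  move=> y1; have y0 : 0 < y by exact: lt_le_trans y1.
  rewrite ler_pdivlMr// -rE; apply: le_trans (hC j y y0).
  rewrite mulrAC ler_wpM2r// -[X in _ * X](powRr1 (ltW y0)) -powRD; last by rewrite (gt_eqF y0) implybT.
  by rewrite -powR_mulrn ?(ltW y0)//; apply: ler_powR.
pose B : R := C * de `^ (u - N.+1%:R).
have B0 : 0 < B by rewrite mulr_gt0 ?powR_gt0.
have med j y : de <= y -> y `^ u * `|w f j y| <= B * r ^+ j.
  move=> dy; have y0 : 0 < y by exact: lt_le_trans dy.
  have -> : y `^ u = y `^ (u - N.+1%:R) * y ^+ N.+1.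
    by rewrite -powR_mulrn ?(ltW y0)// -powRD ?subrK// (gt_eqF y0) implybT.
  rewrite -mulrA; apply: (@le_trans _ _ (de `^ (u - N.+1%:R) * (C * r ^+ j))).
    apply: ler_pM; rewrite ?powR_ge0 ?mulr_ge0 ?exprn_ge0 ?(ltW y0)//; last by rewrite -rE; exact: hC.
    by apply: powR_antitone => //; lra.
  by rewrite /B mulrA [de `^ _ * C]mulrC.
(* K = 2 B / [kp] solves K (1 - 2 [kp]) + 2 B = (1 - [kp]) K, which closes the induction. *)
exists (2 * B / kp); first by rewrite divr_gt0// mulr_gt0.
set K := 2 * B / kp.
have K0 : 0 < K by rewrite divr_gt0// mulr_gt0.
suff main : forall j y, 0 < y -> y `^ u * `|w f j y| <= K * r ^+ j by move=> j y y0; rewrite rE; exact: main.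
have step j : (forall y, 0 < y -> y `^ u * `|w f j y - wdiff f j y| <= K * (r ^+ j / r)) ->
    (forall y, de <= y -> y `^ u * `|w f j y - wdiff f j y| <= B * r ^+ j) ->
    (forall y, 1 <= y -> y `^ u * `|wdiff f j y| <= 2 * (C * r ^+ j) / y) ->
    forall y, 0 < y -> y `^ u * `|w f j y| <= K * r ^+ j.
  move=> hp hpm hpb t t0; have rj : 0 < r ^+ j by rewrite exprn_gt0.
  have [||z tz hz] := @attain_max R (fun y => y `^ u * `|w f j y|) t (C * r ^+ j) t0 _ _ (big j).
  - move=> x x0.
    have c1 : {for x, continuous (fun y => y `^ u)} by apply: der_cont; eexists; exact: der_powR u x0 (der_id x).
    have c2 : {for x, continuous (fun y => `|w f j y|)}.
      by apply: continuous_comp; [exact: w_cont|exact: norm_continuous].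
    exact: cvgM c1 c2.
  - by move=> x x0; rewrite mulr_ge0 ?powR_ge0.
  apply: (le_trans (hz t (lexx t))); set S := _ * _.
  have z0 := lt_le_trans t0 tz.
  have [D' hD] := coeigen_equation_decay j.
  have [x [tx hx phx]] := max_principle z0 hD iu hpb.
  have x0 := lt_le_trans z0 tx.
  have hS : S <= K * (r ^+ j / r) + x `^ u * `|wdiff f j x|.
    apply: (@le_trans _ _ (z `^ u * `|w f j z - wdiff f j z| + z `^ u * `|wdiff f j z|)).
      rewrite -mulrDr /S ler_wpM2l ?powR_ge0// -[X in `|X| <= _](subrK (wdiff f j z)).
      exact: ler_normD.
    by apply: lerD; [exact: hp|exact: hx].
  have S0 : 0 <= S by rewrite mulr_ge0 ?powR_ge0.
  (* Below [de] the maximum principle compares with the maximum [S] itself; above, [wdiff] is split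
     into w_j and its predecessor. *)
  have h2 : x `^ u * `|wdiff f j x| <= kp * S + 2 * B * r ^+ j.
    have [xd|xd] := leP x de.
      have Br : 0 <= 2 * B * r ^+ j by apply: mulr_ge0 (ltW rj); apply: mulr_ge0 => //; exact: ltW.
      apply: (@le_trans _ _ (kp * S)); last by rewrite lerDl.
      rewrite -(ler_pM2l phu); apply: (@le_trans _ _ (x `^ u * (x * `|w f j x|))).
        by rewrite mulrCA ler_wpM2l ?powR_ge0.
      rewrite mulrCA (_ : ph p u * (kp * S) = kp * ph p u * S); last by ring.
      apply: ler_pM; rewrite ?mulr_ge0 ?powR_ge0 ?(ltW x0)//.
        exact: le_trans de2.
      by apply: hz; exact: le_trans tx.
    apply: (@le_trans _ _ (2 * B * r ^+ j)); last by rewrite lerDr mulr_ge0// ltW.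
    apply: (@le_trans _ _ (x `^ u * `|w f j x - wdiff f j x| + x `^ u * `|w f j x|)).
      rewrite -mulrDr ler_wpM2l ?powR_ge0//.
      rewrite -[X in `|X| <= _](subKr (w f j x)) (le_trans (ler_normB _ _))// addrC.
      done.
    have := lerD (hpm x (ltW xd)) (med j x (ltW xd)); lra.
  have e1 : K * kp = 2 * B by rewrite /K mulfVK// lt0r_neq0.
  have e2 : r^-1 = 1 - 2 * kp by rewrite /kp; move: (r^-1) => ri'; field.
  rewrite e2 in hS.
  have ri0 : 0 < r^-1 by rewrite invr_gt0.
  have k1 : 0 < 1 - kp by rewrite e2 in ri0; lra.
  rewrite -(ler_pM2l k1).
  have : (1 - kp) * S <= K * (r ^+ j * (1 - 2 * kp)) + K * kp * r ^+ j by rewrite e1; lra.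
  by move=> /le_trans; apply; rewrite le_eqVlt; apply/orP; left; apply/eqP; ring.
elim=> [|j IH].
  apply: step.
  - move=> y y0; rewrite /wdiff subr0 subrr normr0 mulr0; apply: mulr_ge0; first exact: ltW.
    by rewrite divr_ge0 ?exprn_ge0// ltW.
  - move=> y y0; rewrite /wdiff subr0 subrr normr0 mulr0; apply: mulr_ge0; first exact: ltW.
    by rewrite exprn_ge0// ltW.
  - move=> y y1; rewrite /wdiff subr0; apply: (le_trans (big 0 y y1)).
    have y0 : 0 < y by exact: lt_le_trans y1.
    by rewrite ler_pM2r ?invr_gt0// ler_peMl ?ler1n// mulr_ge0 ?(ltW C0)// exprn_ge0// ltW.
have rj : 0 < r ^+ j by rewrite exprn_gt0.
have rr : r ^+ j.+1 / r = r ^+ j by rewrite exprSr mulfK// lt0r_neq0.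
have rjj : r ^+ j <= r ^+ j.+1 by rewrite exprS ler_peMl// ltW.
have pE y : w f j.+1 y - wdiff f j.+1 y = w f j y by rewrite /wdiff subKr.
apply: step.
- by move=> y y0; rewrite pE rr; exact: IH.
- by move=> y y0; rewrite pE; apply: (le_trans (med j y y0)); rewrite ler_pM2l.
- move=> y y1; have y0 : 0 < y by exact: lt_le_trans y1.
  apply: (@le_trans _ _ (y `^ u * `|w f j.+1 y| + y `^ u * `|w f j y|)).
    by rewrite -mulrDr ler_wpM2l ?powR_ge0// /wdiff ler_normB.
  apply: (le_trans (lerD (big j.+1 y y1) (big j y y1))).
  rewrite -mulrDl ler_pM2r ?invr_gt0// -mulrDr mulrCA ler_pM2l//; lra.
Qed.

End PointwiseBound.

(** * Triplets and invariant densities *)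

Section LevyOfTriplet.
Variables (R : realType) (p : classN R).
Local Notation mu := (@lebesgue_measure R).
Local Notation st := (@stp R).

Lemma itg_EFin (f : R -> R) : itg f -> (\int[mu]_x (f x)%:E)%E = (I f)%:E.
Proof. by rewrite itgE IE => h; rewrite /Rintegral fineK//; exact: integrable_fin_num. Qed.

Lemma itg_of_fin (f : R -> R) : measurable_fun setT f -> (forall x, 0 <= f x) ->
  (\int[mu]_x (f x)%:E < +oo)%E -> itg f.
Proof.
move=> mf f0 h; rewrite itgE; apply/integrableP; split; first exact/measurable_EFinP.
by under eq_integral do rewrite /= ger0_norm//.
Qed.

Lemma Pi_tail_fin y : 0 < y -> (Pi_tail p y < +oo)%E.
Proof.
move=> y0; pose c : R := Num.min (y ^+ 2) y.
have c0 : 0 < c by rewrite lt_min exprn_gt0.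
have my : measurable ([set` `]y, +oo[] : set (measurableTypeR R)) by exact: measurable_itv.
have m0 : measurable ([set` `]0, +oo[] : set (measurableTypeR R)) by exact: measurable_itv.
have mm : measurable_fun [set: measurableTypeR R] (fun t : R => (Num.min (t ^+ 2) t)%:E).
  by apply/measurable_EFinP; meas.
have nn (t : R) : 0 < t -> (0 <= (Num.min (t ^+ 2) t)%:E)%E.
  by move=> t0; rewrite lee_fin le_min exprn_ge0 ltW.
have h : (c%:E * Pi_tail p y <= \int[Pi p]_(t in `]0%R, +oo[) (Num.min (t ^+ 2) t)%:E)%E.
  apply: (@le_trans _ _ (\int[Pi p]_(t in `]y, +oo[) (Num.min (t ^+ 2) t)%:E)%E).
    rewrite -integral_cst//; apply: ge0_le_integral => //.
    - by move=> t _; rewrite lee_fin ltW.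
    - exact: measurable_funTS.
    - move=> t; rewrite /= in_itv/= andbT => yt; rewrite lee_fin /c.
      by rewrite le_min !ge_min ler_sqr ?nnegrE ?(ltW y0) ?(ltW (lt_trans y0 yt)) ?(ltW yt) ?orbT.
  apply: ge0_subset_integral => //; first exact: measurable_funTS.
  - by move=> t; rewrite /= in_itv/= andbT; exact: nn.
  - by move=> t; rewrite /= !in_itv/= !andbT; exact: lt_trans.
have := le_lt_trans h (Pi_int p); rewrite ltey; apply: contraPlt; rewrite leye_eq => /eqP ->.
by rewrite gt0_muley ?lte_fin// eqxx.
Qed.

Definition ltail (y : R) : R := if 0 < y then fine (Pi_tail p y) else 0.

Lemma ltailE y : 0 < y -> Pi_tail p y = (ltail y)%:E.
Proof. by move=> y0; rewrite /ltail y0 fineK// ge0_fin_numE ?Pi_tail_fin. Qed.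

Lemma ltail_ge0 y : 0 <= ltail y.
Proof. by rewrite /ltail; case: ifP => // _; rewrite fine_ge0. Qed.

Lemma ltail_eq0 y : y <= 0 -> ltail y = 0.
Proof. by rewrite /ltail ltNge => ->. Qed.

Lemma ltail_decr x y : 0 < x -> x <= y -> ltail y <= ltail x.
Proof.
move=> x0 xy; rewrite -lee_fin -!ltailE//; last exact: lt_le_trans xy.
apply: le_measure; rewrite ?inE; try exact: measurable_itv.
by move=> t; rewrite /= !in_itv/= !andbT; exact: le_lt_trans.
Qed.

Lemma jump_meas (k : R -> R) : measurable_fun setT k ->
  measurable_fun setT (fun z : R * R => k z.1 * (st z.1 * st (z.2 - z.1))).
Proof. by move=> mk; have ms := @stp_meas R; meas. Qed.

Lemma stp_Pi v k : 0 <= k -> (\int[Pi p]_t (k * (st v * st (t - v)))%:E)%E = (k * ltail v)%:E.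
Proof.
move=> k0; have [v0|v0] := leP v 0.
  by rewrite ltail_eq0// mulr0; under eq_integral do rewrite (stp0 v0) mul0r mulr0; rewrite integral0.
rewrite EFinM -ltailE// /Pi_tail -integral_cst; last exact: measurable_itv.
rewrite [RHS]integral_mkcond; apply: eq_integral => t _; rewrite patchE.
rewrite mem_setE/= in_itv/= andbT; have [vt|vt] := ltP v t.
  by rewrite (stp1 v0) stp1 ?subr_gt0// !mulr1.
by rewrite (stp0 (_ : t - v <= 0)) ?subr_le0// !mulr0.
Qed.

(** The product of step factors is the indicator of 0 < v < t: integrating it in t for Pi gives the
    tail, and in v for Lebesgue measure a primitive of k. *)
Lemma ltail_tonelli (k : R -> R) : measurable_fun setT k -> (forall v, 0 < v -> 0 <= k v) ->
  measurable_fun setT (fun v => k v * ltail v) /\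
  (\int[mu]_v (k v * ltail v)%:E)%E = (\int[Pi p]_t \int[mu]_v (k v * (st v * st (t - v)))%:E)%E.
Proof.
move=> mk k0.
pose F (z : measurableTypeR R * measurableTypeR R) := (k z.1 * (st z.1 * st (z.2 - z.1)))%:E.
have mF : measurable_fun setT F by apply/measurable_EFinP; exact: jump_meas.
have F0 z : (0 <= F z)%E.
  rewrite lee_fin; have [z0|z0] := leP z.1 0; first by rewrite (stp0 z0) mul0r mulr0.
  by rewrite mulr_ge0 ?k0// mulr_ge0// stp_ge0.
have Fv v : (\int[Pi p]_t F (v, t))%E = (k v * ltail v)%:E.
  have [v0|v0] := leP (v : R) 0; last exact: (stp_Pi v (k0 _ v0)).
  rewrite ltail_eq0// mulr0; under eq_integral do rewrite /F /= (stp0 v0) mul0r mulr0.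
  by rewrite integral0.
split.
  have := @measurable_fun_fubini_tonelli_F _ _ (measurableTypeR R) (measurableTypeR R) R (Pi p) F mF F0.
  by rewrite /fubini_F (funext Fv) => /measurable_EFinP.
have := @fubini_tonelli _ _ (measurableTypeR R) (measurableTypeR R) R mu (Pi p) F mF F0.
by under eq_integral do rewrite Fv.
Qed.

Lemma prim_EFin (k : R -> R) C t : measurable_fun setT k -> expbd 0 k C ->
  (\int[mu]_v (k v * (st v * st (t - v)))%:E)%E = (prim k t)%:E.
Proof. by move=> mk kC; apply: itg_EFin; exact: (prim_itg (lexx 0) t mk kC). Qed.

Lemma Pi_int_setT (h : R -> R) : (forall t, t <= 0 -> h t = 0) ->
  (\int[Pi p]_(t in `]0%R, +oo[) (h t)%:E)%E = (\int[Pi p]_t (h t)%:E)%E.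
Proof.
move=> h0; rewrite integral_mkcond; apply: eq_integral => t _; rewrite patchE mem_setE/= in_itv/= andbT.
by have [//|t0] := ltP 0 t; rewrite h0.
Qed.

Lemma ltail_prim (k : R -> R) C : measurable_fun setT k -> (forall v, 0 < v -> 0 <= k v) ->
  expbd 0 k C -> measurable_fun setT (fun v => k v * ltail v) /\
  (\int[mu]_v (k v * ltail v)%:E)%E = (\int[Pi p]_(t in `]0%R, +oo[) (prim k t)%:E)%E.
Proof.
move=> mk k0 kC; have [h1 h2] := ltail_tonelli mk k0; split => //; rewrite h2.
rewrite Pi_int_setT; last by move=> t; exact: prim_le0.
by apply: eq_integral => t _; exact: prim_EFin kC.
Qed.

Lemma prim_ge0 (k : R -> R) t : (forall v, 0 < v -> 0 <= k v) -> 0 <= prim k t.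
Proof.
move=> k0; apply: I_ge0 => v; have [v0|v0] := leP v 0; first by rewrite (stp0 v0) mul0r mulr0.
by apply: mulr_ge0; [exact: k0|apply: mulr_ge0; exact: stp_ge0].
Qed.

(** The primitive of min (v, 1) at t is at most t min (t, 1) = min (t ^ 2, t), which is the function
    that Pi integrates. *)
Lemma ltail_itg : itg (fun y => Num.min y 1 * ltail y).
Proof.
pose k (y : R) : R := Num.min y 1.
have mk : measurable_fun setT k by rewrite /k; meas.
have k0 (v : R) : 0 < v -> 0 <= k v by move=> v0; rewrite le_min ler01 ltW.
have kC : expbd 0 k 1.
  by move=> v v0; rewrite ger0_norm ?k0// mul0r expR0 mul1r ge_min lexx orbT.
have [m1 e1] := ltail_prim mk k0 kC.
apply: itg_of_fin => //.
  move=> x; have [x0|x0] := leP x 0; first by rewrite ltail_eq0// mulr0.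
  by rewrite mulr_ge0 ?ltail_ge0// k0.
rewrite e1; apply: le_lt_trans (Pi_int p).
have mp : measurable_fun setT (prim k) := prim_meas (lexx 0) mk kC.
apply: ge0_le_integral.
- exact: measurable_itv.
- by move=> t _; rewrite lee_fin prim_ge0.
- by apply: measurable_funTS; apply/measurable_EFinP.
- by apply: measurable_funTS; apply/measurable_EFinP; meas.
move=> t; rewrite /= in_itv/= andbT => t0; rewrite lee_fin.
have -> : Num.min (t ^+ 2) t = Num.min t 1 * (t - 0).
  by rewrite subr0 expr2; case: (leP t 1) => t1; rewrite ?mul1r /Num.min; case: ifPn => //; nra.
rewrite -(I_indic_itv (ltW t0)) -I_Z; last exact: itg_indic_itv.
apply: I_le.
- exact: (prim_itg (lexx 0) t mk kC).
- by apply: itgZ; exact: itg_indic_itv.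
move=> v; have := stp_mul_itv v (lexx 0) (ltW t0); rewrite sub0r => h.
have [v0|v0] := leP v 0.
  by rewrite (stp0 v0) mul0r mulr0 mulr_ge0// le_min ler01 ltW.
rewrite (@stp0 _ (- v)) ?oppr_le0 ?(ltW v0)// subr0 in h.
have [vt|vt] := ltP v t; last first.
  by rewrite (@stp0 _ (t - v)) ?subr_le0// !mulr0 mulr_ge0// le_min ler01 ltW.
apply: ler_pM; rewrite ?k0 ?mulr_ge0 ?stp_ge0//.
  by rewrite /k le_min !ge_min (ltW vt) lexx orbT.
by apply: le_trans h; exact: ler_norm.
Qed.

Lemma ltail_nondeg : 0 < sigma p ^+ 2 \/ exists2 y, 0 < y & 0 < ltail y.
Proof.
have [s0|P0] := Defs.nondegenerate p; [left|right].
  by rewrite exprn_even_gt0//=; exact/eqP.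
apply: contrapT => h.
have h0 y : 0 < y -> Pi_tail p y = 0%E.
  move=> y0; rewrite ltailE//; congr (_%:E); apply/eqP; rewrite eq_le ltail_ge0 andbT leNgt.
  by apply/negP => l0; apply: h; exists y.
(* If every tail vanished, countable subadditivity over the half-lines (1 / (n + 1), oo) would make
   Pi null. *)
have e : [set` `]0%R, +oo[] = \bigcup_n ([set` `](n.+1%:R^-1 : R), +oo[] : set (measurableTypeR R)).
  apply/seteqP; split => [t|t [n _]]; rewrite /= in_itv/= andbT.
    move=> t0; exists (Num.bound t^-1) => //; rewrite /= in_itv/= andbT.
    rewrite invf_plt ?posrE//; apply: lt_le_trans (_ : (Num.bound t^-1)%:R <= _); last by rewrite ler_nat.
    by apply: archi_boundP; rewrite invr_ge0 ltW.
  by rewrite in_itv/= andbT; apply: lt_trans.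
have : (Pi p [set` `]0%R, +oo[] <= \sum_(n <oo) Pi p [set` `]((n.+1%:R^-1)%R : R), +oo[])%E.
  rewrite e; apply: measure_sigma_subadditive => //.
  by rewrite -e; exact: measurable_itv.
rewrite eseries0; last by move=> n _ _; apply: h0.
by rewrite leNgt P0.
Qed.

Lemma ltail_meas : measurable_fun setT ltail.
Proof.
have h : expbd 0 (fun=> 1 : R) 1 by move=> v v0; rewrite normr1 mul0r expR0 mulr1.
have [m1 _] := @ltail_prim (fun=> 1) 1 (measurable_cst _) (fun _ _ => ler01) h.
by apply: eq_measurable_fun m1 => y _; rewrite mul1r.
Qed.

Definition levy_of : levy R := @Levy R (drift p) (sigma p ^+ 2) ltail (drift_ge0 p) (sqr_ge0 _)
  ltail_ge0 ltail_meas ltail_eq0 ltail_decr ltail_itg ltail_nondeg.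

Lemma expR_sub_le (u y : R) : 0 <= u -> 0 < y -> 0 <= 1 - expR (- (u * y)) <= 1.
Proof.
move=> u0 y0; by rewrite subr_ge0 expR_le1 oppr_le0 mulr_ge0 ?(ltW y0)//= lerBlDr lerDl expR_ge0.
Qed.

Lemma Rint_half (mu' : {measure set (measurableTypeR R) -> \bar R}) (f g : R -> R) :
  (forall y, 0 < y -> f y = g y) -> (forall y, y <= 0 -> g y = 0) ->
  (\int[mu']_(y in `]0, +oo[) f y)%R = (\int[mu']_y g y)%R.
Proof.
move=> fg g0; rewrite /Rintegral integral_mkcond; congr fine; apply: eq_integral => t _.
rewrite patchE mem_setE/= in_itv/= andbT; have [t0|t0] := ltP 0 t; first by rewrite fg.
by rewrite g0.
Qed.

Lemma Re_phi (u b : R) : complex.Re (phi p (u +i* b)%C) = phiR levy_of u b.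
Proof.
rewrite phiRE /phi /cintegral /=.
rewrite (@Rint_half lebesgue_measure _ (fun y => (1 - expR (- (u * y)) * cos (b * y)) * ltail y)).
- by rewrite IE; ring.
- by move=> y y0; rewrite /ltail y0 /=; rewrite !(mulr0, subr0, addr0, add0r, mul0r) cosN; ring.
- by move=> y y0; rewrite ltail_eq0// mulr0.
Qed.

Lemma Im_phi (u b : R) : complex.Im (phi p (u +i* b)%C) = phiI levy_of u b.
Proof.
rewrite phiIE /phi /cintegral /=.
rewrite (@Rint_half lebesgue_measure _ (fun y => expR (- (u * y)) * sin (b * y) * ltail y)).
- by rewrite IE; ring.
- by move=> y y0; rewrite /ltail y0 /=; rewrite !(mulr0, subr0, addr0, mul0r, add0r) sinN; ring.
- by move=> y y0; rewrite ltail_eq0// mulr0.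
Qed.

Lemma Re_phi_real (u : R) : complex.Re (phi p u%:C%C) = ph levy_of u.
Proof. by rewrite -phR0 -Re_phi. Qed.

Lemma normc_phi (u b : R) : ComplexField.Normc.normc (phi p (u +i* b)%C) = phN levy_of u b.
Proof. by rewrite phNE norm2E -Re_phi -Im_phi; case: (phi _ _). Qed.

(** Integration by parts in the form of [ltail_prim]: u times the primitive of 1 - exp (- u v) is
    exp (- u t) - 1 + u t. *)
Lemma Re_psi (u : R) : 0 < u -> complex.Re (psi p u%:C%C) = u * ph levy_of u.
Proof.
move=> u0; pose k v := 1 - expR (- (u * v)).
have mk : measurable_fun setT k by rewrite /k; meas.
have k01 v : 0 < v -> 0 <= k v <= 1 by exact: expR_sub_le (ltW u0).
have kC : expbd 0 k 1.
  by move=> v /k01 /andP[h1 h2]; rewrite ger0_norm// mul0r expR0 mulr1.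
have [m1 e1] := ltail_prim mk (fun v v0 => proj1 (andP (k01 v v0))) kC.
have pk t : 0 < t -> prim k t = t + (expR (- (u * t)) - 1) / u.
  move=> t0; apply: (@prim_FTC R 0 (lexx 0) k (fun t => t + (expR (- (u * t)) - 1) / u) 1 t mk kC t0).
  - by move=> v v0; apply: hasd_eq; [der|rewrite /k /=; field; rewrite lt0r_neq0].
  - move=> v v0; apply: der_cont; eexists; rewrite /k; der.
  - apply: cvg_at_right_filter.
    have c : {for 0, continuous (fun t => t + (expR (- (u * t)) - 1) / u)} by apply: der_cont; eexists; der.
    by have := c; rewrite /continuous_at /prop_for /= mulr0 oppr0 expR0 subrr mul0r addr0.
have e2 : (\int[Pi p]_(y in `]0%R, +oo[) (expR (- (u * y)) - 1 + u * y))%R = u * I (fun v => k v * ltail v).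
  have ik : itg (fun v => k v * ltail v) := itg_ph levy_of (ltW u0).
  have : (\int[Pi p]_(t in `]0%R, +oo[) (u * prim k t)%:E = (u * I (fun v => (k v * ltail v)%R))%:E)%E.
    rewrite EFinM -(itg_EFin ik) e1.
    under eq_integral do rewrite EFinM.
    have mp : measurable_fun (`]0%R, +oo[ : set (measurableTypeR R)) (fun t : R => (prim k t)%:E).
      have mp' : measurable_fun setT (prim k) := prim_meas (lexx 0) mk kC.
      by apply: measurable_funTS; apply/measurable_EFinP.
    apply: (ge0_integralZl _ _ mp) => //; last by rewrite lee_fin ltW.
    by move=> t _; rewrite lee_fin; apply: prim_ge0 => v /k01 /andP[].
  move=> e3; rewrite -[RHS]/(fine (u * I (fun v => k v * ltail v)%R)%:E) -e3; congr fine.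
  apply: eq_integral => t; rewrite inE/= in_itv/= andbT => t0.
  by rewrite pk//; congr EFin; field; rewrite lt0r_neq0.
rewrite phE /psi /cintegral /=.
transitivity (sigma p ^+ 2 * u ^+ 2 + drift p * u + (\int[Pi p]_(y in `]0%R, +oo[) (expR (- (u * y)) - 1 + u * y))%R).
  congr (_ + _); first by rewrite /= !(mulr0, mul0r, subr0, addr0); ring.
  rewrite /Rintegral; congr fine; apply: eq_integral => t _; congr EFin => /=.
  by rewrite !(mulr0, mul0r, subr0, addr0) oppr0 cos0 mulr1.
by rewrite e2; ring.
Qed.

End LevyOfTriplet.

Section LawOfDensity.
Variables (R : realType) (p : classN R) (nu : R -> R).
Hypothesis hnu : is_nu p nu.
Local Notation mu := (@lebesgue_measure R).
Local Notation st := (@stp R).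

Definition ndens (x : R) : R := if 0 < x then nu x else 0.

Lemma ndensE x : 0 < x -> ndens x = nu x.
Proof. by rewrite /ndens => ->. Qed.

Lemma ndens_gt0 x : 0 < x -> 0 < ndens x.
Proof. by move=> x0; rewrite ndensE//; case: hnu => + _ _; apply. Qed.

Lemma ndens_eq0 x : x <= 0 -> ndens x = 0.
Proof. by rewrite /ndens ltNge => ->. Qed.

Lemma nu_cont x : 0 < x -> {for x, continuous nu}.
Proof.
move=> x0; case: hnu => _ d _; have := d 0%N x x0; rewrite derive1n0 => h.
by apply: differentiable_continuous; apply/derivable1_diffP.
Qed.

Lemma ndens_cont x : 0 < x -> {for x, continuous ndens}.
Proof.
move=> x0; have c := nu_cont x0.
rewrite /prop_for /continuous_at ndensE//.
apply: cvg_trans c; apply: near_eq_cvg; near=> z; rewrite ndensE//.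
by near: z; exact: lt_nbhsr.
Unshelve. all: by end_near.
Qed.

Lemma ndens_meas : measurable_fun setT ndens.
Proof.
have m1 : measurable_fun (`]0, +oo[%classic : set R) nu.
  apply: open_continuous_measurable_fun; first exact: interval_open.
  by move=> x; rewrite inE/= in_itv/= andbT; exact: nu_cont.
rewrite (_ : ndens = nu \_ (`]0, +oo[%classic : set R)); last first.
  by apply/funext => x; rewrite /ndens patchE mem_setE/= in_itv/= andbT.
by apply/measurable_restrict => //; rewrite setTI.
Qed.

Lemma ndens_mom n : itg (fun x => x ^+ n * ndens x) /\
  I (fun x => x ^+ n * ndens x) = \prod_(k < n) ph (levy_of p) k.+1%:R.
Proof.
have mn := ndens_meas.
have e : (\int[mu]_x (x ^+ n * ndens x)%:E)%E = (\prod_(k < n) ph (levy_of p) k.+1%:R)%:E.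
  have [_ _ /(_ n) h] := hnu.
  transitivity (\int[mu]_(x in `]0%R, +oo[) (x ^+ n * nu x)%:E)%E.
    rewrite [RHS]integral_mkcond; apply: eq_integral => x _.
    rewrite patchE mem_setE/= in_itv/= andbT /ndens; case: ifPn => // _; by rewrite mulr0.
  rewrite h big_add1 big_mkord; congr EFin; apply: eq_bigr => k _.
  exact: Re_phi_real.
have i : itg (fun x => x ^+ n * ndens x).
  apply: itg_of_fin; [by meas| |by rewrite e ltry].
  move=> x; have [x0|x0] := leP x 0; first by rewrite ndens_eq0// mulr0.
  by rewrite mulr_ge0 ?exprn_ge0 ?(ltW x0)// ltW// ndens_gt0.
by split => //; apply: EFin_inj; rewrite -itg_EFin.
Qed.

Definition law_of : law (levy_of p) := @Law R (levy_of p) ndens ndens_gt0 ndens_eq0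
  ndens_meas ndens_cont (fun n => proj1 (ndens_mom n)) (fun n => proj2 (ndens_mom n)).

End LawOfDensity.

Section ThetaLow.
Variables (R : realType) (p : classN R).
Local Notation mu := (@lebesgue_measure R).
Local Notation lp := (levy_of p).

Lemma Theta_int (b : R) : 0 < b ->
  (\int[mu]_(y in `]0%R, +oo[)
       (ln (ComplexField.Normc.normc (phi p ((b * y) +i* b)%C)
            / complex.Re (phi p (b * y)%:C%C)))%:E)%E = (I (lnr lp b))%:E.
Proof.
move=> b0; rewrite -itg_EFin; last exact: lnr_itg.
under eq_integral => y _ do rewrite normc_phi Re_phi_real -ratioE.
rewrite integral_mkcond; apply: eq_integral => y _; rewrite patchE mem_setE/= in_itv/= andbT.
rewrite lnrE; have [y0|y0] := ltP 0 y; last by rewrite (stp0 y0) mul0r.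
by rewrite (stp1 y0) mul1r.
Qed.

Lemma Theta_low_near t : (t%:E < Theta_low p)%E -> \forall b \near +oo, t < I (lnr lp b).
Proof.
rewrite /Theta_low limf_einfE => /ereal_sup_gt[_ [V FV <-]] h.
near=> b; have b0 : 0 < b by near: b; exact: nbhs_pinfty_gt.
have Vb : V b by near: b; exact: FV.
rewrite -lte_fin -Theta_int//; apply: lt_le_trans h _.
by apply: ereal_inf_lbound; exists b.
Unshelve. all: by end_near.
Qed.

Lemma Theta_low_le : (Theta_low p <= (pi / 2)%:E)%E.
Proof.
rewrite /Theta_low limf_einfE; apply: ub_ereal_sup => _ [V FV <-].
have [b [b0 Vb]] : exists b : R, 0 < b /\ V b.
  have : \forall b \near (+oo : set_system R), 0 < b /\ V b.
    by near=> b; split; near: b; [exact: nbhs_pinfty_gt|exact: FV].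
  by move=> /filter_ex[b hb]; exists b.
apply: (@le_trans _ _ (I (lnr lp b))%:E); last by rewrite lee_fin; exact: lnr_total_le.
by rewrite -Theta_int//; apply: ereal_inf_lbound; exists b.
Unshelve. all: by end_near.
Qed.

Lemma Theta_fine : in_N_Theta p -> exists th, [/\ Theta_low p = th%:E, 0 < th & th <= pi / 2].
Proof.
rewrite /in_N_Theta => h; have := Theta_low_le; move: h.
by case: (Theta_low p) => [t| |]//; rewrite lte_fin lee_fin => t0 t1; exists t.
Qed.

Lemma Theta_decay th (L : law lp) : Theta_low p = th%:E -> 0 < th -> forall n t, 0 < t -> t < th ->
  exists2 A, 0 < A & forall b, 0 < b -> MN L n b <= A * expR (- (t * b)).
Proof.
move=> e th0 n t t0 tth.
have h : \forall b \near +oo, (t + th) / 2 < I (lnr lp b).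
  by apply: Theta_low_near; rewrite e lte_fin; lra.
have d : 0 < (th - t) / 2 by lra.
have th1 : 0 < (t + th) / 2 by lra.
have [A A0 hA] := MN_decay L n th1 h d; exists A => // b b0.
by rewrite (_ : t = (t + th) / 2 - (th - t) / 2); [exact: hA|field].
Qed.

End ThetaLow.

(** * The exponent to the left of the origin *)

Section Dphi.
Variables (R : realType) (p : classN R).
Local Notation mu := (@lebesgue_measure R).
Local Notation lp := (levy_of p).
Local Notation q := (ltail p).

Definition ph_itg u := itg (fun y => (1 - expR (- (u * y))) * q y).

Lemma phie_int u : (\int[mu]_(y in `]0%R, +oo[) ((1 - expR (- (u * y)))%:E * Pi_tail p y))%E =
  (\int[mu]_y ((1 - expR (- (u * y))) * q y)%:E)%E.
Proof.
rewrite integral_mkcond; apply: eq_integral => y _; rewrite patchE mem_setE/= in_itv/= andbT.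
have [y0|y0] := ltP 0 y; first by rewrite ltailE// EFinM.
by rewrite ltail_eq0// mulr0.
Qed.

Lemma phie_fin u : ph_itg u -> phie p u = (ph lp u)%:E.
Proof.
by move=> i; rewrite /phie phie_int itg_EFin// phE -EFinD.
Qed.

(** For u < 0 the integrand has a constant sign, so the only way to fail integrability is the value
    -oo. *)
Lemma phie_itg u : u < 0 -> phie p u <> -oo%E -> ph_itg u.
Proof.
move=> u0 h; have mq := ltail_meas p.
have n0 y : 0 <= (expR (- (u * y)) - 1) * q y.
  have [y0|y0] := leP y 0; first by rewrite ltail_eq0// mulr0.
  rewrite mulr_ge0 ?ltail_ge0// subr_ge0 -[leLHS]expR0 ler_expR oppr_ge0.
  by rewrite mulr_le0_ge0// ltW.
have i : itg (fun y => (expR (- (u * y)) - 1) * q y).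
  apply: itg_of_fin => //; first by meas.
  rewrite ltey; apply/eqP => e; apply: h; rewrite /phie phie_int.
  rewrite (_ : (\int[mu]_y _)%E = (- (\int[mu]_y ((expR (- (u * y)) - 1) * q y)%:E))%E); first by rewrite e.
  rewrite -integral_ge0N; last by move=> y _; rewrite lee_fin.
  by apply: eq_integral => y _; rewrite -EFinN; congr EFin; ring.
by apply: itg_eq (itgZ (-1) i) => y; ring.
Qed.

Lemma ph_itg_mono a u : ph_itg a -> a <= u -> u <= 0 -> ph_itg u.
Proof.
move=> ia au u0; have mq := ltail_meas p.
apply: (itg_dom _ (itgZ (-1) ia)); first by meas.
move=> y; have [y0|y0] := leP y 0; first by rewrite ltail_eq0// !mulr0 normr0.
rewrite normrM (ger0_norm (ltail_ge0 p y)) mulrA; apply: ler_wpM2r; first exact: ltail_ge0.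
have h1 : expR 0 <= expR (- (u * y)) by rewrite ler_expR oppr_ge0 mulr_le0_ge0// ltW.
have h2 : expR (- (u * y)) <= expR (- (a * y)) by rewrite ler_expR lerN2 ler_wpM2r// ltW.
by rewrite expR0 in h1; rewrite ler0_norm; lra.
Qed.

Lemma ph_seq_cvg a (un : nat -> R) u : ph_itg a -> (forall n, a <= un n <= 0) ->
  un n @[n --> \oo] --> u -> ph lp (un n) @[n --> \oo] --> ph lp u.
Proof.
move=> ia una cu; have mq := ltail_meas p.
under eq_fun do rewrite phE; rewrite phE.
apply: cvgD; first by apply: cvgD; [exact: cvg_cst|exact: cvgMr].
apply: (proj2 (I_dct (g := fun y => -1 * ((1 - expR (- (a * y))) * q y)) _ _ (itgZ (-1) ia) _)).
- by move=> n; meas.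
- move=> y; apply: cvgMl; apply: cvgB; first exact: cvg_cst.
  apply: continuous_cvg; first exact: continuous_expR.
  by apply: cvgN; exact: cvgMl.
- move=> n y; have /andP[au u0] := una n; change (lq lp) with q.
  have [y0|y0] := leP y 0; first by rewrite ltail_eq0// !mulr0 normr0.
  rewrite normrM (ger0_norm (ltail_ge0 p y)) mulrA; apply: ler_wpM2r; first exact: ltail_ge0.
  have h1 : expR 0 <= expR (- (un n * y)) by rewrite ler_expR oppr_ge0 mulr_le0_ge0// ltW.
  have h2 : expR (- (un n * y)) <= expR (- (a * y)) by rewrite ler_expR lerN2 ler_wpM2r// ltW.
  by rewrite expR0 in h1; rewrite ler0_norm; lra.
Qed.

Lemma ph_itg0 : ph_itg 0.
Proof. by apply: itg_eq (itg0 R) => y; rewrite mul0r oppr0 expR0 subrr mul0r. Qed.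

Lemma ph0 : ph lp 0 = drift p.
Proof.
rewrite phE mulr0 addr0 (I_eq (g := fun=> 0)) ?I0 ?addr0//.
by move=> y; rewrite mul0r oppr0 expR0 subrr mul0r.
Qed.

Lemma ph_IVT a : a <= 0 -> ph_itg a -> ph lp a <= 0 -> exists u, [/\ a <= u, u <= 0 & ph lp u = 0].
Proof.
(* Clamping the argument to [a, 0] makes the composed function continuous on the whole line, by
   dominated convergence against the integrand at a. *)
move=> a0 ia pa; pose clamp u : R := Num.min (Num.max u a) 0.
have cE u : a <= u <= 0 -> clamp u = u.
  by move=> /andP[h1 h2]; rewrite /clamp (max_l h1) (min_l h2).
have cb u : a <= clamp u <= 0.
  by rewrite /clamp ge_min lexx orbT andbT le_min a0 andbT le_max lexx orbT.
have lip (u v : R) : `|clamp u - clamp v| <= `|u - v|.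
  have h3 (c x y : R) : `|Num.min x c - Num.min y c| <= `|x - y|.
    have := lerNnormlW (lexx `|x - y|); have := ler_norm (x - y).
    move: (`|x - y|) => N h1 h2; rewrite ler_norml.
    by case: (leP x c) => ?; case: (leP y c) => ?; apply/andP; split; lra.
  have h4 (c x y : R) : `|Num.max x c - Num.max y c| <= `|x - y|.
    have := lerNnormlW (lexx `|x - y|); have := ler_norm (x - y).
    move: (`|x - y|) => N h1 h2; rewrite ler_norml.
    by case: (leP x c) => ?; case: (leP y c) => ?; apply/andP; split; lra.
  exact: le_trans (h3 _ _ _) (h4 _ _ _).
have [||u /[!in_itv]/= uI e] := @IVT R (fun u => ph lp (clamp u)) a 0 0 a0.
- apply: continuous_subspaceT => x.
  apply/(@cvg_nbhsP _ R^o) => un cu.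
  apply: (ph_seq_cvg ia) => [n|]; first exact: cb.
  apply/cvgrPdist_le => e e0; near=> n; apply: (le_trans (lip _ _)).
  by near: n; move/cvgrPdist_le : cu; apply.
- rewrite !cE ?lexx ?a0// ph0 ge_min pa /=.
  by rewrite le_max drift_ge0 orbT.
exists u; move: e; rewrite cE// => e; by case/andP: uI.
Unshelve. all: by end_near.
Qed.

(** A nonpositive value at a would force a zero in [a, 0], since phi 0 is the drift; that zero would
    lie below the supremum [d_phi], which is smaller than a. *)
Lemma d_phi_pos a : (d_phi p < a%:E)%E -> ph_itg a /\ 0 < ph lp a.
Proof.
move=> h; have nS u : u <= 0 -> a <= u -> phie p u <> -oo%E /\ phie p u <> 0%E.
  move=> u0 au; apply/not_orP => hu.
  have : (u%:E <= d_phi p)%E by apply: ereal_sup_ubound; exists u.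
  by move=> /le_lt_trans /(_ h); rewrite lte_fin ltNge au.
have [a0|a0] := ltP 0 a; first by split; [exact: (@itg_ph R lp a (ltW a0))|exact: ph_gt0].
have ia : ph_itg a.
  move: a0; rewrite le_eqVlt => /predU1P[->|a0]; first exact: ph_itg0.
  by apply: phie_itg => //; case: (nS a (ltW a0) (lexx _)).
split => //; rewrite ltNge; apply/negP => pa.
have [u [au u0 e]] := ph_IVT a0 ia pa.
have [_] := nS u u0 au; apply; rewrite phie_fin ?e//; exact: ph_itg_mono ia au u0.
Qed.

Lemma phie0_pos a : (0 < phie p 0)%E -> 0 <= a -> ph_itg a /\ 0 < ph lp a.
Proof.
move=> h; rewrite le_eqVlt => /predU1P[<-|a0]; last by split; [exact: (@itg_ph R lp a (ltW a0))|exact: ph_gt0].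
by split; [exact: ph_itg0|rewrite -lte_fin -phie_fin//; exact: ph_itg0].
Qed.

End Dphi.

(** * Norms under a decay condition *)

Section Weights.
Variable R : realType.
Implicit Types (g f H : R -> R) (s a c x : R).

Lemma itg_exhaust g (a c : nat -> R) (D : pred R) (C : R) :
  (forall x, D x -> 0 <= g x) ->
  (forall n, itg (fun x => \1_`[a n, c n] x * g x) /\ I (fun x => \1_`[a n, c n] x * g x) <= C) ->
  (forall x, D x -> \forall n \near \oo, a n <= x <= c n) ->
  (forall n x, a n <= x <= c n -> D x) ->
  itg (fun x => (D x)%:R * g x).
Proof.
move=> g0 hI hD hD'.
apply: (proj1 (@I_fatou R (fun n x => \1_`[a n, c n] x * g x) _ C _ _ _ _)).
- by move=> n; case: (hI n).
- move=> n x; rewrite indic_itvE; case: (boolP (a n <= x <= c n)) => h; last by rewrite mul0r.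
  by rewrite mul1r; apply: g0; exact: hD' h.
- move=> x; case: (boolP (D x)) => Dx; apply: cvg_near_cst.
    by near=> n; rewrite indic_itvE (_ : _ <= x <= _)//; near: n; exact: hD.
  near=> n; rewrite indic_itvE; case: (boolP (a n <= x <= c n)) => // h.
  by rewrite (hD' _ _ h) in Dx.
- by move=> n; case: (hI n).
Unshelve. all: by end_near.
Qed.


Lemma inv_succ_near x : 0 < x -> \forall n \near \oo, (n.+2%:R^-1 : R) <= x.
Proof.
move=> x0; have xi : 0 <= x^-1 by rewrite invr_ge0 ltW.
exists (Num.bound x^-1) => // n /= hn.
rewrite invf_ple ?posrE//; apply: (le_trans (ltW (archi_boundP xi))).
by rewrite ler_nat (leq_trans hn)// -addn2 leq_addr.
Qed.

Lemma succ_near x : \forall n \near \oo, x <= (n.+2%:R : R).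
Proof.
exists (Num.bound `|x|) => // n /= hn; apply: (le_trans (ler_norm x)).
apply: (le_trans (ltW (archi_boundP (normr_ge0 x)))).
by rewrite ler_nat (leq_trans hn)// -addn2 leq_addr.
Qed.

Lemma hasd_powR s x : 0 < x -> hasd (fun x => x `^ s) x (s * x `^ (s - 1)).
Proof. by move=> x0; apply: hasd_eq (der_powR s x0 (der_id x)) _; rewrite mulr1. Qed.

Lemma powR_cont s x : 0 < x -> {for x, continuous (fun x => x `^ s)}.
Proof. by move=> x0; exact: der_continuous (hasd_powR s x0). Qed.

Lemma itg_pow_near0 s : -1 < s -> itg (fun x => (0 < x <= 1)%R%:R * x `^ s).
Proof.
move=> s1; have s0 : 0 < s + 1 by lra.
have sn : s + 1 != 0 by rewrite gt_eqF.
apply: (@itg_exhaust (fun x => x `^ s) (fun n => n.+2%:R^-1) (fun=> 1) (fun x => 0 < x <= 1) (s + 1)^-1).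
- by move=> x _; exact: powR_ge0.
- move=> n; have n0 : 0 < n.+2%:R^-1 :> R by rewrite invr_gt0.
  have n1 : n.+2%:R^-1 < 1 :> R by rewrite invf_lt1// ltr1n.
  have [||i e] := @I_FTC_itv R (fun x => (s + 1)^-1 * x `^ (s + 1)) (fun x => x `^ s) _ _ n1.
  + move=> x /andP[x0 _]; have xp := lt_le_trans n0 x0.
    have h := der_mul (der_cst (s + 1)^-1 x) (hasd_powR (s + 1) xp).
    apply: (hasd_eq h); rewrite mulr0 addr0 mulrA mulVf// mul1r; congr (_ `^ _); ring.
  + by move=> x /andP[x0 _]; apply: powR_cont; exact: lt_le_trans x0.
  split => //; rewrite e powR1 mulr1 lerBlDr lerDl; apply: mulr_ge0; [by rewrite invr_ge0 ltW|exact: powR_ge0].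
- move=> x /andP[x0 x1]; near=> n; rewrite x1 andbT; near: n; exact: inv_succ_near.
- by move=> n x /andP[h1 ->]; rewrite andbT; apply: lt_le_trans h1; rewrite invr_gt0.
Unshelve. all: by end_near.
Qed.

Lemma itg_pow_inf s : s < -1 -> itg (fun x => (1 <= x)%R%:R * x `^ s).
Proof.
move=> s1; have s0 : s + 1 < 0 by lra.
have sn : s + 1 != 0 by rewrite lt_eqF.
apply: (@itg_exhaust (fun x => x `^ s) (fun=> 1) (fun n => n.+2%:R) (fun x => 1 <= x) (- (s + 1)^-1)).
- by move=> x _; exact: powR_ge0.
- move=> n; have n1 : 1 < n.+2%:R :> R by rewrite ltr1n.
  have [||i e] := @I_FTC_itv R (fun x => (s + 1)^-1 * x `^ (s + 1)) (fun x => x `^ s) _ _ n1.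
  + move=> x /andP[x0 _]; have xp := lt_le_trans ltr01 x0.
    have h := der_mul (der_cst (s + 1)^-1 x) (hasd_powR (s + 1) xp).
    apply: (hasd_eq h); rewrite mulr0 addr0 mulrA mulVf// mul1r; congr (_ `^ _); ring.
  + by move=> x /andP[x0 _]; apply: powR_cont; exact: lt_le_trans x0.
  split => //; rewrite e powR1 mulr1 gerDr.
  by apply: mulr_le0_ge0; [rewrite invr_le0 ltW|exact: powR_ge0].
- move=> x x1; near=> n; rewrite x1 /=; near: n; exact: succ_near.
- by move=> n x /andP[].
Unshelve. all: by end_near.
Qed.

Lemma wnorm_le g f H c : measurable_fun setT H ->
  measurable_fun (`]0, +oo[%classic : set R) (fun x => `|f x| ^+ 2 * g x) ->
  (forall x, 0 < x -> 0 <= g x) -> 0 <= c -> itg H -> (forall x, 0 <= H x) ->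
  (forall x, 0 < x -> `|f x| ^+ 2 * g x <= c ^+ 2 * H x) ->
  (wnorm g f <= ((I H) `^ 2^-1 * c)%:E)%E.
Proof.
move=> mH mf g0 c0 iH H0 fH; rewrite /wnorm.
have e : (I H) `^ 2^-1 * c = (c ^+ 2 * I H) `^ 2^-1.
  rewrite powRM ?sqr_ge0 ?I_ge0// mulrC; congr (_ * _).
  by rewrite -powR_mulrn// -powRrM divff// powRr1.
rewrite e -poweR_EFin; apply: gt0_ler_poweR.
- by rewrite invr_ge0.
- rewrite in_itv/= leey andbT; apply: integral_ge0 => x; rewrite /= in_itv/= andbT => x0.
  by rewrite lee_fin mulr_ge0 ?sqr_ge0 ?g0.
- by rewrite in_itv/= leey andbT lee_fin mulr_ge0 ?sqr_ge0 ?I_ge0.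
rewrite -(I_Z _ iH) -itg_EFin; last exact: itgZ.
rewrite integral_mkcond; apply: ge0_le_integral => //.
- move=> x _; rewrite patchE mem_setE/= in_itv/= andbT; case: ifPn => // x0.
  by rewrite lee_fin mulr_ge0 ?sqr_ge0 ?g0.
- apply/measurable_restrict => //; rewrite setTI; exact/measurable_EFinP.
- by apply/measurable_EFinP; meas.
move=> x _; rewrite patchE mem_setE/= in_itv/= andbT; case: ifPn => x0; rewrite lee_fin.
  exact: fH.
by rewrite mulr_ge0 ?sqr_ge0.
Qed.

(** The power n ^ (1/2 - a) of the rate is dominated by any exponential: a bound with a slightly
    smaller exponential rate and no power of n is enough. *)
Lemma rate_absorb (a T T' : R) : T' < T -> exists2 C : R, 0 < C &
  forall n, (0 < n)%N -> expR (T' * n%:R) <= C * rate a T n.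
Proof.
move=> TT; pose h := T - T'; have h0 : 0 < h by rewrite subr_gt0.
pose k := Num.bound `|a - 2^-1|.
have ak : a - 2^-1 <= k%:R by apply: (le_trans (ler_norm _)); exact: ltW (archi_boundP (normr_ge0 _)).
exists (k`!%:R / h ^+ k); first by rewrite divr_gt0 ?exprn_gt0// ltr0n fact_gt0.
move=> n n0; have n1 : 1 <= n%:R :> R by rewrite ler1n.
have np : 0 < n%:R :> R by rewrite ltr0n.
have h1 := pow_le_expM k h0 (ltW np).
rewrite /rate (_ : 2^-1 - a = - (a - 2^-1)); last by rewrite opprB.
rewrite (powRN _ (a - 2^-1)).
have h2 : n%:R `^ (a - 2^-1) <= n%:R ^+ k :> R by rewrite -powR_mulrn ?(ltW np)// ler_powR.
have p0 : 0 < n%:R `^ (a - 2^-1) :> R by rewrite powR_gt0.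
rewrite mulrCA ler_pdivlMl//.
apply: (@le_trans _ _ (k`!%:R / h ^+ k * expR (h * n%:R) * expR (T' * n%:R))).
  by rewrite ler_wpM2r ?expR_ge0// (le_trans h2).
by rewrite -mulrA -expRD -mulrDl /h subrK.
Qed.

End Weights.

Section NormBound.
Variables (R : realType) (f : R -> R) (T0 : R) (P : R -> Prop).
Hypothesis bound : forall u T, P u -> T0 < T ->
  exists2 K, 0 < K & forall j y, 0 < y -> y `^ u * `|w f j y| <= K * expR (T * j%:R).
Hypothesis wc : forall j x, 0 < x -> {for x, continuous (w f j)}.

Lemma w_meas j : measurable_fun (`]0, +oo[%classic : set R) (w f j).
Proof.
apply: open_continuous_measurable_fun; first exact: interval_open.
by move=> x; rewrite inE/= in_itv/= andbT; exact: wc.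
Qed.

Lemma pointwise_rate a eps : P a -> 0 < eps ->
  exists C : R, \forall n \near \oo, forall x : R, 0 < x ->
    x `^ a * `|w f n x| <= C * rate a (T0 + eps) n.
Proof.
move=> Pa e0; have h1 : T0 < T0 + eps / 2 by rewrite ltrDl divr_gt0.
have h2 : T0 + eps / 2 < T0 + eps by lra.
have [K K0 hK] := bound Pa h1; have [C C0 hC] := rate_absorb a h2.
exists (K * C); near=> n => x x0; apply: (le_trans (hK n x x0)).
rewrite -mulrA ler_pM2l//; apply: hC; near: n; by exists 1%N.
Unshelve. all: by end_near.
Qed.

(** The exponent a is used on (0, 1] and the exponent 2 on [1, oo): a < (c + 1) / 2 makes x ^ (c - 2
    a) integrable at 0, and c <= 2 makes x ^ (c - 4) at most x ^ (- 2). *)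
Lemma norm_rate (a eps c : R) (g : R -> R) (F : nat -> R -> R) : P a -> P 2 -> 0 < eps ->
  a < (c + 1) / 2 -> c <= 2 -> (forall x, 0 < x -> 0 <= g x) ->
  (forall n x, 0 < x -> `|F n x| ^+ 2 * g x = `|w f n x| ^+ 2 * x `^ c) ->
  bigO_seq (fun n => wnorm g (F n)) (rate a (T0 + eps)).
Proof.
move=> Pa P2 e0 ac c2 g0 Fw.
have h1 : T0 < T0 + eps / 2 by rewrite ltrDl divr_gt0.
have h2 : T0 + eps / 2 < T0 + eps by lra.
have [K1 K10 hK1] := bound Pa h1; have [K2 K20 hK2] := bound P2 h1.
have [C C0 hC] := rate_absorb a h2.
pose K := Num.max K1 K2; have K0 : 0 < K by rewrite lt_max K10.
pose H x : R := (0 < x <= 1)%R%:R * x `^ (c - 2 * a) + (1 <= x)%R%:R * x `^ (-2).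
have iH : itg H by apply: itgD; [apply: itg_pow_near0; lra|apply: itg_pow_inf; lra].
have H0 x : 0 <= H x by rewrite addr_ge0 ?mulr_ge0 ?powR_ge0.
have sq (u x : R) : 0 < x -> x `^ (2 * u) = (x `^ u) ^+ 2.
  by move=> x0; rewrite -powR_mulrn ?powR_ge0// -powRrM mulrC.
exists ((I H) `^ 2^-1 * K * C); near=> n.
apply: (@le_trans _ _ ((I H) `^ 2^-1 * (K * expR ((T0 + eps / 2) * n%:R)))%:E); last first.
  rewrite lee_fin -!mulrA; apply: ler_wpM2l; first exact: powR_ge0.
  rewrite ler_pM2l//; apply: hC; near: n; by exists 1%N.
set E := expR _.
apply: wnorm_le => //.
- exact: itg_meas iH.
- have m1 : measurable_fun (`]0, +oo[%classic : set R) (fun x => `|w f n x| ^+ 2 * x `^ c).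
    apply: measurable_funM; last by apply: measurable_funTS; meas.
    apply: measurable_funX; apply: measurableT_comp => //; exact: w_meas.
  apply: eq_measurable_fun m1 => x; rewrite inE/= in_itv/= andbT => x0.
  by rewrite Fw.
- by rewrite mulr_ge0 ?expR_ge0// ltW.
move=> x x0; rewrite Fw//.
have key (u : R) (Ku : R) : 0 < Ku -> Ku <= K -> x `^ u * `|w f n x| <= Ku * E ->
    `|w f n x| ^+ 2 * x `^ c <= (K * E) ^+ 2 * x `^ (c - 2 * u).
  move=> Ku0 KuK hu; rewrite (_ : x `^ c = (x `^ u) ^+ 2 * x `^ (c - 2 * u)); last first.
    by rewrite -sq// -powRD; [congr (_ `^ _); ring|rewrite (gt_eqF x0) implybT].
  rewrite mulrA; apply: ler_wpM2r; first exact: powR_ge0.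
  rewrite -exprMn mulrC lerXn2r ?nnegrE ?mulr_ge0 ?powR_ge0 ?expR_ge0 ?(ltW K0)//.
  by apply: (le_trans hu); rewrite ler_wpM2r// expR_ge0.
have KE : 0 <= (K * E) ^+ 2 by exact: sqr_ge0.
have [x1|x1] := leP x 1.
  apply: (le_trans (key a K1 K10 _ (hK1 n x x0))); first by rewrite le_max lexx.
  apply: ler_wpM2l => //; rewrite /H x0 x1 mul1r lerDl; apply: mulr_ge0 => //; exact: powR_ge0.
apply: (le_trans (key 2 K2 K20 _ (hK2 n x x0))); first by rewrite le_max lexx orbT.
apply: ler_wpM2l => //; rewrite /H (ltW x1) mul1r.
apply: (@le_trans _ _ (x `^ (-2))); first by rewrite ler_powR ?(ltW x1)//; lra.
by rewrite lerDr; apply: mulr_ge0 => //; exact: powR_ge0.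
Unshelve. all: by end_near.
Qed.

End NormBound.

Section PartOne.
Variables (R : realType) (p : classN R) (nu : R -> R).
Hypothesis hnu : is_nu p nu.

Lemma part_one : in_N_Theta p ->
    [/\ forall a eps : R,
          (d_phi p < a%:E)%E \/
            [/\ (0 < phie p 0)%E, d_phi p = 0%E & 0 <= a] ->
          0 < eps ->
          exists C : R, \forall n \near \oo, forall x : R, 0 < x ->
            x `^ a * `|w nu n x| <= C * rate a (T_Theta p + eps) n,
        forall a eps : R, (d_phi p < a%:E)%E -> a < 2^-1 -> 0 < eps ->
          bigO_seq (fun n => wnorm (fun=> 1) (w nu n))
                   (rate a (T_Theta p + eps))
      & forall alpha a eps : R, 0 < alpha < 1 ->
          (d_phi p < a%:E)%E -> a < (alpha + 1) / 2 -> 0 < eps ->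
          bigO_seq
            (fun n => wnorm (p_weight alpha)
                            (fun x => w nu n x / p_weight alpha x))
            (rate a (T_Theta p + eps))].
Proof.
move=> hT; have [th [eT th0 thpi]] := Theta_fine hT.
pose L := law_of hnu.
have decay := Theta_decay L eT th0.
have fnu x : 0 < x -> nu x = dens L x by move=> x0; rewrite /L /= ndensE.
pose P u := ph_itg p u /\ 0 < ph (levy_of p) u.
have bound u T : P u -> T_Theta p < T ->
  exists2 K, 0 < K & forall j y, 0 < y -> y `^ u * `|w nu j y| <= K * expR (T * j%:R).
  rewrite /T_Theta eT /= => -[iu pu] hT'.
  exact: (coeigen_bound fnu th0 decay thpi hT' iu pu).
have wc j x : 0 < x -> {for x, continuous (w nu j)} by exact: (w_cont fnu th0 decay).
have P2 : P 2 by split; [exact: (@itg_ph R (levy_of p) 2 (ler0n _ 2))|exact: ph_gt0].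
split.
- move=> a eps ha e0; apply: (pointwise_rate bound) => //.
  by case: ha => [/d_phi_pos//|[h1 _ h2]]; exact: phie0_pos.
- move=> a eps /d_phi_pos Pa a1 e0.
  apply: (@norm_rate _ _ _ _ bound wc a eps 0 _ (w nu)) => //; first by lra.
  by move=> n x x0; rewrite powRr0.
- move=> al a eps /andP[al0 al1] /d_phi_pos Pa a1 e0.
  apply: (@norm_rate _ _ _ _ bound wc a eps al _ (fun n x => w nu n x / p_weight al x)) => //.
    by lra.
  + by move=> x x0; exact: powR_ge0.
  move=> n x x0; rewrite /p_weight powRN invrK normrM exprMn (ger0_norm (powR_ge0 _ _)).
  by rewrite -mulrA; congr (_ * _); rewrite expr2 mulfK// gt_eqF// powR_gt0.
Qed.

End PartOne.

(** * Regular variation *)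

Section StableExponent.
Variables (R : realType) (al : R).
Hypotheses (al0 : 0 < al) (al1 : al < 1).
Local Notation st := (@stp R).
Implicit Types (u b v : R).

Definition qst v : R := st v * v `^ (-1 - al).

Lemma qst_ge0 v : 0 <= qst v.
Proof. by rewrite mulr_ge0 ?stp_ge0 ?powR_ge0. Qed.

Lemma qst_meas : measurable_fun setT qst.
Proof. by have ms := @stp_meas R; rewrite /qst; meas. Qed.

Lemma qst_eq0 v : v <= 0 -> qst v = 0.
Proof. by move=> v0; rewrite /qst (stp0 v0) mul0r. Qed.

Lemma qst_decr v1 v2 : 0 < v1 -> v1 <= v2 -> qst v2 <= qst v1.
Proof.
move=> v10 v12; have v20 := lt_le_trans v10 v12.
by rewrite /qst (stp1 v10) (stp1 v20) !mul1r; apply: powR_antitone => //; have := al0; lra.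
Qed.

Lemma powRS v (s : R) : 0 < v -> v * v `^ s = v `^ (s + 1).
Proof.
move=> v0; rewrite -[X in X * _](powRr1 (ltW v0)) -powRD; first by rewrite addrC.
by rewrite (gt_eqF v0) implybT.
Qed.

Lemma qst_mul v : v * qst v = st v * v `^ (- al).
Proof.
have [v0|v0] := leP v 0; first by rewrite qst_eq0// (stp0 v0) mulr0 mul0r.
by rewrite /qst (stp1 v0) !mul1r powRS//; congr (_ `^ _); ring.
Qed.

Lemma qst_itg : itg (fun v => Num.min v 1 * qst v).
Proof.
have m1 := qst_meas; have a1 : -1 < - al by have := al1; lra.
have a2 : -1 - al < -1 by have := al0; lra.
apply: (itg_dom _ (itgD (itg_pow_near0 a1) (itg_pow_inf a2))); first by meas.
move=> v; have [v0|v0] := leP v 0.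
  by rewrite qst_eq0// mulr0 normr0 addr_ge0// mulr_ge0// powR_ge0.
rewrite ger0_norm; last by rewrite mulr_ge0 ?qst_ge0// le_min ler01 ltW.
have [v1|v1] := leP v 1.
  by rewrite qst_mul (stp1 v0) !mul1r lerDl mulr_ge0// powR_ge0.
by rewrite /qst (stp1 v0) (ltW v1) !mul1r lerDr mulr_ge0// powR_ge0.
Qed.

Lemma qst_nondeg : 0 < 0 :> R \/ exists2 y, 0 < y & 0 < qst y.
Proof. by right; exists 1 => //; rewrite /qst stp1// powR1 mul1r. Qed.

(* The model exponent with [phi u] proportional to [u `^ al]. *)
Definition stable : levy R := @Levy R 0 0 qst (lexx 0) (lexx 0) qst_ge0 qst_meas qst_eq0
  qst_decr qst_itg qst_nondeg.

(* [exp (- u v) v ^ (- al)] integrated against [cos (b v)] and [sin (b v)];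
   these are the derivatives of the exponent of [stable]. *)
Definition Est u v := expR (- (u * v)) * (st v * v `^ (- al)).
Definition Cst u b := I (fun v => Est u v * cos (b * v)).
Definition Sst u b := I (fun v => Est u v * sin (b * v)).

Lemma Est_ge0 u v : 0 <= Est u v.
Proof. by rewrite mulr_ge0 ?expR_ge0// mulr_ge0 ?stp_ge0 ?powR_ge0. Qed.

Lemma Est_meas u : measurable_fun setT (Est u).
Proof. by have ms := @stp_meas R; rewrite /Est; meas. Qed.

Lemma Est_itg u : 0 < u -> itg (Est u).
Proof.
move=> u0; have m1 := Est_meas u; have ms := @stp_meas R.
have a1 : -1 < - al by have := al1; lra.
have [i _] := half_exp u0.
apply: (itg_dom m1 (itgD (itg_pow_near0 a1) i)) => v.
rewrite ger0_norm ?Est_ge0// /Est; have [v0|v0] := leP v 0.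
  by rewrite (stp0 v0) !mul0r mulr0 addr_ge0// mulr_ge0// powR_ge0.
rewrite (stp1 v0) !mul1r; have e1 : expR (- (u * v)) <= 1.
  by rewrite expR_le1 oppr_le0 mulr_ge0// ltW.
have [v1|v1] := leP v 1.
  by rewrite mul1r ler_wpDr ?expR_ge0// ler_piMl// powR_ge0.
rewrite mul0r add0r ler_piMr ?expR_ge0//.
by rewrite -(powRr0 v) ler_powR ?(ltW v1)// oppr_le0 ltW.
Qed.

Lemma EstC_itg u b : 0 < u -> itg (fun v => Est u v * cos (b * v)).
Proof.
move=> u0; have m1 := Est_meas u; apply: (itg_dom _ (Est_itg u0)); first by meas.
by move=> v; rewrite normrM ger0_norm ?Est_ge0// ler_piMr ?Est_ge0 ?cos_max.
Qed.

Lemma EstS_itg u b : 0 < u -> itg (fun v => Est u v * sin (b * v)).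
Proof.
move=> u0; have m1 := Est_meas u; apply: (itg_dom _ (Est_itg u0)); first by meas.
by move=> v; rewrite normrM ger0_norm ?Est_ge0// ler_piMr ?Est_ge0 ?sin_max.
Qed.

Lemma cvg_succ_powN (a : R) : 0 < a -> (n.+2%:R : R) `^ (- a) @[n --> \oo] --> (0 : R).
Proof.
move=> a0; apply/cvgr0Pnorm_le => e e0; near=> n.
have n0 : 0 < n.+2%:R :> R by [].
rewrite ger0_norm ?powR_ge0// powRN invf_ple ?posrE ?powR_gt0//.
have h : e^-1 = (e^-1 `^ a^-1) `^ a.
  by rewrite -powRrM mulVf ?gt_eqF// powRr1 ?invr_ge0 ?ltW.
rewrite h; apply: ge0_ler_powR; rewrite ?nnegrE ?powR_ge0 ?(ltW a0)//.
near: n; exact: succ_near.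
Unshelve. all: by end_near.
Qed.

(** The boundary terms vanish: g is O(v ^ (1 - al)) at 0 and O(v ^ (- al)) at infinity. *)
Lemma I_derivative0 (g dg : R -> R) (K : R) :
  (forall v, 0 < v -> hasd g v (dg v)) -> (forall v, 0 < v -> {for v, continuous dg}) ->
  (forall v, 0 < v -> `|g v| <= K * (Num.min v 1 * v `^ (- al))) ->
  measurable_fun setT dg -> itg (fun v => st v * dg v) -> I (fun v => st v * dg v) = 0.
Proof.
move=> hg cg gK mdg idg.
have n1 n : n.+2%:R^-1 < n.+2%:R :> R.
  by apply: (@lt_trans _ _ 1); [rewrite invf_lt1// ltr1n|rewrite ltr1n].
have n0 n : 0 < n.+2%:R^-1 :> R by rewrite invr_gt0.
have h n : itg (fun v => \1_`[n.+2%:R^-1, n.+2%:R] v * dg v) /\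
    I (fun v => \1_`[n.+2%:R^-1, n.+2%:R] v * dg v) = g n.+2%:R - g n.+2%:R^-1.
  apply: I_FTC_itv => // v /andP[v1 _]; [apply: hg|apply: cg]; exact: lt_le_trans v1.
have c1 : I (fun v => \1_`[n.+2%:R^-1, n.+2%:R] v * dg v) @[n --> \oo] --> I (fun v => st v * dg v).
  apply: (proj2 (I_dct (g := fun v => `|st v * dg v|) _ _ (itg_norm idg) _)).
  - by move=> n; exact: itg_meas (proj1 (h n)).
  - move=> v; apply: cvgMl; apply: cvg_near_cst; have [v0|v0] := leP v 0.
      rewrite (stp0 v0); apply: nearW => n; rewrite indic_itvE.
      by rewrite leNgt (le_lt_trans v0 (n0 n)).
    near=> n; rewrite (stp1 v0) indic_itvE (_ : _ <= _ <= _)//; apply/andP; split; near: n.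
      exact: inv_succ_near.
    exact: succ_near.
  - move=> n v; rewrite !normrM; apply: ler_wpM2r => //; rewrite indic_itvE.
    case: (boolP (_ <= _ <= _)) => [/andP[v1 _]|_]; last by rewrite normr0.
    by rewrite (stp1 (lt_le_trans (n0 n) v1)).
have c2 : g n.+2%:R - g n.+2%:R^-1 @[n --> \oo] --> (0 - 0 : R).
  apply: cvgB.
    apply: (@squeeze_cvgr _ _ _ _ (fun n => - (K * n.+2%:R `^ (- al))) (fun n => K * n.+2%:R `^ (- al))).
    - apply: nearW => n; rewrite -ler_norml; have := gK n.+2%:R (ltr0Sn _ _).
      by rewrite (min_r (_ : 1 <= n.+2%:R)) ?mul1r// ler1n.
    - rewrite -oppr0; apply: cvgN; rewrite -(mulr0 K); apply: cvgMr; exact: cvg_succ_powN.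
    - rewrite -(mulr0 K); apply: cvgMr; exact: cvg_succ_powN.
  have a1 : 0 < 1 - al by rewrite subr_gt0.
  apply: (@squeeze_cvgr _ _ _ _ (fun n => - (K * n.+2%:R `^ (- (1 - al)))) (fun n => K * n.+2%:R `^ (- (1 - al)))).
  - apply: nearW => n; rewrite -ler_norml; have := gK n.+2%:R^-1 (n0 n).
    rewrite (min_l (_ : n.+2%:R^-1 <= 1)) ?invf_le1// ?ler1n// powRS// => /le_trans; apply.
    by rewrite -powR_inv1// -powRrM le_eqVlt; apply/orP; left; apply/eqP; congr (_ * _ `^ _); ring.
  - rewrite -oppr0; apply: cvgN; rewrite -(mulr0 K); apply: cvgMr; exact: cvg_succ_powN.
  - rewrite -(mulr0 K); apply: cvgMr; exact: cvg_succ_powN.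
rewrite subr0 in c2.
rewrite -(cvg_lim _ c1)// -(cvg_lim _ c2)//; congr (lim (_ @ \oo)).
by apply/funext => n; case: (h n).
Unshelve. all: by end_near.
Qed.

(** Integration by parts of (1 - exp (- z v)) v ^ (- al). In complex form it is Euler's equation z
    phi' z = al phi z with z = u + i b and phi' z = [Cst] - i [Sst]. *)
Lemma stable_parts u b : 0 < u ->
  u * Cst u b + b * Sst u b = al * phiR stable u b /\
  b * Cst u b - u * Sst u b = al * phiI stable u b.
Proof.
move=> u0; have u0' := ltW u0; have ms := @stp_meas R.
have iR := itg_re stable b u0'; have iI := itg_im stable b u0'.
have iC := EstC_itg b u0; have iS := EstS_itg b u0.
have pR : phiR stable u b = I (fun v => (1 - expR (- (u * v)) * cos (b * v)) * qst v).
  by rewrite phiRE /= mul0r !add0r.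
have pI : phiI stable u b = I (fun v => expR (- (u * v)) * sin (b * v) * qst v).
  by rewrite phiIE /= mul0r !add0r.
have dv (v : R) : 0 < v -> hasd (fun v => v `^ (- al)) v (- al * v `^ (-1 - al)).
  by move=> v0; apply: (hasd_eq (hasd_powR (- al) v0)); congr (_ * _ `^ _); ring.
pose cc (v : R) := expR (- (u * v)) * cos (b * v).
pose ss (v : R) := expR (- (u * v)) * sin (b * v).
have hc v : hasd cc v (- u * cc v - b * ss v) by apply: hasd_eq; [rewrite /cc; der|rewrite /cc /ss /=; ring].
have hs v : hasd ss v (- u * ss v + b * cc v) by apply: hasd_eq; [rewrite /ss; der|rewrite /cc /ss /=; ring].
split.
- pose g v := (1 - cc v) * v `^ (- al).
  pose dg v := (u * cc v + b * ss v) * v `^ (- al) - al * ((1 - cc v) * v `^ (-1 - al)).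
  have e v : st v * dg v = (u * (Est u v * cos (b * v)) + b * (Est u v * sin (b * v))) -
      al * ((1 - expR (- (u * v)) * cos (b * v)) * qst v).
    by rewrite /dg /Est /qst /cc /ss; ring.
  have i : itg (fun v => st v * dg v).
    apply: itg_eq (itgB (itgD (itgZ u iC) (itgZ b iS)) (itgZ al iR)) => v.
    by rewrite e.
  have := @I_derivative0 g dg (3 + u + 2 * `|b|) _ _ _ _ i.
  rewrite (I_eq e) I_B; [|by apply: itgD; apply: itgZ|exact: itgZ].
  rewrite I_D; [|exact: itgZ|exact: itgZ]; rewrite !I_Z// -pR => h.
  apply/eqP; rewrite -subr_eq0; apply/eqP; apply: h.
  + move=> v v0; apply: hasd_eq; first by apply: der_mul; [apply: der_sub; [exact: der_cst|exact: hc]|exact: dv].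
    by rewrite /dg; ring.
  + move=> v v0; apply: der_cont; eexists; apply: der_sub.
      apply: der_mul; last exact: hasd_powR.
      by apply: der_add; apply: der_mul; [exact: der_cst|exact: hc|exact: der_cst|exact: hs].
    apply: der_mul; first exact: der_cst.
    by apply: der_mul; [apply: der_sub; [exact: der_cst|exact: hc]|exact: hasd_powR].
  + move=> v v0; rewrite /g normrM (ger0_norm (powR_ge0 _ _)) mulrA; apply: ler_wpM2r; first exact: powR_ge0.
    exact: one_sub_cexp_bound.
  + by rewrite /dg /cc /ss; meas.
- pose g v := ss v * v `^ (- al).
  pose dg v := (- u * ss v + b * cc v) * v `^ (- al) - al * (ss v * v `^ (-1 - al)).
  have e v : st v * dg v = (b * (Est u v * cos (b * v)) - u * (Est u v * sin (b * v))) -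
      al * (expR (- (u * v)) * sin (b * v) * qst v).
    by rewrite /dg /Est /qst /cc /ss; ring.
  have i : itg (fun v => st v * dg v).
    apply: itg_eq (itgB (itgB (itgZ b iC) (itgZ u iS)) (itgZ al iI)) => v.
    by rewrite e.
  have := @I_derivative0 g dg (1 + `|b|) _ _ _ _ i.
  rewrite (I_eq e) I_B; [|by apply: itgB; apply: itgZ|exact: itgZ].
  rewrite I_B; [|exact: itgZ|exact: itgZ]; rewrite !I_Z// -pI => h.
  apply/eqP; rewrite -subr_eq0; apply/eqP; apply: h.
  + move=> v v0; apply: hasd_eq; first by apply: der_mul; [exact: hs|exact: dv].
    by rewrite /dg; ring.
  + move=> v v0; apply: der_cont; eexists; apply: der_sub.
      apply: der_mul; last exact: hasd_powR.
      by apply: der_add; apply: der_mul; [exact: der_cst|exact: hs|exact: der_cst|exact: hc].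
    apply: der_mul; first exact: der_cst.
    by apply: der_mul; [exact: hs|exact: hasd_powR].
  + move=> v v0; rewrite /g normrM (ger0_norm (powR_ge0 _ _)) mulrA; apply: ler_wpM2r; first exact: powR_ge0.
    exact: expR_sin_le.
  + by rewrite /dg /cc /ss; meas.
Qed.

Lemma hasd_phiR_stable u b : 0 < u -> hasd (phiR stable u) b (Sst u b).
Proof.
move=> u0; have -> : phiR stable u = (fun b => I (fun v => (1 - expR (- (u * v)) * cos (b * v)) * qst v)).
  by apply/funext => b'; rewrite phiRE /= mul0r !add0r.
apply: (@hasd_I R (fun b v => (1 - expR (- (u * v)) * cos (b * v)) * qst v) (fun b v => Est u v * sin (b * v)) (Est u)).
- by move=> x; exact: (itg_re stable x (ltW u0)).
- move=> x v; apply: hasd_eq; first by der.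
  rewrite /Est -qst_mul /=; ring.
- exact: Est_itg.
- by move=> x v; rewrite normrM ger0_norm ?Est_ge0// ler_piMr ?Est_ge0 ?sin_max.
Qed.

Lemma hasd_phiI_stable u b : 0 < u -> hasd (phiI stable u) b (Cst u b).
Proof.
move=> u0; have -> : phiI stable u = (fun b => I (fun v => expR (- (u * v)) * sin (b * v) * qst v)).
  by apply/funext => b'; rewrite phiIE /= mul0r !add0r.
apply: (@hasd_I R (fun b v => expR (- (u * v)) * sin (b * v) * qst v) (fun b v => Est u v * cos (b * v)) (Est u)).
- by move=> x; exact: (itg_im stable x (ltW u0)).
- move=> x v; apply: hasd_eq; first by der.
  rewrite /Est -qst_mul /=; ring.
- exact: Est_itg.
- by move=> x v; rewrite normrM ger0_norm ?Est_ge0// ler_piMr ?Est_ge0 ?cos_max.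
Qed.

Lemma hasd_ph_stable u : 0 < u -> hasd (ph stable) u (Cst u 0).
Proof.
move=> u0; have -> : ph stable = (fun u => I (fun v => (1 - expR (- (u * v))) * qst v)).
  by apply/funext => u'; rewrite phE /= mul0r !add0r.
apply: (@hasd_I_loc R (fun u v => (1 - expR (- (u * v))) * qst v) (fun u v => Est u v * cos (0 * v)) (Est (u / 2)) (u / 2) (2 * u)).
- by apply/andP; split; lra.
- by move=> x /andP[x0 _]; apply: (itg_ph stable); lra.
- move=> x v _; apply: hasd_eq; first by der.
  rewrite /Est -qst_mul mul0r cos0 /=; ring.
- by apply: Est_itg; lra.
- move=> x v /andP[x0 _]; rewrite mul0r cos0 mulr1 ger0_norm ?Est_ge0// /Est.
  have [v0|v0] := leP v 0; first by rewrite (stp0 v0) mul0r !mulr0.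
  apply: ler_wpM2r; first by rewrite mulr_ge0 ?stp_ge0 ?powR_ge0.
  by rewrite ler_expR lerN2 ler_pM2r// ltW.
Qed.

Lemma constant_of_der0 (F : R -> R) (a c : R) : a <= c ->
  (forall x, a <= x <= c -> hasd F x 0) -> F a = F c.
Proof.
move=> ac hF; apply/eqP; rewrite eq_le; apply/andP; split.
  by apply: (@der_incr R F (fun=> 0) a c ac).
by apply: (@der_decr R F (fun=> 0) a c ac).
Qed.

Lemma ph_stable u : 0 < u -> ph stable u = u `^ al * ph stable 1.
Proof.
pose F u := ph stable u * u `^ (- al).
have hF x : 0 < x -> hasd F x 0.
  move=> x0; have [h _] := stable_parts 0 x0; rewrite mul0r addr0 phR0 in h.
  apply: hasd_eq; first by apply: der_mul; [exact: hasd_ph_stable|exact: hasd_powR].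
  have -> : x `^ (- al) = x * x `^ (- al - 1) by rewrite powRS// subrK.
  transitivity (x `^ (- al - 1) * (x * Cst x 0 - al * ph stable x)); first by ring.
  by rewrite h subrr mulr0.
have key x y : 0 < x -> x <= y -> F x = F y.
  by move=> x0 xy; apply: constant_of_der0 => // z /andP[xz _]; apply: hF; exact: lt_le_trans xz.
move=> u0; have e : F u = ph stable 1.
  have -> : ph stable 1 = F 1 by rewrite /F powR1 mulr1.
  by have [u1|u1] := leP u 1; [exact: key|apply/esym/key => //; exact: ltW].
rewrite -e /F mulrCA -powRD; first by rewrite addrN powRr0 mulr1.
by rewrite (gt_eqF u0) implybT.
Qed.

(** By Euler's equation |phi z| / |z| ^ al has derivative 0 along vertical lines; it is squared here
    to avoid roots. *)
Lemma phN_stable u b : 0 < u -> 0 <= b ->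
  phN stable u b ^+ 2 * (u ^+ 2 + b ^+ 2) `^ (- al) = ph stable u ^+ 2 * (u ^+ 2) `^ (- al).
Proof.
move=> u0 b0.
pose F b := (phiR stable u b ^+ 2 + phiI stable u b ^+ 2) * (u ^+ 2 + b ^+ 2) `^ (- al).
have -> : phN stable u b ^+ 2 * (u ^+ 2 + b ^+ 2) `^ (- al) = F b by rewrite phNE norm2_sqr.
have -> : ph stable u ^+ 2 * (u ^+ 2) `^ (- al) = F 0.
  by rewrite /F phR0 phI0 expr0n /= !addr0.
apply/esym/constant_of_der0 => // x _.
have D0 : 0 < u ^+ 2 + x ^+ 2 by rewrite ltr_pwDl ?exprn_gt0// sqr_ge0.
have [h1 h2] := stable_parts x u0.
have hD : hasd (fun b => u ^+ 2 + b ^+ 2) x (2 * x) by apply: hasd_eq; [der|rewrite /=; ring].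
have hP := hasd_phiR_stable x u0; have hQ := hasd_phiI_stable x u0.
have hF := der_mul (der_add (der_exp 2 hP) (der_exp 2 hQ)) (@der_powR R (fun b => u ^+ 2 + b ^+ 2) x _ (- al) D0 hD).
apply: (hasd_eq hF); rewrite /=.
have -> : (u ^+ 2 + x ^+ 2) `^ (- al) = (u ^+ 2 + x ^+ 2) * (u ^+ 2 + x ^+ 2) `^ (- al - 1).
  by rewrite powRS// subrK.
move: (phiR stable u x) (phiI stable u x) (Cst u x) (Sst u x) (_ `^ (- al - 1)) h1 h2 => P Q C S E h1 h2.
have e1 : (u ^+ 2 + x ^+ 2) * S = x * (u * C + x * S) - u * (x * C - u * S) by ring.
have e2 : (u ^+ 2 + x ^+ 2) * C = u * (u * C + x * S) + x * (x * C - u * S) by ring.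
transitivity (2 * E * (P * ((u ^+ 2 + x ^+ 2) * S) + Q * ((u ^+ 2 + x ^+ 2) * C) - al * x * (P ^+ 2 + Q ^+ 2))).
  by ring.
by rewrite e1 e2 h1 h2; ring.
Qed.

Lemma ratio_stable y : 0 < y -> ratio stable y 1 = expR (al * logr y).
Proof.
move=> y0; have h := phN_stable y0 ler01.
have p0 := ph_gt0 stable y0; have n0 : 0 <= phN stable y 1 by apply: le_trans (ltW p0) (phN_ge _ _ (ltW y0)).
have y2 : 0 < y ^+ 2 by rewrite exprn_gt0.
have D0 : 0 < y ^+ 2 + 1 ^+ 2 by rewrite ltr_pwDl.
apply/eqP; rewrite -(@eqrXn2 _ 2) ?ratioE ?expR_ge0 ?divr_ge0// ?(ltW p0)//; apply/eqP.
have a1 : 0 < 1 + y ^- 2 by exact: logr_arg_gt0.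
rewrite -expRM_natl (_ : 2 * (al * logr y) = al * ln (1 + y ^- 2)); last by rewrite /logr; field.
have -> : expR (al * ln (1 + y ^- 2)) = (1 + y ^- 2) `^ al by rewrite /powR gt_eqF.
have e : 1 + y ^- 2 = (y ^+ 2 + 1 ^+ 2) / y ^+ 2 by rewrite expr1n mulrDl divff ?mul1r// gt_eqF.
rewrite e powRM ?invr_ge0 ?(ltW D0) ?(ltW y2)// expr_div_n.
have -> : (y ^- 2) `^ al = (y ^+ 2) `^ (- al).
  by rewrite -powR_inv1 ?(ltW y2)// -powRrM mulN1r.
have pn : ph stable y != 0 by rewrite gt_eqF.
have DD : (y ^+ 2 + 1 ^+ 2) `^ al * (y ^+ 2 + 1 ^+ 2) `^ (- al) = 1.
  by rewrite -powRD ?subrr ?powRr0// (gt_eqF D0) implybT.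
move: (_ `^ al) (_ `^ (- al)) (_ `^ (- al)) DD h => A B C DD h.
apply: (mulfI (expf_neq0 2 pn)); rewrite mulrCA divff ?expf_neq0// mulr1.
transitivity (phN stable y 1 ^+ 2 * C * A); first by rewrite -mulrA (mulrC C) DD mulr1.
by rewrite h; ring.
Qed.

End StableExponent.

(** * From convergence of moments to convergence of Lipschitz integrals *)

Section BernsteinTransfer.
Variable R : realType.
Implicit Types (F : R -> R) (L e u : R).

(** The nodes (j + 1) / (m + 2) stay inside the open interval, where alone [F] is controlled: the
    quotients to which this applies are singular at 1. *)
Lemma bern_unif F L e : 0 <= L -> 0 < e ->
  (forall s t, 0 < s < 1 -> 0 < t < 1 -> `|F s - F t| <= L * `|s - t|) ->
  exists m (f : nat -> R), forall u, 0 < u < 1 -> `|bern m f u - F u| <= e.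
Proof.
move=> L0 e0 hF; pose m := Num.bound (L ^+ 2 / e ^+ 2).
have hm : L ^+ 2 / e ^+ 2 <= m%:R.
  by apply/ltW/archi_boundP; rewrite divr_ge0// sqr_ge0.
pose M : R := m.+2%:R; have M0 : 0 < M by [].
have ME : M = m%:R + 2 by rewrite /M -addn2 natrD.
exists m, (fun j => F (j.+1%:R / M)) => u u01; have /andP[u0 u1] := u01.
have u01' : 0 <= u <= 1 by rewrite !ltW.
(* Young's inequality L d <= e / 2 + L ^ 2 d ^ 2 / (2 e) turns the Lipschitz bound into a quadratic
   majorant; [x] is the centre in the index j of the node (j + 1) / M. *)
pose k := L ^+ 2 / (2 * e) / M ^+ 2; pose x := u * M - 1.
have k0 : 0 <= k by rewrite !divr_ge0 ?sqr_ge0 ?mulr_ge0 ?(ltW e0) ?(ltW M0).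
have bd j : (j <= m)%N -> `|F (j.+1%:R / M) - F u| <= e / 2 + k * (j%:R - x) ^+ 2.
  move=> jm; have x01 : 0 < j.+1%:R / M < 1.
    by rewrite divr_gt0//= ltr_pdivrMr// mul1r ltr_nat !ltnS.
  apply: (le_trans (hF _ _ x01 u01)); set d := `|_|.
  have -> : k * (j%:R - x) ^+ 2 = L ^+ 2 / (2 * e) * d ^+ 2.
    rewrite /d real_normK ?num_real// (_ : j.+1%:R / M - u = (j%:R - x) / M); last first.
      by rewrite /x -natr1; field; rewrite gt_eqF.
    by rewrite /k expr_div_n; move: (M ^+ 2) (expf_neq0 2 (lt0r_neq0 M0)) => M2 M20; field; rewrite M20 gt_eqF.
  have : 0 <= (e - L * d) ^+ 2 / (2 * e) by rewrite divr_ge0 ?sqr_ge0// mulr_ge0// ltW.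
  have -> : (e - L * d) ^+ 2 / (2 * e) = e / 2 - L * d + L ^+ 2 / (2 * e) * d ^+ 2 by field; rewrite gt_eqF.
  lra.
apply: (le_trans (bern_dist u01' bd)); rewrite bern_var.
have h1 : (m%:R * u - x) ^+ 2 + m%:R * u * (1 - u) <= M.
  have -> : m%:R * u - x = 1 - 2 * u by rewrite /x ME; ring.
  have : (1 - 2 * u) ^+ 2 <= 1 by nra.
  have m0 : 0 <= m%:R :> R by [].
  have : m%:R * u * (1 - u) <= m%:R by nra.
  by rewrite ME; lra.
rewrite [leRHS](splitr e) lerD2l; apply: (le_trans (ler_wpM2l k0 h1)).
have -> : k * M = L ^+ 2 / e ^+ 2 / M * (e / 2) by rewrite /k; field; rewrite !gt_eqF.
rewrite ler_piMl ?divr_ge0 ?(ltW e0)// ler_pdivrMr// mul1r (le_trans hm)// ME; lra.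
Qed.

(** The derivative of N / (1 - u) is P / (1 - u) ^ 2 with P = N' (1 - u) + N. Here P vanishes at 1
    and P' = N'' (1 - u), so |P| <= L (1 - u) ^ 2. *)
Lemma quotient_lipschitz (N N1 N2 : R -> R) L :
  (forall u, 0 < u <= 1 -> hasd N u (N1 u)) -> (forall u, 0 < u <= 1 -> hasd N1 u (N2 u)) ->
  (forall u, 0 < u <= 1 -> `|N2 u| <= 2 * L) -> N 1 = 0 ->
  forall s t, 0 < s < 1 -> 0 < t < 1 -> `|N s / (1 - s) - N t / (1 - t)| <= L * `|s - t|.
Proof.
move=> hN hN1 N2L N10.
pose P u := N1 u * (1 - u) + N u.
have hP u : 0 < u <= 1 -> hasd P u (N2 u * (1 - u)).
  move=> hu; have h1 := hN1 u hu; have h2 := hN u hu.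
  apply: hasd_eq.
    by apply: der_add; [apply: der_mul; [exact: h1|apply: der_sub; [exact: der_cst|exact: der_id]]|exact: h2].
  by rewrite /=; ring.
have hQ u : hasd (fun u : R => L * (1 - u) ^+ 2) u (- (2 * L * (1 - u))).
  by apply: hasd_eq; [der|rewrite /=; ring].
have Pb u : 0 < u < 1 -> `|P u| <= L * (1 - u) ^+ 2.
  move=> /andP[u0 u1].
  have N2b x : u < x < 1 -> - (2 * L) <= N2 x <= 2 * L.
    by move=> /andP[x0 x1]; rewrite -ler_norml; apply: N2L; rewrite (lt_trans u0 x0) ltW.
  have h1 : 0 <= P u + L * (1 - u) ^+ 2.
    have := @der_decr R (fun u => P u + L * (1 - u) ^+ 2) (fun u => N2 u * (1 - u) + - (2 * L * (1 - u))) u 1 (ltW u1).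
    rewrite /P subrr mulr0 N10 expr0n /= mulr0 !addr0; apply.
      move=> x /andP[x0 x1]; apply: der_add; [apply: hP|exact: hQ].
      by rewrite x1 andbT (lt_le_trans u0).
    move=> x hx; have /andP[a1 a2] := N2b x hx; case/andP: hx => x0 x1; nra.
  have h2 : P u - L * (1 - u) ^+ 2 <= 0.
    have := @der_incr R (fun u => P u - L * (1 - u) ^+ 2) (fun u => N2 u * (1 - u) - - (2 * L * (1 - u))) u 1 (ltW u1).
    rewrite /P subrr mulr0 N10 expr0n /= mulr0 !addr0 subr0; apply.
      move=> x /andP[x0 x1]; apply: der_sub; [apply: hP|exact: hQ].
      by rewrite x1 andbT (lt_le_trans u0).
    move=> x hx; have /andP[a1 a2] := N2b x hx; case/andP: hx => x0 x1; nra.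
  by rewrite ler_norml; apply/andP; split; lra.
pose F u := N u / (1 - u).
have hF u : 0 < u < 1 -> hasd F u (P u / (1 - u) ^+ 2).
  move=> /andP[u0 u1]; have n1 : 1 - u != 0 by rewrite subr_eq0 gt_eqF.
  have h1 : 0 < u <= 1 by rewrite u0 ltW.
  have hs : hasd (fun u : R => 1 - u) u (0 - 1) by apply: der_sub; [exact: der_cst|exact: der_id].
  have := der_mul (hN u h1) (@der_inv R (fun u => 1 - u) u (0 - 1) n1 hs) => h; apply: (hasd_eq h).
  by rewrite /P; field.
have Fb u : 0 < u < 1 -> - L <= P u / (1 - u) ^+ 2 <= L.
  move=> hu; have := Pb u hu; case/andP: hu => u0 u1.
  have D0 : 0 < (1 - u) ^+ 2 by rewrite exprn_gt0// subr_gt0.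
  by rewrite ler_norml -mulNr ler_pdivlMr// ler_pdivrMr.
have main s t : 0 < s -> s <= t -> t < 1 -> `|F s - F t| <= L * `|s - t|.
  move=> s0 st t1; rewrite distrC [X in L * X]distrC (ger0_norm (_ : 0 <= t - s)) ?subr_ge0//.
  have inI x : s <= x <= t -> 0 < x < 1.
    by move=> /andP[x0 x1]; rewrite (lt_le_trans s0 x0) (le_lt_trans x1 t1).
  have inI' x : s < x < t -> 0 < x < 1.
    by move=> /andP[x0 x1]; apply: inI; rewrite !ltW.
  have h1 := @der_incr R (fun u => F u + L * u) (fun u => P u / (1 - u) ^+ 2 + L) s t st.
  have h2 := @der_decr R (fun u => F u - L * u) (fun u => P u / (1 - u) ^+ 2 - L) s t st.
  have d x : hasd (fun u : R => L * u) x L by apply: hasd_eq; [der|rewrite /=; ring].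
  have k1 : F s + L * s <= F t + L * t.
    apply: h1 => x hx; first by apply: der_add; [apply: hF; exact: inI|exact: d].
    by have /andP[] := Fb x (inI' x hx); lra.
  have k2 : F t - L * t <= F s - L * s.
    apply: h2 => x hx; first by apply: der_sub; [apply: hF; exact: inI|exact: d].
    by have /andP[] := Fb x (inI' x hx); lra.
  by rewrite ler_norml; apply/andP; split; lra.
move=> s t /andP[s0 s1] /andP[t0 t1]; have [st|ts] := leP s t; first exact: main.
by rewrite distrC [X in L * X]distrC; apply: main => //; exact: ltW.
Qed.

Variables (sb rb : nat -> R -> R) (s r : R -> R).
Hypotheses (msb : forall n, measurable_fun setT (sb n)) (ms : measurable_fun setT s).
Hypotheses (irb : forall n, itg (rb n)) (ir : itg r).
Hypotheses (rb0 : forall n v, 0 <= rb n v) (r0 : forall v, 0 <= r v).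
Hypotheses (sb1 : forall n v, 0 < v -> 0 < sb n v < 1) (s1 : forall v, 0 < v -> 0 < s v < 1).
Hypotheses (rbn : forall n v, v <= 0 -> rb n v = 0) (rn : forall v, v <= 0 -> r v = 0).
Hypothesis mom : forall j, I (fun v => sb n v ^+ j * rb n v) @[n --> \oo] --> I (fun v => s v ^+ j * r v).

(* Convergence of the moments of the measures [rb n] in the variable [sb n]
   passes to polynomials, and to Lipschitz functions by Bernstein approximation. *)
Definition transfers (g : R -> R) := [/\ forall n, itg (fun v => g (sb n v) * rb n v),
  itg (fun v => g (s v) * r v) &
  I (fun v => g (sb n v) * rb n v) @[n --> \oo] --> I (fun v => g (s v) * r v)].

Lemma transfers_lin g1 g2 (a c : R) : transfers g1 -> transfers g2 ->
  transfers (fun u => a * g1 u + c * g2 u).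
Proof.
move=> [i1 j1 c1] [i2 j2 c2].
have e t w : (a * g1 t + c * g2 t) * w = a * (g1 t * w) + c * (g2 t * w) by ring.
split.
- by move=> n; apply: itg_eq (itgD (itgZ a (i1 n)) (itgZ c (i2 n))) => v; rewrite e.
- by apply: itg_eq (itgD (itgZ a j1) (itgZ c j2)) => v; rewrite e.
rewrite (I_eq (fun v => e (s v) (r v))) (I_D (itgZ a j1) (itgZ c j2)) (I_Z a j1) (I_Z c j2).
rewrite (_ : (fun n => _) = (fun n => a * I (fun v => g1 (sb n v) * rb n v) + c * I (fun v => g2 (sb n v) * rb n v))).
  by apply: cvgD; exact: cvgMr.
apply/funext => n; rewrite (I_eq (fun v => e (sb n v) (rb n v))).
by rewrite (I_D (itgZ a (i1 n)) (itgZ c (i2 n))) (I_Z a (i1 n)) (I_Z c (i2 n)).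
Qed.

Lemma expr01_itg (s' r' : R -> R) k : measurable_fun setT s' -> itg r' -> (forall v, 0 <= r' v) ->
  (forall v, 0 < v -> 0 < s' v < 1) -> (forall v, v <= 0 -> r' v = 0) ->
  itg (fun v => s' v ^+ k * r' v).
Proof.
move=> ms' ir' r'0 s'1 r'n; have mr := itg_meas ir'.
apply: (itg_dom _ ir'); first by meas.
move=> v; have [v0|v0] := leP v 0; first by rewrite r'n// mulr0 normr0.
have /andP[a1 a2] := s'1 v v0.
rewrite normrM (ger0_norm (r'0 v)) ger0_norm ?exprn_ge0 ?(ltW a1)//.
by rewrite ler_piMl// exprn_ile1 ?ltW.
Qed.

Lemma transfers_pow k : transfers (fun u => u ^+ k).
Proof.
by split; [move=> n; apply: expr01_itg; rewrite // => v; [exact: sb1|exact: rbn]|exact: expr01_itg|exact: mom].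
Qed.

Lemma transfers_bern m f k : transfers (fun u => u ^+ k * bern m f u).
Proof.
elim: m f k => [|m IH] f k.
  have h := transfers_lin (f 0%N) 0 (transfers_pow k) (transfers_pow k).
  rewrite (_ : (fun u => _) = (fun u => f 0%N * u ^+ k + 0 * u ^+ k))//.
  by apply/funext => u /=; ring.
have h := transfers_lin 1 (-1) (transfers_lin 1 1 (IH (fun j => f j.+1) k.+1) (IH f k)) (IH f k.+1).
rewrite (_ : (fun u => _) = (fun u => 1 * (1 * (u ^+ k.+1 * bern m (fun j => f j.+1) u) + 1 * (u ^+ k * bern m f u)) +
   -1 * (u ^+ k.+1 * bern m f u)))//.
by apply/funext => u /=; rewrite exprS; ring.
Qed.

(** A Bernstein polynomial within e' of [F] costs e' times each total mass. The masses are bounded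
    because the moments of order 0 converge. *)
Lemma lipschitz_transfer F L : 0 <= L ->
  (forall s t, 0 < s < 1 -> 0 < t < 1 -> `|F s - F t| <= L * `|s - t|) ->
  (forall n, itg (fun v => F (sb n v) * rb n v)) -> itg (fun v => F (s v) * r v) ->
  I (fun v => F (sb n v) * rb n v) @[n --> \oo] --> I (fun v => F (s v) * r v).
Proof.
move=> L0 hF iFn iF.
have Ir0 : 0 <= I r by exact: I_ge0.
have near_bern (s' r' g : R -> R) e' : itg r' -> (forall v, 0 <= r' v) ->
   (forall v, 0 < v -> 0 < s' v < 1) -> (forall v, v <= 0 -> r' v = 0) ->
   itg (fun v => g (s' v) * r' v) -> itg (fun v => F (s' v) * r' v) ->
   (forall u, 0 < u < 1 -> `|g u - F u| <= e') ->
   `|I (fun v => g (s' v) * r' v) - I (fun v => F (s' v) * r' v)| <= e' * I r'.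
  move=> ir' r'0 s'1 r'n ig iF' gF; rewrite -I_B// -I_Z//.
  apply: I_norm_le; [exact: itg_meas (itgB ig iF')|exact: itgZ|].
  move=> v; rewrite -mulrBl normrM (ger0_norm (r'0 v)).
  have [v0|v0] := leP v 0; first by rewrite r'n// !mulr0.
  by rewrite ler_wpM2r// gF// s'1.
apply/cvgrPdist_le => e e0.
pose e' : R := e / (3 * (I r + 1)).
have M0 : 0 < I r + 1 by rewrite ltr_wpDl.
have e'0 : 0 < e' by rewrite divr_gt0// mulr_gt0.
have [m [f hf]] := bern_unif L0 e'0 hF.
have [ib jb cb] := transfers_bern m f 0.
have e0r u : u ^+ 0 * bern m f u = bern m f u by rewrite expr0 mul1r.
have ib' n : itg (fun v => bern m f (sb n v) * rb n v) by apply: itg_eq (ib n) => v /=; rewrite e0r.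
have jb' : itg (fun v => bern m f (s v) * r v) by apply: itg_eq jb => v /=; rewrite e0r.
have cb' : I (fun v => bern m f (sb n v) * rb n v) @[n --> \oo] --> I (fun v => bern m f (s v) * r v).
  move: cb; under eq_fun do under eq_fun do rewrite e0r.
  by under [in X in _ --> X]eq_fun do rewrite e0r.
have c0 : I (rb n) @[n --> \oo] --> I r.
  have h0 := @mom 0%N; have er : I (fun v => s v ^+ 0 * r v) = I r by apply: I_eq => v; rewrite expr0 mul1r.
  rewrite er in h0; move: h0.
  rewrite (_ : (fun n => _) = (fun n => I (rb n)))//.
  by apply/funext => n; apply: I_eq => v; rewrite expr0 mul1r.
have h1 := near_bern s r (bern m f) e' ir r0 s1 rn jb' iF hf.
have e3 : e' * (I r + 1) = e / 3 by rewrite /e'; field; rewrite gt_eqF.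
near=> n.
have h2 := near_bern (sb n) (rb n) (bern m f) e' (irb n) (rb0 n) (sb1 n) (@rbn n) (ib' n) (iFn n) hf.
have h3 : `|I (fun v => bern m f (s v) * r v) - I (fun v => bern m f (sb n v) * rb n v)| <= e / 3.
  by near: n; move/cvgrPdist_le : cb'; apply; rewrite divr_gt0.
have h4 : I (rb n) <= I r + 1.
  have : `|I r - I (rb n)| <= 1 by near: n; move/cvgrPdist_le : c0; apply.
  by rewrite ler_norml => /andP[]; lra.
have h5 : e' * I r <= e / 3 by rewrite -e3 ler_pM2l// lerDl.
have h6 : e' * I (rb n) <= e / 3 by rewrite -e3 ler_pM2l.
move: h1 h2 h3; rewrite !ler_norml => /andP[a1 a2] /andP[b1 b2] /andP[d1 d2].
by apply/andP; split; lra.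
Unshelve. all: by end_near.
Qed.

End BernsteinTransfer.

Section ZeroGaussian.
Variables (R : realType) (p : levy R).
Hypothesis s0 : ls p = 0.
Local Notation q := (lq p).
Implicit Types (u b v y : R).

Lemma ph_zero : ph p 0 = lm p.
Proof.
rewrite phE mulr0 addr0 (I_eq (g := fun=> 0)) ?I0 ?addr0//.
by move=> v; rewrite mul0r oppr0 expR0 subrr mul0r.
Qed.

(** Moments of the measure (1 - exp (- u v)) q v in the variable exp (- u v) are increments of phi
    on the real axis; this reduces the behaviour of phi at complex points to regular variation on
    the axis. *)
Lemma ph_increment j u : 0 <= u ->
  I (fun v => expR (- (u * v)) ^+ j * ((1 - expR (- (u * v))) * q v)) = ph p (j.+1%:R * u) - ph p (j%:R * u).
Proof.
move=> u0; have i1 : 0 <= j.+1%:R * u by rewrite mulr_ge0.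
have i2 : 0 <= j%:R * u by rewrite mulr_ge0.
rewrite !phE s0 !mul0r addr0 opprD addrACA subrr add0r -I_B; [|exact: itg_ph|exact: itg_ph].
apply: I_eq => v; rewrite -!expRM_natl.
have -> : expR (- (j.+1%:R * u * v)) = expR (j%:R * - (u * v)) * expR (- (u * v)).
  by rewrite -expRD -natr1; congr expR; ring.
have -> : expR (- (j%:R * u * v)) = expR (j%:R * - (u * v)) by congr expR; ring.
by ring.
Qed.

(** Taking u = exp (- y b v / 2) rather than its square is deliberate: exp (- y b v) becomes u ^ 2,
    and u ^ 2 cos (c ln u) has a bounded second derivative near 0 despite its oscillation. *)
Lemma osc_factor y b v : 0 < y -> 0 < b ->
  let u := expR (- (y / 2 * b * v)) in
  (1 - u ^+ 2 * cos ((y / 2)^-1 * ln u)) / (1 - u) * ((1 - u) * q v) =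
    (1 - expR (- (b * y * v)) * cos (b * v)) * q v /\
  (- (u ^+ 2 * sin ((y / 2)^-1 * ln u))) / (1 - u) * ((1 - u) * q v) =
    expR (- (b * y * v)) * sin (b * v) * q v.
Proof.
move=> y0 b0 u; have [v0|v0] := leP v 0; first by rewrite lq_eq0// !mulr0.
have h0 : 0 < y / 2 * b * v by rewrite !mulr_gt0.
have u1 : 1 - u != 0 by rewrite subr_eq0 gt_eqF// expR_lt1 oppr_lt0.
have e1 : u ^+ 2 = expR (- (b * y * v)) by rewrite -expRM_natl; congr expR; field.
have e2 : (y / 2)^-1 * ln u = - (b * v) by rewrite expRK; field; rewrite gt_eqF.
rewrite e1 e2 cosN sinN; move: (expR _) (cos _) (sin _) => E c s.
by split; field.
Qed.

Lemma osc_integrals y b : 0 < y -> 0 < b ->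
  let u v := expR (- (y / 2 * b * v)) in
  let FR u := (1 - u ^+ 2 * cos ((y / 2)^-1 * ln u)) / (1 - u) in
  let FI u := (- (u ^+ 2 * sin ((y / 2)^-1 * ln u))) / (1 - u) in
  [/\ itg (fun v => FR (u v) * ((1 - u v) * q v)), itg (fun v => FI (u v) * ((1 - u v) * q v)),
   I (fun v => FR (u v) * ((1 - u v) * q v)) = phiR p (b * y) b - lm p &
   I (fun v => FI (u v) * ((1 - u v) * q v)) = phiI p (b * y) b].
Proof.
move=> y0 b0 u FR FI; have by0 : 0 <= b * y by rewrite mulr_ge0// ltW.
have eR v : FR (u v) * ((1 - u v) * q v) = (1 - expR (- (b * y * v)) * cos (b * v)) * q v.
  exact: (proj1 (osc_factor v y0 b0)).
have eI v : FI (u v) * ((1 - u v) * q v) = expR (- (b * y * v)) * sin (b * v) * q v.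
  exact: (proj2 (osc_factor v y0 b0)).
have iR := itg_re p b by0; have iI := itg_im p b by0.
split.
- by apply: itg_eq iR => v; rewrite eR.
- by apply: itg_eq iI => v; rewrite eI.
- by rewrite (I_eq eR) phiRE s0 mul0r addr0 addrC addKr.
- by rewrite (I_eq eI) phiIE s0 mul0r add0r.
Qed.

End ZeroGaussian.

Section OscillatingQuotients.
Variables (R : realType) (c : R).
Hypothesis c0 : 0 < c.
(** Half of a bound for the second derivatives of u ^ 2 cos (c ln u) and u ^ 2 sin (c ln u). *)
Let L := (2 + 3 * c + c ^+ 2) / 2.

Lemma osc_bound (a1 a2 t : R) : `|a1| <= 2 + c ^+ 2 -> `|a2| <= 3 * c ->
  `|a1 * cos t + a2 * sin t| <= 2 * L /\ `|a1 * sin t + a2 * cos t| <= 2 * L.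
Proof.
move=> h1 h2; have k x (a M : R) : `|a| <= M -> `|x| <= 1 -> `|a * x| <= M.
  by move=> aM x1; rewrite normrM (le_trans _ aM)// ler_piMr.
have e : 2 * L = (2 + c ^+ 2) + 3 * c by rewrite /L; field.
rewrite e; split; rewrite (le_trans (ler_normD _ _))// lerD// k ?cos_max ?sin_max//.
Qed.

Lemma osc_lipschitz (s t : R) : 0 < s < 1 -> 0 < t < 1 ->
  `|(1 - s ^+ 2 * cos (c * ln s)) / (1 - s) - (1 - t ^+ 2 * cos (c * ln t)) / (1 - t)| <= L * `|s - t| /\
  `|(- (s ^+ 2 * sin (c * ln s))) / (1 - s) - (- (t ^+ 2 * sin (c * ln t))) / (1 - t)| <= L * `|s - t|.
Proof.
move=> s01 t01; have b1 : `|c ^+ 2 - 2| <= 2 + c ^+ 2.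
  by rewrite (le_trans (ler_normB _ _))// !ger0_norm ?sqr_ge0// addrC.
have b2 : `|3 * c| <= 3 * c by rewrite ger0_norm// mulr_ge0// ltW.
split.
- refine (@quotient_lipschitz R (fun u => 1 - u ^+ 2 * cos (c * ln u))
    (fun u => - (2 * u * cos (c * ln u)) + c * u * sin (c * ln u))
    (fun u => (c ^+ 2 - 2) * cos (c * ln u) + (3 * c) * sin (c * ln u)) L _ _ _ _ s t s01 t01).
  + move=> u /andP[u0 _]; apply: hasd_eq; first by der.
    by rewrite /=; field; rewrite gt_eqF.
  + move=> u /andP[u0 _]; apply: hasd_eq; first by der.
    by rewrite /=; field; rewrite gt_eqF.
  + by move=> u _; apply: (proj1 (osc_bound _ b1 b2)).
  + by rewrite ln1 mulr0 cos0 expr1n mulr1 subrr.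
- refine (@quotient_lipschitz R (fun u => - (u ^+ 2 * sin (c * ln u)))
    (fun u => - (2 * u * sin (c * ln u)) - c * u * cos (c * ln u))
    (fun u => (c ^+ 2 - 2) * sin (c * ln u) + (- (3 * c)) * cos (c * ln u)) L _ _ _ _ s t s01 t01).
  + move=> u /andP[u0 _]; apply: hasd_eq; first by der.
    by rewrite /=; field; rewrite gt_eqF.
  + move=> u /andP[u0 _]; apply: hasd_eq; first by der.
    by rewrite /=; field; rewrite gt_eqF.
  + by move=> u _; apply: (proj2 (osc_bound _ b1 _)); rewrite normrN.
  + by rewrite ln1 mulr0 sin0 mulr0 oppr0.
Qed.

Lemma osc_L_ge0 : 0 <= L.
Proof. by rewrite divr_ge0// !addr_ge0 ?sqr_ge0// mulr_ge0// ltW. Qed.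

End OscillatingQuotients.

Section RegularVariation.
Variables (R : realType) (p : levy R) (al C : R).
Hypotheses (al0 : 0 < al) (al1 : al < 1) (C0 : 0 < C).
Hypothesis reg : ph p u / (C * u `^ al) @[u --> +oo] --> (1 : R).
Local Notation st := (@stp R).
Local Notation q := (lq p).
Local Notation S := (stable al0 al1).

Lemma ph_between e : 0 < e -> exists2 u0 : R, 0 < u0 &
  forall u, u0 <= u -> (1 - e) * (C * u `^ al) <= ph p u <= (1 + e) * (C * u `^ al).
Proof.
move=> e0; move/cvgrPdist_le : reg => /(_ _ e0) [u1 [_ h]].
exists (Num.max 1 (u1 + 1)); first by rewrite lt_max ltr01.
move=> u; rewrite ge_max => /andP[u1' uu]; have u0 : 0 < u by exact: lt_le_trans u1'.
have D0 : 0 < C * u `^ al by rewrite mulr_gt0 ?powR_gt0.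
have /h : u1 < u by apply: lt_le_trans uu; rewrite ltrDl.
rewrite [X in _ -> _ <= X <= _](_ : ph p u = ph p u / (C * u `^ al) * (C * u `^ al)); last by rewrite divfK// gt_eqF.
rewrite !ler_pM2r// ler_norml; move: (_ / _) => z /andP[a1 a2]; apply/andP; split; lra.
Qed.

(** A Gaussian part would make phi grow linearly, faster than u ^ al. *)
Lemma no_gaussian : ls p = 0.
Proof.
apply/eqP; rewrite eq_le ls_ge0 andbT leNgt; apply/negP => s0.
have [u0 u00 h] := ph_between ltr01.
pose K := 2 * C / ls p; have K0 : 0 < K by rewrite divr_gt0// mulr_gt0.
pose u := Num.max (Num.max u0 1) ((K + 1) `^ (1 - al)^-1).
have uu0 : u0 <= u by rewrite !le_max lexx.
have u1 : 1 <= u by rewrite !le_max lexx orbT.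
have uz : (K + 1) `^ (1 - al)^-1 <= u by rewrite !le_max lexx !orbT.
move: u uu0 u1 uz => u uu0 u1 uz.
have u0' : 0 < u by exact: lt_le_trans u1.
have a1 : 0 < 1 - al by rewrite subr_gt0.
have uK : K < u `^ (1 - al).
  apply: (@lt_le_trans _ _ (K + 1)); first by rewrite ltrDl.
  have -> : K + 1 = ((K + 1) `^ (1 - al)^-1) `^ (1 - al).
    by rewrite -powRrM mulVf ?gt_eqF// powRr1// addr_ge0// ltW.
  by apply: ge0_ler_powR; rewrite ?nnegrE ?powR_ge0 ?(ltW u0') ?(ltW a1).
have /andP[_ hu] := h u uu0.
have su : ls p * u <= ph p u.
  rewrite phE -addrA addrCA lerDl addr_ge0 ?lm_ge0//.
  apply: I_ge0 => v; have [v0|v0] := leP v 0; first by rewrite lq_eq0// mulr0.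
  by rewrite mulr_ge0 ?lq_ge0//; have /andP[] := one_subE_le (ltW u0') v0.
have := le_trans su hu; rewrite leNgt => /negP; apply.
have e : u = u `^ al * u `^ (1 - al).
  rewrite -powRD; last by rewrite (gt_eqF u0') implybT.
  by rewrite [al + _]addrC subrK powRr1// ltW.
have p0 : 0 < u `^ al by rewrite powR_gt0.
rewrite [ltRHS](_ : _ = u `^ al * (ls p * u `^ (1 - al))); last by rewrite {1}e; ring.
rewrite [ltLHS](_ : _ = u `^ al * (ls p * K)); last by rewrite /K; field; rewrite gt_eqF.
by rewrite ltr_pM2l// ltr_pM2l.
Qed.

Variable bn : nat -> R.
Hypotheses (bn0 : forall n, 0 < bn n) (bny : bn n @[n --> \oo] --> +oo).

Lemma powR_cvgy : bn n `^ al @[n --> \oo] --> +oo.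
Proof.
apply/cvgryPge => A; near=> n.
apply: (@le_trans _ _ `|A|); first exact: ler_norm.
have -> : `|A| = (`|A| `^ al^-1) `^ al by rewrite -powRrM mulVf ?gt_eqF// powRr1.
apply: ge0_ler_powR; rewrite ?nnegrE ?powR_ge0 ?(ltW al0) ?(ltW (bn0 n))//.
near: n; move/cvgryPge : bny; apply.
Unshelve. all: by end_near.
Qed.

Lemma cst_scaled_cvg (k : R) : k / (C * bn n `^ al) @[n --> \oo] --> 0.
Proof.
apply/cvgr0Pnorm_le => e e0; near=> n.
have b0 : 0 < bn n `^ al by rewrite powR_gt0.
have D0 : 0 < C * bn n `^ al by rewrite mulr_gt0.
rewrite normrM normfV (gtr0_norm D0) ler_pdivrMr// mulrA -ler_pdivrMl ?mulr_gt0//.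
near: n; move/cvgryPge : powR_cvgy; apply.
Unshelve. all: by end_near.
Qed.

Lemma scaled_cvg c : 0 <= c -> ph p (c * bn n) / (C * bn n `^ al) @[n --> \oo] --> c `^ al.
Proof.
rewrite le_eqVlt => /predU1P[<-|c0].
  rewrite powR0 ?gt_eqF//; under eq_fun do rewrite mul0r.
  exact: cst_scaled_cvg.
have cy : c * bn n @[n --> \oo] --> +oo.
  apply/cvgryPge => A; near=> n; rewrite -ler_pdivrMl//; near: n; move/cvgryPge : bny; apply.
have h := @cvg_comp _ _ _ (fun n => c * bn n) (fun u => ph p u / (C * u `^ al)) _ _ _ cy reg.
rewrite (_ : (fun n => _) = (fun n => c `^ al * (ph p (c * bn n) / (C * (c * bn n) `^ al)))); last first.
  apply/funext => n; have b0 : 0 < bn n `^ al by rewrite powR_gt0.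
  have ca : 0 < c `^ al by rewrite powR_gt0.
  rewrite powRM ?(ltW c0) ?(ltW (bn0 n))//; move: (ph p _) (bn n `^ al) (c `^ al) b0 ca => z w k w0 k0.
  by field; rewrite !gt_eqF.
by rewrite -[X in _ --> X]mulr1; apply: cvgMr.
Unshelve. all: by end_near.
Qed.

Variable y : R.
Hypothesis y0 : 0 < y.

(** Up to the factor 1 / (C b ^ al), the measures (1 - exp (- y b v / 2)) q v have moments
    converging to those of the model [stable], by [ph_increment] and regular variation. The transfer
    lemma then applies to the two quotients of [osc_factor]. *)
Lemma phi_scaled_cvg :
  (phiR p (bn n * y) (bn n) - lm p) / (C * bn n `^ al) @[n --> \oo] --> phiR S y 1 / ph S 1 /\
  phiI p (bn n * y) (bn n) / (C * bn n `^ al) @[n --> \oo] --> phiI S y 1 / ph S 1.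
Proof.
have s0 := no_gaussian; have h0 : 0 < y / 2 by rewrite divr_gt0.
have J0 : 0 < ph S 1 by exact: ph_gt0.
have D0 n : 0 < C * bn n `^ al by rewrite mulr_gt0 ?powR_gt0.
pose sb n v := expR (- (y / 2 * bn n * v)); pose s v := expR (- (y / 2 * 1 * v)).
pose rb n v := (C * bn n `^ al)^-1 * ((1 - sb n v) * q v).
pose r v := (ph S 1)^-1 * ((1 - s v) * lq S v).
have hb n : 0 < y / 2 * bn n by rewrite mulr_gt0.
have h1 : 0 < y / 2 * 1 by rewrite mulr1.
have irb n : itg (rb n) by apply: itgZ; exact: (itg_ph p (ltW (hb n))).
have ir : itg r by apply: itgZ; exact: (itg_ph S (ltW h1)).
have e01 (u v : R) : 0 < u -> 0 < v -> 0 < expR (- (u * v)) < 1.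
  by move=> u0 v0; rewrite expR_gt0 expR_lt1 oppr_lt0 mulr_gt0.
have nn (p0 : levy R) (k u v : R) : 0 <= k -> 0 < u -> 0 <= k * ((1 - expR (- (u * v))) * lq p0 v).
  move=> k0 u0; rewrite mulr_ge0//; have [v0|v0] := leP v 0; first by rewrite lq_eq0// mulr0.
  by rewrite mulr_ge0 ?lq_ge0// subr_ge0; have /andP[_ /ltW] := e01 u v u0 v0.
have rb0 n v : 0 <= rb n v by apply: nn => //; rewrite invr_ge0 ltW.
have r0 v : 0 <= r v by apply: nn => //; rewrite invr_ge0 ltW.
have rbn n v : v <= 0 -> rb n v = 0 by move=> v0; rewrite /rb lq_eq0// !mulr0.
have rn v : v <= 0 -> r v = 0 by move=> v0; rewrite /r lq_eq0// !mulr0.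
have pS c : 0 <= c -> ph S c = c `^ al * ph S 1.
  rewrite le_eqVlt => /predU1P[<-|c0]; last exact: ph_stable.
  by rewrite (ph_zero S) powR0 ?mul0r// gt_eqF.
have mom j : I (fun v => sb n v ^+ j * rb n v) @[n --> \oo] --> I (fun v => s v ^+ j * r v).
  have eL n : I (fun v => sb n v ^+ j * rb n v) =
      ph p (j.+1%:R * (y / 2) * bn n) / (C * bn n `^ al) - ph p (j%:R * (y / 2) * bn n) / (C * bn n `^ al).
    rewrite -mulrBl -(mulrA j.+1%:R) -(mulrA j%:R) -(ph_increment s0 j (ltW (hb n))) mulrC -I_Z.
      by apply: I_eq => v; rewrite /rb /sb mulrCA.
    apply: (expr01_itg j); [by rewrite /sb; meas|exact: (itg_ph p (ltW (hb n)))| | |].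
    - by move=> v; have := nn p 1 _ v ler01 (hb n); rewrite mul1r.
    - by move=> v v0; exact: e01.
    - by move=> v v0; rewrite lq_eq0// mulr0.
  have eR : I (fun v => s v ^+ j * r v) = (j.+1%:R * (y / 2)) `^ al - (j%:R * (y / 2)) `^ al.
    have z0 k : 0 <= k%:R * (y / 2) by rewrite mulr_ge0// ltW.
    transitivity ((ph S 1)^-1 * (ph S (j.+1%:R * (y / 2 * 1)) - ph S (j%:R * (y / 2 * 1)))).
      rewrite -(ph_increment (erefl : ls S = 0) j (ltW h1)) -I_Z.
        by apply: I_eq => v; rewrite /r /s mulrCA.
      apply: (expr01_itg j); [by rewrite /s; meas|exact: (itg_ph S (ltW h1))| | |].
      - by move=> v; have := nn S 1 _ v ler01 h1; rewrite mul1r.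
      - by move=> v v0; exact: e01.
      - by move=> v v0; rewrite lq_eq0// mulr0.
    rewrite (mulr1 (y / 2)) (pS _ (z0 j.+1)) (pS _ (z0 j)).
    move: ((j.+1%:R * (y / 2)) `^ al) ((j%:R * (y / 2)) `^ al) (ph S 1) J0 => a1 a2 J J00.
    by field; rewrite gt_eqF.
  rewrite eR (funext eL : (fun n => I (fun v => sb n v ^+ j * rb n v)) = _).
  by apply: cvgB; apply: scaled_cvg; rewrite mulr_ge0// ltW.
have c0 : 0 < (y / 2)^-1 by rewrite invr_gt0.
pose FR (u : R) := (1 - u ^+ 2 * cos ((y / 2)^-1 * ln u)) / (1 - u).
pose FI (u : R) := (- (u ^+ 2 * sin ((y / 2)^-1 * ln u))) / (1 - u).
have trans F : (forall s t, 0 < s < 1 -> 0 < t < 1 ->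
      `|F s - F t| <= (2 + 3 * (y / 2)^-1 + (y / 2)^-1 ^+ 2) / 2 * `|s - t|) ->
    (forall n, itg (fun v => F (sb n v) * ((1 - sb n v) * q v))) ->
    itg (fun v => F (s v) * ((1 - s v) * lq S v)) ->
    I (fun v => F (sb n v) * ((1 - sb n v) * q v)) / (C * bn n `^ al) @[n --> \oo] -->
    I (fun v => F (s v) * ((1 - s v) * lq S v)) / ph S 1.
  move=> hF iFn iF.
  have en n v : F (sb n v) * rb n v = (C * bn n `^ al)^-1 * (F (sb n v) * ((1 - sb n v) * q v)).
    by rewrite /rb mulrCA.
  have e v : F (s v) * r v = (ph S 1)^-1 * (F (s v) * ((1 - s v) * lq S v)) by rewrite /r mulrCA.
  have := @lipschitz_transfer R sb rb s r _ _ irb ir rb0 r0 _ _ rbn rn mom F _ (osc_L_ge0 c0) hF.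
  rewrite (I_eq e) I_Z// [_^-1 * _]mulrC.
  rewrite (_ : (fun n => I (fun v => F (sb n v) * rb n v)) =
    (fun n => I (fun v => F (sb n v) * ((1 - sb n v) * q v)) / (C * bn n `^ al))); last first.
    by apply/funext => n; rewrite (I_eq (en n)) I_Z// mulrC.
  apply.
  - by move=> n; rewrite /sb; meas.
  - by rewrite /s; meas.
  - by move=> n v v0; exact: e01.
  - by move=> v v0; exact: e01.
  - by move=> n; apply: itg_eq (itgZ (C * bn n `^ al)^-1 (iFn n)) => v; rewrite en.
  - by apply: itg_eq (itgZ (ph S 1)^-1 iF) => v; rewrite e.
have oS := osc_integrals (erefl : ls S = 0) y0 ltr01.
have on n := osc_integrals s0 y0 (bn0 n).
split.
- have h := trans FR (fun s t h1 h2 => proj1 (osc_lipschitz c0 h1 h2)).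
  move: h; case: oS => i1 _ e1 _; rewrite e1 mul1r subr0 => h.
  rewrite (_ : (fun n => _) = (fun n => I (fun v => FR (sb n v) * ((1 - sb n v) * q v)) / (C * bn n `^ al))).
    by apply: h => // n; case: (on n).
  by apply/funext => n; case: (on n) => _ _ -> _.
- have h := trans FI (fun s t h1 h2 => proj2 (osc_lipschitz c0 h1 h2)).
  move: h; case: oS => _ i1 _ e1; rewrite e1 mul1r => h.
  rewrite (_ : (fun n => _) = (fun n => I (fun v => FI (sb n v) * ((1 - sb n v) * q v)) / (C * bn n `^ al))).
    by apply: h => // n; case: (on n).
  by apply/funext => n; case: (on n) => _ _ _ ->.
Qed.

(** The drift, subtracted in [phi_scaled_cvg], is negligible against b ^ al; the limit of the ratio
    is that of the model, |(y + i) / y| ^ al. *)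
Lemma lnr_cvg : lnr p (bn n) y @[n --> \oo] --> al * logr y.
Proof.
have [cR cI] := phi_scaled_cvg.
have J0 : 0 < ph S 1 by exact: ph_gt0.
have ya : 0 < y `^ al by rewrite powR_gt0.
have D0 n : 0 < C * bn n `^ al by rewrite mulr_gt0 ?powR_gt0.
have cR' : phiR p (bn n * y) (bn n) / (C * bn n `^ al) @[n --> \oo] --> phiR S y 1 / ph S 1.
  rewrite (_ : (fun n => _) = (fun n => (phiR p (bn n * y) (bn n) - lm p) / (C * bn n `^ al) + lm p / (C * bn n `^ al))).
    rewrite -[X in _ --> X]addr0; apply: cvgD => //; exact: cst_scaled_cvg.
  by apply/funext => n; rewrite -mulrDl subrK.
have cN : phN p (bn n * y) (bn n) / (C * bn n `^ al) @[n --> \oo] --> phN S y 1 / ph S 1.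
  have eN (a b D : R) : 0 < D -> norm2 a b / D = Num.sqrt ((a / D) ^+ 2 + (b / D) ^+ 2).
    by move=> Dp; rewrite -norm2E ![_ / D]mulrC norm2Z ger0_norm// invr_ge0 ltW.
  rewrite (_ : (fun n => _) = (fun n => Num.sqrt ((phiR p (bn n * y) (bn n) / (C * bn n `^ al)) ^+ 2 +
     (phiI p (bn n * y) (bn n) / (C * bn n `^ al)) ^+ 2))); last first.
    by apply/funext => n; rewrite phNE eN.
  rewrite phNE eN//; apply: continuous_cvg; first exact: sqrt_continuous.
  by apply: cvgD; rewrite !expr2; under eq_fun do rewrite expr2; apply: cvgM.
have cP := scaled_cvg (ltW y0).
have rE : expR (al * logr y) = phN S y 1 / ph S 1 / (y `^ al).
  rewrite -(ratio_stable al0 al1 y0) ratioE (ph_stable al0 al1 y0).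
  by move: (phN _ _ _) (y `^ al) (ph S 1) ya J0 => a b c b0 c0; field; rewrite !gt_eqF.
have cr : ratio p (bn n * y) (bn n) @[n --> \oo] --> expR (al * logr y).
  rewrite rE (_ : (fun n => _) = (fun n => phN p (bn n * y) (bn n) / (C * bn n `^ al) / (ph p (y * bn n) / (C * bn n `^ al)))).
    by apply: cvgM => //; apply: cvgV => //; rewrite gt_eqF.
  apply/funext => n; rewrite ratioE [bn n * y]mulrC.
  have : 0 < ph p (y * bn n) by apply: ph_gt0; rewrite mulr_gt0.
  move: (phN _ _ _) (ph p _) (C * _) (D0 n) => a b D Dp b0; by field; rewrite !gt_eqF.
rewrite -[X in _ --> X]expRK.
rewrite (_ : (fun n => _) = (fun n => ln (ratio p (bn n * y) (bn n)))); last first.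
  by apply/funext => n; rewrite lnrE (stp1 y0) mul1r.
by apply: continuous_cvg => //; apply: continuous_ln; exact: expR_gt0.
Qed.

End RegularVariation.

(** * Decay at infinity *)

Section FactorialBounds.
Variable R : realType.

(** The induction rests on (1 - 1 / (n + 2)) ^ (n + 2) <= exp (- 1). *)
Lemma fact_le (n : nat) : (n.+1`!)%:R <= n.+1%:R ^+ n.+2 * expR (1 - n.+1%:R) :> R.
Proof.
elim: n => [|n IH]; first by rewrite subrr expR0 mulr1 expr1n.
have n0 : 0 < n.+1%:R :> R by [].
have m0 : 0 < n.+2%:R :> R by [].
have h : n.+1%:R ^+ n.+2 * expR 1 <= n.+2%:R ^+ n.+2 :> R.
  have h1 : n.+1%:R / n.+2%:R <= expR (- n.+2%:R^-1) :> R.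
    apply: le_trans (expR_ge1Dx _); rewrite le_eqVlt; apply/orP; left; apply/eqP.
    rewrite [n.+1%:R](_ : _ = n.+2%:R - 1); last by rewrite -[n.+2%:R]natr1 addrK.
    by rewrite mulrBl mul1r divff// pnatr_eq0.
  have h2 : (n.+1%:R / n.+2%:R) ^+ n.+2 <= expR (- 1) :> R.
    have -> : expR (- 1) = expR (- n.+2%:R^-1) ^+ n.+2 :> R.
      by rewrite -expRM_natl mulrN divff// pnatr_eq0.
    by rewrite lerXn2r ?nnegrE ?expR_ge0 ?divr_ge0.
  rewrite expr_div_n ler_pdivrMr ?exprn_gt0// expRN in h2.
  by rewrite -ler_pdivlMr ?expR_gt0// mulrC.
rewrite factS natrM; apply: (le_trans (ler_wpM2l (ltW m0) IH)).
have -> : expR (1 - n.+1%:R) = expR 1 * expR (1 - n.+2%:R) :> R.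
  by rewrite -expRD -[n.+2%:R]natr1; congr expR; ring.
rewrite [n.+2%:R ^+ n.+3]exprS -[leRHS]mulrA ler_pM2l// mulrA; apply: ler_wpM2r => //; exact: expR_ge0.
Qed.

(** Stirling's bound at n equal to the integral part of X: the quotient is at most n exp (1 - n), of
    order X exp (- X), and eta absorbs the factor X. For X < 1 take n = 0. *)
Lemma fact_small (eta : R) : 0 < eta -> eta < 1 -> exists2 K, 0 < K &
  forall X : R, 0 < X -> exists n : nat, (n`!)%:R / X ^+ n <= K * expR (- ((1 - eta) * X)).
Proof.
move=> e0 e1; have K0 : 0 < expR 2 / eta by rewrite divr_gt0 ?expR_gt0.
exists (expR 2 / eta) => // X X0; have [X1|X1] := ltP X 1.
  exists 0%N; rewrite expr0 divr1 -mulrA mulrC -mulrA -expRD mulrC ler_pdivlMr// mul1r.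
  apply: (le_trans (ltW e1)); rewrite -[leLHS]expR0 ler_expR.
  have : (1 - eta) * X <= 1 by nra.
  lra.
have t1 : (0 < Num.truncn X)%N by rewrite truncn_gt0.
have t2 : (Num.truncn X)%:R <= X by rewrite truncn_le ltW.
have t3 := truncnS_gt X.
move: (Num.truncn X) t1 t2 t3 => [//|n] _ t2 t3; exists n.+1.
have n0 : 0 < n.+1%:R :> R by [].
have nn : 0 < n.+1%:R ^+ n.+1 :> R by rewrite exprn_gt0.
apply: (@le_trans _ _ (n.+1%:R * expR (1 - n.+1%:R))).
  rewrite ler_pdivrMr ?exprn_gt0//; apply: (le_trans (fact_le n)).
  rewrite exprS mulrAC ler_pM2l ?mulr_gt0 ?expR_gt0//.
  by rewrite lerXn2r ?nnegrE ?(ltW X0)// ltW.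
apply: (@le_trans _ _ (X * expR (2 - X))).
  apply: ler_pM; rewrite ?expR_ge0// ler_expR; move: t3; rewrite -natr1; lra.
have h : eta * X <= expR (eta * X) by apply: le_trans (expR_ge1Dx _); lra.
have -> : expR 2 / eta * expR (- ((1 - eta) * X)) = expR (eta * X) / eta * expR (2 - X).
  rewrite mulrAC -expRD [in RHS]mulrAC -expRD; congr (expR _ / _); ring.
by apply: ler_wpM2r; rewrite ?expR_ge0// ler_pdivlMr// mulrC.
Qed.

Lemma eventually_nonincr (x : nat -> R) n0 : (forall n, 0 <= x n) ->
  (forall n, (n0 <= n)%N -> x n.+1 <= x n) -> exists2 K, 0 < K & forall n, x n <= K.
Proof.
move=> x0 xd; have S0 : 0 <= \sum_(k < n0.+1) x k by apply: sumr_ge0.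
exists (\sum_(k < n0.+1) x k + 1); first by rewrite ltr_wpDl.
have small n : (n <= n0)%N -> x n <= \sum_(k < n0.+1) x k.
  rewrite -ltnS => h; rewrite (bigD1 (Ordinal h))//= lerDl; exact: sumr_ge0.
move=> n; apply: (@le_trans _ _ (\sum_(k < n0.+1) x k)); last by rewrite lerDl.
elim: n => [|n IH]; first exact: small.
have [h|h] := leqP n.+1 n0; first exact: small.
by apply: le_trans IH; apply: xd.
Qed.

End FactorialBounds.

Section NAlpha.
Variables (R : realType) (p : levy R) (al C : R).
Hypotheses (al0 : 0 < al) (al1 : al < 1) (C0 : 0 < C).
Hypothesis reg : ph p u / (C * u `^ al) @[u --> +oo] --> (1 : R).
Variable L : law p.
Local Notation st := (@stp R).
Local Notation nu := (dens L).

(** Only pointwise convergence of [lnr] along sequences is known. Dominated convergence applied to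
    the positive part of al [logr] - [lnr], integrated over the whole half-line, makes the error
    uniform in the cut c; a contradiction argument passes from sequences to all large b. *)
Lemma tail_lower e : 0 < e -> exists2 b0 : R, 0 < b0 &
  forall b c, b0 <= b -> 0 < c -> al * (pi / 2 - Glog c) - e <= Tail p b c.
Proof.
move=> e0; have ms := @stp_meas R; have ml := @logr_meas R.
have [ilog _] := @logr_total R.
pose pos b y := Num.max (st y * (al * logr y) - lnr p b y) 0.
have sl y : 0 <= st y * (al * logr y) by rewrite mulr_ge0 ?stp_ge0// mulr_ge0 ?logr_ge0// ltW.
have mpos b : 0 <= b -> measurable_fun setT (pos b).
  by move=> b0; have mb := lnr_meas p b0; rewrite /pos; meas.
have pos_le b y : 0 < b -> `|pos b y| <= al * (st y * logr y).
  move=> b0; rewrite ger0_norm; last by rewrite /pos le_max lexx orbT.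
  rewrite mulrCA /pos ge_max sl andbT lerBlDr lerDl; exact: lnr_ge0.
have ipos b : 0 < b -> itg (pos b).
  by move=> b0; apply: (itg_dom (mpos b (ltW b0)) (itgZ al ilog)) => y; exact: pos_le.
have [b0 b00 hb] : exists2 b0 : R, 0 < b0 & forall b, b0 <= b -> I (pos b) <= e.
  apply: contrapT => h.
  have /choice[bn hbn] : forall n : nat, exists b : R, n.+1%:R <= b /\ e < I (pos b).
    move=> n; apply: contrapT => h2; apply: h; exists n.+1%:R => // b nb.
    by rewrite leNgt; apply/negP => eb; apply: h2; exists b.
  have bn0 n : 0 < bn n by have [h1 _] := hbn n; exact: lt_le_trans h1.
  have bny : bn n @[n --> \oo] --> +oo.
    apply/cvgryPge => A; near=> n; have [h1 _] := hbn n; apply: le_trans h1.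
    rewrite -natr1 (@le_trans _ _ n%:R)// ?lerDl//; near: n; exact: nbhs_infty_ger.
  have [_ c0] : itg (fun=> 0 : R) /\ I (pos (bn n)) @[n --> \oo] --> I (fun=> 0 : R).
    apply: (I_dct (g := fun y => al * (st y * logr y))).
    - by move=> n; apply: mpos; exact: ltW.
    - move=> y; have [y0|y0] := leP y 0.
        apply: cvg_near_cst; apply: nearW => n.
        by rewrite /pos lnrE (stp0 y0) !mul0r subr0 maxxx.
      have c : st y * (al * logr y) - lnr p (bn n) y @[n --> \oo] --> (0 : R).
        rewrite (stp1 y0) mul1r -(subrr (al * logr y)); apply: cvgB; first exact: cvg_cst.
        exact: (lnr_cvg al0 al1 C0 reg bn0 bny y0).
      apply/cvgr0Pnorm_le => d d0; near=> n.
      apply: (@le_trans _ _ `|st y * (al * logr y) - lnr p (bn n) y|).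
        by rewrite /pos /Num.max; case: ifP => _; rewrite ?normr0.
      by near: n; move/cvgr0Pnorm_le : c; apply.
    - exact: itgZ.
    - by move=> n y; exact: pos_le.
  rewrite I0 in c0; move/cvgrPdist_lt : c0 => /(_ e e0) [N _ hN].
  have := hN N (leqnn _); rewrite /= sub0r normrN ger0_norm; last first.
    by apply: I_ge0 => y; rewrite /pos le_max lexx orbT.
  by have [_ /lt_trans h1] := hbn N; move=> /h1; rewrite ltxx.
exists b0 => // b c bb cc; have b1 : 0 < b by exact: lt_le_trans bb.
have [i1 e1] := logr_tail cc.
rewrite -e1 -I_Z// TailE lerBlDr; apply: le_trans (lerD (lexx _) (hb b bb)).
rewrite -I_D; [|exact: Tail_itg|exact: ipos].
apply: I_le; [exact: itgZ|by apply: itgD; [exact: Tail_itg|exact: ipos]|].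
move=> y; have [yc|yc] := leP (y - c) 0.
  by rewrite (stp0 yc) !mul0r mulr0 add0r /pos le_max lexx orbT.
have y0 : 0 < y by have := cc; lra.
rewrite (stp1 yc) !mul1r -lerBlDl /pos le_max (stp1 y0) mul1r lexx; done.
Unshelve. all: by end_near.
Qed.

(** Unlike in [MN_decay], the constant is independent of n, which allows n to be optimized later.
    The tangent bound on [Glog ((n + 1) / b)] converts the cut of the integral into the geometric
    factor sin th ^ (- al (n + 1)). *)
Lemma MN_star th e : 0 < th < pi / 2 -> 0 < e -> exists2 K, 0 < K & forall n b, 0 < b ->
  MN L n b <= K * Mo L n * (sin th `^ (- al)) ^+ n.+1 * expR (- ((al * (pi / 2 - th) - e) * b)).
Proof.
move=> hth e0; have [b0 b00 hb] := tail_lower e0.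
have s0 : 0 < sin th := sin_gt0_pihalf hth.
have [th0 th1] := andP hth.
have pi20 : 0 < pi / 2 :> R := lt_trans th0 th1.
exists (expR (al * (pi / 2) * b0)); first exact: expR_gt0.
move=> n b bp; have M0 := Mo_gt0 L n.
have siE : (sin th `^ (- al)) ^+ n.+1 = expR (n.+1%:R * (- al * ln (sin th))).
  by rewrite expRM_natl /powR gt_eqF.
have ls0 : ln (sin th) <= 0 by apply: ln_le0; exact: sin_le1.
have si1 : 1 <= (sin th `^ (- al)) ^+ n.+1.
  by rewrite siE -[leLHS]expR0 ler_expR mulr_ge0// mulNr -mulrN mulr_ge0 ?oppr_ge0// ltW.
have [bb|bb] := leP b0 b; last first.
  apply: (le_trans (MN_le_Mo L n b)).
  rewrite [leRHS](_ : _ = Mo L n * ((sin th `^ (- al)) ^+ n.+1 * (expR (al * (pi / 2) * b0) *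
    expR (- ((al * (pi / 2 - th) - e) * b))))); last by ring.
  rewrite ler_peMr ?(ltW M0)// mulr_ege1// -expRD -[leLHS]expR0 ler_expR.
  have h1 : al * (pi / 2) * b <= al * (pi / 2) * b0 by rewrite ler_pM2l; [exact: ltW|exact: mulr_gt0].
  have h2 : 0 <= al * th * b by rewrite !mulr_ge0// ltW.
  have h3 : 0 <= e * b by rewrite mulr_ge0// ltW.
  have -> : (al * (pi / 2 - th) - e) * b = al * (pi / 2) * b - al * th * b - e * b by ring.
  by lra.
apply: (le_trans (MN_le_Tail L n bp)).
have c0 : 0 < n.+1%:R / b by rewrite divr_gt0.
have h1 := hb b _ bb c0; have h2 := Glog_le hth c0.
rewrite siE [leRHS](_ : _ = Mo L n * (expR (al * (pi / 2) * b0) * expR (n.+1%:R * (- al * ln (sin th))) *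
  expR (- ((al * (pi / 2 - th) - e) * b)))); last by move: (expR _) (expR _) (expR _) => a1 a2 a3; ring.
rewrite ler_pM2l// -!expRD ler_expR.
have h3 : b * (al * (pi / 2 - (th - n.+1%:R / b * ln (sin th))) - e) <= b * Tail p b (n.+1%:R / b).
  rewrite ler_pM2l//; apply: le_trans h1; rewrite lerD2r ler_pM2l// lerD2l lerN2 //.
have h4 : 0 <= al * (pi / 2) * b0 by apply: mulr_ge0; [apply: mulr_ge0|]; exact: ltW.
have e1 : b * (al * (pi / 2 - (th - n.+1%:R / b * ln (sin th))) - e) =
  (al * (pi / 2 - th) - e) * b + n.+1%:R * (al * ln (sin th)).
  by move: (ln _) (pi / 2) => l z; field; rewrite gt_eqF.
rewrite e1 in h3; rewrite mulNr mulrN.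
move: h3 h4; move: (b * Tail _ _ _) (n.+1%:R * _) (_ * b) (_ * b0) => z1 z2 z3 z4; lra.
Qed.

Lemma NAlpha_decay n t : 0 < t -> t < pi / 2 * al ->
  exists2 A, 0 < A & forall b, 0 < b -> MN L n b <= A * expR (- (t * b)).
Proof.
(* The gap pi al / 2 - t is shared equally, al th = e. *)
move=> t0 ht; pose th := (pi / 2 - t / al) / 2; pose e := (pi / 2 * al - t) / 2.
have e0 : 0 < e by rewrite divr_gt0// subr_gt0.
have tal : 0 < t / al by rewrite divr_gt0.
have th1 : 0 < pi / 2 - t / al by rewrite subr_gt0 ltr_pdivrMr.
have hth : 0 < th < pi / 2 by rewrite /th; apply/andP; split; lra.
have [K K0 hK] := MN_star hth e0.
have s0 : 0 < sin th := sin_gt0_pihalf hth.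
exists (K * Mo L n * (sin th `^ (- al)) ^+ n.+1).
  by rewrite !mulr_gt0 ?Mo_gt0// exprn_gt0// powR_gt0.
move=> b b0; apply: (le_trans (hK n b b0)).
rewrite (_ : al * (pi / 2 - th) - e = t)// /th /e.
by move: (pi / 2) => z; field; rewrite gt_eqF.
Qed.

(** The ratio of consecutive moments is phi (n + 1), eventually at most (1 + e) C (n + 1) ^ al, so
    the quotient of both sides is eventually nonincreasing. *)
Lemma Mo_le e : 0 < e -> exists2 K, 0 < K & forall n, Mo L n <= K * ((C * (1 + e)) ^+ n * (n`!)%:R `^ al).
Proof.
move=> e0; have [u0 u00 hu] := ph_between C0 reg e0.
have A0 : 0 < C * (1 + e) by rewrite mulr_gt0// addr_gt0.
have D0 n : 0 < (C * (1 + e)) ^+ n * (n`!)%:R `^ al.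
  by rewrite mulr_gt0 ?exprn_gt0// powR_gt0// ltr0n fact_gt0.
have [||K K0 hK] := @eventually_nonincr R (fun n => Mo L n / ((C * (1 + e)) ^+ n * (n`!)%:R `^ al)) (Num.bound u0).
- by move=> n; rewrite divr_ge0 ?(ltW (D0 n))// ltW// Mo_gt0.
- move=> n hn; have nu0 : u0 <= n.+1%:R.
    apply: (le_trans (ltW (archi_boundP (ltW u00)))); rewrite ler_nat; exact: leqW.
  have /andP[_ h] := hu _ nu0.
  rewrite ler_pdivrMr ?D0// Mo_rec.
  have -> : (C * (1 + e)) ^+ n.+1 * (n.+1`!)%:R `^ al =
     ((1 + e) * (C * n.+1%:R `^ al)) * ((C * (1 + e)) ^+ n * (n`!)%:R `^ al).
    by rewrite factS natrM powRM// exprS; ring.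
  rewrite mulrCA divfK ?gt_eqF ?D0//; apply: ler_wpM2r => //; exact: ltW (Mo_gt0 L n).
by exists K => // n; rewrite -ler_pdivrMr ?D0.
Qed.

Lemma Mo_ge e : 0 < e -> e < 1 -> exists2 K, 0 < K & forall n, K * ((C * (1 - e)) ^+ n * (n`!)%:R `^ al) <= Mo L n.
Proof.
move=> e0 e1; have [u0 u00 hu] := ph_between C0 reg e0.
have A0 : 0 < C * (1 - e) by rewrite mulr_gt0// subr_gt0.
have D0 n : 0 < (C * (1 - e)) ^+ n * (n`!)%:R `^ al.
  by rewrite mulr_gt0 ?exprn_gt0// powR_gt0// ltr0n fact_gt0.
have [||K K0 hK] := @eventually_nonincr R (fun n => ((C * (1 - e)) ^+ n * (n`!)%:R `^ al) / Mo L n) (Num.bound u0).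
- by move=> n; rewrite divr_ge0 ?(ltW (D0 n))// ltW// Mo_gt0.
- move=> n hn; have nu0 : u0 <= n.+1%:R.
    apply: (le_trans (ltW (archi_boundP (ltW u00)))); rewrite ler_nat; exact: leqW.
  have /andP[h _] := hu _ nu0.
  rewrite ler_pdivrMr ?Mo_gt0// Mo_rec.
  have -> : (C * (1 - e)) ^+ n.+1 * (n.+1`!)%:R `^ al =
     ((1 - e) * (C * n.+1%:R `^ al)) * ((C * (1 - e)) ^+ n * (n`!)%:R `^ al).
    by rewrite factS natrM powRM// exprS; ring.
  rewrite [leRHS](_ : _ = ph p n.+1%:R * ((C * (1 - e)) ^+ n * (n`!)%:R `^ al)).
    by apply: ler_wpM2r => //; exact: ltW (D0 n).
  by move: (_ * _ `^ al) (Mo L n) (Mo_gt0 L n) => a b b0; field; rewrite gt_eqF.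
exists K^-1; first by rewrite invr_gt0.
by move=> n; rewrite ler_pdivrMl// -ler_pdivrMr ?Mo_gt0.
Qed.

Variable f : R -> R.
Hypothesis fnu : forall x, 0 < x -> f x = nu x.

(* The bound is [w_bound] with the moment order [n] close to
   [(y / D) ^ (1 / al)], which minimizes [n! ^ al (D / y) ^ n]. *)
Lemma w_large (th e t d eta : R) : 0 < th < pi / 2 -> 0 < e -> 0 < t < pi / 2 ->
  t < al * (pi / 2 - th) - e -> 0 < d -> 0 < eta -> eta < 1 ->
  exists2 K, 0 < K & forall j y, 0 < y -> y * `|w f j y| <= K * ((1 + d) / sin t) ^+ j *
    expR (- (al * (1 - eta) * (y / (C * (1 + e) * ((1 + d^-1) * sin th `^ (- al)))) `^ al^-1)).
Proof.
move=> hth e0 ht tk d0 eta0 eta1.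
set si := sin th `^ (- al); set B := (1 + d^-1) * si; set D := C * (1 + e) * B.
have si0 : 0 < si by rewrite powR_gt0// sin_gt0_pihalf.
have d1 : 0 < 1 + d^-1 by rewrite addr_gt0 ?invr_gt0.
have B0 : 0 < B by rewrite mulr_gt0.
have A0 : 0 < C * (1 + e) by rewrite mulr_gt0// addr_gt0.
have D0 : 0 < D by rewrite mulr_gt0.
have [K1 K10 h1] := MN_star hth e0; have [K2 K20 h2] := Mo_le e0.
have [K3 K30 h3] := fact_small eta0 eta1.
move: (al * (pi / 2 - th) - e) tk h1 => k tk h1.
have [t0 _] := andP ht; have k0 : 0 < k := lt_trans t0 tk.
have st0 : 0 < sin t := sin_gt0_pihalf ht.
have Pk : 0 < pi * (k - t) by rewrite mulr_gt0 ?pi_gt0// subr_gt0.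
have r0 : 0 < (1 + d) / sin t by rewrite divr_gt0// addr_gt0.
exists (K1 * K2 * B / (pi * (k - t)) * K3 `^ al).
  by rewrite mulr_gt0 ?powR_gt0// divr_gt0// !mulr_gt0.
move=> j y y0.
pose X := (y / D) `^ al^-1; have X0 : 0 < X by rewrite powR_gt0// divr_gt0.
have XE : X `^ al = y / D by rewrite -powRrM mulVf ?gt_eqF// powRr1// ltW// divr_gt0.
have [n hn] := h3 X X0.
have M0 := Mo_gt0 L n.
have wb := @w_bound R p L n (K1 * Mo L n * si ^+ n.+1) k _ k0 (h1 n) f t d fnu ht tk d0 j y y0.
have {}wb : y ^+ n.+1 * `|w f j y| <= K1 * Mo L n * si ^+ n.+1 / (pi * (k - t)) *
    ((1 + d) ^+ j * (1 + d^-1) ^+ n.+1) * (sin t ^+ j)^-1.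
  by apply: wb; rewrite !mulr_gt0// exprn_gt0.
have yn : 0 < y ^+ n by rewrite exprn_gt0.
rewrite -(ler_pM2l yn) mulrA -exprSr; apply: (le_trans wb).
have e1 : K1 * Mo L n * si ^+ n.+1 / (pi * (k - t)) * ((1 + d) ^+ j * (1 + d^-1) ^+ n.+1) * (sin t ^+ j)^-1
   = K1 * B / (pi * (k - t)) * ((1 + d) / sin t) ^+ j * (Mo L n * B ^+ n).
  rewrite expr_div_n /B exprMn !exprS.
  move: (pi * _) Pk (si ^+ n) ((1 + d^-1) ^+ n) (sin t ^+ j) (exprn_gt0 j st0) ((1 + d) ^+ j) (Mo L n) (1 + d^-1) => a1 a10 a2 a3 a4 a40 a5 a6 a7.
  by field; rewrite !gt_eqF.
rewrite e1.
have e2 : Mo L n * B ^+ n <= K2 * (D ^+ n * (n`!)%:R `^ al).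
  have eD : D ^+ n = (C * (1 + e)) ^+ n * B ^+ n by rewrite /D [LHS]exprMn.
  rewrite eD [leRHS](_ : _ = K2 * ((C * (1 + e)) ^+ n * (n`!)%:R `^ al) * B ^+ n); last first.
    by move: ((C * (1 + e)) ^+ n) => a; ring.
  by rewrite ler_wpM2r ?exprn_ge0 ?(ltW B0).
have e3 : D ^+ n * (n`!)%:R `^ al <= y ^+ n * (K3 `^ al * expR (- (al * (1 - eta) * X))).
  have e4 : y ^+ n = D ^+ n * (X ^+ n) `^ al.
    have -> : y = D * X `^ al by rewrite XE mulrC divfK// gt_eqF.
    rewrite exprMn; congr (_ * _).
    by rewrite -(powR_mulrn n (powR_ge0 X al)) -(powR_mulrn n (ltW X0)) -(powRrM X) -(powRrM X) mulrC.
  rewrite e4 -[leRHS]mulrA ler_pM2l ?exprn_gt0//.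
  have e5 : expR (- (al * (1 - eta) * X)) = expR (- ((1 - eta) * X)) `^ al.
    by rewrite -expRM; congr expR; ring.
  rewrite e5 -!powRM ?expR_ge0 ?(ltW K30) ?exprn_ge0 ?(ltW X0) ?mulr_ge0 ?expR_ge0 ?(ltW K30)//.
  apply: ge0_ler_powR; rewrite ?nnegrE ?(ltW al0) ?ler0n ?mulr_ge0 ?expR_ge0 ?exprn_ge0 ?(ltW X0) ?(ltW K30)//.
  by rewrite mulrC -ler_pdivrMr ?exprn_gt0.
set E := expR _ in e3 *.
have k1 : 0 <= K1 * B / (pi * (k - t)) * ((1 + d) / sin t) ^+ j.
  by apply/ltW/mulr_gt0; [apply: divr_gt0 => //; exact: mulr_gt0|exact: exprn_gt0].
apply: (le_trans (ler_wpM2l k1 (le_trans e2 (ler_wpM2l (ltW K20) e3)))).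
rewrite le_eqVlt; apply/orP; left; apply/eqP; ring.
Qed.

End NAlpha.

Section TwoZones.
Variable R : realType.

(** The integrable majorant is a power above -1 on (0, 1] and x ^ (- 2) on [1, oo). *)
Lemma wnorm_two_zones (g : R -> R) (F : nat -> R -> R) (r : nat -> R) (s K1 K2 : R) :
  -1 < s -> 0 <= K1 -> 0 <= K2 -> (forall n, 0 <= r n) ->
  (forall n, measurable_fun (`]0, +oo[%classic : set R) (fun x => `|F n x| ^+ 2 * g x)) ->
  (forall x, 0 < x -> 0 <= g x) ->
  (forall n x, 0 < x -> x <= 1 -> `|F n x| ^+ 2 * g x <= r n ^+ 2 * (K1 * x `^ s)) ->
  (forall n x, 1 <= x -> `|F n x| ^+ 2 * g x <= r n ^+ 2 * (K2 * x `^ (-2))) ->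
  exists C : R, forall n, (wnorm g (F n) <= (C * r n)%:E)%E.
Proof.
move=> s1 K10 K20 r0 mF g0 h1 h2.
pose H x : R := K1 * ((0 < x <= 1)%R%:R * x `^ s) + K2 * ((1 <= x)%R%:R * x `^ (-2)).
have iH : itg H.
  by apply: itgD; apply: itgZ; [exact: itg_pow_near0|apply: itg_pow_inf; lra].
have z1 x : 0 <= K1 * ((0 < x <= 1)%R%:R * x `^ s) by apply: mulr_ge0 => //; apply: mulr_ge0 => //; exact: powR_ge0.
have z2 x : 0 <= K2 * ((1 <= x)%R%:R * x `^ (-2)) by apply: mulr_ge0 => //; apply: mulr_ge0 => //; exact: powR_ge0.
have H0 x : 0 <= H x by apply: addr_ge0.
exists (I H `^ 2^-1) => n; apply: wnorm_le => //; first exact: itg_meas iH.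
move=> x x0; have [x1|x1] := leP x 1.
  apply: (le_trans (h1 n x x0 x1)); apply: ler_wpM2l; first exact: sqr_ge0.
  by rewrite /H x0 x1 mul1r lerDl.
apply: (le_trans (h2 n x (ltW x1))); apply: ler_wpM2l; first exact: sqr_ge0.
by rewrite /H (ltW x1) mul1r lerDr.
Qed.

Lemma powR_le_superlinear (k b : R) : 0 < k -> 1 < b -> exists M, forall x, 0 < x -> x <= k * x `^ b + M.
Proof.
move=> k0 b1; have b10 : 0 < b - 1 by rewrite subr_gt0.
exists ((k^-1) `^ (b - 1)^-1) => x x0.
have [h|h] := leP x ((k^-1) `^ (b - 1)^-1).
  by apply: (le_trans h); rewrite lerDr mulr_ge0 ?powR_ge0// ltW.
have h2 : k^-1 <= x `^ (b - 1).
  have -> : k^-1 = ((k^-1) `^ (b - 1)^-1) `^ (b - 1).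
    by rewrite -powRrM mulVf ?gt_eqF// powRr1// invr_ge0 ltW.
  by apply: ge0_ler_powR; rewrite ?nnegrE ?powR_ge0 ?(ltW x0)// ltW.
have e : x `^ b = x `^ (b - 1) * x.
  by rewrite -{3}(powRr1 (ltW x0)) -powRD ?subrK// (gt_eqF x0) implybT.
apply: (@le_trans _ _ (k * x `^ b)); last by rewrite lerDl powR_ge0.
by rewrite e mulrA ler_peMl ?(ltW x0)// mulrC -ler_pdivrMr// mul1r.
Qed.

End TwoZones.

Section PartTwoA.
Variables (R : realType) (p : classN R) (nu : R -> R) (al : R).
Hypotheses (hnu : is_nu p nu) (al0 : 0 < al) (al1 : al < 1) (hal : in_N_alpha p al).
Local Notation L := (law_of hnu).

Lemma ph_regular : exists2 C : R, 0 < C & ph (levy_of p) u / (C * u `^ al) @[u --> +oo] --> (1 : R).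
Proof.
have [C C0 h] := hal; exists C => //.
apply: cvg_trans h; apply: near_eq_cvg; near=> u.
have u0 : 0 < u by near: u; exact: nbhs_pinfty_gt.
rewrite Re_psi// powRD; last by rewrite (gt_eqF u0) implybT.
rewrite powRr1 ?ltW//; have p0 : 0 < u `^ al by rewrite powR_gt0.
move: (ph _ u) (u `^ al) p0 => a b b0.
by field; rewrite !gt_eqF.
Unshelve. all: by end_near.
Qed.

Lemma nu_dens x : 0 < x -> nu x = dens L x.
Proof. by move=> x0; rewrite /= ndensE. Qed.

Let th0 : 0 < pi / 2 * al := mulr_gt0 (divr_gt0 (pi_gt0 R) (ltr0Sn R 1)) al0.

Lemma pi2al_le : pi / 2 * al <= pi / 2 :> R.
Proof. by rewrite ler_piMr ?(ltW al1)// divr_ge0// pi_ge0. Qed.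

Lemma NAlpha_decay_of n t : 0 < t -> t < pi / 2 * al ->
  exists2 A, 0 < A & forall b, 0 < b -> MN L n b <= A * expR (- (t * b)).
Proof. by have [C C0 reg] := ph_regular; exact: (NAlpha_decay al0 al1 C0 reg L). Qed.

Lemma NAlpha_w_cont j x : 0 < x -> {for x, continuous (w nu j)}.
Proof. exact: (w_cont nu_dens th0 NAlpha_decay_of). Qed.

Lemma NAlpha_w_small T u : T_pi al < T -> itg (fun y => (1 - expR (- (u * y))) * lq (levy_of p) y) ->
  0 < ph (levy_of p) u ->
  exists2 K, 0 < K & forall j y, 0 < y -> y `^ u * `|w nu j y| <= K * expR (T * j%:R).
Proof. by move=> hT; apply: (coeigen_bound nu_dens th0 NAlpha_decay_of pi2al_le). Qed.

Lemma NAlpha_w_exp T : T_pi al < T -> exists k K, [/\ 0 < k, 0 < K &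
  forall j y, 0 < y -> y * `|w nu j y| <= K * expR (T * j%:R) * expR (- (k * y `^ al^-1))].
Proof.
move=> hT; have [C C0 reg] := ph_regular.
have [t [d [/andP[t0 tth] d0 rd]]] := choose_rate th0 pi2al_le hT.
have tp : t < pi / 2 := lt_le_trans tth pi2al_le.
pose th' : R := (pi / 2 - t / al) / 3.
have tal : 0 < t / al by rewrite divr_gt0.
have thp : 0 < pi / 2 - t / al by rewrite subr_gt0 ltr_pdivrMr.
have hth : 0 < th' < pi / 2 by rewrite /th'; apply/andP; split; lra.
have th'0 : 0 < th' by case/andP: hth.
have e0 : 0 < al * th' by rewrite mulr_gt0.
have ht : 0 < t < pi / 2 by rewrite t0.
have tk : t < al * (pi / 2 - th') - al * th'.
  have -> : al * (pi / 2 - th') - al * th' = t + (al * (pi / 2 - t / al)) / 3.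
    by rewrite /th'; move: (pi / 2) => z; field; rewrite gt_eqF.
  by rewrite ltrDl divr_gt0// mulr_gt0.
have h2 : 0 < (2^-1 : R) by rewrite invr_gt0.
have h2' : (2^-1 : R) < 1 by rewrite invf_lt1// ltr1n.
have [K K0 hK] := w_large al0 al1 C0 reg nu_dens hth e0 ht tk d0 h2 h2'.
set D := C * (1 + al * th') * _ in hK.
have D0 : 0 < D.
  rewrite /D; apply: mulr_gt0; first by rewrite mulr_gt0// addr_gt0.
  by rewrite mulr_gt0 ?addr_gt0 ?invr_gt0// powR_gt0// sin_gt0_pihalf.
exists (al * (1 - 2^-1) / D `^ al^-1), K; split; [|exact: K0|].
  by rewrite divr_gt0 ?powR_gt0// mulr_gt0// subr_gt0.
move=> j y y0; apply: (le_trans (hK j y y0)); rewrite rd -expRM_natr le_eqVlt.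
apply/orP; left; apply/eqP; congr (_ * expR (- _)).
by rewrite powRM ?invr_ge0 ?(ltW y0) ?(ltW D0)// -(powR_inv1 (ltW D0)) -powRrM mulN1r powRN mulrA mulrAC.
Qed.

Lemma part_two_a (a eps gamma : R) : 0 < eps -> 1 + al < gamma ->
  bigO_seq (fun n => wnorm (nubar gamma) (fun x => w nu n x / nubar gamma x)) (rate a (T_pi al + eps)).
Proof.
move=> e0 hg.
have hT1 : T_pi al < T_pi al + eps / 2 by rewrite ltrDl divr_gt0.
have hT2 : T_pi al + eps / 2 < T_pi al + eps by lra.
have g1 : 1 < gamma by apply: lt_trans hg; rewrite ltrDl.
have g0 : 0 < gamma by exact: lt_trans g1.
have q0 : 0 <= (4^-1 : R) by rewrite invr_ge0.
(* Any exponent in (0, 1/2) serves near the origin: with 1/4, w ^ 2 is O(x ^ (- 1/2)), which is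
   integrable. *)
have [K K0 hK] := NAlpha_w_small hT1 (@itg_ph R (levy_of p) 4^-1 q0) (@ph_gt0 R (levy_of p) 4^-1 (ltac:(by rewrite invr_gt0))).
have [k [K' [k0 K'0 hK']]] := NAlpha_w_exp hT1.
have [C C0 hC] := rate_absorb a hT2.
(* For x >= 1 the inverse weight is exp (x ^ (1 / gamma)) <= exp x, and the squared decay exp (- 2 k
   x ^ (1 / al)) absorbs exp x up to exp M since 1 / al > 1. *)
have [M hM] := @powR_le_superlinear R (2 * k) al^-1 (mulr_gt0 (ltr0Sn R 1) k0) (ltac:(by rewrite invf_gt1)).
pose r n : R := expR ((T_pi al + eps / 2) * n%:R).
have r0 n : 0 <= r n by exact: expR_ge0.
have E n x : `|w nu n x / nubar gamma x| ^+ 2 * nubar gamma x = `|w nu n x| ^+ 2 * expR (x `^ gamma^-1).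
  rewrite /nubar normrM normfV (ger0_norm (expR_ge0 _)) exprMn expRN invrK.
  have := expR_gt0 (x `^ gamma^-1); move: (expR _) `|_| => u v u0.
  by field; rewrite gt_eqF.
have [||||||H hH] := @wnorm_two_zones R (nubar gamma) (fun n x => w nu n x / nubar gamma x) r (- 2^-1)
   (K ^+ 2 * expR 1) (K' ^+ 2 * expR M) (ltac:(lra)) _ _ r0.
- by rewrite mulr_ge0 ?sqr_ge0 ?expR_ge0.
- by rewrite mulr_ge0 ?sqr_ge0 ?expR_ge0.
- move=> n; have -> : (fun x => `|w nu n x / nubar gamma x| ^+ 2 * nubar gamma x) =
    (fun x => `|w nu n x| ^+ 2 * expR (x `^ gamma^-1)) by apply/funext => x; exact: E.
  apply: measurable_funM; last by apply: measurable_funTS; meas.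
  apply: measurable_funX; apply: measurableT_comp => //; exact: (w_meas NAlpha_w_cont).
- by move=> x _; exact: expR_ge0.
- move=> n x x0 x1; rewrite E.
  have h := hK n x x0.
  have xp : 0 < x `^ 4^-1 by rewrite powR_gt0.
  rewrite (_ : x `^ (- 2^-1) = (x `^ 4^-1) ^- 2); last first.
    by rewrite -powR_mulrn ?powR_ge0// -powRrM -powRN; congr (_ `^ _); field.
  rewrite (_ : r n ^+ 2 * (K ^+ 2 * expR 1 * (x `^ 4^-1) ^- 2) = (K * r n) ^+ 2 / (x `^ 4^-1) ^+ 2 * expR 1); last first.
    by rewrite exprMn; ring.
  apply: ler_pM; rewrite ?sqr_ge0 ?expR_ge0//.
    rewrite ler_pdivlMr ?exprn_gt0// -exprMn mulrC lerXn2r ?nnegrE ?mulr_ge0 ?r0 ?(ltW K0) ?(ltW xp)//.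
  have -> : 1 = 1 `^ gamma^-1 :> R by rewrite powR1.
  rewrite ler_expR; apply: ge0_ler_powR; rewrite ?nnegrE ?invr_ge0 ?(ltW g0) ?(ltW x0)//.
- move=> n x x1; have x0 : 0 < x by exact: lt_le_trans x1.
  rewrite E; have h := hK' n x x0.
  rewrite (_ : x `^ (- 2) = x ^- 2); last by rewrite powRN -powR_mulrn ?(ltW x0).
  have e1 : x `^ gamma^-1 <= 2 * k * x `^ al^-1 + M.
    apply: le_trans (hM x x0); rewrite -[leRHS](powRr1 (ltW x0)).
    by rewrite ler_powR// invf_le1// ltW.
  apply: (@le_trans _ _ (`|w nu n x| ^+ 2 * expR (2 * k * x `^ al^-1 + M))).
    by rewrite ler_wpM2l ?sqr_ge0// ler_expR.
  have e2 : (x * `|w nu n x|) ^+ 2 <= (K' * r n * expR (- (k * x `^ al^-1))) ^+ 2.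
    have m1 : 0 <= x * `|w nu n x| by apply: mulr_ge0; [exact: ltW|].
    by rewrite lerXn2r// nnegrE; apply: le_trans m1 h.
  have e3 : expR (2 * k * x `^ al^-1 + M) = expR M / expR (- (k * x `^ al^-1)) ^+ 2.
    by rewrite expRD -expRM_natl -expRN mulrC; congr (_ * expR _); ring.
  rewrite e3; move: (expR_gt0 (- (k * x `^ al^-1))) e2; move: (expR (- _)) (expR M) (expR_gt0 M) => z m m0 z0 e2.
  rewrite exprMn [leRHS]exprMn in e2.
  have xx : 0 < x ^+ 2 by rewrite exprn_gt0.
  have zz : 0 < z ^+ 2 by rewrite exprn_gt0.
  rewrite [leRHS](_ : _ = (K' * r n) ^+ 2 * z ^+ 2 / x ^+ 2 * (m / z ^+ 2)); last first.
    by rewrite exprMn; field; rewrite !gt_eqF.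
  apply: ler_wpM2r; first by rewrite ltW// divr_gt0.
  by rewrite ler_pdivlMr// mulrC.
exists (`|H| * C); near=> n; apply: (le_trans (hH n)); rewrite lee_fin -mulrA.
apply: (@le_trans _ _ (`|H| * r n)); first by rewrite ler_wpM2r ?r0// ler_norm.
apply: ler_wpM2l => //; apply: hC; near: n; by exists 1%N.
Unshelve. all: by end_near.
Qed.

End PartTwoA.

(** * Lower bounds on the density *)

Section ExponentialSubstitution.
Variable R : realType.

Lemma primitive_itv (g : R -> R) (a c : R) : 0 < a -> a < c ->
  (forall x, 0 < x -> {for x, continuous g}) ->
  exists G : R -> R, forall x, a <= x <= c -> hasd G x (g x).
Proof.
move=> a0 ac cg; pose a' := a / 2; pose u := c + 1.
have a'0 : 0 < a' by rewrite divr_gt0.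
have a'a : a' < a by rewrite /a'; lra.
have ic : (@lebesgue_measure R).-integrable [set` `[a', u]] (EFin \o g).
  apply: continuous_compact_integrable; first exact: segment_compact.
  apply: continuous_in_subspaceT => t /set_mem/=; rewrite in_itv/= => /andP[h _].
  by apply: cg; exact: lt_le_trans h.
exists (fun x => (\int[@lebesgue_measure R]_(t in [set` `[a', x]]) g t)%R) => x /andP[ax xc].
have x0 : 0 < x by exact: lt_le_trans ax.
have [|d1 d2] := @continuous_FTC1_closed R g a' x u _ ic (lt_le_trans a'a ax) (cg x x0).
  by rewrite /u; lra.
apply: DeriveDef; [exact: d1|by rewrite -derive1E; exact: d2].
Qed.

(** The change of variable y = t exp v, through a primitive of h y / y on both sides; it makes the
    window integral independent of the base point t. *)
Lemma exp_substitution (h : R -> R) (t a c : R) : 0 < t -> 0 < a -> a < c ->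
  (forall x, 0 < x -> {for x, continuous h}) ->
  itg (fun v => \1_`[ln (a / t), ln (c / t)] v * h (t * expR v)) /\
  I (fun v => \1_`[ln (a / t), ln (c / t)] v * h (t * expR v)) =
  I (fun y => \1_`[a, c] y * (y^-1 * h y)).
Proof.
move=> t0 a0 ac ch; have c0 : 0 < c := lt_trans a0 ac.
have cg (x : R) : 0 < x -> {for x, continuous (fun y : R => y^-1 * h y)}.
  move=> x0; apply: cvgM; last exact: ch.
  by apply: cvgV; [rewrite gt_eqF|exact: cvg_id].
have [G hG] := primitive_itv a0 ac cg.
have [_ e1] := @I_FTC_itv R G (fun y => y^-1 * h y) a c ac hG (fun x hx => cg x (lt_le_trans a0 (proj1 (andP hx)))).
have lac : ln (a / t) < ln (c / t) by rewrite ltr_ln ?posrE ?divr_gt0// ltr_pM2r ?invr_gt0.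
have rg v : ln (a / t) <= v <= ln (c / t) -> a <= t * expR v <= c.
  rewrite -[ln (a / t) <= v]ler_expR -[v <= _]ler_expR !lnK ?posrE ?divr_gt0// => /andP[h1 h2].
  by rewrite -ler_pdivrMl// mulrC h1 -ler_pdivlMl// mulrC h2.
have tv v : 0 < t * expR v by rewrite mulr_gt0 ?expR_gt0.
have [||i2 e2] := @I_FTC_itv R (fun v => G (t * expR v)) (fun v => h (t * expR v)) (ln (a / t)) (ln (c / t)) lac.
- move=> v /rg hv; have d1 : hasd (fun v : R => t * expR v) v (t * expR v).
    by apply: hasd_eq; [der|rewrite /=; ring].
  apply: (hasd_eq (@der_comp R G (fun v : R => t * expR v) v _ _ (hG _ hv) d1)).
  move: (expR v) (expR_gt0 v) (h _) => z z0 y; by field; rewrite !gt_eqF.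
- move=> v _; apply: (@continuous_comp _ _ _ (fun v => t * expR v) h); last exact: ch.
  by apply: der_cont; eexists; der.
split => //; rewrite e2 e1 !lnK ?posrE ?divr_gt0//.
by rewrite ![t * _]mulrC !divfK ?gt_eqF.
Qed.

End ExponentialSubstitution.

Section DensityLowerBounds.
Variables (R : realType) (p : levy R) (L : law p).
Local Notation m := (lm p).
Local Notation q := (lq p).
Local Notation nu := (dens L).
Local Notation st := (@stp R).
(** The nonlocal equation for j = 0, where [wdiff] is the density itself, in the absence of a
    Gaussian part. *)
Hypothesis balance : forall t, 0 < t -> itg (fun v => (nu t - nu (t * expR v)) * q v) /\
  (t - m) * nu t = I (fun v => (nu t - nu (t * expR v)) * q v).

Lemma tail_itg k : 1 <= k -> itg (fun v => st (v - k) * q v).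
Proof.
move=> k1; have ms := @stp_meas R; apply: (@itg_dom_minq R p (fun v => st (v - k)) 1); first by meas.
move=> v v0; rewrite ger0_norm ?stp_ge0// mul1r; have [vk|vk] := leP (v - k) 0.
  by rewrite (stp0 vk) le_min (ltW v0)/=.
by rewrite (stp1 vk) le_min lexx andbT; lra.
Qed.

Lemma tail_cvg0 : I (fun v => st (v - n.+1%:R) * q v) @[n --> \oo] --> 0.
Proof.
have ms := @stp_meas R; have mq := lq_meas p.
have [||||] := @I_dct R (fun n v => st (v - n.+1%:R) * q v) (fun=> 0) (fun v => st (v - 1) * q v).
- by move=> n; meas.
- move=> v; apply: cvg_near_cst; exists (Num.bound `|v|) => // n /= hn.
  rewrite stp0 ?mul0r// subr_le0; apply: (le_trans (ler_norm v)).
  by apply: (le_trans (ltW (archi_boundP (normr_ge0 _)))); rewrite ler_nat (leq_trans hn).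
- exact: tail_itg.
- move=> n v; rewrite ger0_norm ?mulr_ge0 ?stp_ge0 ?lq_ge0//; apply: ler_wpM2r; first exact: lq_ge0.
  have [h|h] := leP (v - n.+1%:R) 0; first by rewrite (stp0 h) stp_ge0.
  rewrite !stp1//; have : 1 <= n.+1%:R :> R by rewrite ler1n.
  by lra.
by rewrite I0.
Qed.

Section NearZero.
Variable b : R.
Let h k v := (1 - st (v - k)) * ((expR (b * v) - 1) * q v).

(* A minimum of [t `^ - b * nu t] that is reached close to the origin forces the
   truncated exponential moment below [m] up to the tail. *)
Let bad k t := [/\ 0 < t, t <= expR (- k) & forall y, t <= y -> y <= 1 -> t `^ (- b) * nu t <= y `^ (- b) * nu y].

(** For v <= k the point t exp v stays below 1, and minimality gives nu (t exp v) >= exp (b v) nu t;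
    for v > k only positivity of nu is used, at the price of the tail. Both are inserted in the
    balance equation divided by nu t. *)
Let bad_moment k t : 0 <= b -> 1 <= k -> bad k t ->
  [/\ itg (h k), forall v, 0 <= h k v & I (h k) <= m + I (fun v => st (v - k) * q v)].
Proof.
move=> b0 k1 [t0 tk ht]; have n0 : 0 < nu t := dens_gt0 L t0.
have ms := @stp_meas R; have mq := lq_meas p.
have [ib eb] := balance t0.
have h0 v : 0 <= h k v.
  have [v0|v0] := leP v 0; first by rewrite /h (lq_eq0 p v0) !mulr0.
  apply: mulr_ge0; first by rewrite subr_ge0 stp_le1.
  by apply: mulr_ge0; [rewrite subr_ge0 -[leLHS]expR0 ler_expR mulr_ge0// ltW|exact: lq_ge0].
pose g v := - (nu t)^-1 * ((nu t - nu (t * expR v)) * q v) + st (v - k) * q v.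
have ig : itg g by apply: itgD; [exact: itgZ|exact: tail_itg].
have hg v : h k v <= g v.
  have [v0|v0] := leP v 0; first by rewrite /h /g (lq_eq0 p v0) !mulr0 addr0.
  have -> : g v = (nu (t * expR v) / nu t - 1 + st (v - k)) * q v.
    by rewrite /g; field; rewrite gt_eqF.
  rewrite /h mulrA; apply: ler_wpM2r; first exact: lq_ge0.
  have tv : 0 < t * expR v by rewrite mulr_gt0 ?expR_gt0.
  have [vk|vk] := leP (v - k) 0; last first.
    by rewrite (stp1 vk) subrr mul0r subrK divr_ge0 ?dens_ge0.
  rewrite (stp0 vk) subr0 mul1r addr0 lerD2r ler_pdivlMr//.
  have t1 : t <= t * expR v by rewrite ler_peMr ?(ltW t0)// -[leLHS]expR0 ler_expR ltW.
  have t2 : t * expR v <= 1.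
    apply: (le_trans (ler_wpM2r (expR_ge0 v) tk)).
    by rewrite -expRD -[leRHS]expR0 ler_expR; lra.
  have := ht _ t1 t2; rewrite powRM ?(ltW t0) ?expR_ge0// -mulrA ler_pM2l ?powR_gt0//.
  by rewrite -expRM mulrN expRN ler_pdivlMl ?expR_gt0// (mulrC v).
have ih : itg (h k).
  apply: (itg_dom _ ig); first by rewrite /h; meas.
  by move=> v; rewrite ger0_norm.
split => //; apply: (le_trans (I_le ih ig hg)).
rewrite I_D; [|exact: itgZ|exact: tail_itg]; rewrite lerD2r I_Z// -eb.
rewrite (_ : - (nu t)^-1 * _ = m - t); first by rewrite gerBl ltW.
by field; rewrite gt_eqF.
Qed.

(** Bad points for every k would give, by Fatou and the vanishing of the tails, an integral at most
    m, against the hypothesis. So for some k there is no bad point. *)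
Lemma dens_lower_near0 : 0 <= b ->
  (itg (fun v => (expR (b * v) - 1) * q v) -> m < I (fun v => (expR (b * v) - 1) * q v)) ->
  exists2 c, 0 < c & forall x, 0 < x -> x <= 1 -> c * x `^ b <= nu x.
Proof.
move=> b0 hm; have ms := @stp_meas R; have mq := lq_meas p.
have [n hn] : exists n : nat, forall t, ~ bad n.+1%:R t.
  apply: contrapT => hc.
  have /choice[tn htn] : forall n : nat, exists t, bad n.+1%:R t.
    by move=> n; apply: contrapT => h1; apply: hc; exists n => t ht; apply: h1; exists t.
  have B n := bad_moment b0 (ltac:(by rewrite ler1n) : 1 <= n.+1%:R :> R) (htn n).
  have F N : itg (fun v => (expR (b * v) - 1) * q v) /\
      I (fun v => (expR (b * v) - 1) * q v) <= m + I (fun v => st (v - N.+1%:R) * q v).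
    apply: (@I_fatou R (fun k v => h (k + N).+1%:R v)).
    - by move=> k; have [] := B (k + N)%N.
    - by move=> k v; have [] := B (k + N)%N.
    - move=> v; apply: cvg_near_cst; exists (Num.bound `|v|) => // k /= hk.
      rewrite /h stp0 ?subr0 ?mul1r// subr_le0; apply: (le_trans (ler_norm v)).
      apply: (le_trans (ltW (archi_boundP (normr_ge0 _)))); rewrite ler_nat.
      by rewrite (leq_trans hk)// (leq_trans (leq_addr N k)).
    move=> k; have [_ _ h1] := B (k + N)%N; apply: (le_trans h1); rewrite lerD2l.
    apply: I_le; [by apply: tail_itg; rewrite ler1n|by apply: tail_itg; rewrite ler1n|].
    move=> v; apply: ler_wpM2r; first exact: lq_ge0.
    have NN : N.+1%:R <= (k + N).+1%:R :> R by rewrite ler_nat ltnS leq_addl.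
    have [h2|h2] := leP (v - (k + N).+1%:R) 0; first by rewrite (stp0 h2) stp_ge0.
    by rewrite !stp1//; lra.
  have [iH _] := F 0%N; have := hm iH; rewrite ltNge => /negP; apply.
  have c : m + I (fun v => st (v - N.+1%:R) * q v) @[N --> \oo] --> m + 0.
    by apply: cvgD; [exact: cvg_cst|exact: tail_cvg0].
  rewrite addr0 in c; rewrite -(cvg_lim _ c)//; apply: limr_ge.
    by apply/cvg_ex; exists m.
  by apply: nearW => N; have [_] := F N.
pose g t := t `^ (- b) * nu t.
have g0 x : 0 < x -> 0 < g x by move=> x0; rewrite mulr_gt0 ?powR_gt0// dens_gt0.
have gc x : 0 < x -> {for x, continuous g}.
  by move=> x0; apply: cvgM; [exact: powR_cont|exact: dens_cont].
have gmin a : 0 < a -> a <= 1 -> exists2 z, a <= z <= 1 & forall y, a <= y -> y <= 1 -> g z <= g y.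
  move=> a0 a1; have [|z + hz] := @EVT_min R g a 1 a1.
    apply: continuous_in_subspaceT => x /set_mem/=; rewrite in_itv/= => /andP[ax _].
    by apply: gc; exact: lt_le_trans ax.
  rewrite in_itv/= => hz'; exists z => // y ay y1; apply: hz; by rewrite in_itv/= ay.
(* No bad point lies below [a0], so the minimum over [x, 1] is attained in [a0, 1], where it is at
   least the value at [z0]. *)
pose a0 : R := expR (- n.+1%:R).
have a00 : 0 < a0 by exact: expR_gt0.
have a01 : a0 <= 1 by rewrite /a0 -[leRHS]expR0 ler_expR oppr_le0.
have [z0 /andP[z01 z02] hz0] := gmin a0 a00 a01.
have z00 : 0 < z0 by exact: lt_le_trans z01.
exists (g z0); first exact: g0.
move=> x x0 x1; have [z /andP[z1 z2] hz] := gmin x x0 x1.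
have zz : 0 < z by exact: lt_le_trans z1.
have az : a0 <= z.
  rewrite leNgt; apply/negP => za; apply: (hn z); split => //; first exact: ltW.
  by move=> y zy y1; apply: hz => //; exact: le_trans zy.
have h1 : g z0 <= g x by apply: (le_trans (hz0 z az z2)); exact: hz.
by rewrite -ler_pdivlMr ?powR_gt0// mulrC -powRN.
Qed.

End NearZero.

Lemma minh_itg eta : 0 < eta -> itg (fun v => Num.min v eta * q v).
Proof.
move=> e0; apply: (@itg_dom_minq R p (fun v => Num.min v eta) (1 + eta)); first by meas.
move=> v v0; have mv : 0 <= Num.min v eta by rewrite le_min (ltW v0) ltW.
rewrite ger0_norm//; have [v1|v1] := leP v 1.
  by rewrite ge_min; apply/orP; left; nra.
by rewrite ge_min; apply/orP; right; lra.
Qed.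

(* The minimum over [x, x e^(eta/2)] of [nu] minus a logarithm vanishing with
   [nu] at [x]: there the balance equation bounds the jumps into the window. *)
Lemma dens_harnack eta x : 0 < eta -> m <= x -> 0 < x ->
  q (2 * eta) * I (fun y => \1_`[x * expR eta, x * expR (2 * eta)] y * (y^-1 * nu y)) <=
  2 / eta * nu x * I (fun v => Num.min v (eta / 2) * q v).
Proof.
move=> e0 mx x0; pose y1 := x * expR (eta / 2); pose lam := 2 / eta * nu x.
have e2 : 0 < eta / 2 by rewrite divr_gt0.
have lam0 : 0 <= lam by rewrite mulr_ge0 ?dens_ge0 ?divr_ge0 ?(ltW e0).
have xy : x <= y1 by rewrite ler_peMr ?(ltW x0)// -[leLHS]expR0 ler_expR ltW.
have y10 : 0 < y1 := lt_le_trans x0 xy.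
have ly1 : ln y1 = ln x + eta / 2 by rewrite lnM ?posrE ?expR_gt0// expRK.
pose f t := nu t - lam * (ln y1 - ln t).
have [|t + ht] := @EVT_min R f x y1 xy.
  apply: continuous_in_subspaceT => t /set_mem/=; rewrite in_itv/= => /andP[xt _].
  have t0 := lt_le_trans x0 xt; apply: cvgB; first exact: dens_cont.
  by apply: cvgM; [exact: cvg_cst|apply: cvgB; [exact: cvg_cst|exact: continuous_ln]].
rewrite in_itv/= => /andP[xt ty]; have t0 := lt_le_trans x0 xt.
have lxt : ln x <= ln t by rewrite ler_ln ?posrE.
have lty : ln t <= ln y1 by rewrite ler_ln ?posrE.
have ft : nu t <= lam * (ln y1 - ln t).
  rewrite -subr_le0; apply: (le_trans (ht x _)); first by rewrite in_itv/= lexx.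
  rewrite /f ly1 addrAC subrr add0r /lam (_ : 2 / eta * nu x * (eta / 2) = nu x) ?subrr//.
  by field; rewrite gt_eqF.
have [ib eb] := balance t0.
pose a := x * expR eta; pose c := x * expR (2 * eta).
have a0 : 0 < a by rewrite mulr_gt0 ?expR_gt0.
have c0 : 0 < c by rewrite mulr_gt0 ?expR_gt0.
have ac : a < c by rewrite ltr_pM2l// ltr_expR; lra.
have [iw ew] := exp_substitution t0 a0 ac (@dens_cont _ _ L).
have la : ln (a / t) = ln x + eta - ln t.
  by rewrite ln_div ?posrE// lnM ?posrE ?expR_gt0// expRK.
have lc : ln (c / t) = ln x + 2 * eta - ln t.
  by rewrite ln_div ?posrE// lnM ?posrE ?expR_gt0// expRK.
(* Three kinds of jumps: those landing in [x exp eta, x exp (2 eta)] have v <= 2 eta and provide the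
   window term; those staying below [y1] are controlled by the minimality of f at t; the others by
   nu >= 0 and [ft], as ln y1 - ln t is then at most min (v, eta / 2). *)
have key v : (nu t - nu (t * expR v)) * q v <=
   lam * (Num.min v (eta / 2) * q v) - q (2 * eta) * (\1_`[ln (a / t), ln (c / t)] v * nu (t * expR v)).
  have tv : 0 < t * expR v by rewrite mulr_gt0 ?expR_gt0.
  have n0 := dens_ge0 L (t * expR v).
  have q0 := lq_ge0 p v.
  rewrite indic_itvE la lc; case: (boolP (_ <= v <= _)) => [/andP[v1 v2]|_].
    have v0 : 0 < v by lra.
    have vm : nu t <= lam * Num.min v (eta / 2).
      by apply: (le_trans ft); apply: ler_wpM2l => //; rewrite le_min; apply/andP; split; lra.
    rewrite mul1r mulrBl; apply: lerB; first by rewrite mulrA; exact: ler_wpM2r.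
    rewrite mulrC; apply: ler_wpM2l => //; apply: lq_decr => //; lra.
  rewrite mul0r mulr0 subr0 mulrA.
  have [v0|v0] := leP v 0; first by rewrite (lq_eq0 p v0) !mulr0.
  apply: ler_wpM2r => //.
  have lv : ln (t * expR v) = ln t + v by rewrite lnM ?posrE ?expR_gt0// expRK.
  have [h|h] := leP (t * expR v) y1.
    have tx : x <= t * expR v by rewrite (le_trans xt)// ler_peMr ?(ltW t0)// -[leLHS]expR0 ler_expR ltW.
    have := ht (t * expR v); rewrite in_itv/= tx h /f lv => /(_ isT).
    have : ln (t * expR v) <= ln y1 by rewrite ler_ln ?posrE.
    rewrite lv => h1 h2; have -> : Num.min v (eta / 2) = v by apply/min_idPl; lra.
    by nra.
  have : ln y1 < ln (t * expR v) by rewrite ltr_ln ?posrE.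
  rewrite lv => h1; have : nu t <= lam * Num.min v (eta / 2).
    by apply: (le_trans ft); apply: ler_wpM2l => //; rewrite le_min; apply/andP; split; lra.
  by lra.
have i1 : itg (fun v => lam * (Num.min v (eta / 2) * q v)) by apply: itgZ; exact: minh_itg.
have := I_le ib (itgB i1 (itgZ (q (2 * eta)) iw)) key.
rewrite -eb I_B//; last exact: itgZ.
rewrite !I_Z//; last exact: minh_itg.
rewrite ew -/a -/c -/lam => h; rewrite -subr_ge0; apply: le_trans h.
by apply: mulr_ge0; [rewrite subr_ge0; lra|exact: dens_ge0].
Qed.

End DensityLowerBounds.

Section Chebyshev.
Variables (R : realType) (p : levy R) (L : law p).
Local Notation nu := (dens L).

(** Chebyshev for the law proportional to y ^ N nu. Its mean is mu = phi (N + 1) and its variance mu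
    (phi (N + 2) - mu), at most mu ^ 2 / (N + 1) by [ph_scale]. *)
Lemma window_mass N (a c d : R) : 0 < a -> 0 < d -> a <= ph p N.+1%:R * (1 - d) ->
  ph p N.+1%:R * (1 + d) <= c -> 2 <= N.+1%:R * d ^+ 2 ->
  Mo L N / 2 <= c ^+ N.+1 * I (fun y => \1_`[a, c] y * (y^-1 * nu y)).
Proof.
set mu := ph p N.+1%:R => a0 d0 ha hc hN.
have mu0 : 0 < mu by apply: ph_gt0.
have c0 : 0 < c by apply: lt_le_trans hc; rewrite mulr_gt0// addr_gt0.
have M0 := Mo_gt0 L N.
have ac : a < c by apply: le_lt_trans ha _; apply: lt_le_trans hc; rewrite ltr_pM2l//; lra.
pose s := (d * mu) ^+ 2; have s0 : 0 < s by rewrite exprn_gt0// mulr_gt0.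
(* The quadratic minorant 1 - (y - mu) ^ 2 / s of the indicator of the window, expanded so that its
   integral is a combination of three moments. *)
pose g y : R := (1 - mu ^+ 2 / s) * (y ^+ N * nu y) +
  (2 * mu / s * (y ^+ N.+1 * nu y) + (- s^-1) * (y ^+ N.+2 * nu y)).
have i0 := dens_itg L N; have i1 := dens_itg L N.+1; have i2 := dens_itg L N.+2.
have ig : itg g by apply: itgD; [|apply: itgD]; exact: itgZ.
have gE y : g y = y ^+ N * nu y * (1 - (y - mu) ^+ 2 / s).
  by rewrite /g !exprS; field; rewrite gt_eqF.
have IgE : I g = Mo L N * (1 - (ph p N.+2%:R - mu) / (d ^+ 2 * mu)).
  rewrite I_D; [|exact: itgZ|by apply: itgD; exact: itgZ].
  rewrite I_D; [|exact: itgZ|exact: itgZ].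
  rewrite !I_Z// -!MoE !Mo_rec -/mu /s.
  by field; rewrite !gt_eqF.
have mu2 : ph p N.+2%:R - mu <= mu / N.+1%:R.
  have := @ph_scale R p N.+1%:R N.+2%:R ltac:(by []) ltac:(by rewrite ler_nat).
  rewrite -/mu lerBlDl => h; apply: (le_trans h).
  rewrite -[N.+2%:R]natr1 le_eqVlt; apply/orP; left; apply/eqP.
  have : 0 < N.+1%:R :> R by [].
  by move: (N.+1%:R) (mu) => z z1 z0; field; rewrite gt_eqF.
have cg (x : R) : 0 < x -> {for x, continuous (fun y : R => y^-1 * nu y)}.
  move=> x0; apply: cvgM; last exact: dens_cont.
  by apply: cvgV; [rewrite gt_eqF|exact: cvg_id].
have [G hG] := primitive_itv a0 ac cg.
have [iw _] := @I_FTC_itv R G (fun y => y^-1 * nu y) a c ac hG (fun x hx => cg x (lt_le_trans a0 (proj1 (andP hx)))).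
apply: (@le_trans _ _ (I g)).
  rewrite IgE ler_pM2l//.
  have h1 : (ph p N.+2%:R - mu) / (d ^+ 2 * mu) <= 2^-1.
    rewrite ler_pdivrMr ?mulr_gt0 ?exprn_gt0//; apply: (le_trans mu2).
    rewrite ler_pdivrMr// [leRHS](_ : _ = mu * (N.+1%:R * d ^+ 2 / 2)); last by field.
    by rewrite ler_peMr ?(ltW mu0)//; lra.
  lra.
rewrite -I_Z//; apply: I_le => //; first exact: itgZ.
move=> y; have [y0|y0] := leP y 0.
  by rewrite gE (dens_eq0 L y0) !(mulr0, mul0r).
have n0 := dens_ge0 L y.
have yn : 0 < y ^+ N by rewrite exprn_gt0.
rewrite gE indic_itvE; case: (boolP (a <= y <= c)) => [/andP[h1 h2]|h].
  rewrite mul1r; apply: (@le_trans _ _ (y ^+ N * nu y)).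
    by rewrite ler_piMr ?mulr_ge0 ?(ltW yn)// gerBl divr_ge0 ?sqr_ge0 ?(ltW s0).
  have -> : y ^+ N * nu y = y ^+ N.+1 * (y^-1 * nu y) by rewrite exprS; field; rewrite gt_eqF.
  apply: ler_wpM2r; first by rewrite mulr_ge0// invr_ge0 ltW.
  by rewrite lerXn2r ?nnegrE ?(ltW y0) ?(ltW c0).
rewrite mul0r mulr0 mulr_ge0_le0 ?mulr_ge0 ?(ltW yn)// subr_le0 ler_pdivlMr// mul1r.
rewrite -[(y - mu) ^+ 2]real_normK ?num_real// lerXn2r ?nnegrE ?mulr_ge0 ?(ltW d0) ?(ltW mu0)//.
rewrite ler_normr; move: h; rewrite negb_and -!ltNge => /orP[h|h]; apply/orP; [right|left]; lra.
Qed.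

End Chebyshev.

Section AsymptoticLowerBound.
Variables (R : realType) (p : levy R) (al C : R).
Hypotheses (al0 : 0 < al) (al1 : al < 1) (C0 : 0 < C).
Hypothesis reg : ph p u / (C * u `^ al) @[u --> +oo] --> (1 : R).
Variable L : law p.
Local Notation nu := (dens L).
Local Notation m := (lm p).
Local Notation q := (lq p).
Hypothesis balance : forall t, 0 < t -> itg (fun v => (nu t - nu (t * expR v)) * q v) /\
  (t - m) * nu t = I (fun v => (nu t - nu (t * expR v)) * q v).

(** e is the error of regular variation and eta the logarithmic width of the Harnack window. The
    last two inequalities keep their combined effect within sg; they are used for [Mlow] and [Nup]
    below. *)
Let parameters (sg v0 : R) : 0 < sg -> 0 < v0 -> exists e eta : R,
  [/\ 0 < e < 1, 0 < eta, eta <= v0, eta <= sg / 2 & (1 + e) / (1 - e) <= expR (sg / 4) /\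
   (expR (3 / 2 * eta) / (1 - e)) `^ al^-1 * (al + sg / 2) <= al + sg].
Proof.
move=> s0 v00; have d0 : 0 < al + sg / 2 by rewrite addr_gt0// divr_gt0.
pose r := (al + sg) / (al + sg / 2).
have r1 : 1 < r by rewrite /r ltr_pdivlMr// mul1r; lra.
pose l := al / 2 * ln r; have l0 : 0 < l by rewrite mulr_gt0 ?divr_gt0// ln_gt0.
pose s := expR (sg / 4).
have s1 : 1 < s by rewrite /s expR_gt1 divr_gt0.
pose e := Num.min ((s - 1) / (s + 1)) (1 - expR (- l)).
have el1 : expR (- l) < 1 by rewrite expR_lt1 oppr_lt0.
have e0 : 0 < e.
  by rewrite lt_min subr_gt0 el1 andbT divr_gt0 ?subr_gt0//; lra.
have ee2 : e <= 1 - expR (- l) by rewrite ge_min lexx orbT.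
have e1 : e < 1 by have := expR_gt0 (- l); lra.
have ee1 : e <= (s - 1) / (s + 1) by rewrite ge_min lexx.
pose eta := Num.min v0 (Num.min (sg / 2) (2 / 3 * l)).
have eta3 : eta <= 2 / 3 * l by rewrite !ge_min lexx !orbT.
exists e, eta; split.
- by rewrite e0 e1.
- by rewrite !lt_min v00/= divr_gt0// mulr_gt0.
- by rewrite ge_min lexx.
- by rewrite !ge_min lexx orbT.
split.
  rewrite ler_pdivrMr ?subr_gt0// -/s.
  have sp : 0 < s + 1 by lra.
  by rewrite ler_pdivlMr// in ee1; lra.
rewrite -ler_pdivlMr// -/r.
have h : expR (3 / 2 * eta) / (1 - e) <= expR (al * ln r).
  rewrite ler_pdivrMr ?subr_gt0//.
  apply: (@le_trans _ _ (expR l)); first by rewrite ler_expR; lra.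
  have -> : expR (al * ln r) = expR l * expR l by rewrite -expRD /l; congr expR; field.
  rewrite -mulrA ler_peMr ?expR_ge0//.
  have : expR (- l) <= 1 - e by lra.
  by rewrite expRN => h; rewrite -ler_pdivrMl ?expR_gt0// mulr1.
have r0 : 0 < r by exact: lt_trans r1.
apply: (@le_trans _ _ (expR (al * ln r) `^ al^-1)).
  apply: ge0_ler_powR; rewrite ?nnegrE ?invr_ge0 ?(ltW al0) ?expR_ge0//.
  by rewrite divr_ge0 ?expR_ge0// subr_ge0 ltW.
by rewrite -expRM mulrAC divff ?gt_eqF// mul1r lnK.
Qed.

Lemma fact_pow_ge N : expR (- N.+1%:R) * N.+1%:R ^+ N <= (N`!)%:R :> R.
Proof.
have := pow_le_exp N (ler0n R N.+1).
rewrite expRN ler_pdivrMr ?ltr0n ?fact_gt0// => h.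
by rewrite ler_pdivrMl ?expR_gt0.
Qed.

(** The first index whose mean phi (N + 1) reaches A; the bound at [N1] forces it to be large. *)
Let crossing (A : R) N1 : ph p N1.+1%:R < A -> exists N, [/\ (N1 < N)%N, A <= ph p N.+1%:R & ph p N%:R < A].
Proof.
move=> hA; have [u0 u00 hu] := ph_between C0 reg (ltac:(by rewrite invr_gt0) : 0 < 2^-1 :> R).
have A0 : 0 < A by apply: lt_trans hA; apply: ph_gt0.
have ex : exists n, A <= ph p n.+1%:R.
  pose B := (2 * A / C) `^ al^-1; have B0 : 0 <= B by exact: powR_ge0.
  exists (maxn (Num.bound u0) (Num.bound B)); set n := maxn _ _.
  have n1 : u0 <= n.+1%:R.
    by apply: (le_trans (ltW (archi_boundP (ltW u00)))); rewrite ler_nat leqW// leq_maxl.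
  have n2 : B <= n.+1%:R.
    by apply: (le_trans (ltW (archi_boundP B0))); rewrite ler_nat leqW// leq_maxr.
  have /andP[h _] := hu _ n1; apply: le_trans h.
  have : B `^ al <= n.+1%:R `^ al by apply: ge0_ler_powR; rewrite ?nnegrE ?(ltW al0).
  rewrite /B -powRrM mulVf ?gt_eqF// powRr1; last by rewrite divr_ge0 ?(ltW C0)// mulr_ge0 ?(ltW A0).
  rewrite ler_pdivrMr// => h; lra.
have [N hN hmin] := ex_minnP ex.
have N1N : (N1 < N)%N.
  rewrite ltnNge; apply/negP => h; have : ph p N.+1%:R <= ph p N1.+1%:R by apply: ph_mono; rewrite ?ler_nat.
  by lra.
have Np : (0 < N)%N := leq_ltn_trans (leq0n N1) N1N.
exists N; split; [exact: N1N|exact: hN|].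
by rewrite -(prednK Np) ltNge; apply/negP => /hmin; rewrite leqNgt prednK ?leqnn.
Qed.

(** Harnack bounds nu x below by the mass of nu on a window to the right of x, and Chebyshev bounds
    that mass by a moment whose order N is such that phi (N + 1) falls in the window. Lower bounds
    on the moments then give the exponential. *)
Lemma dens_lower_large sg : 0 < sg -> exists c X : R, [/\ 0 < c, 1 <= X &
  forall x, X <= x -> c / x * expR (- ((al + sg) * (x / C) `^ al^-1)) <= nu x].
Proof.
move=> sg0; have sN := no_gaussian al1 C0 reg.
have [v0 v00 qv0] : exists2 y, 0 < y & 0 < q y.
  by case: (l_nondeg p) => // ; rewrite sN ltxx.
have [e [eta [/andP[e0 e1] eta0 etav etas [he1 he2]]]] := parameters sg0 (divr_gt0 v00 (ltr0Sn R 1)).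
have n1 : eta <= 3 / 2 * eta + - (eta / 4) by lra.
have n2 : 3 / 2 * eta + (eta / 4 + eta / 4) <= 2 * eta by lra.
have n3 : 2 * eta <= eta / 2 + 3 / 2 * eta by lra.
have n4 : - (sg / 2) + eta / 2 <= - (sg / 4) by lra.
have q0 : 0 < q (2 * eta) by apply: lt_le_trans qv0 _; apply: lq_decr; lra.
have [u0 u00 hu] := ph_between C0 reg e0.
have [K K0 hK] := Mo_ge C0 reg L e0 e1.
pose kap := I (fun v => Num.min v (eta / 2) * q v).
pose d : R := 1 - expR (- (eta / 4)).
have ed : expR (- (eta / 4)) < 1 by rewrite expR_lt1 oppr_lt0 divr_gt0.
have d0 : 0 < d by rewrite /d subr_gt0.
have d1 : d <= eta / 4 by have := expR_ge1Dx (- (eta / 4)); rewrite /d; lra.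
have d2 : 0 <= 1 + d by rewrite addr_ge0 ?(ltW d0).
(* Three requirements on N: consecutive means differ by a factor at most exp (eta / 4), the
   condition of [window_mass], and the range of [ph_between]. *)
pose N1 := (Num.bound (4 / eta) + Num.bound (2 / d ^+ 2) + Num.bound u0)%N.
have N1a : 4 / eta <= N1%:R.
  have z : 0 <= 4 / eta by rewrite divr_ge0 ?(ltW eta0).
  apply: (le_trans (ltW (archi_boundP z))).
  by rewrite ler_nat /N1 -addnA leq_addr.
have N1b : 2 / d ^+ 2 <= N1%:R.
  have z : 0 <= 2 / d ^+ 2 by rewrite divr_ge0 ?sqr_ge0.
  apply: (le_trans (ltW (archi_boundP z))).
  by rewrite ler_nat /N1 addnAC leq_addl.
have N1c : u0 <= N1%:R.
  by apply: (le_trans (ltW (archi_boundP (ltW u00)))); rewrite ler_nat leq_addl.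
have k0 : 0 <= kap.
  apply: I_ge0 => v; have [v1|v1] := leP v 0; first by rewrite (lq_eq0 p v1) mulr0.
  by apply: mulr_ge0; [rewrite le_min (ltW v1) divr_ge0 ?(ltW eta0)|exact: lq_ge0].
pose c1 := q (2 * eta) * eta / (4 * (kap + 1)).
have c10 : 0 < c1 by rewrite divr_gt0 ?mulr_gt0// ltr_wpDl.
pose X := Num.max 1 (Num.max m (ph p N1.+1%:R)).
exists (c1 * K * expR (- (2 * eta)) * expR (- al)), X; split.
- by apply: mulr_gt0 (expR_gt0 _); apply: mulr_gt0 (expR_gt0 _); exact: mulr_gt0.
- by rewrite le_max lexx.
move=> x; rewrite /X !ge_max => /and3P[x1 xm xp].
have x0 : 0 < x by exact: lt_le_trans x1.
(* The logarithmic middle of the window [x exp eta, x exp (2 eta)]. The mean lies in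
   [A, A exp (eta / 4)], and the relative width [d] costs another exp (eta / 4) on each side. *)
pose A := x * expR (3 / 2 * eta).
have A0 : 0 < A by rewrite mulr_gt0 ?expR_gt0.
have hA : ph p N1.+1%:R < A.
  apply: (le_lt_trans xp); rewrite ltr_pMr// expR_gt1 mulr_gt0//; lra.
have [N [N1N hN1 hN2]] := crossing hA.
have Npos : (0 < N)%N by exact: leq_ltn_trans N1N.
have NR : 0 < N%:R :> R by rewrite ltr0n.
have N1R : N1%:R <= N%:R :> R by rewrite ler_nat ltnW.
set mu := ph p N.+1%:R in hN1.
have mu0 : 0 < mu by apply: ph_gt0.
have muA : mu <= expR (eta / 4) * A.
  have := @ph_scale R p N%:R N.+1%:R NR ltac:(by rewrite ler_nat) => h.
  apply: (le_trans h); apply: ler_pM; [by rewrite divr_ge0|by apply: ltW; apply: ph_gt0| |exact: ltW].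
  rewrite -natr1 mulrDl divff ?gt_eqF// mul1r; apply: le_trans (expR_ge1Dx _); rewrite lerD2l.
  rewrite invf_ple ?posrE ?divr_gt0//; apply: le_trans N1R; by rewrite invf_div.
have sub1 : x * expR eta <= mu * (1 - d).
  apply: (@le_trans _ _ (A * expR (- (eta / 4)))); last first.
    by rewrite /d subKr; apply: ler_wpM2r; rewrite ?expR_ge0.
  by rewrite /A -mulrA -expRD (ler_pM2l x0) ler_expR.
have sub2 : mu * (1 + d) <= x * expR (2 * eta).
  apply: (@le_trans _ _ (expR (eta / 4) * A * expR (eta / 4))).
    apply: ler_pM; [exact: ltW|exact: d2|exact: muA|].
    by apply: le_trans (expR_ge1Dx _); rewrite lerD2l.
  rewrite [leLHS](_ : _ = x * (expR (3 / 2 * eta) * (expR (eta / 4) * expR (eta / 4)))).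
    by rewrite -!expRD (ler_pM2l x0) ler_expR.
  by rewrite /A; move: (expR _) (expR _) => z1 z2; ring.
have big : 2 <= N.+1%:R * d ^+ 2.
  rewrite -ler_pdivrMr ?exprn_gt0//; apply: (le_trans N1b).
  by rewrite ler_nat ltnW// ltnS ltnW.
have wm := window_mass L (mulr_gt0 x0 (expR_gt0 eta)) d0 sub1 sub2 big.
have hk := dens_harnack balance eta0 xm x0.
set W := I _ in wm hk.
pose b : R := x * expR (2 * eta); rewrite -/b in wm.
have b0 : 0 < b by rewrite mulr_gt0 ?expR_gt0.
have bN : 0 < b ^+ N by rewrite exprn_gt0.
have s1 : c1 * (Mo L N / b ^+ N.+1) <= nu x.
  have hW : Mo L N / b ^+ N.+1 / 2 <= W.
    have bN1 : 0 < b ^+ N.+1 by exact: exprn_gt0.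
    rewrite mulrAC (ler_pdivrMr _ _ bN1) [W * _]mulrC; exact: wm.
  have h1 : q (2 * eta) * W <= 2 / eta * nu x * (kap + 1).
    apply: (le_trans hk); rewrite -/kap ler_wpM2l ?lerDl//.
    by rewrite mulr_ge0 ?dens_ge0 ?divr_ge0 ?(ltW eta0).
  have h2 := le_trans (ler_wpM2l (ltW q0) hW) h1.
  have kp : 0 < kap + 1 by rewrite ltr_wpDl.
  rewrite /c1 mulrAC ler_pdivrMr ?mulr_gt0//.
  have h3 := ler_wpM2l (ltW (mulr_gt0 (ltr0Sn R 1) eta0)) h2.
  have e3 : 2 * eta * (2 / eta * nu x * (kap + 1)) = nu x * (4 * (kap + 1)).
    by move: (nu x) (kap) => z1 z2; field; rewrite gt_eqF.
  rewrite e3 in h3; apply: le_trans h3; rewrite le_eqVlt; apply/orP; left; apply/eqP.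
  by move: (Mo L N / _) (q _) => z1 z2; field.
apply: le_trans s1; rewrite exprS invfM.
have N1u : u0 <= N%:R := le_trans N1c N1R.
have bup : b <= expR (eta / 2) * ((1 + e) * (C * N.+1%:R `^ al)).
  have NN : N%:R <= N.+1%:R :> R by rewrite ler_nat.
  have /andP[_ h] := hu N.+1%:R (le_trans N1u NN).
  apply: (@le_trans _ _ (expR (eta / 2) * mu)); last by rewrite ler_wpM2l ?expR_ge0.
  apply: (@le_trans _ _ (expR (eta / 2) * A)); last by rewrite ler_wpM2l ?expR_ge0.
  by rewrite /A /b mulrCA -expRD (ler_pM2l x0) ler_expR.
(* The factors C ^ N and (N + 1) ^ (al N) cancel between the moment and b ^ N; exp (- al (N + 1))
   comes from the lower bound on N!, and sg / 2 pays for e and eta. *)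
have Mlow : K * expR (- (N%:R * (sg / 2)) - al * N.+1%:R) <= Mo L N / b ^+ N.
  rewrite ler_pdivlMr//; apply: le_trans (hK N).
  rewrite -mulrA ler_pM2l//.
  set T := expR (eta / 2) * ((1 + e) * (C * N.+1%:R `^ al)) in bup.
  apply: (@le_trans _ _ (expR (- (N%:R * (sg / 2)) - al * N.+1%:R) * T ^+ N)).
    rewrite ler_wpM2l ?expR_ge0// lerXn2r ?nnegrE ?(ltW b0)//.
    by rewrite !mulr_ge0 ?expR_ge0 ?powR_ge0 ?(ltW C0)// addr_ge0 ?(ltW e0).
  have Ef : (expR (- N.+1%:R) * N.+1%:R ^+ N) `^ al <= (N`!)%:R `^ al.
    by apply: ge0_ler_powR; rewrite ?nnegrE ?(ltW al0) ?mulr_ge0 ?expR_ge0 ?exprn_ge0 ?fact_pow_ge.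
  apply: le_trans (ler_wpM2l _ Ef); last first.
    by rewrite exprn_ge0// mulr_ge0 ?(ltW C0)// subr_ge0 ltW.
  have pn : (N.+1%:R ^+ N) `^ al = (N.+1%:R `^ al) ^+ N :> R.
    rewrite -(powR_mulrn N (powR_ge0 N.+1%:R al)) -(powR_mulrn N (ler0n R N.+1)).
    by rewrite -(powRrM N.+1%:R) -(powRrM N.+1%:R) mulrC.
  rewrite powRM ?expR_ge0 ?exprn_ge0// pn -expRM.
  rewrite /T expRD (exprMn N (expR (eta / 2))) (exprMn N (1 + e)) !(exprMn N C).
  set P := (N.+1%:R `^ al) ^+ N.
  have P0 : 0 <= P by rewrite exprn_ge0 ?powR_ge0.
  have CN : 0 <= C ^+ N by rewrite exprn_ge0 ?(ltW C0).
  have h4 : expR (- (N%:R * (sg / 2))) * (expR (eta / 2) ^+ N * (1 + e) ^+ N) <= (1 - e) ^+ N.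
    have -> : - (N%:R * (sg / 2)) = N%:R * (- (sg / 2)) by ring.
    rewrite expRM_natl -!exprMn lerXn2r ?nnegrE//.
    - by rewrite !mulr_ge0 ?expR_ge0// addr_ge0 ?(ltW e0).
    - by rewrite subr_ge0 ltW.
    rewrite mulrA -expRD; rewrite ler_pdivrMr ?subr_gt0// in he1.
    apply: (@le_trans _ _ (expR (- (sg / 4)) * (expR (sg / 4) * (1 - e)))).
      by apply: ler_pM; rewrite ?expR_ge0 ?addr_ge0 ?(ltW e0)// ler_expR.
    by rewrite mulrA -expRD addNr expR0 mul1r.
  have PC : 0 <= C ^+ N * P * expR (- (al * N.+1%:R)).
    by rewrite !mulr_ge0 ?expR_ge0.
  have := ler_wpM2r PC h4.
  rewrite (_ : - N.+1%:R * al = - (al * N.+1%:R)); last by ring.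
  move: (expR _) (expR _) (expR _ ^+ N) (C ^+ N) ((1 + e) ^+ N) ((1 - e) ^+ N) => z1 z2 z3 z4 z5 z6 h.
  apply: le_trans (le_trans h _); rewrite le_eqVlt; apply/orP; left; apply/eqP; ring.
(* The inequality phi N < A inverts to N <= (x / C) ^ (1 / al), up to the factor controlled in
   [parameters]. *)
have Nup : N%:R * (al + sg / 2) <= (al + sg) * (x / C) `^ al^-1.
  have /andP[h _] := hu N%:R N1u.
  have NA : N%:R `^ al <= x / C * (expR (3 / 2 * eta) / (1 - e)).
    rewrite [leRHS](_ : _ = A / ((1 - e) * C)); last first.
      by rewrite /A; field; rewrite !gt_eqF// subr_gt0.
    by rewrite ler_pdivlMr ?mulr_gt0 ?subr_gt0// mulrC -mulrA; exact: le_trans h (ltW hN2).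
  have xC : 0 <= x / C by rewrite divr_ge0 ?(ltW x0) ?(ltW C0).
  have ee : 0 <= expR (3 / 2 * eta) / (1 - e) by rewrite divr_ge0 ?expR_ge0// subr_ge0 ltW.
  have : (N%:R `^ al) `^ al^-1 <= (x / C * (expR (3 / 2 * eta) / (1 - e))) `^ al^-1.
    by apply: ge0_ler_powR => //; [rewrite invr_ge0 ltW|rewrite nnegrE powR_ge0|rewrite nnegrE; exact: mulr_ge0].
  rewrite -powRrM divff ?gt_eqF// powRr1// powRM// => h1.
  have s2 : 0 <= al + sg / 2 by rewrite addr_ge0 ?(ltW al0)// divr_ge0 ?(ltW sg0).
  apply: (le_trans (ler_wpM2r s2 h1)).
  have pz : 0 <= (x / C) `^ al^-1 by exact: powR_ge0.
  by have := ler_wpM2l pz he2; rewrite [X in _ <= X]mulrC [X in X <= _]mulrA.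
have x'0 : 0 <= b^-1 by rewrite invr_ge0 ltW.
have h5 := ler_wpM2l (ltW c10) (ler_wpM2l x'0 Mlow).
rewrite [leRHS](_ : _ = c1 * (b^-1 * (Mo L N / b ^+ N))); last first.
  by move: (b ^- N) (b^-1) (Mo L N) => z1 z2 z3; ring.
apply: le_trans h5.
rewrite [leRHS](_ : _ = c1 * K * expR (- (2 * eta)) / x * expR (- (N%:R * (sg / 2)) - al * N.+1%:R)); last first.
  rewrite /b invfM -expRN; move: (expR _) (expR _) (x^-1) => z1 z2 z3; ring.
have cx : 0 <= c1 * K * expR (- (2 * eta)) / x.
  by apply/ltW/divr_gt0 => //; apply: mulr_gt0 (expR_gt0 _); exact: mulr_gt0.
rewrite [leLHS](_ : _ = c1 * K * expR (- (2 * eta)) / x * (expR (- al) * expR (- ((al + sg) * (x / C) `^ al^-1)))); last first.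
  by move: (expR _) (expR _) (expR _) (x^-1) => z1 z2 z3 z4; ring.
apply: ler_wpM2l => //; rewrite -expRD ler_expR.
rewrite -[N.+1%:R]natr1; move: Nup; move: (_ `^ _) => z; nra.
Qed.

(** On the remaining compact interval nu is bounded below by its positive minimum, and the
    exponential factor over x is at most 1. *)
Lemma dens_lower_exp sg : 0 < sg -> exists2 c : R, 0 < c &
  forall x, 1 <= x -> c / x * expR (- ((al + sg) * (x / C) `^ al^-1)) <= nu x.
Proof.
move=> s0; have [c [X [c0 X1 hc]]] := dens_lower_large s0.
have [|z + hz] := @EVT_min R nu 1 X X1.
  apply: continuous_in_subspaceT => x /set_mem/=; rewrite in_itv/= => /andP[x1 _].
  by apply: dens_cont; exact: lt_le_trans x1.
rewrite in_itv/= => /andP[z1 _]; have z0 : 0 < z by exact: lt_le_trans z1.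
exists (Num.min c (nu z)); first by rewrite lt_min c0 dens_gt0.
move=> x x1; have x0 : 0 < x by exact: lt_le_trans x1.
have mz : 0 <= Num.min c (nu z) by rewrite le_min (ltW c0) dens_ge0.
have [h|h] := leP X x.
  apply: le_trans (hc x h); apply: ler_wpM2r; first exact: expR_ge0.
  by apply: ler_wpM2r; rewrite ?invr_ge0 ?(ltW x0)// ge_min lexx.
apply: le_trans (hz x _); last by rewrite in_itv/= x1 ltW.
apply: (@le_trans _ _ (Num.min c (nu z))); last by rewrite ge_min lexx orbT.
rewrite -mulrA ler_piMr// mulr_ile1 ?invr_ge0 ?expR_ge0 ?(ltW x0)//; first by rewrite invf_le1.
rewrite -[leRHS]expR0 ler_expR oppr_le0 mulr_ge0 ?powR_ge0// addr_ge0// ltW//.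
Qed.

End AsymptoticLowerBound.

(** * The norm weighted by the density *)

Section Constants.
Variable R : realType.
Implicit Types x al : R.

Lemma cos_pi3 : cos (pi / 3) = 2^-1 :> R.
Proof.
have p0 := pi_gt0 R.
have c0 : 0 < cos (pi / 3) :> R.
  by apply: cos_gt0_pihalf; apply/andP; split; lra.
have e : cos (pi : R) = 4 * cos (pi / 3) ^+ 3 - 3 * cos (pi / 3).
  have {1}-> : (pi : R) = pi / 3 + (pi / 3 + pi / 3) by field.
  rewrite cosD cosD sinD; have := cos2Dsin2 (pi / 3 : R).
  move: (cos _) (sin _) => c s cs.
  rewrite (_ : c * (c * c - s * s) - s * (s * c + c * s) = c ^+ 3 - 3 * c * s ^+ 2); last by ring.
  by have -> : s ^+ 2 = 1 - c ^+ 2 by [rewrite -cs; ring]; ring.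
rewrite cospi in e; move: (cos _) c0 e => c c0 e.
(* The triple-angle polynomial at cos pi = - 1 has a double root at 1/2. *)
have : (c + 1) * (2 * c - 1) ^+ 2 = 0.
  rewrite (_ : _ * _ = 4 * c ^+ 3 - 3 * c + 1); last by ring.
  by rewrite -e addNr.
by move/eqP; rewrite mulf_eq0 sqrf_eq0 => /orP[/eqP|/eqP]; lra.
Qed.

Lemma sin_pi3_sqr : sin (pi / 3) ^+ 2 = 3 / 4 :> R.
Proof. by have := cos2Dsin2 (pi / 3 : R); rewrite cos_pi3; lra. Qed.

Lemma sin_pi6 : sin (pi / 6) = 2^-1 :> R.
Proof. by rewrite -cos_pi3 -cosBpihalf -cosN; congr cos; field. Qed.

Lemma pi_ge3 : 3 <= pi :> R.
Proof.
have := @sin_le R (pi / 6) (ltac:(by rewrite divr_ge0// pi_ge0)).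
by rewrite sin_pi6; lra.
Qed.

(** 7/9 = 1 - (2/3) ^ 2 / 2 bounds the cosine below on [0, 2/3], which contains pi / 6 because pi <
    4. The same constant bounds ln 2 above, so the two cancel in [rate_bound] thanks to pi >= 3. *)
Lemma sin_ge_linear x : 0 <= x -> x <= pi / 6 -> 7 / 9 * x <= sin x.
Proof.
move=> x0 x6; have p4 := @pihalf_lt2 R.
have := @der_incr R (fun x => sin x - 7 / 9 * x) (fun x => cos x - 7 / 9) 0 x x0.
rewrite sin0 mulr0 subrr subr_ge0; apply.
  by move=> t _; apply: hasd_eq; [der|rewrite /=; field].
move=> t /andP[t0 tx]; have := @cos_ge R t.
have : t <= 2 / 3 by lra.
by nra.
Qed.

Lemma ln2_le : ln 2 <= 7 / 9 :> R.
Proof.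
rewrite -ler_expR lnK ?posrE//; have := @exp_partial_le R 3 (7 / 9) (ltac:(lra)).
rewrite !big_ord_recr big_ord0/= !factS fact0 !muln1 expr0 expr1 => h.
by apply: le_trans h; rewrite add0r; lra.
Qed.

Lemma expR1_ge : 8 / 3 <= expR 1 :> R.
Proof.
have := @exp_partial_le R 4 1 ler01.
rewrite !big_ord_recr big_ord0/= !expr1n !factS fact0 !muln1 => h.
by apply: le_trans h; rewrite add0r; lra.
Qed.

(** x ^ 2 exp (- x / 2) is largest at x = 4, with value 16 / e ^ 2 < e; hence the tangent of the
    exponential at x / 4 = 1 and the bound 8/3 <= e. *)
Lemma sqr_le_expR x : 0 <= x -> x ^+ 2 <= expR (1 + x / 2).
Proof.
move=> x0; have h := expR_ge1Dx (x / 4 - 1).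
have h2 : (x / 4) ^+ 2 <= expR (x / 4 - 1) ^+ 2.
  by rewrite lerXn2r ?nnegrE ?expR_ge0 ?divr_ge0//; lra.
have e : expR (1 + x / 2) = expR (x / 4 - 1) ^+ 2 * expR 1 ^+ 3.
  by rewrite -!expRM_natl -expRD; congr expR; field.
have h3 : (8 / 3) ^+ 3 <= expR 1 ^+ 3 :> R.
  by rewrite lerXn2r ?nnegrE ?expR_ge0 ?expR1_ge.
rewrite e; apply: (@le_trans _ _ ((x / 4) ^+ 2 * (8 / 3) ^+ 3)); first by nra.
by apply: ler_pM; rewrite ?sqr_ge0 ?exprn_ge0.
Qed.

End Constants.

Section RateTwoB.
Variables (R : realType) (al : R).
Hypotheses (al0 : 0 < al) (al1 : al < 1).

(** Above, the cosine is at most 1, so (1 - rho) ^ (1 / al) >= 1/2. Below, the function is 1 at 0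
    and at most 1/2 at 1 - 2 ^ (- al), so there is a solution in between and the largest one is
    positive. *)
Lemma rho_bounds rho : is_rho al rho -> 0 < rho <= 1 - expR (- (al * ln 2)).
Proof.
have ai0 : 0 < al^-1 by rewrite invr_gt0.
have ln20 : 0 < ln 2 :> R by rewrite ln_gt0// ltr1n.
pose e := expR (- (al * ln 2)); have e0 : 0 < e := expR_gt0 _.
have e1 : e < 1 by rewrite expR_lt1 oppr_lt0 mulr_gt0.
have ei : e `^ al^-1 = 2^-1.
  by rewrite -expRM (_ : _ / al = - ln 2) ?expRN ?lnK ?posrE//; field; rewrite gt_eqF.
move=> [[/andP[r1 r2] hr] hmax]; apply/andP; split; last first.
  have h : 2^-1 <= (1 - rho) `^ al^-1.
    rewrite -hr; have := powR_ge0 (1 - rho) al^-1; have := @cos_le1 R (asin rho / al).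
    by nra.
  have : (2^-1 : R) `^ al <= ((1 - rho) `^ al^-1) `^ al.
    by apply: ge0_ler_powR; rewrite ?nnegrE ?powR_ge0 ?(ltW al0) ?invr_ge0.
  rewrite -ei -!powRrM mulVf ?gt_eqF// !powRr1 ?(ltW e0) ?subr_ge0// /e; lra.
pose f r := (1 - r) `^ al^-1 * cos (asin r / al).
have asin0 : asin 0 = 0 :> R.
  by rewrite -[X in asin X]sin0 sinK// in_itv/= oppr_le0 divr_ge0// pi_ge0.
have f0 : f 0 = 1 by rewrite /f subr0 powR1 asin0 mul0r cos0 mulr1.
have fb : f (1 - e) <= 2^-1.
  by rewrite /f subKr ei ler_piMr ?invr_ge0//; exact: cos_le1.
have fc0 (r : R) : 0 <= r -> r <= 1 - e -> {for r, continuous f}.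
  move=> h1 h2; have r1' : 0 < 1 - r by lra.
  have ra : -1 < r < 1 by apply/andP; split; lra.
  have c1 : {for r, continuous (fun r : R => (1 - r) `^ al^-1)}.
    apply: der_cont; eexists; apply: (@der_powR R (fun r => 1 - r) r _ al^-1 r1'); der.
  have c2 : {for r, continuous (fun r : R => cos (asin r / al))}.
    apply: (@continuous_comp R R R (fun r => asin r / al) cos); last exact: continuous_cos.
    by apply: cvgMl; exact: continuous_asin.
  exact: cvgM c1 c2.
have fc : {within `[0, 1 - e], continuous f}.
  by apply: continuous_in_subspaceT => r /set_mem/=; rewrite in_itv/= => /andP[]; exact: fc0.
have [||c] := @IVT R f 0 (1 - e) 2^-1 _ fc; first by rewrite subr_ge0 ltW.
  by rewrite f0 ge_min fb orbT/= le_max invf_le1// ler1n.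
rewrite in_itv/= => /andP[c0 c1] hc; apply: lt_le_trans (hmax c _); last first.
  by split; [apply/andP; split; lra|exact: hc].
rewrite lt_neqAle c0 andbT; apply/eqP => hc0; move: hc; rewrite -hc0 f0.
by move=> /eqP; rewrite eq_sym invr_eq1 pnatr_eq1.
Qed.

(** z = 2 ^ (al / 2). The parameter of [bin_le] is taken to be d = 1 / (z - 1), so that 1 + 1 / d =
    z and 1 + d = 1 / (1 - 1 / z). *)
Let z : R := expR (al / 2 * ln 2).

Let z1 : 1 < z.
Proof. by rewrite expR_gt1 mulr_gt0 ?divr_gt0// ln_gt0// ltr1n. Qed.

(** With y = 1 - 1 / z one has y <= sin (al pi / 6), and rho <= 1 - z ^ (- 2) <= 2 y. Both sides are
    then compared through y ^ (- 2) <= exp (1 + 1 / (2 y)). *)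
Lemma rate_bound rho : is_rho al rho -> (1 + (z - 1)^-1) / sin (al * (pi / 6)) <= expR (1 + rho^-1).
Proof.
move=> /rho_bounds/andP[r0 r1].
pose y : R := 1 - z^-1; have z0 : 0 < z := expR_gt0 _.
have y0 : 0 < y by rewrite subr_gt0 invf_lt1.
have zE : 1 + (z - 1)^-1 = y^-1.
  by rewrite /y; field; rewrite !gt_eqF ?subr_gt0// -(@mulfV _ z) ?gt_eqF.
have yr : rho <= 2 * y.
  apply: (le_trans r1).
  have -> : expR (- (al * ln 2)) = z^-1 ^+ 2.
    by rewrite /z -expRN -expRM_natl; congr expR; field.
  by rewrite /y; have : z^-1 <= 1 by [rewrite invf_le1// ltW]; have : 0 <= z^-1 by [rewrite invr_ge0 ltW]; nra.
have x6 : al * (pi / 6) <= pi / 6 :> R by rewrite ler_piMl ?(ltW al1)// divr_ge0// pi_ge0.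
have x0 : 0 <= al * (pi / 6) :> R by rewrite mulr_ge0 ?(ltW al0)// divr_ge0// pi_ge0.
have ys : y <= sin (al * (pi / 6)).
  apply: le_trans (sin_ge_linear x0 x6).
  have h1 := expR_ge1Dx (- (al / 2 * ln 2)); rewrite expRN -/z in h1.
  have h2 := @ln2_le R; have h3 := @pi_ge3 R.
  apply: (@le_trans _ _ (al / 2 * (7 / 9))).
    apply: (@le_trans _ _ (al / 2 * ln 2)); first by rewrite /y; lra.
    by rewrite ler_pM2l// divr_gt0.
  by rewrite [leRHS](_ : _ = al / 2 * (7 / 9) * (pi / 3)); [rewrite ler_peMr ?mulr_ge0 ?divr_ge0 ?(ltW al0)//; lra|field].
rewrite zE; have s0 := lt_le_trans y0 ys.
apply: (@le_trans _ _ (y^-1 ^+ 2)).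
  by rewrite expr2 ler_pM2l ?invr_gt0// lef_pV2 ?posrE.
have yi : 0 <= y^-1 by rewrite invr_ge0 ltW.
apply: (le_trans (sqr_le_expR yi)).
rewrite ler_expR lerD2l -invfM lef_pV2 ?posrE ?mulr_gt0//; lra.
Qed.

Lemma rate_choice rho T : is_rho al rho -> 1 + rho^-1 < T ->
  exists t, 0 < t < al * (pi / 6) /\ (1 + (z - 1)^-1) / sin t <= expR T.
Proof.
move=> hr hT; have rb := rate_bound hr.
have z0 : 0 < 1 + (z - 1)^-1 by rewrite addr_gt0 ?invr_gt0 ?subr_gt0.
set x := al * (pi / 6) in rb *.
have x0 : 0 < x by rewrite mulr_gt0// divr_gt0// pi_gt0.
have x6 : x <= pi / 6 by rewrite ler_piMl ?(ltW al1)// divr_ge0// pi_ge0.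
have px : x < pi / 2 by apply: (le_lt_trans x6); have := pi_gt0 R; lra.
have sx : 0 < sin x by apply: sin_gt0_pihalf; rewrite x0.
pose s0 := (1 + (z - 1)^-1) / expR T.
have s0x : s0 < sin x.
  rewrite /s0 ltr_pdivrMr ?expR_gt0// mulrC -ltr_pdivrMr//.
  by apply: (le_lt_trans rb); rewrite ltr_expR.
have : \forall t \near x^'-, s0 < sin t.
  have c : sin t @[t --> x^'-] --> sin x by apply: cvg_at_left_filter; exact: continuous_sin.
  by move/cvgrPdist_lt: c => /(_ (sin x - s0) (ltac:(by rewrite subr_gt0))) c; near=> t;
     have : `|sin x - sin t| < sin x - s0 by [near: t; exact: c]; rewrite ltr_norml => /andP[_]; lra.
move=> hs; near x^'- => t; exists t.
have t0 : 0 < t by near: t; exact: nbhs_left_gt.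
have tx : t < x by near: t; exact: nbhs_left_lt.
split; first by rewrite t0 tx.
have st : 0 < sin t by apply: sin_gt0_pihalf; rewrite t0 (lt_trans tx).
rewrite ler_pdivrMr// mulrC -ler_pdivrMr ?expR_gt0//; apply: ltW; near: t; exact: hs.
Unshelve. all: by end_near.
Qed.

(* With [th = pi / 3] the exponential rates of [w ^+ 2] and of [nu] compare as
   [2 * sin (pi / 3) / sqrt 2 > 1]. *)
Lemma exponent_gap e : 0 < e -> e <= al / 40 ->
  11 / 10 * ((1 + e) * ((1 + (z - 1)^-1^-1) * sin (pi / 3) `^ (- al))) `^ al^-1 <= 19 / 10.
Proof.
move=> e0 eal; have s0 : 0 < sin (pi / 3) :> R.
  by apply: sin_gt0_pihalf; have := pi_gt0 R => p0; apply/andP; split; lra.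
have a0 : al != 0 by rewrite gt_eqF.
rewrite invrK (addrC 1 (z - 1)) subrK.
have -> : sin (pi / 3) `^ (- al) = expR (- al * ln (sin (pi / 3))) by rewrite /powR gt_eqF.
apply: (@le_trans _ _ (11 / 10 * (expR e * (z * expR (- al * ln (sin (pi / 3))))) `^ al^-1)).
  rewrite ler_pM2l; last by lra.
  apply: ge0_ler_powR; rewrite ?nnegrE ?invr_ge0 ?(ltW al0)//.
  - by apply: mulr_ge0; [lra|apply: mulr_ge0; exact: expR_ge0].
  - by apply: mulr_ge0; [exact: expR_ge0|apply: mulr_ge0; exact: expR_ge0].
  - by apply: ler_wpM2r; [apply: mulr_ge0; exact: expR_ge0|exact: expR_ge1Dx].
rewrite /z -!expRD -expRM.
have -> : (e + (al / 2 * ln 2 + - al * ln (sin (pi / 3)))) / al = e / al + (ln 2 / 2 - ln (sin (pi / 3))) by field.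
rewrite expRD.
have h1 : expR (e / al) <= 40 / 39.
  have h := expR_ge1Dx (- (e / al)); rewrite expRN in h.
  have : e / al <= 40^-1 by rewrite ler_pdivrMr// mulrC.
  move=> h2; rewrite -[expR _]invrK invf_ple ?posrE ?invr_gt0 ?expR_gt0//; lra.
(* 1.64 bounds sqrt (8/3), that is sqrt 2 / sin (pi / 3). *)
have h2 : expR (ln 2 / 2 - ln (sin (pi / 3))) <= 164 / 100 :> R.
  have h : expR (ln 2 / 2 - ln (sin (pi / 3))) ^+ 2 = 8 / 3 :> R.
    rewrite -expRM_natl mulrBr (_ : 2 * (ln 2 / 2) = ln 2); last by field.
    rewrite expRD expRN expRM_natl !lnK ?posrE// sin_pi3_sqr; by field.
  rewrite -ler_sqr ?nnegrE ?expR_ge0// h; lra.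
have := ler_pM (expR_ge0 _) (expR_ge0 _) h1 h2.
move: (expR _) (expR _) => u v; lra.
Qed.

End RateTwoB.

(** * Exponents for the upper and lower bounds at the origin *)

Section NonlocalExponents.
Variables (R : realType) (p : levy R).
Local Notation m := (lm p).
Local Notation q := (lq p).
Hypotheses (s0 : ls p = 0).

Lemma minq_gt0 : 0 < I (fun v => Num.min v 1 * q v).
Proof.
have [v0 v00 qv0] : exists2 y, 0 < y & 0 < q y by case: (l_nondeg p) => //; rewrite s0 ltxx.
pose k : R := Num.min (v0 / 2) 1 * q v0.
have k0 : 0 < k by rewrite mulr_gt0// lt_min divr_gt0/=.
have iv := @itg_indic_itv R (v0 / 2) v0.
have e : I (fun v => k * \1_`[v0 / 2, v0] v) = k * (v0 / 2).
  by rewrite I_Z// I_indic_itv; [congr (_ * _); field|lra].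
apply: (@lt_le_trans _ _ (I (fun v => k * \1_`[v0 / 2, v0] v))); first by rewrite e mulr_gt0// divr_gt0.
apply: I_le; [exact: itgZ|exact: lq_int|].
move=> v; rewrite indic_itvE; case: (boolP (_ <= v <= _)) => [/andP[h1 h2]|_]; last first.
  rewrite mulr0; have [h|h] := leP v 0; first by rewrite (lq_eq0 p h) mulr0.
  by apply: mulr_ge0; [rewrite le_min (ltW h)/=|exact: lq_ge0].
rewrite mulr1; apply: ler_pM; [|exact: lq_ge0| |].
- by rewrite le_min divr_ge0 ?(ltW v00)/=.
- by rewrite le_min !ge_min h1 lexx orbT.
by apply: lq_decr => //; apply: lt_le_trans h1; rewrite divr_gt0.
Qed.

(* [u] and [- b] lie close to the point below which [ph] is negative or infinite,
   on its two sides: [x ^ - u] will bound [w n] from above near the origin and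
   [x ^ b] the density from below. *)
Lemma critical_exponents : exists u b : R,
  [/\ itg (fun v => (1 - expR (- (u * v))) * q v), 0 < ph p u, 0 <= b,
   (itg (fun v => (expR (b * v) - 1) * q v) -> m < I (fun v => (expR (b * v) - 1) * q v)) &
   2 * u + b <= 3 / 8].
Proof.
have c16 : 1 / 16 < 1 / 8 :> R by lra.
pose Q := I (fun v => Num.min v 1 * q v); have Q0 : 0 < Q := minq_gt0.
have mq := lq_meas p.
pose B : set R := [set b | 0 <= b /\
  (itg (fun v => (expR (b * v) - 1) * q v) -> m < I (fun v => (expR (b * v) - 1) * q v))].
have notB b : 0 <= b -> ~ B b -> itg (fun v => (expR (b * v) - 1) * q v) /\
    I (fun v => (expR (b * v) - 1) * q v) <= m.
  move=> b0 hb; apply: contrapT => h; apply: hb; split => // ib.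
  by rewrite ltNge; apply/negP => h2; apply: h.
have incr b c : 0 <= b -> b <= c -> itg (fun v => (expR (c * v) - 1) * q v) ->
    itg (fun v => (expR (b * v) - 1) * q v) /\
    I (fun v => (expR (b * v) - 1) * q v) + (c - b) * Q <= I (fun v => (expR (c * v) - 1) * q v).
  move=> b0 bc ic.
  have key v : 0 <= (expR (b * v) - 1) * q v /\
      (expR (b * v) - 1) * q v + (c - b) * (Num.min v 1 * q v) <= (expR (c * v) - 1) * q v.
    have [v0|v0] := leP v 0; first by rewrite (lq_eq0 p v0) !mulr0 addr0.
    have q0 := lq_ge0 p v.
    have e1 : 1 <= expR (b * v) by rewrite -[leLHS]expR0 ler_expR mulr_ge0// ltW.
    split; first by rewrite mulr_ge0// subr_ge0.
    rewrite mulrA -mulrDl; apply: ler_wpM2r => //.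
    have -> : expR (c * v) = expR (b * v) * expR ((c - b) * v) by rewrite -expRD; congr expR; ring.
    have h1 := expR_ge1Dx ((c - b) * v).
    have h2 : Num.min v 1 <= v by rewrite ge_min lexx.
    have h3 : (c - b) * Num.min v 1 <= (c - b) * v by rewrite ler_wpM2l// subr_ge0.
    have h4 : 0 <= (c - b) * v by rewrite mulr_ge0 ?subr_ge0// ltW.
    by nra.
  have i1 : itg (fun v => (c - b) * (Num.min v 1 * q v)) by apply: itgZ; exact: lq_int.
  have ib : itg (fun v => (expR (b * v) - 1) * q v).
    apply: (itg_dom _ ic); first by meas.
    move=> v; have [h1 h2] := key v; rewrite ger0_norm//; apply: le_trans h2; rewrite lerDl.
    have [v0|v0] := leP v 0; first by rewrite (lq_eq0 p v0) !mulr0.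
    by rewrite !mulr_ge0 ?lq_ge0 ?subr_ge0// le_min (ltW v0)/=.
  split=> //; rewrite -I_Z ?lq_int// -I_D//; apply: I_le => //; first exact: itgD.
  by move=> v; have [] := key v.
have Bn : exists b, B b.
  (* The integral grows at least with slope [Q] in the exponent, so it exceeds m at m / Q + 1. *)
  apply: contrapT => h; pose n : R := m / Q + 1.
  have n0 : 0 <= n by rewrite addr_ge0// divr_ge0 ?lm_ge0// ltW.
  have [i1 h1] := notB n n0 (ltac:(by move=> hb; apply: h; exists n)).
  have [_] := incr 0 n (lexx _) n0 i1.
  rewrite (@I_eq _ _ (fun=> 0)); last by move=> v; rewrite mul0r expR0 subrr mul0r.
  rewrite I0 add0r subr0 /n mulrDl divfK ?gt_eqF// mul1r; lra.
have Blb : lbound B 0 by move=> b [].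
have hB : has_inf B by split; [exact: Bn|exists 0].
pose p0 := inf B; have p00 : 0 <= p0 by apply: lb_le_inf.
have [b Bb bp] := @inf_adherent R B (1 / 8) (ltac:(by rewrite divr_gt0)) hB.
have [b0 hb] := Bb.
rewrite -/p0 in bp.
(* Since b < p0 + 1/8, the sum 2 u + b is below 3/8 - p0. What matters later is 2 u + b < 1: then x
   ^ (- (2 u + b)) is integrable at the origin. *)
exists (1 / 8 - p0), b.
have sum : 2 * (1 / 8 - p0) + b <= 3 / 8 by lra.
have [u0|u0] := ltP 0 (1 / 8 - p0).
  split => //; first exact: itg_ph (ltW u0).
  exact: ph_gt0.
(* A point strictly between p0 - 1/8 and p0. Lying outside [B], it gives integrability and the bound
   m; strict growth from p0 - 1/8 to [b'] makes phi u positive. *)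
pose b' : R := p0 - 1 / 16; have b'0 : 0 <= b' by rewrite /b'; lra.
have nb : ~ B b'.
  move=> hb'; have : p0 <= b' by apply: ge_inf => //; exists 0.
  by rewrite /b'; lra.
have [i1 h1] := notB _ b'0 nb.
have c0 : 0 <= p0 - 1 / 8 by lra.
have cb : p0 - 1 / 8 < b' by rewrite /b' ltrD2l ltrN2.
have [i2 h2] := incr _ _ c0 (ltW cb) i1.
have E v : (1 - expR (- ((1 / 8 - p0) * v))) * q v = (-1) * ((expR ((p0 - 1 / 8) * v) - 1) * q v).
  by rewrite (_ : - ((1 / 8 - p0) * v) = (p0 - 1 / 8) * v); ring.
split => //.
  by apply: (itg_eq (fun v => esym (E v))); exact: itgZ.
rewrite phE s0 mul0r addr0 (I_eq E) I_Z// mulN1r subr_gt0.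
by apply: lt_le_trans (le_trans h2 h1); rewrite ltrDl mulr_gt0// subr_gt0.
Qed.

End NonlocalExponents.

Section PartTwoB.
Variables (R : realType) (p : classN R) (nu : R -> R) (al : R).
Hypotheses (hnu : is_nu p nu) (al0 : 0 < al) (al1 : al < 1) (hal : in_N_alpha p al).
Local Notation L := (law_of hnu).

Let decay := @NAlpha_decay_of R p nu al hnu al0 al1 hal.

Let th0 : 0 < pi / 2 * al := mulr_gt0 (divr_gt0 (pi_gt0 R) (ltr0Sn R 1)) al0.

Lemma NAlpha_balance t : 0 < t ->
  itg (fun v => (dens L t - dens L (t * expR v)) * lq (levy_of p) v) /\
  (t - lm (levy_of p)) * dens L t = I (fun v => (dens L t - dens L (t * expR v)) * lq (levy_of p) v).
Proof.
move=> t0; have [C C0 reg] := ph_regular hal; have s0 := no_gaussian al1 C0 reg.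
have [D' hD] := coeigen_equation_decay (nu_dens hnu) th0 decay 0.
have [_ i e] := hD t t0.
have w0 x : 0 < x -> w nu 0 x = dens L x.
  by move=> x0; rewrite -(nu_dens hnu)// /w derive1n0 expr0 mul1r fact0 divr1.
have E : (fun v => (wdiff nu 0 t - wdiff nu 0 (t * expR v)) * lq (levy_of p) v) =
    (fun v => (dens L t - dens L (t * expR v)) * lq (levy_of p) v).
  by apply/funext => v; rewrite /wdiff !subr0 !w0// mulr_gt0// expR_gt0.
rewrite E in i e; split; first exact: i.
rewrite s0 mul0r subr0 w0// in e; rewrite /wdiff subr0 w0// in e.
by rewrite mulrBl e addrAC subrr add0r.
Qed.

Lemma V_sqr n x : 0 < x -> `|V nu n x| ^+ 2 * nu x = `|w nu n x| ^+ 2 / nu x.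
Proof.
move=> x0; have n0 : 0 < nu x by case: hnu => h _ _; exact: h.
rewrite /V normrM normfV (gtr0_norm n0) exprMn; move: `|_| => a.
by field; rewrite gt_eqF.
Qed.

Lemma part_two_b (rho eps : R) : is_rho al rho -> 0 < eps ->
  bigO_seq (fun n => wnorm nu (V nu n)) (fun n => expR ((T_pi_rho al rho + eps) * n%:R)).
Proof.
move=> hrho e0; pose T := T_pi_rho al rho + eps.
have hT1 : T_pi al < T by apply: (@le_lt_trans _ _ (T_pi_rho al rho)); [rewrite /T_pi_rho le_max lexx|rewrite ltrDl].
have hT2 : 1 + rho^-1 < T by apply: (@le_lt_trans _ _ (T_pi_rho al rho)); [rewrite /T_pi_rho le_max lexx orbT|rewrite ltrDl].
have [C C0 reg] := ph_regular hal; have s0 := no_gaussian al1 C0 reg.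
have nu0 x : 0 < x -> 0 < nu x by case: hnu => h _ _; exact: h.
have [u [b [iu pu b0 hb ub]]] := critical_exponents s0.
have [K1 K10 h1] := NAlpha_w_small hnu al0 al1 hal hT1 iu pu.
have [c1 c10 l1] := dens_lower_near0 NAlpha_balance b0 hb.
(* Budget of the exponents, in units of al (x / C) ^ (1 / al): nu decays at rate at most 21/20 and w
   at rate at least 11/20, so w ^ 2 / nu keeps a decay of rate 1/20. *)
have sg0 : 0 < al / 20 by rewrite divr_gt0.
have [c2 c20 l2] := dens_lower_exp al0 al1 C0 reg NAlpha_balance sg0.
have [t [/andP[t0 t6] ht]] := rate_choice al0 al1 hrho hT2.
set z := expR (al / 2 * ln 2) in ht.
have z1 : 1 < z by rewrite expR_gt1 mulr_gt0 ?divr_gt0// ln_gt0// ltr1n.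
have d0 : 0 < (z - 1)^-1 by rewrite invr_gt0 subr_gt0.
(* The first bound serves [exponent_gap], the second one keeps t below al (pi / 2 - pi / 3) - e. *)
pose e := Num.min (al / 40) ((al * (pi / 6) - t) / 2).
have ee0 : 0 < e by rewrite lt_min !divr_gt0// subr_gt0.
have ee1 : e <= al / 40 by rewrite ge_min lexx.
have ee2 : e <= (al * (pi / 6) - t) / 2 by rewrite ge_min lexx orbT.
have hth : 0 < (pi : R) / 3 < pi / 2 by have := pi_gt0 R => h; apply/andP; split; lra.
have pal : al * (pi / 6) <= pi / 6 by rewrite ler_piMl ?(ltW al1)// divr_ge0// pi_ge0.
have htp : 0 < t < pi / 2 by rewrite t0/=; apply: (lt_trans t6); apply: (le_lt_trans pal); have := pi_gt0 R; lra.
have tk : t < al * (pi / 2 - pi / 3) - e.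
  have -> : al * (pi / 2 - pi / 3) = al * (pi / 6) by congr (_ * _); field.
  by lra.
have n0 : 0 < (20^-1 : R) by rewrite invr_gt0.
have n1 : (20^-1 : R) < 1 by rewrite invf_lt1// ltr1n.
have [K2 K20 h2] := w_large al0 al1 C0 reg (nu_dens hnu) hth ee0 htp tk d0 n0 n1.
have gap := exponent_gap al0 ee0 ee1; rewrite -/z in gap.
set M := (1 + (z - 1)^-1^-1) * _ in h2 gap.
have M0 : 0 < M.
  apply: mulr_gt0; first by rewrite invrK (addrC 1) subrK (lt_trans ltr01).
  by rewrite powR_gt0// sin_gt0_pihalf.
have eM0 : 0 < (1 + e) * M by rewrite mulr_gt0// addr_gt0.
set G := _ `^ al^-1 in gap.
have G0 : 0 < G by rewrite powR_gt0.
(* The loss eta = 1/20 in [w_large] leaves the rate (19/20) / G for w, hence 11/20. *)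
have Gi : 11 / 19 <= G^-1.
  by rewrite -[leLHS]invrK lef_pV2 ?posrE ?invr_gt0// invf_div; lra.
(* The spare decay exp (- k x ^ (1 / al)) is at most 1 / (k x) for x >= 1; with the 1 / x left by w
   ^ 2 over the bound on nu, it gives the integrable x ^ (- 2). *)
pose k : R := al / 20 / C `^ al^-1.
have Ca : 0 < C `^ al^-1 by rewrite powR_gt0.
have k0 : 0 < k by rewrite divr_gt0.
pose r n : R := expR (T * n%:R).
have r0 n : 0 <= r n by exact: expR_ge0.
have [||||||H hH] := @wnorm_two_zones R nu (V nu) r (- (2 * u + b)) (K1 ^+ 2 / c1) (K2 ^+ 2 / (c2 * k)) (ltac:(lra)) _ _ r0.
- by rewrite divr_ge0 ?sqr_ge0// ltW.
- by rewrite divr_ge0 ?sqr_ge0// mulr_ge0// ltW.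
- move=> n; apply: (@eq_measurable_fun _ _ _ _ _ (fun x => `|w nu n x| ^+ 2 / nu x)).
    by move=> x; rewrite inE/= in_itv/= andbT => x0; rewrite V_sqr.
  have wc := NAlpha_w_cont hnu al0 al1 hal.
  apply: open_continuous_measurable_fun; first exact: interval_open.
  move=> x; rewrite inE/= in_itv/= andbT => x0.
  have cw : {for x, continuous (fun y => `|w nu n y|)}.
    by apply: (continuous_comp (wc n x x0)); exact: norm_continuous.
  apply: cvgM; first exact: (cvgM cw cw).
  by apply: cvgV; [rewrite gt_eqF// nu0|exact: nu_cont hnu x x0].
- by move=> x x0; exact: ltW (nu0 x x0).
- move=> n x x0 x1; rewrite V_sqr// ler_pdivrMr ?nu0//.
  have xu : 0 < x `^ u by rewrite powR_gt0.
  have xb : 0 < x `^ b by rewrite powR_gt0.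
  have -> : x `^ (- (2 * u + b)) = ((x `^ u) ^+ 2 * x `^ b)^-1.
    rewrite -(powR_mulrn 2 (powR_ge0 x u)) -(powRrM x) -(@powRD _ x); last by rewrite (gt_eqF x0) implybT.
    by rewrite -powRN [u * _]mulrC.
  have l1' : c1 * x `^ b <= nu x by rewrite (nu_dens hnu)//; exact: l1.
  have kk : 0 <= r n ^+ 2 * (K1 ^+ 2 / c1 / ((x `^ u) ^+ 2 * x `^ b)).
    apply: mulr_ge0; first exact: sqr_ge0.
    by apply/ltW/divr_gt0; [apply: divr_gt0|apply: mulr_gt0] => //; exact: exprn_gt0.
  apply: le_trans (ler_wpM2l kk l1').
  rewrite [leRHS](_ : _ = (K1 * r n) ^+ 2 / (x `^ u) ^+ 2); last by field; rewrite !gt_eqF.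
  rewrite ler_pdivlMr ?exprn_gt0// -exprMn lerXn2r ?nnegrE ?mulr_ge0 ?r0 ?(ltW K10) ?(ltW xu)//.
  by rewrite mulrC; exact: h1.
- move=> n x x1; have x0 : 0 < x by exact: lt_le_trans x1.
  rewrite V_sqr// ler_pdivrMr ?nu0//.
  have l2' : c2 / x * expR (- ((al + al / 20) * (x / C) `^ al^-1)) <= nu x by rewrite (nu_dens hnu)//; exact: l2.
  have xx : 0 < x ^+ 2 by rewrite exprn_gt0.
  rewrite (_ : x `^ (- 2) = x ^- 2); last by rewrite powRN -powR_mulrn ?(ltW x0).
  have kk : 0 <= r n ^+ 2 * (K2 ^+ 2 / (c2 * k) / x ^+ 2).
    apply: mulr_ge0; first exact: sqr_ge0.
    by apply/ltW/divr_gt0 => //; apply: divr_gt0; [exact: exprn_gt0|exact: mulr_gt0].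
  apply: le_trans (ler_wpM2l kk l2').
  pose Y : R := (x / C) `^ al^-1; rewrite -/Y.
  have Y0 : 0 <= Y by exact: powR_ge0.
  have hw := h2 n x x0.
  have eY : (x / (C * (1 + e) * M)) `^ al^-1 = Y / G.
    rewrite /Y /G -mulrA invfM mulrA powRM ?invr_ge0 ?(ltW eM0) ?divr_ge0 ?(ltW x0) ?(ltW C0)//.
    by rewrite -(powR_inv1 (ltW eM0)) -(powRrM ((1 + e) * M)) mulN1r powRN.
  rewrite eY in hw.
  have hw2 : x * `|w nu n x| <= K2 * r n * expR (- (al * (11 / 20) * Y)).
    apply: (le_trans hw); apply: ler_pM.
    - apply: mulr_ge0; first exact: ltW.
      by apply: exprn_ge0; apply: divr_ge0; [rewrite addr_ge0 ?(ltW d0)|apply/ltW/sin_gt0_pihalf].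
    - exact: expR_ge0.
    - rewrite ler_pM2l// /r expRM_natr lerXn2r ?nnegrE ?expR_ge0//.
      by apply: divr_ge0; [rewrite addr_ge0 ?(ltW d0)|apply/ltW/sin_gt0_pihalf].
    rewrite ler_expR lerN2.
    have aY : 0 <= al * Y by rewrite mulr_ge0// ltW.
    have := ler_wpM2l aY Gi.
    by move=> h; rewrite [leLHS](_ : _ = 19 / 20 * (al * Y * (11 / 19))); [rewrite [leRHS](_ : _ = 19 / 20 * (al * Y / G)); [rewrite ler_pM2l//|field; rewrite gt_eqF]|field].
  have sq : (x * `|w nu n x|) ^+ 2 <= (K2 * r n * expR (- (al * (11 / 20) * Y))) ^+ 2.
    have q0 : 0 <= x * `|w nu n x| by apply: mulr_ge0; [exact: ltW|].
    by rewrite lerXn2r// nnegrE; apply: le_trans q0 hw2.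
  have kx : k * x <= expR (k * x `^ al^-1).
    apply: (@le_trans _ _ (k * x `^ al^-1)); last by apply: le_trans (expR_ge1Dx _); rewrite lerDr.
    by rewrite ler_pM2l// -[leLHS](powRr1 (ltW x0)) ler_powR// invf_ge1// ltW.
  have ek : expR (- (al * (11 / 20) * Y)) ^+ 2 * expR (k * x `^ al^-1) = expR (- ((al + al / 20) * Y)).
    have -> : k * x `^ al^-1 = al / 20 * Y.
      rewrite /k /Y powRM ?invr_ge0 ?(ltW x0) ?(ltW C0)//.
      by rewrite -(powR_inv1 (ltW C0)) -(powRrM C) mulN1r powRN mulrAC mulrA.
    by rewrite -expRM_natl -expRD; congr expR; field.
  rewrite -ek; move: (expR (- _)) (expR_gt0 (- (al * (11 / 20) * Y))) sq => f f0 sq.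
  rewrite exprMn [leRHS]exprMn in sq.
  rewrite -(ler_pM2l xx); apply: (le_trans sq).
  rewrite [leLHS](_ : _ = (K2 * r n) ^+ 2 * f ^+ 2 / (k * x) * (k * x)); last first.
    by rewrite divfK// gt_eqF// mulr_gt0.
  rewrite [leRHS](_ : _ = (K2 * r n) ^+ 2 * f ^+ 2 / (k * x) * expR (k * x `^ al^-1)); last first.
    by move: (expR _) => g; field; rewrite !gt_eqF.
  apply: ler_wpM2l kx; apply: divr_ge0; [apply: mulr_ge0; exact: sqr_ge0|].
  by apply/ltW/mulr_gt0.
by exists H; apply: nearW.
Qed.

End PartTwoB.

Theorem theorem9p1 (R : realType) (p : classN R) (nu : R -> R)
    (hnu : is_nu p nu) :
  (in_N_Theta p ->
    [/\ forall a eps : R,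
          (d_phi p < a%:E)%E \/
            [/\ (0 < phie p 0)%E, d_phi p = 0%E & 0 <= a] ->
          0 < eps ->
          exists C : R, \forall n \near \oo, forall x : R, 0 < x ->
            x `^ a * `|w nu n x| <= C * rate a (T_Theta p + eps) n,
        forall a eps : R, (d_phi p < a%:E)%E -> a < 2^-1 -> 0 < eps ->
          bigO_seq (fun n => wnorm (fun=> 1) (w nu n))
                   (rate a (T_Theta p + eps))
      & forall alpha a eps : R, 0 < alpha < 1 ->
          (d_phi p < a%:E)%E -> a < (alpha + 1) / 2 -> 0 < eps ->
          bigO_seq
            (fun n => wnorm (p_weight alpha)
                            (fun x => w nu n x / p_weight alpha x))
            (rate a (T_Theta p + eps))])
  /\
  (forall alpha : R, 0 < alpha < 1 -> in_N_alpha p alpha ->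
    (forall a eps gamma : R, (d_phi p < a%:E)%E -> 0 < eps ->
       1 + alpha < gamma ->
       bigO_seq
         (fun n => wnorm (nubar gamma) (fun x => w nu n x / nubar gamma x))
         (rate a (T_pi alpha + eps)))
    /\
    (forall rho eps : R, is_rho alpha rho -> 0 < eps ->
       bigO_seq (fun n => wnorm nu (V nu n))
                (fun n => expR ((T_pi_rho alpha rho + eps) * n%:R)))).
Proof.
split; first exact: part_one.
move=> al /andP[al0 al1] hal; split.
  by move=> a eps gamma _ e0 hg; exact: (part_two_a hnu al0 al1 hal).
by move=> rho eps hr e0; exact: (part_two_b hnu al0 al1 hal hr e0).
Qed.
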